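(* Let $q,k\ge 1$ be integers, $\psi_\downarrow\in(0,1/q)$, $\psi_\uparrow=1/\psi_\downarrow$, $d_\uparrow>0$, and $\mathfrak g=(q,k,\psi_\downarrow,d_\uparrow)$. There exist $\rho>0$ and $c>0$ depending only on $\mathfrak g$ such that for all $(p,\gamma^* )\in\mathfrak A$, all $d\in[0,d_\uparrow]$ and all integers $n\ge 1$, $$\Big|\mathbb E\big[\phi_{\gamma^*}(\boldsymbol G^*_{\boldsymbol m}(\boldsymbol\sigma^* ))\big]-B_\uparrow(d)\Big|\le c\,n^{-\rho},$$ where $(\boldsymbol\sigma^*,\boldsymbol m)\sim\gamma^{*\otimes n}\otimes\mathrm{Po}(dn/k)$ and $B_\uparrow(d)=\sup_{\pi\in\mathcal P^2_{*,\gamma^*}}B_{p,\gamma^*,d}(\pi)$.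
   Context: Notation. $[n]=\{1,\dots,n\}$; $\mathcal P(X)$ is the set of Borel probability measures on $X$; laws on finite sets are identified with their probability mass functions; $\mathrm u(S)$ is the uniform distribution on $S$; $\otimes$ denotes product measures; bold symbols are random; $\Lambda(t)=t\ln t$. Graphs. A factor graph with $n$ variables and $m$ factors is $G=(v_a,\psi_a)_{a\in[m]}$ with $v_a\in[n]^k$ and $\psi_a\in[\psi_\downarrow,\psi_\uparrow]^{[q]^k}$. For $\sigma\in[q]^n$, $v\in[n]^k$ let $\sigma_v=(\sigma(v_1),\dots,\sigma(v_k))$. Let $\psi_G(\sigma)=\prod_{a}\psi_a(\sigma_{v_a})$, $Z_\gamma(G)=\sum_{\sigma\in[q]^n}\prod_{i\in[n]}\gamma(\sigma(i))\,\psi_G(\sigma)$ and $\phi_\gamma(G)=\frac1n\ln Z_\gamma(G)$ for $\gamma\in\mathcal P([q])$. Random graphs. Let $p\in\mathcal P([\psi_\downarrow,\psi_\uparrow]^{[q]^k})$. The null model is $\boldsymbol G_m\sim(\mathrm u([n]^k)\otimes p)^{\otimes m}$. For $\sigma\in[q]^n$ the teacher-student model $\boldsymbol G^*_m(\sigma)$ has Radon–Nikodym derivative $G\mapsto\psi_G(\sigma)/\mathbb E[\psi_{\boldsymbol G_m}(\sigma)]$ with respect to $\boldsymbol G_m$. For random $\boldsymbol\sigma^*,\boldsymbol m$, the graph $\boldsymbol G^*_{\boldsymbol m}(\boldsymbol\sigma^* )$ is drawn conditionally on $(\boldsymbol\sigma^*,\boldsymbol m)$. Assumptions. For $\psi:[q]^k\to\mathbb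 R_{\ge0}$, $\gamma,\gamma'\in\mathcal P([q])^k$, $h\in[k]$ let $Z_{\mathrm f}(\psi,\gamma)=\sum_{\tau\in[q]^k}\psi(\tau)\prod_{h'}\gamma_{h'}(\tau_{h'})$ and $Z_{\mathrm{fm}}(\psi,h,\gamma,\gamma')=\sum_\tau\psi(\tau)\gamma_h(\tau_h)\prod_{h'\ne h}\gamma'_{h'}(\tau_{h'})$. For $\gamma\in\mathcal P([q])$ let $\bar Z_p(\gamma)=\mathbb E[Z_{\mathrm f}(\boldsymbol\psi,(\gamma,\dots,\gamma))]$, $\boldsymbol\psi\sim p$, and $\xi_p=\sup_{\gamma\in\mathcal P([q])}\bar Z_p(\gamma)$. Let $\mathcal P^2_{*,\gamma}$ be the set of $\pi\in\mathcal P(\mathcal P([q]))$ whose mean is $\gamma$. For $\pi_1,\pi_2\in\mathcal P(\mathcal P([q]))$ let $$\nabla_p(\pi_1,\pi_2)=\mathbb E\big[\Lambda(Z_{\mathrm f}(\boldsymbol\psi,\boldsymbol\gamma_1))+(k-1)\Lambda(Z_{\mathrm f}(\boldsymbol\psi,\boldsymbol\gamma_2))-k\Lambda(Z_{\mathrm{fm}}(\boldsymbol\psi,\boldsymbol h,\boldsymbol\gamma_1,\boldsymbol\gamma_2))\big],$$ $(\boldsymbol\psi,\boldsymbol h,\boldsymbol\gamma_1,\boldsymbol\gamma_2)\sim p\otimes\mathrm u([k])\otimes\pi_1^{\otimes k}\otimes\pi_2^{\otimes k}$. Then $\mathfrak A$ is the set of pairs $(p,\gamma^* )\in\mathcal P([\psi_\downarrow,\psi_\uparrow]^{[q]^k})\times\mathcal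 P([q])$ with $\gamma^*(z)\ge\psi_\downarrow$ for all $z\in[q]$, $\bar Z_p(\gamma^* )=\xi_p$, and $\nabla_p(\pi_1,\pi_2)\ge0$ for all $\pi_1,\pi_2\in\mathcal P^2_{*,\gamma^*}$. Bethe free entropy. For $d'\in\mathbb Z_{\ge0}$ and sequences $\psi=(\psi_a)$, $h=(h_a)$, $\gamma=(\gamma_{a,h'})$ let $$Z_{\mathrm v}(d',\psi,h,\gamma)=\sum_{\sigma\in[q]}\gamma^*(\sigma)\prod_{a\in[d']}\Big(\sum_{\tau\in[q]^k}\mathbf 1\{\tau_{h_a}=\sigma\}\psi_a(\tau)\prod_{h'\ne h_a}\gamma_{a,h'}(\tau_{h'})\Big).$$ For $\pi\in\mathcal P(\mathcal P([q]))$ let $$B_{p,\gamma^*,d}(\pi)=\mathbb E\big[\xi_p^{-\boldsymbol d}\Lambda(Z_{\mathrm v}(\boldsymbol d,\boldsymbol\psi,\boldsymbol h,\boldsymbol\gamma))\big]-\frac{d(k-1)}{k\xi_p}\mathbb E\big[\Lambda(Z_{\mathrm f}(\boldsymbol\psi_\circ,\boldsymbol\gamma_\circ))\big],$$ where $(\boldsymbol d,\boldsymbol\psi,\boldsymbol h,\boldsymbol\gamma)\sim\mathrm{Po}(d)\otimes(p\otimes\mathrm u([k])\otimes\pi^{\otimes k})^{\otimes\mathbb Z_{>0}}$ and $(\boldsymbol\psi_\circ,\boldsymbol\gamma_\circ)\sim p\otimes\pi^{\otimes k}$. *)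

(* Defs.v *)
From HB Require Import structures.
From mathcomp Require Import all_boot all_order all_algebra.
From mathcomp Require Import all_classical all_reals all_analysis.
From mathcomp Require Import measurable_realfun.

Set Implicit Arguments.
Unset Strict Implicit.
Unset Printing Implicit Defensive.
Import Order.TTheory GRing.Theory Num.Theory.
Import numFieldNormedType.Exports.

Local Open Scope classical_set_scope.
Local Open Scope ring_scope.

(* Measurable types are pointed in this library, so the finite sets [q], [k]
   and [n], which are nonempty, are represented by 'I_q.+1, 'I_k.+1 and
   'I_n.+1: in all definitions below the number of colours is q.+1, the arity
   of the factors is k.+1 and the number of variables is n.+1. *)
HB.instance Definition _ n := isPointed.Build 'I_n.+1 ord0.

HB.instance Definition _ n := @isMeasurable.Build default_measure_display
  'I_n.+1 discrete_measurable discrete_measurable0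
  discrete_measurableC discrete_measurableU.

#[short(type="finMeasurableType")]
HB.structure Definition FinMeasurable d := {T of Finite T & Measurable d T}.

HB.saturate ordinal.
HB.saturate tuple_of.

Lemma measurable_tuple_ord k n (A : set (k.-tuple 'I_n.+1)) : measurable A.
Proof.
have m1 (v : k.-tuple 'I_n.+1) : measurable [set v].
  rewrite [X in measurable X](_ : _ =
    \bigcap_(i in [set: 'I_k]) ((@tnth _ _ ^~ i) @^-1` [set tnth v i])).
    apply: fin_bigcap_measurable; first exact: finite_finset.
    move=> i _; rewrite -[X in measurable X]setTI.
    exact: (@measurable_tnth _ 'I_n.+1).
  apply/seteqP; split => [w -> //|w wv] /=.
  by apply/eq_from_tnth => i; exact: (wv i).
rewrite (_ : A = \bigcup_(v in A) [set v]); last first.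
  by apply/seteqP; split => [v Av|v [w Aw ->//]]; exists v.
by apply: fin_bigcup_measurable => //; exact: finite_finset.
Qed.

Section unif.
Local Open Scope ereal_scope.
Context d (T : finMeasurableType d) (R : realType).

Definition unif (A : set T) : \bar R :=
  ((#|T|%:R)^-1)%:E * \sum_(x : T) \d_x A.

Let unif0 : unif set0 = 0.
Proof. by rewrite /unif big1 ?mule0. Qed.

Let unif_ge0 A : 0 <= unif A.
Proof. by rewrite mule_ge0 ?lee_fin ?invr_ge0 ?sume_ge0. Qed.

Let unif_sigma_additive : semi_sigma_additive unif.
Proof.
move=> F mF tF mUF.
rewrite [X in X @ _ --> _](_ : _ = fun n =>
    ((#|T|%:R)^-1)%:E * \sum_(0 <= i < n) \sum_(x : T) \d_x (F i)); last first.
  apply/funext => n; rewrite ge0_sume_distrr// => i _; exact: sume_ge0.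
apply: cvgeZl => //.
rewrite [X in _ --> X](_ : _ =
    lim ((fun n => \sum_(0 <= i < n) \sum_(x : T) \d_x (F i)) @ \oo)).
  by apply: is_cvg_ereal_nneg_natsum => i _; exact: sume_ge0.
rewrite nneseries_sum//; apply: eq_bigr => x _.
exact: measure_semi_bigcup.
Qed.

HB.instance Definition _ :=
  isMeasure.Build _ _ _ unif unif0 unif_ge0 unif_sigma_additive.

Let unif_setT : unif setT = 1.
Proof.
rewrite /unif; under eq_bigr do rewrite diracT.
rewrite sumEFin sumr_const -EFinM mulVf// pnatr_eq0.
by rewrite -lt0n; apply/card_gt0P; exists point.
Qed.

HB.instance Definition _ := Measure_isProbability.Build _ _ _ unif unif_setT.

End unif.
Arguments unif {d} T R.

Section iid.
Context d (T : measurableType d) (R : realType).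

Definition tcons n (x : T * n.-tuple T) : n.+1.-tuple T := [tuple of x.1 :: x.2].

Lemma measurable_tcons n : measurable_fun setT (@tcons n).
Proof. exact: measurable_cons. Qed.

HB.instance Definition _ n :=
  isMeasurableFun.Build _ _ _ _ (@tcons n) (@measurable_tcons n).

(* The n-fold product of P, as a law on n-tuples; see iidE. *)
Fixpoint iid (P : probability T R) n : probability (n.-tuple T) R :=
  if n is m.+1 then distribution (P \x iid P m)%E (@tcons m)
  else dirac ([tuple] : 0.-tuple T).

Lemma iidE (P : probability T R) n (A : 'I_n -> set T) :
  (forall i, measurable (A i)) ->
  iid P n [set x | forall i, A i (tnth x i)] = (\prod_(i < n) P (A i))%E.
Proof.
elim: n A => [|n IH] A mA.
  rewrite big_ord0 /= (_ : [set x | _] = setT) ?diracT//.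
  by apply/seteqP; split => // x _ [].
rewrite big_ord_recl -IH// -product_measure1E//; last first.
  rewrite (_ : [set x | _] = \bigcap_(i in [set: 'I_n])
    ((@tnth _ T ^~ i) @^-1` A (lift ord0 i))); last first.
    by apply/seteqP; split => [x xA i _|x xA i]; [exact: xA|exact: (xA i)].
  apply: fin_bigcap_measurable; first exact: finite_finset.
  by move=> i _; rewrite -[X in measurable X]setTI; exact: measurable_tnth.
congr (product_measure1 _ _ _); apply/seteqP; split => -[x t] /=.
- move=> xA; split; first exact: (xA ord0).
  by move=> i; have := xA (lift ord0 i); rewrite /tcons tnthS.
- move=> [xA tA] i; have [j ->|->] := unliftP ord0 i; last exact: xA.
  by rewrite /tcons tnthS; exact: tA.
Qed.

End iid.

Section weight.
Context (R : realType) (q k : nat).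

(* Weight functions [q]^k -> R_{>=0}, with the product Borel sigma-algebra. *)
Definition weight : Type := k.+1.-tuple 'I_q.+1 -> {nonneg R}.

HB.instance Definition _ := gen_eqMixin weight.
HB.instance Definition _ := gen_choiceMixin weight.
HB.instance Definition _ := isPointed.Build weight (fun=> 0%:nng).

Definition weight_eval (psi : weight) (tau : k.+1.-tuple 'I_q.+1) : R :=
  (psi tau)%:num.

Definition weight_cylinder : set (set weight) :=
  [set (weight_eval ^~ tau) @^-1` B | tau in setT & B in measurable].

HB.instance Definition _ := @isMeasurable.Build (sigma_display weight_cylinder)
  weight <<s weight_cylinder >> (@sigma_algebra0 _ setT weight_cylinder)
  (@sigma_algebraC _ weight_cylinder)
  (@sigma_algebra_bigcup _ setT weight_cylinder).

Lemma measurable_weight_eval tau :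
  measurable_fun setT (weight_eval ^~ tau).
Proof.
move=> _ B mB; rewrite setTI; apply: sub_sigma_algebra.
by exists tau => //; exists B.
Qed.

End weight.

Section bethe.
Context {R : realType} {q k : nat}.

Local Notation color := 'I_q.+1.
Local Notation assignment := (k.+1.-tuple 'I_q.+1).
Local Notation W := (weight R q k).
(* P([q]), with the sigma-algebra generated by the maps gam |-> gam(A), which
   is the Borel sigma-algebra of the simplex. *)
Local Notation simplex := (pprobability 'I_q.+1 R).

Definition mass (gam : simplex) (z : color) : R :=
  fine ((gam : probability 'I_q.+1 R) [set z]).

Definition Lambda (t : R) : R := t * ln t.

Section graphs.
Context (n m : nat).

(* Factor graphs with n.+1 variables and m factors. *)
Definition factor_graph := (m.-tuple (k.+1.-tuple 'I_n.+1 * W))%type.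

Definition at_factor (sigma : n.+1.-tuple color) (v : k.+1.-tuple 'I_n.+1) :
  assignment := [tuple tnth sigma (tnth v h) | h < k.+1].

Definition psiG (G : factor_graph) (sigma : n.+1.-tuple color) : R :=
  \prod_(a < m) ((tnth G a).2 (at_factor sigma (tnth G a).1))%:num.

Definition ZG (gam : simplex) (G : factor_graph) : R :=
  \sum_(sigma : n.+1.-tuple color)
    (\prod_(i < n.+1) mass gam (tnth sigma i)) * psiG G sigma.

Definition phiG (gam : simplex) (G : factor_graph) : R :=
  (n.+1%:R)^-1 * ln (ZG gam G).

Definition null_model (p : probability W R) : probability factor_graph R :=
  iid (unif (k.+1.-tuple 'I_n.+1) R \x p)%E m.

Definition teacher_density (p : probability W R) (sigma : n.+1.-tuple color)
    (G : factor_graph) : R :=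
  psiG G sigma / \int[null_model p]_G' psiG G' sigma.

Definition teacher_student (p : probability W R) (sigma : n.+1.-tuple color)
    (A : set factor_graph) : \bar R :=
  (\int[null_model p]_(G in A) (teacher_density p sigma G)%:E)%E.

Lemma psiG_ge0 G sigma : 0 <= psiG G sigma.
Proof. by apply: prodr_ge0. Qed.

Lemma measurable_psiG sigma : measurable_fun setT (psiG ^~ sigma).
Proof.
apply: measurable_prod => a _.
apply: (@measurableT_comp _ _ _ _ _ _
  (fun x : k.+1.-tuple 'I_n.+1 * W => (x.2 (at_factor sigma x.1))%:num)); last first.
  exact: measurable_tnth.
move=> _ B mB; rewrite setTI.
rewrite [X in measurable X](_ : _ = \bigcup_(v in [set: k.+1.-tuple 'I_n.+1])
   ([set v] `*` ((@weight_eval R q k ^~ (at_factor sigma v)) @^-1` B))).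
  apply: fin_bigcup_measurable; first exact: finite_finset.
  move=> v _; apply: measurableX; first exact: measurable_tuple_ord.
  rewrite -[X in measurable X]setTI; exact: measurable_weight_eval.
apply/seteqP; split => [[v psi] /= Bpsi|[v psi] [w _ [/= -> //]]].
by exists v.
Qed.

Lemma teacher_density_ge0 p sigma G : 0 <= teacher_density p sigma G.
Proof.
rewrite divr_ge0 ?psiG_ge0// fine_ge0// integral_ge0// => x _.
by rewrite lee_fin psiG_ge0.
Qed.

Lemma measurable_teacher_density p sigma :
  measurable_fun setT (teacher_density p sigma).
Proof. by apply: measurable_funM => //; exact: measurable_psiG. Qed.

Section teacher_student_measure.
Variables (p : probability W R) (sigma : n.+1.-tuple color).

Let ts0 : teacher_student p sigma set0 = 0%E.
Proof. exact: integral_set0. Qed.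

Let ts_ge0 A : (0 <= teacher_student p sigma A)%E.
Proof.
by apply: integral_ge0 => G _; rewrite lee_fin teacher_density_ge0.
Qed.

Let ts_sigma_additive : semi_sigma_additive (teacher_student p sigma).
Proof.
apply: semi_sigma_additive_nng_induced => [|G].
  by apply/measurable_EFinP; exact: measurable_teacher_density.
by rewrite lee_fin teacher_density_ge0.
Qed.

HB.instance Definition _ := isMeasure.Build _ _ _ (teacher_student p sigma)
  ts0 ts_ge0 ts_sigma_additive.

End teacher_student_measure.

End graphs.

(* The outer integral draws the ground truth sigma ~ gam^{n.+1} and, independently,
   the number of factors m ~ Po(d n.+1 / k.+1); the inner one draws the graph
   given (sigma, m).
   The last argument of poisson_prob is a dummy. *)
Definition expected_phi (p : probability W R) (gam : simplex) (d : R) n : R :=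
  \int[(iid (gam : probability 'I_q.+1 R) n.+1 \x
        poisson_prob (d * n.+1%:R / k.+1%:R) 0)%E]_x
    let '(sigma, m) := x in
    \int[@teacher_student n m p sigma]_G phiG gam G.

Definition Zf (psi : W) (g : k.+1.-tuple simplex) : R :=
  \sum_(tau : assignment)
    (psi tau)%:num * \prod_(h < k.+1) mass (tnth g h) (tnth tau h).

Definition Zfm (psi : W) (h : 'I_k.+1) (g g' : k.+1.-tuple simplex) : R :=
  \sum_(tau : assignment)
    (psi tau)%:num * mass (tnth g h) (tnth tau h) *
    \prod_(h' < k.+1 | h' != h) mass (tnth g' h') (tnth tau h').

Definition Zbar (p : probability W R) (gam : simplex) : R :=
  \int[p]_psi Zf psi [tuple of nseq k.+1 gam].

Definition xi (p : probability W R) : R := sup (range (Zbar p)).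

Definition has_mean (pi : probability simplex R) (gam : simplex) : Prop :=
  forall z, \int[pi]_g mass g z = mass gam z.

Definition nabla (p : probability W R) (pi1 pi2 : probability simplex R) : R :=
  \int[(p \x unif 'I_k.+1 R \x iid pi1 k.+1 \x iid pi2 k.+1)%E]_x
    let '(psi, h, g1, g2) := x in
    Lambda (Zf psi g1) + (k.+1%:R - 1) * Lambda (Zf psi g2)
    - k.+1%:R * Lambda (Zfm psi h g1 g2).

(* The set of admissible pairs (p, gam). A law on the box
   [psidn, psiup]^([q]^k), psiup = 1 / psidn, is a law on weight functions
   that gives full measure to this box. *)
Definition admissible (psidn : R) (p : probability W R) (gam : simplex) : Prop :=
  [/\ p [set psi | forall tau, psidn <= (psi tau)%:num <= psidn^-1] = 1%E,
      forall z, psidn <= mass gam z,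
      Zbar p gam = xi p &
      forall pi1 pi2, has_mean pi1 gam -> has_mean pi2 gam ->
        0 <= nabla p pi1 pi2].

(* The data (psi_a, h_a, gamma_{a,.}) attached to the a-th factor. *)
Local Notation factor_data := (W * 'I_k.+1 * k.+1.-tuple simplex)%type.

Definition Zv (gam : simplex) (d' : nat) (x : d'.-tuple factor_data) : R :=
  \sum_(sigma : color) mass gam sigma *
    \prod_(a < d') let '(psi, h, g) := tnth x a in
      \sum_(tau : assignment) (tnth tau h == sigma)%:R * (psi tau)%:num *
        \prod_(h' < k.+1 | h' != h) mass (tnth g h') (tnth tau h').

(* Given d', Zv only involves the first d' terms of the i.i.d. sequence of
   factor data, so the expectation is over their joint law. *)
Definition Bethe (p : probability W R) (gam : simplex) (d : R)
    (pi : probability simplex R) : R :=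
  \int[poisson_prob d 0]_d'
    \int[iid (p \x unif 'I_k.+1 R \x iid pi k.+1)%E d']_x
      ((xi p) ^- d' * Lambda (Zv gam x))
  - d * (k.+1%:R - 1) / (k.+1%:R * xi p) *
    \int[(p \x iid pi k.+1)%E]_x Lambda (Zf x.1 x.2).

Definition Bethe_sup (p : probability W R) (gam : simplex) (d : R) : R :=
  sup [set Bethe p gam d pi | pi in [set pi | has_mean pi gam]].

End bethe.

(* Main.v *)
(* Posterior expectations are written as iterated averaging operators acting on
   nonnegative weights W on configurations: op mu f F W is the mean of
   F (W * f x), x ~ mu, where every f has mean one at each configuration. Such
   operators commute, so a one-step comparison of two of them can be telescoped
   (tele). In this language the teacher-student free entropy is, up to a Jensen
   error of order n^(-1/2), the Poisson average of the iterates of opA applied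
   to t ln t, started from the product weight.
   Pinning T uniformly random coordinates, T ~ n^(1/4), costs only T ln q and
   makes the Gibbs marginals asymptotically independent; the marginals are then
   corrected so as to average exactly to gam.
   Lower bound: interpolation between factors and half-edges with messages drawn
   from pi; each step has the sign given by nabla >= 0.
   Upper bound: Aizenman-Sims-Starr, adding one variable together with its
   factors while thinning the others, and comparing with the Bethe functional at
   the empirical law of the corrected marginals.
   Since Zbar is maximal at gam, the side average cc is constant, which keeps
   the side operators mean one. All the errors balance at n^(-1/8). *)
Require Import Defs.
From HB Require Import structures.
From mathcomp Require Import all_boot all_order all_algebra.
From mathcomp Require Import all_classical all_reals all_analysis.
From mathcomp Require Import measurable_realfun.
From mathcomp Require Import ring lra zify.

Set Implicit Arguments.
Unset Strict Implicit.
Unset Printing Implicit Defensive.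
Import Order.TTheory GRing.Theory Num.Theory.
Import numFieldNormedType.Exports.

Local Open Scope classical_set_scope.
Local Open Scope ring_scope.

(** Planting turns the expectation of [ln Z] into a null-model expectation of [Z ln Z]; hence the
    functional [Lh] on unnormalised weights. Mean-one operators fix every linear functional of the
    weight, so an error [lin e W] passes through iteration unchanged and is evaluated only once, at
    the product weight. A first obstacle is that the normaliser of a planted factor, [nrm s],
    depends on the ground truth. Its distance to [xi_] is controlled by [er s], the deviation of the
    empirical colour law from [gam]. When a variable is added, its first-order change is again small
    by the constancy of [cc]; an error of order [1/n] in each of about [n] factors would otherwise
    sum to order one. A second obstacle, in the upper bound, is that the larger graph has fewer
    factors on the old variables than the smaller graph, by [d (1 - 1/K)] in the mean, [K] being the
    arity. Since [Lh] has nondecreasing increments in the number of factors, this deficit is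
    compensated by a multiple of one increment, and that increment is the edge term of the Bethe
    functional. Weights are clipped to the box by [cl], so that bounds hold pointwise and not just
    almost surely. *)

Section bounded_measurable.
Context {R : realType}.

(** Boundedness is preferred to integrability because it is stable under products and composition
    and does not mention the law: one proof of [bmf f] serves a product measure and all its
    marginals. *)
Definition bmf d (T : measurableType d) (f : T -> R) :=
  measurable_fun setT f /\ exists C : R, forall x, `|f x| <= C.

(** * Expectations of bounded measurable functions *)

Section one.
Context d (T : measurableType d).
Implicit Types (f g : T -> R) (P : probability T R).

Lemma bmf_cst (c : R) : bmf (fun _ : T => c).
Proof. by split => //; exists `|c|. Qed.

Lemma bmfD f g : bmf f -> bmf g -> bmf (fun x => f x + g x).
Proof.
move=> [mf [C fC]] [mg [D gD]]; split; first exact: measurable_funD.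
by exists (C + D) => x; rewrite (le_trans (ler_normD _ _))// lerD.
Qed.

Lemma bmfM f g : bmf f -> bmf g -> bmf (fun x => f x * g x).
Proof.
move=> [mf [C fC]] [mg [D gD]]; split; first exact: measurable_funM.
by exists (C * D) => x; rewrite normrM ler_pM.
Qed.

Lemma bmfZ c f : bmf f -> bmf (fun x => c * f x).
Proof. by move=> bf; apply: bmfM => //; exact: bmf_cst. Qed.

Lemma bmfN f : bmf f -> bmf (fun x => - f x).
Proof. by move=> /(bmfZ (-1)); under eq_fun do rewrite mulN1r. Qed.

Lemma bmfB f g : bmf f -> bmf g -> bmf (fun x => f x - g x).
Proof. by move=> bf bg; apply: bmfD => //; exact: bmfN. Qed.

Lemma bmf_norm f : bmf f -> bmf (fun x => `|f x|).
Proof.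
move=> [mf [C fC]]; split; first exact: measurableT_comp.
by exists C => x; rewrite normr_id.
Qed.

Lemma bmf_sum (I : Type) (r : seq I) (Q : pred I) (f : I -> T -> R) :
  (forall i, bmf (f i)) -> bmf (fun x => \sum_(i <- r | Q i) f i x).
Proof.
move=> bf; elim: r => [|i r IH].
  by under eq_fun do rewrite big_nil; exact: bmf_cst.
under eq_fun do rewrite big_cons.
by case: (Q i) => //; exact: bmfD.
Qed.

Lemma bmf_prod (I : Type) (r : seq I) (Q : pred I) (f : I -> T -> R) :
  (forall i, bmf (f i)) -> bmf (fun x => \prod_(i <- r | Q i) f i x).
Proof.
move=> bf; elim: r => [|i r IH].
  by under eq_fun do rewrite big_nil; exact: bmf_cst.
under eq_fun do rewrite big_cons.
by case: (Q i) => //; exact: bmfM.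
Qed.

Lemma bmf_integrable P f : bmf f -> P.-integrable setT (EFin \o f).
Proof.
move=> [mf [C fC]]; apply: measurable_bounded_integrable => //.
  by rewrite (le_lt_trans (probability_le1 _ _)) ?ltry.
exists C; split; first by rewrite num_real.
by move=> M CM x _ /=; rewrite (le_trans (fC x))// ltW.
Qed.

Lemma ExD P f g : bmf f -> bmf g ->
  \int[P]_x (f x + g x) = \int[P]_x f x + \int[P]_x g x.
Proof. by move=> bf bg; rewrite RintegralD//; exact: bmf_integrable. Qed.

Lemma ExB P f g : bmf f -> bmf g ->
  \int[P]_x (f x - g x) = \int[P]_x f x - \int[P]_x g x.
Proof. by move=> bf bg; rewrite RintegralB//; exact: bmf_integrable. Qed.

Lemma ExZ P c f : bmf f -> \int[P]_x (c * f x) = c * \int[P]_x f x.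
Proof. by move=> bf; rewrite RintegralZl//; exact: bmf_integrable. Qed.

Lemma ExZr P c f : bmf f -> \int[P]_x (f x * c) = \int[P]_x f x * c.
Proof. by move=> bf; rewrite RintegralZr//; exact: bmf_integrable. Qed.

Lemma Ex_cst P (c : R) : \int[P]_x c = c.
Proof.
rewrite (Rintegral_cst _ measurableT) -[RHS]mulr1; congr (_ * _).
exact: (congr1 fine (@probability_setT _ _ _ P)).
Qed.

Lemma Ex_le P f g : bmf f -> bmf g -> (forall x, f x <= g x) ->
  \int[P]_x f x <= \int[P]_x g x.
Proof. by move=> bf bg fg; apply: le_Rintegral => //; exact: bmf_integrable. Qed.

Lemma Ex_ge0 P f : (forall x, 0 <= f x) -> 0 <= \int[P]_x f x.
Proof. by move=> f0; apply: Rintegral_ge0. Qed.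

Lemma Ex_sum P (I : Type) (r : seq I) (Q : pred I) (f : I -> T -> R) :
  (forall i, bmf (f i)) ->
  \int[P]_x (\sum_(i <- r | Q i) f i x) = \sum_(i <- r | Q i) \int[P]_x f i x.
Proof.
move=> bf; elim: r => [|i r IH].
  by under eq_Rintegral do rewrite big_nil; rewrite Ex_cst big_nil.
under eq_Rintegral do rewrite big_cons.
rewrite big_cons; case: (Q i) => //.
by rewrite ExD// ?IH//; exact: bmf_sum.
Qed.

Lemma Ex_normr P f : bmf f -> `|\int[P]_x f x| <= \int[P]_x `|f x|.
Proof. by move=> bf; apply: le_normr_Rintegral => //; exact: bmf_integrable. Qed.

Lemma Ex_bound P f C : bmf f -> (forall x, `|f x| <= C) -> `|\int[P]_x f x| <= C.
Proof.
move=> bf fC; rewrite (le_trans (Ex_normr P bf))// -[leRHS](Ex_cst P).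
by apply: Ex_le => //; [exact: bmf_norm|exact: bmf_cst].
Qed.

End one.

Lemma bmf_comp d d' (T : measurableType d) (T' : measurableType d')
    (f : T' -> R) (h : T -> T') :
  measurable_fun setT h -> bmf f -> bmf (fun x => f (h x)).
Proof.
by move=> mh [mf [C fC]]; split; [exact: measurableT_comp|exists C].
Qed.

Lemma Ex_distribution d d' (T : measurableType d) (T' : measurableType d')
    (P : probability T R) (X : {mfun T >-> T'}) (f : T' -> R) : bmf f ->
  \int[distribution P X]_y f y = \int[P]_x f (X x).
Proof.
move=> bf; rewrite /Rintegral integral_distribution//.
  by apply/measurable_EFinP; case: bf.
exact: (bmf_integrable P (bmf_comp _ bf)).
Qed.

Section two.
Context d1 d2 (T1 : measurableType d1) (T2 : measurableType d2).
Variables (P : probability T1 R) (Q : probability T2 R) (f : T1 * T2 -> R).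
Hypothesis bf : bmf f.

Lemma bmf_pair1 x : bmf (fun y => f (x, y)).
Proof.
case: bf => mf [C fC]; split; last by exists C.
exact: measurableT_comp.
Qed.

Lemma bmf_pair2 y : bmf (fun x => f (x, y)).
Proof.
case: bf => mf [C fC]; split; last by exists C.
exact: measurableT_comp.
Qed.

Lemma bmf_Ex : bmf (fun x => \int[Q]_y f (x, y)).
Proof.
case: (bf) => mf [C fC]; split; last first.
  by exists C => x; apply: Ex_bound => //; exact: bmf_pair1.
have := measurable_fubini_F (bmf_integrable (P \x Q)%E bf).
exact: measurableT_comp.
Qed.

Lemma Ex_prod : \int[(P \x Q)%E]_z f z = \int[P]_x \int[Q]_y f (x, y).
Proof.
rewrite /Rintegral -integral12_prod_meas1; last exact: (bmf_integrable (P \x Q)%E).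
congr fine; apply: eq_integral => x _; rewrite /fubini_F/= fineK//.
by apply: integrable_fin_num => //; apply: (bmf_integrable Q); exact: bmf_pair1.
Qed.

Lemma Ex_prod2 : \int[(P \x Q)%E]_z f z = \int[Q]_y \int[P]_x f (x, y).
Proof.
rewrite /Rintegral -integral21_prod_meas1; last exact: (bmf_integrable (P \x Q)%E).
congr fine; apply: eq_integral => x _; rewrite /fubini_G/= fineK//.
by apply: integrable_fin_num => //; apply: (bmf_integrable P); exact: bmf_pair2.
Qed.

End two.

Lemma Ex_swap d1 d2 (T1 : measurableType d1) (T2 : measurableType d2)
    (P : probability T1 R) (Q : probability T2 R) (f : T1 -> T2 -> R) :
  bmf (fun z : T1 * T2 => f z.1 z.2) ->
  \int[P]_x \int[Q]_y f x y = \int[Q]_y \int[P]_x f x y.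
Proof.
by move=> bf; rewrite -(Ex_prod P Q bf) (Ex_prod2 P Q bf).
Qed.

Lemma bmf_tcons d (T : measurableType d) n (f : n.+1.-tuple T -> R) : bmf f ->
  bmf (fun z => f (@tcons _ T n z)).
Proof. by apply: bmf_comp; exact: measurable_tcons. Qed.

Lemma Ex_iid0 d (T : measurableType d) (P : probability T R)
    (f : 0.-tuple T -> R) : measurable_fun setT f ->
  \int[iid P 0]_x f x = f [tuple].
Proof.
move=> mf; rewrite /Rintegral integral_dirac// ?diracT ?mul1e//.
exact/measurable_EFinP.
Qed.

Lemma Ex_iidS d (T : measurableType d) (P : probability T R) n
    (f : n.+1.-tuple T -> R) : bmf f ->
  \int[iid P n.+1]_x f x = \int[P]_x \int[iid P n]_t f (tcons (x, t)).
Proof.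
move=> bf; rewrite [iid P n.+1]/= Ex_distribution// Ex_prod//; exact: bmf_tcons.
Qed.

Lemma Ex_unif d (T : finMeasurableType d) (f : T -> R) : measurable_fun setT f ->
  \int[unif T R]_x f x = #|T|%:R^-1 * \sum_(x : T) f x.
Proof.
move=> mf.
have bfs (g : T -> R) : exists C : R, forall x, `|g x| <= C.
  exists (\sum_x `|g x|) => x; rewrite (bigD1 x)//= lerDl sumr_ge0//.
have T0 : (0 : R) <= #|T|%:R^-1 by rewrite invr_ge0.
have pos (g : T -> R) : measurable_fun setT g -> (forall x, 0 <= g x) ->
    \int[unif T R]_x g x = #|T|%:R^-1 * \sum_(x : T) g x.
  move=> mg g0; rewrite /Rintegral.
  pose m := mscale (NngNum T0) (msum (fun i => dirac (nth point (enum T) i)) #|T|).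
  rewrite (@eq_measure_integral _ _ _ _ m); last first.
    move=> A mA _; rewrite /m /mscale/= /unif /msum; congr (_ * _)%E.
    transitivity (\sum_(0 <= i < #|T|) \d_(nth point (enum T) i) A : \bar R)%E; last by rewrite big_mkord.
    by rewrite cardE -(big_nth point xpredT (fun x => \d_x A)) big_enum.
  have mg' : measurable_fun setT (EFin \o g) by exact/measurable_EFinP.
  have g0' x : setT x -> (0 <= (g x)%:E)%E by rewrite lee_fin.
  rewrite ge0_integral_mscale//= ge0_integral_measure_sum//=.
  under eq_bigr do rewrite (integral_dirac _ measurableT mg') diracT mul1e.
  rewrite sumEFin -EFinM /=; congr (_ * _).
  transitivity (\sum_(0 <= i < #|T|) g (nth point (enum T) i)); first by rewrite big_mkord.
  by rewrite cardE -(big_nth point xpredT g) big_enum.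
(* Adding a bound of [f] reduces the signed case to the nonnegative one, where the integral is
   additive in the measure. *)
have [C fC] := bfs f.
have -> : \int[unif T R]_x f x = \int[unif T R]_x (f x + C) - C.
  by rewrite (ExD _ (conj mf (bfs f)) (bmf_cst _ C)) Ex_cst addrK.
rewrite pos; last 2 first.
- by apply: measurable_funD.
- by move=> x; have := fC x; rewrite ler_norml => /andP[]; rewrite -lerBlDr sub0r.
rewrite big_split/= sumr_const mulrDr -[C *+ _]mulr_natl mulrA mulVf ?mul1r ?addrK//.
by rewrite pnatr_eq0 -lt0n; apply/card_gt0P; exists point.
Qed.

End bounded_measurable.

(** * Poisson expectations of functions of geometric growth *)

Section poisson.
Context {R : realType}.
Implicit Types (l C K : R) (g h : nat -> R) (m N : nat).

Definition pois l m : R := l ^+ m / m`!%:R * expR (- l).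

(** The class that replaces bounded functions for Poisson variables: the [m]-th iterate of an
    operator grows like [K ^+ m], and the Poisson law has all such moments. *)
Definition geo g := exists C K, [/\ 0 <= C, 0 <= K & forall m, `|g m| <= C * K ^+ m].

Definition PoE l g : R := \int[poisson_prob l 0]_m g m.

Lemma pois_ge0 l m : 0 <= l -> 0 <= pois l m.
Proof. by move=> l0; rewrite mulr_ge0 ?expR_ge0// divr_ge0// exprn_ge0. Qed.

Lemma measurable_nat_fun (g : nat -> R) : measurable_fun setT g.
Proof. by []. Qed.

Lemma poisson_series l g : 0 <= l -> (forall m, 0 <= g m) ->
  (\int[poisson_prob l 0]_m (g m)%:E = \sum_(m <oo) (pois l m * g m)%:E)%E.
Proof.
move=> l0 g0.
have mg : measurable_fun setT (EFin \o g) by [].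
(* At rate [0] the law is the Dirac mass at [0], and the series reproduces it because
   [0 ^+ 0 = 1]. *)
move: l0; rewrite le_eqVlt => /predU1P[<-|l0].
  rewrite (@eq_measure_integral _ _ _ _ (dirac 0%N)); last first.
    by move=> A mA _; rewrite /= /poisson_prob ltxx.
  rewrite (integral_dirac _ measurableT mg) diracT mul1e.
  rewrite (nneseries_split _ 1%N)/=; last by move=> *; rewrite lee_fin mulr_ge0 ?pois_ge0.
  rewrite add0n big_nat1 eseries0 ?adde0; last first.
    by move=> [|i]//= _ _; rewrite /pois expr0n/= !mul0r.
  by rewrite /pois expr0 fact0 divr1 oppr0 expR0 !mul1r.
pose m_ k := mscale (NngNum (@pois_ge0 l k (ltW l0))) (dirac k : {measure set nat -> \bar R}).
rewrite (@eq_measure_integral _ _ _ _ (mseries m_ 0)); last first.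
  move=> A mA _; rewrite /= /poisson_prob l0 /mseries/=.
  rewrite esum_mkcond -nneseries_esumT; last first.
    by move=> n; case: ifP => // _; rewrite lee_fin poisson_pmf_ge0.
  apply: eq_eseriesr => i _; rewrite /m_ /mscale/= diracE.
  by case: (i \in A); rewrite ?mule1 ?mule0// /poisson_pmf l0.
rewrite ge0_integral_measure_series//=; last by move=> t _; rewrite lee_fin.
apply: eq_eseriesr => i _; rewrite /m_ ge0_integral_mscale//=; last first.
  by move=> t _; rewrite lee_fin.
by rewrite (integral_dirac _ measurableT mg) diracT mul1e EFinM.
Qed.

(** Exponential tilting: weighting a Poisson law by [K ^+ m] multiplies its rate by [K], so the
    moment reduces to the total mass of another Poisson law. *)
Lemma pois_mulX l K m : pois l m * K ^+ m = expR (l * K - l) * pois (l * K) m.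
Proof.
rewrite /pois exprMn expRD [expR (- (l * K))]expRN.
by field; rewrite gt_eqF ?expR_gt0// pnatr_eq0 -lt0n fact_gt0.
Qed.

Lemma integral_poisX l K : 0 <= l -> 0 <= K ->
  (\int[poisson_prob l 0]_m (K ^+ m)%:E = (expR (l * K - l))%:E)%E.
Proof.
move=> l0 K0; rewrite poisson_series//; last by move=> m; rewrite exprn_ge0.
under eq_eseriesr do rewrite pois_mulX EFinM.
rewrite nneseriesZl; last by move=> i _; rewrite lee_fin pois_ge0 ?mulr_ge0.
have := @poisson_series (l * K) (fun=> 1) (mulr_ge0 l0 K0) (fun=> ler01).
under [in X in _ = X -> _]eq_eseriesr do rewrite mulr1.
move=> <-; rewrite integral_cst//=.
by rewrite mul1e (_ : poisson_prob _ _ _ = 1%E) ?mule1//; exact: (@probability_setT _ _ _ (poisson_prob (l * K) 0)).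
Qed.

Lemma geo_integrable l g : 0 <= l -> geo g ->
  (poisson_prob l 0).-integrable setT (EFin \o g).
Proof.
move=> l0 [C [K [C0 K0 gCK]]]; apply/integrableP; split => //.
apply: (@le_lt_trans _ _ (\int[poisson_prob l 0]_m (C%:E * (K ^+ m)%:E))%E).
  by apply: ge0_le_integral => //= m _; rewrite lee_fin ?gCK// mulr_ge0 ?exprn_ge0.
rewrite ge0_integralZl//; last by move=> m _; rewrite lee_fin exprn_ge0.
by rewrite integral_poisX// -EFinM ltry.
Qed.

Lemma geo_cst c : geo (fun=> c).
Proof. by exists `|c|, 1; split => // m; rewrite expr1n mulr1. Qed.

Lemma geoX C K : 0 <= K -> geo (fun m => C * K ^+ m).
Proof.
by move=> K0; exists `|C|, K; split => // m; rewrite normrM (ger0_norm (exprn_ge0 _ _)).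
Qed.

Lemma geo_le g h : geo h -> (forall m, `|g m| <= `|h m|) -> geo g.
Proof.
by move=> [C [K [C0 K0 H]]] gh; exists C, K; split => // m; exact: le_trans (H m).
Qed.

Lemma geoM g h : geo g -> geo h -> geo (fun m => g m * h m).
Proof.
move=> [C [K [C0 K0 gCK]]] [D [L [D0 L0 hDL]]].
exists (C * D), (K * L); split; rewrite ?mulr_ge0// => m.
by rewrite normrM exprMn mulrACA ler_pM.
Qed.

Lemma geoD g h : geo g -> geo h -> geo (fun m => g m + h m).
Proof.
move=> [C [K [C0 K0 gCK]]] [D [L [D0 L0 hDL]]].
exists (C + D), (K + L); split; rewrite ?addr_ge0// => m.
rewrite (le_trans (ler_normD _ _))// mulrDl lerD//.
  apply: le_trans (gCK m) _; apply: ler_wpM2l => //.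
  by apply: lerXn2r; rewrite ?nnegrE ?addr_ge0// lerDl.
apply: le_trans (hDL m) _; apply: ler_wpM2l => //.
by apply: lerXn2r; rewrite ?nnegrE ?addr_ge0// lerDr.
Qed.

Lemma geoZ c g : geo g -> geo (fun m => c * g m).
Proof. by move=> gg; apply: geoM => //; exact: geo_cst. Qed.

Lemma geoB g h : geo g -> geo h -> geo (fun m => g m - h m).
Proof.
move=> gg gh; apply: geoD => //.
by have := geoZ (-1) gh; under eq_fun do rewrite mulN1r.
Qed.

Lemma geo_id : geo (fun m => m%:R).
Proof.
exists 1, 2; split => // m; rewrite mul1r ger0_norm// -natrX ler_nat.
by rewrite ltnW// ltn_expl.
Qed.

Lemma geo_sum (I : Type) (r : seq I) (f : I -> nat -> R) :
  (forall i, geo (f i)) -> geo (fun m => \sum_(i <- r) f i m).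
Proof.
move=> gf; elim: r => [|i r IH].
  by under eq_fun do rewrite big_nil; exact: geo_cst.
by under eq_fun do rewrite big_cons; exact: geoD.
Qed.

Variable l : R.
Hypothesis l0 : 0 <= l.

Lemma PoED g h : geo g -> geo h -> PoE l (fun m => g m + h m) = PoE l g + PoE l h.
Proof. by move=> gg gh; rewrite /PoE RintegralD//; exact: geo_integrable. Qed.

Lemma PoEZ c g : geo g -> PoE l (fun m => c * g m) = c * PoE l g.
Proof. by move=> gg; rewrite /PoE RintegralZl//; exact: geo_integrable. Qed.

Lemma PoEB g h : geo g -> geo h -> PoE l (fun m => g m - h m) = PoE l g - PoE l h.
Proof. by move=> gg gh; rewrite /PoE RintegralB//; exact: geo_integrable. Qed.

Lemma PoE_cst c : PoE l (fun=> c) = c.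
Proof. exact: Ex_cst. Qed.

Lemma PoE_le g h : geo g -> geo h -> (forall m, g m <= h m) -> PoE l g <= PoE l h.
Proof. by move=> gg gh H; apply: le_Rintegral => //; exact: geo_integrable. Qed.

Lemma PoE_sum (I : Type) (r : seq I) (f : I -> nat -> R) :
  (forall i, geo (f i)) ->
  PoE l (fun m => \sum_(i <- r) f i m) = \sum_(i <- r) PoE l (f i).
Proof.
move=> gf; elim: r => [|i r IH].
  by rewrite big_nil -[RHS](PoE_cst 0); congr PoE; apply/funext => m; rewrite big_nil.
rewrite big_cons -IH -PoED//; last exact: geo_sum.
by congr PoE; apply/funext => m; rewrite big_cons.
Qed.

Lemma PoE_norm g : geo g -> `|PoE l g| <= PoE l (fun m => `|g m|).
Proof. by move=> gg; apply: le_normr_Rintegral => //; exact: geo_integrable. Qed.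

Lemma PoEX K : 0 <= K -> PoE l (fun m => K ^+ m) = expR (l * K - l).
Proof. by move=> K0; rewrite /PoE /Rintegral integral_poisX. Qed.

Lemma PoE_geo_le g C K : 0 <= C -> 0 <= K -> (forall m, `|g m| <= C * K ^+ m) ->
  `|PoE l g| <= C * expR (l * K - l).
Proof.
move=> C0 K0 H; have gg : geo g by exists C, K.
apply: le_trans (PoE_norm gg) _; rewrite -PoEX// -PoEZ; last first.
  by have := geoX 1 K0; under eq_fun do rewrite mul1r.
by apply: PoE_le => //; [apply: geo_le gg _ => m; rewrite normr_id|exact: geoX].
Qed.

Lemma PoE_series g : (forall m, 0 <= g m) -> geo g ->
  (\sum_(m <oo) (pois l m * g m)%:E = (PoE l g)%:E)%E.
Proof.
move=> g0 gg; rewrite -poisson_series// /PoE /Rintegral fineK//.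
by apply: integrable_fin_num => //; exact: geo_integrable.
Qed.

Lemma PoE_delta i : PoE l (fun m => (m == i)%:R) = pois l i.
Proof.
have gg : geo (fun m => (m == i)%:R).
  by apply: geo_le (geo_cst 1) _ => m; case: eqP; rewrite ?normr1 ?normr0.
apply: EFin_inj; rewrite -PoE_series//.
rewrite (nneseries_split _ i.+1)/=; last by move=> *; rewrite lee_fin mulr_ge0 ?pois_ge0.
rewrite add0n eseries0 ?adde0; last first.
  by move=> j /= ij _; rewrite gtn_eqF ?mulr0.
rewrite big_nat_recr//= eqxx mulr1 big_nat big1 ?add0e// => j /andP[_ ji].
by rewrite ltn_eqF ?mulr0.
Qed.

Definition po_tail K N := PoE l (fun m => K ^+ m) - \sum_(m < N) pois l m * K ^+ m.

Lemma PoE_partial g C K N : 0 <= C -> 0 <= K -> (forall m, `|g m| <= C * K ^+ m) ->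
  `|PoE l g - \sum_(m < N) pois l m * g m| <= C * po_tail K N.
Proof.
move=> C0 K0 gCK.
have gg : geo g by exists C, K.
have gK : geo (fun m => K ^+ m) by have := geoX 1 K0; under eq_fun do rewrite mul1r.
have gd i : geo (fun m => (m == i)%:R).
  by apply: geo_le (geo_cst 1) _ => m; case: eqP; rewrite ?normr1 ?normr0.
(* A partial sum is itself a Poisson expectation, of a combination of point indicators; the
   remainder is then the expectation of [h] cut off below [N], and monotonicity applies. *)
have fin h : geo h -> PoE l h - \sum_(i < N) pois l i * h i =
    PoE l (fun m => (N <= m)%:R * h m).
  move=> gh; under eq_bigr do rewrite -PoE_delta mulrC -PoEZ//.
  rewrite -PoE_sum; last by move=> i; exact: geoZ.
  rewrite -PoEB//; last by apply: geo_sum => i; exact: geoZ.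
  congr PoE; apply/funext => m; case: leqP => Nm.
    rewrite big1 ?subr0 ?mul1r// => i _.
    by rewrite gtn_eqF ?mulr0// (leq_trans _ Nm).
  rewrite (bigD1 (Ordinal Nm))//= eqxx mulr1 big1 ?addr0 ?subrr ?mul0r// => i im.
  by rewrite (_ : (m == i) = false) ?mulr0//; apply/negbTE; apply: contra im => /eqP mi; apply/eqP/val_inj.
have gI h : geo h -> geo (fun m => (N <= m)%:R * h m).
  by move=> gh; apply: geo_le gh _ => m; case: leqP; rewrite ?mul1r ?mul0r ?normr0.
rewrite fin// /po_tail fin// -PoEZ; last exact: gI.
apply: le_trans (PoE_norm (gI _ gg)) _; apply: PoE_le.
- by apply: geo_le (gI _ gg) _ => m; rewrite normr_id.
- exact/geoZ/gI.
- by move=> m; case: leqP; rewrite ?mul1r ?mul0r ?normr0 ?mulr0.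
Qed.

Lemma po_tail_cvg K : 0 <= K -> po_tail K @ \oo --> 0.
Proof.
move=> K0.
have gK : geo (fun m => K ^+ m) by have := geoX 1 K0; under eq_fun do rewrite mul1r.
have : (fun N => \sum_(m < N) pois l m * K ^+ m) @ \oo --> PoE l (fun m => K ^+ m).
  have := @is_cvg_nneseries R (fun m => (pois l m * K ^+ m)%:E) xpredT 0%N.
  have nn n : (0 <= (pois l n * K ^+ n)%:E)%E by rewrite lee_fin mulr_ge0 ?pois_ge0 ?exprn_ge0.
  move=> /(_ (fun n _ _ => nn n)) /cvg_ex[a /[dup] ca /cvg_lim -/(_ (@ereal_hausdorff R))].
  rewrite PoE_series// => [E|m]; last by rewrite exprn_ge0.
  move: ca; rewrite -E; under eq_cvg do rewrite sumEFin big_mkord.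
  by move/fine_cvgP => [].
move=> /(cvgB (cvg_cst (PoE l (fun m => K ^+ m)))); rewrite subrr.
exact.
Qed.

(** Operators are only known to be finitely additive. Estimates are therefore proved for partial
    Poisson sums, uniformly in the cut-off, and passed to the limit here. *)
Lemma PoE_le_partial g G c K : 0 <= K -> geo g ->
  (forall N, \sum_(m < N) pois l m * g m <= G + c * po_tail K N) -> PoE l g <= G.
Proof.
move=> K0 [C [L [C0 L0 gCL]]] H.
have cv : (fun N => G + c * po_tail K N + C * po_tail L N) @ \oo --> G + c * 0 + C * 0.
  apply: cvgD; last by apply: cvgMr; exact: po_tail_cvg.
  by apply: cvgD; [exact: cvg_cst|apply: cvgMr; exact: po_tail_cvg].
rewrite !mulr0 !addr0 in cv.
apply: (ler_cvg_to (cvg_cst (PoE l g)) cv); apply: nearW => N.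
have := PoE_partial N C0 L0 gCL; rewrite ler_norml => /andP[_].
by rewrite lerBlDr => /le_trans; apply; rewrite addrC lerD2r.
Qed.

Lemma PoE_id : PoE l (fun m => m%:R) = l.
Proof.
apply: EFin_inj; rewrite -PoE_series//; last exact: geo_id.
rewrite (nneseries_split _ 1%N)/=; last by move=> *; rewrite lee_fin mulr_ge0 ?pois_ge0.
rewrite add0n big_nat1 mulr0 add0e -nneseries_addn//; last first.
  by move=> i; rewrite lee_fin mulr_ge0 ?pois_ge0.
under eq_eseriesr.
  move=> i _; rewrite (_ : pois l (i + 1) * (i + 1)%:R = l * pois l i); last first.
    rewrite /pois addn1 factS exprS natrM.
    by field; rewrite ?pnatr_eq0 -?lt0n ?fact_gt0 -[1]/(1%:R) -natrD pnatr_eq0.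
  rewrite EFinM; over.
rewrite nneseriesZl; last by move=> i _; rewrite lee_fin pois_ge0.
have := PoE_series (fun=> ler01) (geo_cst 1).
by under eq_eseriesr do rewrite mulr1; move=> ->; rewrite PoE_cst mule1.
Qed.

End poisson.

(** * Splitting of a Poisson variable by independent marks *)

Section poisson_split.
Context {R : realType}.
Variables (l r : R).
Hypotheses (l0 : 0 <= l) (r01 : 0 <= r <= 1).
Let r0 : 0 <= r. Proof. by case/andP: r01. Qed.
Let s0 : 0 <= 1 - r. Proof. by case/andP: r01; rewrite subr_ge0. Qed.
Let rl0 : 0 <= r * l. Proof. by rewrite mulr_ge0. Qed.
Let sl0 : 0 <= (1 - r) * l. Proof. by rewrite mulr_ge0. Qed.

(** The expectation of [a i (M - i)] when [i] is binomial with parameters [M] and [r]. *)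
Definition binmix (a : nat -> nat -> R) (M : nat) : R :=
  \sum_(i < M.+1) 'C(M, i)%:R * r ^+ i * (1 - r) ^+ (M - i) * a i (M - i)%N.

Let binmix_le (a : nat -> nat -> R) (C K : R) :
  (forall i j, `|a i j| <= C * K ^+ (i + j)) ->
  forall M, `|binmix a M| <= C * K ^+ M.
Proof.
move=> aCK M; rewrite (le_trans (ler_norm_sum _ _ _))//.
apply: (@le_trans _ _ (\sum_(i < M.+1) 'C(M, i)%:R * r ^+ i * (1 - r) ^+ (M - i) * (C * K ^+ M))).
  apply: ler_sum => i _; rewrite normrM.
  have c0 : 0 <= 'C(M, i)%:R * r ^+ i * (1 - r) ^+ (M - i).
    by rewrite !mulr_ge0 ?exprn_ge0.
  rewrite ger0_norm//; apply: ler_wpM2l => //.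
  by rewrite (le_trans (aCK _ _))// subnKC// -ltnS.
rewrite -mulr_suml (_ : \sum_(i < _) _ = 1) ?mul1r//.
have := exprDn (1 - r) r M; rewrite subrK expr1n => E.
by rewrite [RHS]E; apply: eq_bigr => i _; rewrite -[RHS]mulr_natl; ring.
Qed.

Let pois_split i j :
  pois l (i + j) * ('C(i + j, i)%:R * r ^+ i * (1 - r) ^+ j) =
  pois (r * l) i * pois ((1 - r) * l) j.
Proof.
have := @bin_fact (i + j) i (leq_addr _ _); rewrite addKn => /(congr1 (fun n => n%:R : R)).
rewrite !natrM => E.
rewrite /pois -E !exprMn exprD (_ : - l = - (r * l) + - ((1 - r) * l)); last by ring.
rewrite expRD; field.
by rewrite !pnatr_eq0 -!lt0n !fact_gt0 bin_gt0 leq_addr.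
Qed.

(** By nonnegativity the double series may be summed along the diagonals [i + j = M], through the
    bijection [(M, i) |-> (i, M - i)] on the pairs with [i <= M]; termwise the identity is
    [pois_split]. *)
Let split_nonneg (a : nat -> nat -> R) (C K : R) : 0 <= C -> 0 <= K ->
  (forall i j, 0 <= a i j) -> (forall i j, `|a i j| <= C * K ^+ (i + j)) ->
  PoE l (binmix a) = PoE (r * l) (fun i => PoE ((1 - r) * l) (a i)).
Proof.
move=> C0 K0 a0 aCK.
pose b i j := pois (r * l) i * pois ((1 - r) * l) j * a i j.
have b0 i j : (0 <= (b i j)%:E)%E.
  by rewrite lee_fin; apply: mulr_ge0 => //; apply: mulr_ge0; exact: pois_ge0.
have gb : geo (binmix a) by exists C, K; split => //; exact: binmix_le.
have bin0 M : 0 <= binmix a M.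
  by apply: sumr_ge0 => i _; rewrite !mulr_ge0 ?exprn_ge0.
have ga i : geo (a i).
  exists (C * K ^+ i), K; split; rewrite ?mulr_ge0 ?exprn_ge0// => j.
  by rewrite -mulrA -exprD.
have gE : geo (fun i => PoE ((1 - r) * l) (a i)).
  exists (C * expR ((1 - r) * l * K - (1 - r) * l)), K; split => //.
    by rewrite mulr_ge0// expR_ge0.
  move=> i; rewrite mulrAC; apply: PoE_geo_le => //; first by rewrite mulr_ge0 ?exprn_ge0.
  by move=> j; rewrite -mulrA -exprD.
apply: EFin_inj; rewrite -PoE_series// -PoE_series//; last by move=> i; exact: Ex_ge0.
transitivity (\esum_(k in [set: nat] `*`` (fun M => `I_M.+1)) (b k.2 (k.1 - k.2)%N)%:E)%E.
  rewrite -(@esum_esum _ _ _ _ _ (fun M i => (b i (M - i)%N)%:E))//.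
  rewrite -nneseries_esumT; last by move=> n; apply: esum_ge0.
  apply: eq_eseriesr => M _.
  rewrite esum_fset//.
  rewrite -fsbig_ord/= sumEFin; congr EFin.
  rewrite /binmix mulr_sumr; apply: eq_bigr => i _.
  have iM : (i <= M)%N by rewrite -ltnS.
  by rewrite /b -pois_split subnKC// !mulrA.
transitivity (\esum_(k in [set: nat] `*`` (fun _ => [set: nat])) (b k.1 k.2)%:E)%E; last first.
  rewrite -(@esum_esum _ _ _ _ _ (fun i j => (b i j)%:E))//.
  rewrite -nneseries_esumT; last by move=> n; apply: esum_ge0.
  apply: eq_eseriesr => i _.
  rewrite EFinM -PoE_series// -nneseriesZl; last first.
    by move=> j _; rewrite lee_fin; apply: mulr_ge0 => //; exact: pois_ge0.
  rewrite -nneseries_esumT//.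
  by apply: eq_eseriesr => j _; rewrite -EFinM /b -!mulrA.
rewrite [RHS](@reindex_esum _ _ _ ([set: nat] `*`` (fun M => `I_M.+1)) _ (fun k : nat * nat => (k.2, (k.1 - k.2)%N)))//.
split => //.
- move=> [M i] [M' i']; rewrite !inE/= => -[_ Mi] [_ Mi'] [ii' H].
  by rewrite ii' in Mi H *; congr pair; lia.
- move=> [i j] _; exists ((i + j)%N, i) => /=; last by rewrite addKn.
  by split => //=; rewrite ltnS leq_addr.
Qed.

(** A Poisson number of points marked with probability [r] is a pair of independent Poisson numbers.
    The signed case follows from the nonnegative one applied to [a] plus its geometric majorant and
    to the majorant alone. *)
Lemma PoE_split (a : nat -> nat -> R) (C K : R) : 0 <= C -> 0 <= K ->
  (forall i j, `|a i j| <= C * K ^+ (i + j)) ->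
  PoE l (binmix a) = PoE (r * l) (fun i => PoE ((1 - r) * l) (a i)).
Proof.
move=> C0 K0 aCK.
pose c i j : R := C * K ^+ (i + j).
have c0 i j : 0 <= c i j by rewrite mulr_ge0 ?exprn_ge0.
have cn i j : `|c i j| <= C * K ^+ (i + j) by rewrite ger0_norm.
pose b i j := a i j + c i j.
have b0 i j : 0 <= b i j.
  by have := aCK i j; rewrite ler_norml => /andP[]; rewrite -lerBlDr sub0r.
have bn i j : `|b i j| <= (C + C) * K ^+ (i + j).
  by rewrite (le_trans (ler_normD _ _))// mulrDl lerD.
have gI d D : (forall i j, `|d i j| <= D * K ^+ (i + j)) -> 0 <= D -> forall i, geo (d i).
  move=> dD D0 i; exists (D * K ^+ i), K; split; rewrite ?mulr_ge0 ?exprn_ge0// => j.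
  by rewrite -mulrA -exprD.
have gE d D : (forall i j, `|d i j| <= D * K ^+ (i + j)) -> 0 <= D ->
    geo (fun i => PoE ((1 - r) * l) (d i)).
  move=> dD D0; exists (D * expR ((1 - r) * l * K - (1 - r) * l)), K; split => //.
    by rewrite mulr_ge0// expR_ge0.
  move=> i; rewrite mulrAC; apply: PoE_geo_le => //; first by rewrite mulr_ge0 ?exprn_ge0.
  by move=> j; rewrite -mulrA -exprD.
have gB d D : (forall i j, `|d i j| <= D * K ^+ (i + j)) -> 0 <= D -> geo (binmix d).
  by move=> dD D0; exists D, K; split => //; exact: binmix_le.
have CC : 0 <= C + C by rewrite addr_ge0.
have -> : binmix a = fun M => binmix b M - binmix c M.
  apply/funext => M; rewrite /binmix -sumrB; apply: eq_bigr => i _.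
  by rewrite /b; ring.
rewrite PoEB//; [|exact: gB bn _|exact: gB cn _].
rewrite (split_nonneg CC K0 b0 bn) (split_nonneg C0 K0 c0 cn) -PoEB//; [|exact: gE bn _|exact: gE cn _].
congr PoE; apply/funext => i; rewrite -PoEB//; [|exact: gI bn _ _|exact: gI cn _ _].
by congr PoE; apply/funext => j; rewrite /b addrK.
Qed.

End poisson_split.

(** * Mean-one averaging operators acting on functionals of nonnegative weights *)

Section cone.
Context {R : realType} {S : finType}.
Implicit Types (W : S -> R) (F G : (S -> R) -> R) (E : ((S -> R) -> R) -> (S -> R) -> R).

Definition cone W := forall s, 0 <= W s.
Definition tot W := \sum_s W s.
Definition lin (e : S -> R) W := \sum_s W s * e s.
(** Quadratic growth in the total mass is a simple polynomial class that contains [t ln t], is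
    closed under sums and absolute values, and is preserved when the weight is multiplied by a
    bounded function. *)
Definition bounded_by C F := forall W, cone W -> `|F W| <= C * (1 + tot W) ^+ 2.

(** Measurability is tested along every measurable family of weights. This needs no sigma-algebra on
    the space of weights, and it is inherited by averages over an auxiliary space. *)
Definition nice F :=
  (forall d (X : measurableType d) (g : X -> S -> R),
    (forall s, measurable_fun setT (g ^~ s)) ->
    measurable_fun setT (fun x => F (g x))) /\
  exists2 C : R, 0 <= C & bounded_by C F.

Lemma tot_ge0 W : cone W -> 0 <= tot W.
Proof. by move=> cW; apply: sumr_ge0. Qed.

Lemma lin1 W : lin (fun=> 1) W = tot W.
Proof. by apply: eq_bigr => s _; rewrite mulr1. Qed.

Lemma linD e e' W : lin (fun s => e s + e' s) W = lin e W + lin e' W.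
Proof. by rewrite /lin -big_split; apply: eq_bigr => s _; rewrite mulrDr. Qed.

Lemma linZ c e W : lin (fun s => c * e s) W = c * lin e W.
Proof. by rewrite /lin mulr_sumr; apply: eq_bigr => s _; rewrite mulrCA. Qed.

Lemma lin_cst c W : lin (fun=> c) W = c * tot W.
Proof. by rewrite /lin -mulr_suml mulrC. Qed.

Lemma lin_le e e' W : cone W -> (forall s, e s <= e' s) -> lin e W <= lin e' W.
Proof. by move=> cW ee'; apply: ler_sum => s _; apply: ler_wpM2l. Qed.

Lemma tot_eq0 W : cone W -> tot W = 0 -> forall s, W s = 0.
Proof.
move=> cW t0 s; apply/eqP; rewrite eq_le cW andbT -t0.
by rewrite /tot (bigD1 s)//= lerDl sumr_ge0.
Qed.

Lemma le_tot W s : cone W -> W s <= tot W.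
Proof. by move=> cW; rewrite /tot (bigD1 s)//= lerDl sumr_ge0. Qed.

Lemma nice_cst c : nice (fun=> c).
Proof.
split=> [d X g mg//|]; exists `|c| => // W cW.
rewrite -[leLHS]mulr1 ler_wpM2l// exprn_ege1// lerDl; exact: tot_ge0.
Qed.

Lemma niceD F G : nice F -> nice G -> nice (fun W => F W + G W).
Proof.
move=> [mF [C C0 bF]] [mG [D D0 bG]]; split.
  by move=> d X g mg; apply: measurable_funD; [exact: mF|exact: mG].
exists (C + D); first exact: addr_ge0.
by move=> W cW; rewrite (le_trans (ler_normD _ _))// mulrDl lerD// ?bF// bG.
Qed.

Lemma niceZ c F : nice F -> nice (fun W => c * F W).
Proof.
move=> [mF [C C0 bF]]; split.
  by move=> d X g mg; apply: measurable_funM => //; exact: mF.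
exists (`|c| * C); first exact: mulr_ge0.
by move=> W cW; rewrite normrM -mulrA ler_wpM2l// bF.
Qed.

Lemma niceB F G : nice F -> nice G -> nice (fun W => F W - G W).
Proof.
move=> nF nG; apply: niceD => //.
by have := niceZ (-1) nG; under eq_fun do rewrite mulN1r.
Qed.

Lemma nice_sum (I : Type) (r : seq I) (Q : pred I) (F : I -> (S -> R) -> R) :
  (forall i, nice (F i)) -> nice (fun W => \sum_(i <- r | Q i) F i W).
Proof.
move=> nF; elim: r => [|i r IH].
  by under eq_fun do rewrite big_nil; exact: nice_cst.
under eq_fun do rewrite big_cons.
by case: (Q i) => //; exact: niceD.
Qed.

Lemma nice_abs F : nice F -> nice (fun W => `|F W|).
Proof.
move=> [mF [C C0 bF]]; split.
  by move=> d X g mg; apply: measurableT_comp => //; exact: mF.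
by exists C => // W cW; rewrite normr_id bF.
Qed.

Lemma nice_ev s : nice (fun W => W s).
Proof.
split=> [d X g mg|]; first exact: mg.
exists 1 => // W cW; rewrite ger0_norm// mul1r.
have t0 := tot_ge0 cW.
rewrite (le_trans (le_tot s cW))//; nra.
Qed.

Lemma nice_tot : nice tot.
Proof. by apply: nice_sum => s; exact: nice_ev. Qed.

Lemma nice_lin e : nice (lin e).
Proof.
apply: nice_sum => s; under eq_fun do rewrite mulrC.
by apply: niceZ; exact: nice_ev.
Qed.

(** What is used of an average over mean-one multipliers: linearity, positivity, and [good_ev], by
    which each coordinate of the weight is a martingale. The factor in [good_growth] is uniform in
    [F], so iterates grow geometrically and can be averaged over a Poisson number of steps. *)
Record good E : Prop := Good {
  good_nice : forall F, nice F -> nice (E F) ;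
  good_D : forall F G W, nice F -> nice G -> cone W ->
    E (fun W => F W + G W) W = E F W + E G W ;
  good_Z : forall c F W, nice F -> cone W -> E (fun W => c * F W) W = c * E F W ;
  good_mono : forall F G, nice F -> nice G -> (forall W, cone W -> F W <= G W) ->
    forall W, cone W -> E F W <= E G W ;
  good_ev : forall s W, cone W -> E (fun W => W s) W = W s ;
  good_growth : exists2 K : R, 0 <= K & forall C F, 0 <= C -> nice F ->
    bounded_by C F -> bounded_by (C * K) (E F)
}.

Section good_theory.
Variable E : ((S -> R) -> R) -> (S -> R) -> R.
Hypothesis gE : good E.

Lemma good_ext F G W : nice F -> nice G -> (forall W, cone W -> F W = G W) ->
  cone W -> E F W = E G W.
Proof.
move=> nF nG FG cW; apply/eqP; rewrite eq_le; apply/andP.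
by split; apply: (good_mono gE) => // W' cW'; rewrite FG.
Qed.

Lemma good_B F G W : nice F -> nice G -> cone W ->
  E (fun W => F W - G W) W = E F W - E G W.
Proof.
move=> nF nG cW; have nG1 := niceZ (-1) nG.
rewrite -mulN1r -(good_Z gE)// -(good_D gE)//.
apply: good_ext => //; first exact: niceB.
  exact: niceD.
by move=> W' _; rewrite mulN1r.
Qed.

Lemma good_sum (I : Type) (r : seq I) (Q : pred I) (F : I -> (S -> R) -> R) W :
  (forall i, nice (F i)) -> cone W ->
  E (fun W => \sum_(i <- r | Q i) F i W) W = \sum_(i <- r | Q i) E (F i) W.
Proof.
move=> nF cW; elim: r => [|i r IH].
  rewrite big_nil; under eq_fun do rewrite big_nil.
  transitivity (0 * E (fun=> 0) W); last by rewrite mul0r.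
  rewrite -(good_Z gE)//; last exact: nice_cst.
  by congr (E _ W); apply/funext => W'; rewrite mul0r.
rewrite big_cons; under eq_fun do rewrite big_cons.
case: (Q i) => //; rewrite (good_D gE)// ?IH//; exact: nice_sum.
Qed.

(** A linear functional is a combination of coordinates, each fixed by [good_ev]. This is why linear
    error terms neither grow nor need to be tracked along an iteration. *)
Lemma good_lin e W : cone W -> E (lin e) W = lin e W.
Proof.
move=> cW; rewrite /lin good_sum//; last first.
  by move=> s; under eq_fun do rewrite mulrC; apply: niceZ; exact: nice_ev.
apply: eq_bigr => s _; under eq_fun do rewrite mulrC.
rewrite (good_Z gE)//; last exact: nice_ev.
by rewrite (good_ev gE)// mulrC.
Qed.

Lemma good_tot W : cone W -> E tot W = tot W.
Proof.
move=> cW; rewrite -lin1 -good_lin//; congr E.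
by apply/funext => W'; rewrite lin1.
Qed.

End good_theory.

Definition commutes E E' := forall F W, nice F -> cone W -> E (E' F) W = E' (E F) W.

Lemma commutesC E E' : commutes E E' -> commutes E' E.
Proof. by move=> c F W nF cW; rewrite c. Qed.

Definition idE : ((S -> R) -> R) -> (S -> R) -> R := id.

Lemma good_id : good idE.
Proof.
split => //; exists 1 => // C F C0 nF bF; rewrite mulr1; exact: bF.
Qed.

Lemma commutes_id E : commutes E idE.
Proof. by []. Qed.

Definition mixE (r : R) E E' : ((S -> R) -> R) -> (S -> R) -> R :=
  fun F W => r * E F W + (1 - r) * E' F W.

Lemma good_mix r E E' : 0 <= r <= 1 -> good E -> good E' -> good (mixE r E E').
Proof.
move=> /andP[r0]; rewrite -subr_ge0 => s0 gE gE'; split.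
- by move=> F nF; apply: niceD; apply: niceZ; apply: good_nice.
- by move=> F G W nF nG cW; rewrite /mixE (good_D gE)// (good_D gE')//; ring.
- by move=> c F W nF cW; rewrite /mixE (good_Z gE)// (good_Z gE')//; ring.
- move=> F G nF nG FG W cW; rewrite /mixE lerD// ler_wpM2l//.
    exact: (good_mono gE).
  exact: (good_mono gE').
- by move=> s W cW; rewrite /mixE (good_ev gE)// (good_ev gE')//; ring.
- have [K K0 HK] := good_growth gE; have [K' K'0 HK'] := good_growth gE'.
  exists (r * K + (1 - r) * K'); first by rewrite addr_ge0// mulr_ge0.
  move=> C F C0 nF bF W cW; rewrite /mixE (le_trans (ler_normD _ _))//.
  rewrite !normrM (ger0_norm r0) (ger0_norm s0).
  have h1 := HK C F C0 nF bF W cW; have h2 := HK' C F C0 nF bF W cW.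
  have := lerD (ler_wpM2l r0 h1) (ler_wpM2l s0 h2).
  by move/le_trans; apply; rewrite le_eqVlt; apply/orP; left; apply/eqP; ring.
Qed.

Lemma commutes_mix r E E' E'' : good E'' -> good E -> good E' ->
  commutes E'' E -> commutes E'' E' -> commutes E'' (mixE r E E').
Proof.
move=> g'' g g' c c' F W nF cW; rewrite /mixE -c// -c'//.
rewrite (good_D g'')//; last 2 first.
- by apply: niceZ; exact: good_nice.
- by apply: niceZ; exact: good_nice.
by rewrite !(good_Z g'')//; apply: good_nice.
Qed.

Lemma good_iter m E : good E -> good (iter m E).
Proof.
move=> gE; elim: m => [|m IH]; first exact: good_id.
split => /=.
- by move=> F nF; apply: (good_nice gE); exact: good_nice.
- move=> F G W nF nG cW; rewrite -(good_D gE)//; [|exact: good_nice..].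
  by apply: (good_ext gE) => //; [apply: good_nice => //; exact: niceD
    |by apply: niceD; apply: good_nice|move=> W' cW'; exact: good_D].
- move=> c F W nF cW; rewrite -(good_Z gE)//; last exact: good_nice.
  by apply: (good_ext gE) => //; [apply: good_nice => //; exact: niceZ
    |by apply: niceZ; apply: good_nice|move=> W' cW'; exact: good_Z].
- move=> F G nF nG FG W cW; apply: (good_mono gE) => //; [exact: good_nice..|].
  exact: good_mono.
- move=> s W cW; rewrite -[RHS](good_ev gE)//.
  apply: (good_ext gE) => //; [exact/good_nice/nice_ev|exact: nice_ev|].
  by move=> W' cW'; exact: good_ev.
- have [K K0 HK] := good_growth gE; have [K' K'0 HK'] := good_growth IH.
  exists (K' * K); first exact: mulr_ge0.
  move=> C F C0 nF bF; rewrite mulrA; apply: HK; rewrite ?mulr_ge0//.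
    exact: good_nice.
  exact: HK'.
Qed.

Lemma iter_growth E : good E -> exists2 K : R, 0 <= K & forall C F m, 0 <= C ->
  nice F -> bounded_by C F -> bounded_by (C * K ^+ m) (iter m E F).
Proof.
move=> gE; have [K K0 HK] := good_growth gE; exists K => // C F m C0 nF bF.
elim: m => [|m IH]; first by rewrite mulr1.
rewrite iterS exprSr mulrA; apply: HK => //; first by rewrite mulr_ge0 ?exprn_ge0.
by apply: good_nice => //; exact: good_iter.
Qed.

Lemma geo_iter E F W : good E -> nice F -> cone W -> geo (fun m => iter m E F W).
Proof.
move=> gE nF cW; have [K K0 HK] := iter_growth gE.
have [_ [C C0 bF]] := nF.
exists (C * (1 + tot W) ^+ 2), K; split => //.
  by rewrite mulr_ge0// sqr_ge0.
by move=> m; rewrite mulrAC; exact: HK.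
Qed.

Lemma commutes_iter m E E' : good E -> good E' -> commutes E' E ->
  commutes E' (iter m E).
Proof.
move=> gE gE' c; elim: m => [//|m IH] F W nF cW /=.
rewrite c//; last by apply: good_nice => //; exact: good_iter.
apply: (good_ext gE) => //.
- by apply: good_nice => //; apply: good_nice => //; exact: good_iter.
- by apply: good_nice; [exact: good_iter|exact: good_nice].
- by move=> W' cW'; rewrite IH.
Qed.

Lemma commutes_iterr m E : good E -> commutes E (iter m E).
Proof. by move=> gE; exact: commutes_iter. Qed.

(** The number of steps is uniform below [T]. A uniform number, unlike a fixed one, lets a bounded
    monotone quantity telescope, so that it changes little at a typical step. *)
Definition avgE (T : nat) E : ((S -> R) -> R) -> (S -> R) -> R :=
  fun F W => T%:R^-1 * \sum_(t < T) iter t E F W.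

Lemma good_avg T E : (0 < T)%N -> good E -> good (avgE T E).
Proof.
move=> T0 gE; have gI t := good_iter t gE.
have T0' : 0 <= T%:R^-1 :> R by rewrite invr_ge0.
split.
- by move=> F nF; apply: niceZ; apply: nice_sum => t; exact: (good_nice (gI t)).
- move=> F G W nF nG cW; rewrite /avgE -mulrDr -big_split/=; congr (_ * _).
  by apply: eq_bigr => t _; rewrite (good_D (gI t)).
- move=> c F W nF cW; rewrite /avgE [RHS]mulrCA; congr (_ * _).
  by rewrite mulr_sumr; apply: eq_bigr => t _; rewrite (good_Z (gI t)).
- move=> F G nF nG FG W cW; rewrite /avgE ler_wpM2l//.
  by apply: ler_sum => t _; exact: (good_mono (gI t)).
- move=> s W cW; rewrite /avgE (eq_bigr (fun=> W s)); last first.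
    by move=> t _; rewrite (good_ev (gI t)).
  rewrite sumr_const card_ord -[W s *+ _]mulr_natl mulrA mulVf ?mul1r//.
  by rewrite pnatr_eq0 -lt0n.
- have [K K0 HK] := iter_growth gE.
  exists (T%:R^-1 * \sum_(t < T) K ^+ t).
    by rewrite mulr_ge0// sumr_ge0// => t _; exact: exprn_ge0.
  move=> C F C0 nF bF W cW; rewrite /avgE normrM (ger0_norm T0').
  rewrite (_ : C * _ * _ = T%:R^-1 * (\sum_(t < T) C * K ^+ t * (1 + tot W) ^+ 2)); last first.
    by rewrite -mulr_suml -mulr_sumr; ring.
  rewrite ler_wpM2l// (le_trans (ler_norm_sum _ _ _))//.
  by apply: ler_sum => t _; exact: HK.
Qed.

Lemma commutes_avg T E E' : good E -> good E' -> commutes E' E ->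
  commutes E' (avgE T E).
Proof.
move=> gE gE' c F W nF cW; rewrite /avgE.
have nI t : nice (iter t E F) by apply: good_nice => //; exact: good_iter.
rewrite (good_Z gE')//; last exact: nice_sum.
rewrite (good_sum gE')//; congr (_ * _); apply: eq_bigr => t _.
exact: (commutes_iter t gE gE' c).
Qed.

(** In the induction the extra [E] is moved inside all the [E'] by commutation, so that the one-step
    comparison is needed for [F] only and not for the iterates of [F]. The errors add up linearly
    because both operators fix [lin e]. *)
Lemma tele E E' F e : good E -> good E' -> commutes E E' -> nice F ->
  (forall W, cone W -> E F W <= E' F W + lin e W) ->
  forall M W, cone W -> iter M E F W <= iter M E' F W + M%:R * lin e W.
Proof.
move=> gE gE' c nF H; elim=> [|M IH] W cW; first by rewrite mul0r addr0.
rewrite !iterS.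
have nI : nice (iter M E F) by apply: good_nice => //; exact: good_iter.
have nI' : nice (iter M E' F) by apply: good_nice => //; exact: good_iter.
have nM : nice (fun W => M%:R * lin e W) by exact/niceZ/nice_lin.
have := good_mono gE nI (niceD nI' nM) IH cW.
rewrite (good_D gE)// (good_Z gE) ?(good_lin gE)//; last exact: nice_lin.
move=> /le_trans; apply.
rewrite (commutes_iter M gE' gE c nF cW).
have nEF := good_nice gE nF; have nE'F := good_nice gE' nF.
have := good_mono (good_iter M gE') nEF (niceD nE'F (nice_lin e)) H cW.
rewrite (good_D (good_iter M gE'))//; last exact: nice_lin.
rewrite (good_lin (good_iter M gE'))//.
rewrite -(commutes_iterr M gE' nF cW) => h.
by rewrite -natr1 mulrDl mul1r; lra.
Qed.

Lemma binmixS (r : R) (a : nat -> nat -> R) M :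
  binmix r a M.+1 = r * binmix r (fun i j => a i.+1 j) M +
                  (1 - r) * binmix r (fun i j => a i j.+1) M.
Proof.
rewrite /binmix big_ord_recl/= bin0 subn0 expr0.
rewrite (eq_bigr (fun i : 'I_M.+1 => 'C(M, i)%:R * r ^+ i.+1 * (1 - r) ^+ (M - i) * a i.+1 (M - i)%N +
   'C(M, i.+1)%:R * r ^+ i.+1 * (1 - r) ^+ (M - i) * a i.+1 (M - i)%N)); last first.
  by move=> i _; rewrite /bump/= add1n binS natrD subSS; ring.
rewrite big_split/= addrCA; congr (_ + _).
  by rewrite mulr_sumr; apply: eq_bigr => i _; rewrite exprS; ring.
rewrite big_ord_recr/= bin_small// !mul0r addr0.
rewrite mulr_sumr big_ord_recl/= bin0 subn0 expr0 exprS; congr (_ + _); first ring.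
apply: eq_bigr => i _; rewrite /bump/= add1n.
have iM : (i < M)%N by [].
have -> : (M - i = (M - i.+1).+1)%N by lia.
by rewrite !exprS; ring.
Qed.

(** The binomial theorem for commuting operators; [binmixS] is its Pascal recursion. *)
Lemma iter_mix r E E' F W M : 0 <= r <= 1 -> good E -> good E' -> commutes E E' ->
  nice F -> cone W ->
  iter M (mixE r E E') F W = binmix r (fun i j => iter i E (iter j E' F) W) M.
Proof.
move=> r01 gE gE' c nF; elim: M W => [|M IH] W cW.
  by rewrite /binmix big_ord1/= bin0 !expr0 !mul1r.
have nI i j : nice (iter i E (iter j E' F)).
  by apply: good_nice; [exact: good_iter|apply: good_nice => //; exact: good_iter].
pose G W := binmix r (fun i j => iter i E (iter j E' F) W) M.
have nG : nice G.
  by apply: nice_sum => i; exact: niceZ.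
have gM := good_mix r01 gE gE'.
rewrite iterS (good_ext gM (_ : nice _) nG IH cW); last first.
  by apply: good_nice => //; exact: good_iter.
rewrite binmixS /mixE /G /binmix.
rewrite (good_sum gE)//; last by move=> i; exact: niceZ.
rewrite (good_sum gE')//; last by move=> i; exact: niceZ.
congr (_ * _ + _ * _); apply: eq_bigr => i _; rewrite good_Z//; congr (_ * _).
rewrite (commutes_iter i gE gE' (commutesC c))//.
by apply: good_nice => //; exact: good_iter.
Qed.

(** A Poisson number of steps, each of random type, amounts to independent Poisson numbers of steps
    of the two types. This replaces any explicit coupling of random graphs. *)
Lemma PoE_mix l r E E' F W : 0 <= l -> 0 <= r <= 1 -> good E -> good E' ->
  commutes E E' -> nice F -> cone W ->
  PoE l (fun M => iter M (mixE r E E') F W) =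
  PoE (r * l) (fun i => PoE ((1 - r) * l) (fun j => iter i E (iter j E' F) W)).
Proof.
move=> l0 r01 gE gE' c nF cW.
under [in LHS]eq_fun do rewrite iter_mix//.
have [K K0 HK] := iter_growth gE; have [K' K'0 HK'] := iter_growth gE'.
have [_ [C C0 bF]] := nF.
apply: (@PoE_split _ _ _ l0 r01 _ (C * (1 + tot W) ^+ 2) (K + K')).
- by rewrite mulr_ge0// sqr_ge0.
- exact: addr_ge0.
move=> i j; rewrite mulrAC.
have nj : nice (iter j E' F) by apply: good_nice => //; exact: good_iter.
have := HK _ _ i (mulr_ge0 C0 (exprn_ge0 j K'0)) nj (HK' C F j C0 nF bF) W cW.
move=> /le_trans; apply; apply: ler_wpM2r; first exact: sqr_ge0.
rewrite -mulrA ler_wpM2l// exprD mulrC ler_pM ?exprn_ge0//.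
  by apply: lerXn2r; rewrite ?nnegrE ?addr_ge0// lerDl.
by apply: lerXn2r; rewrite ?nnegrE ?addr_ge0// lerDr.
Qed.

Lemma PoE_thin l r E F W : 0 <= l -> 0 <= r <= 1 -> good E -> nice F -> cone W ->
  PoE l (fun M => iter M (mixE r E idE) F W) =
  PoE (r * l) (fun i => iter i E F W).
Proof.
move=> l0 r01 gE nF cW; rewrite PoE_mix//; last exact: good_id.
congr PoE; apply/funext => i.
have idj j : iter j idE F = F by elim: j => // j /= ->.
by under eq_fun do rewrite idj; rewrite PoE_cst.
Qed.

End cone.

Section measurability.
Context {R : realType}.

(** Integrability is not assumed: Tonelli is applied to the positive and negative parts, and [fine]
    is measurable whatever their difference is. *)
Lemma measurable_integral_fst d1 d2 (X : measurableType d1) (Y : measurableType d2)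
    (P : probability Y R) (f : X * Y -> R) : measurable_fun setT f ->
  measurable_fun setT (fun x => \int[P]_y f (x, y)).
Proof.
move=> mf; rewrite /Rintegral.
apply: measurableT_comp => //.
rewrite (_ : (fun x => _) = (fun x => \int[P]_y ((EFin \o f)^\+ (x, y)) -
  \int[P]_y ((EFin \o f)^\- (x, y))))%E; last first.
  apply/funext => x; rewrite integralE; congr (_ - _)%E.
    by apply: eq_integral => y _; rewrite !funeposE.
  by apply: eq_integral => y _; rewrite !funenegE.
have mf' : measurable_fun setT (EFin \o f) by exact/measurable_EFinP.
apply: emeasurable_funB.
- apply: (@measurable_fun_fubini_tonelli_F _ _ _ _ _ P) => //; exact: measurable_funepos.
- apply: (@measurable_fun_fubini_tonelli_F _ _ _ _ _ P) => //; exact: measurable_funeneg.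
Qed.

End measurability.

(** * Operators given by random multipliers *)

Section op.
Context {R : realType} {S : finType}.
Implicit Types (W : S -> R) (F G : (S -> R) -> R).

Record mult d (X : measurableType d) (B : R) (f : X -> S -> R) : Prop := Mult {
  mult_measurable : forall s, measurable_fun setT (f ^~ s) ;
  mult_ge0 : forall x s, 0 <= f x s ;
  mult_le : forall x s, f x s <= B
}.

Definition op d (X : measurableType d) (mu : probability X R) (f : X -> S -> R)
  (F : (S -> R) -> R) (W : S -> R) : R := \int[mu]_x F (fun s => W s * f x s).

Section one.
Context d (X : measurableType d) (mu : probability X R) (B : R) (f : X -> S -> R).
Hypothesis mf : mult B f.

Lemma mult_cone W x : cone W -> cone (fun s => W s * f x s).
Proof. by move=> cW s; rewrite mulr_ge0// (mult_ge0 mf). Qed.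

Lemma mult_tot W x : cone W -> tot (fun s => W s * f x s) <= B * tot W.
Proof.
move=> cW; rewrite /tot mulr_sumr; apply: ler_sum => s _.
by rewrite mulrC ler_wpM2r// (mult_le mf).
Qed.

Lemma mult_ev_bmf s : bmf (f ^~ s).
Proof.
split; first exact: (mult_measurable mf).
by exists B => x; rewrite ger0_norm ?(mult_ge0 mf)// (mult_le mf).
Qed.

Lemma mult_bmf F W : nice F -> cone W -> bmf (fun x => F (fun s => W s * f x s)).
Proof.
move=> [mF [C C0 bF]] cW; split.
  by apply: mF => s; apply: measurable_funM => //; exact: (mult_measurable mf).
exists (C * (1 + B * tot W) ^+ 2) => x.
apply: le_trans (bF _ (mult_cone x cW)) _; rewrite ler_wpM2l//.
have := tot_ge0 (mult_cone x cW) => t0.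
apply: lerXn2r; rewrite ?nnegrE ?addr_ge0// ?lerD2l ?mult_tot//.
exact: le_trans t0 (mult_tot x cW).
Qed.

Hypothesis mean1 : forall s, \int[mu]_x f x s = 1.

Lemma good_op : 0 <= B -> good (op mu f).
Proof.
move=> B0; split.
- move=> F nF; have [mF [C C0 bF]] := nF; split.
    move=> d' Y g mg.
    apply: (@measurable_integral_fst _ _ _ _ _ mu
      (fun z : Y * X => F (fun s => g z.1 s * f z.2 s))).
    apply: mF => s; apply: measurable_funM.
      by apply: (measurableT_comp (mg s)).
    by apply: (measurableT_comp (mult_measurable mf s)).
  exists (C * (1 + B) ^+ 2); first by rewrite mulr_ge0// sqr_ge0.
  move=> W cW; apply: Ex_bound => [|x]; first exact: mult_bmf.
  apply: le_trans (bF _ (mult_cone x cW)) _.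
  rewrite -mulrA ler_wpM2l// -exprMn; have t0 := tot_ge0 cW.
  have t1 := tot_ge0 (mult_cone x cW); have t2 := mult_tot x cW.
  apply: lerXn2r; rewrite ?nnegrE ?mulr_ge0 ?addr_ge0//; nra.
- by move=> F G W nF nG cW; rewrite /op ExD//; exact: mult_bmf.
- by move=> c F W nF cW; rewrite /op ExZ//; exact: mult_bmf.
- move=> F G nF nG FG W cW; apply: Ex_le => [||x]; [exact: mult_bmf..|].
  exact/FG/mult_cone.
- move=> s W cW; rewrite /op ExZ ?mean1 ?mulr1//; exact: mult_ev_bmf.
- exists ((1 + B) ^+ 2); first exact: sqr_ge0.
  move=> C F C0 nF bF W cW; apply: Ex_bound => [|x]; first exact: mult_bmf.
  apply: le_trans (bF _ (mult_cone x cW)) _.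
  rewrite -mulrA ler_wpM2l// -exprMn; have t0 := tot_ge0 cW.
  have t1 := tot_ge0 (mult_cone x cW); have t2 := mult_tot x cW.
  apply: lerXn2r; rewrite ?nnegrE ?mulr_ge0 ?addr_ge0//; nra.
Qed.

End one.

Lemma commutes_op d1 d2 (X : measurableType d1) (Y : measurableType d2)
    (mu : probability X R) (nu : probability Y R) B C f g :
  mult B f -> mult C g -> 0 <= B -> 0 <= C -> commutes (op mu f) (op nu g).
Proof.
move=> mf mg B0 C0 F W nF cW; rewrite /op (@Ex_swap _ _ _ _ _ mu nu (fun x y => F (fun s => W s * f x s * g y s))).
  congr (Rintegral _ _ _); apply/funext => y; congr (Rintegral _ _ _); apply/funext => x.
  by congr F; apply/funext => s; rewrite mulrAC.
have mfg : mult (B * C) (fun z : X * Y => fun s => f z.1 s * g z.2 s).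
  split.
  - move=> s; apply: measurable_funM.
      exact: (measurableT_comp (mult_measurable mf s)).
    exact: (measurableT_comp (mult_measurable mg s)).
  - by move=> [x y] s; rewrite mulr_ge0 ?(mult_ge0 mf) ?(mult_ge0 mg).
  - by move=> [x y] s; rewrite ler_pM ?(mult_ge0 mf) ?(mult_ge0 mg) ?(mult_le mf) ?(mult_le mg).
have := mult_bmf mfg nF cW.
by under eq_fun do under eq_fun do rewrite mulrA.
Qed.

(** The way back from iterates to graphs: [m] steps are one expectation over an i.i.d. tuple, which
    for factors is the null model with [m] factors. *)
Lemma iter_op_iid d (X : measurableType d) (mu : probability X R) B f F W m :
  mult B f -> 0 <= B -> nice F -> cone W ->
  bmf (fun x : m.-tuple X => F (fun s => W s * \prod_(a < m) f (tnth x a) s)) /\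
  iter m (op mu f) F W =
  \int[iid mu m]_x F (fun s => W s * \prod_(a < m) f (tnth x a) s).
Proof.
move=> mf B0 nF.
have mprod n : mult (B ^+ n) (fun (x : n.-tuple X) s => \prod_(a < n) f (tnth x a) s).
  split.
  - move=> s; apply: measurable_prod => a _.
    apply: (measurableT_comp (mult_measurable mf s)); exact: measurable_tnth.
  - by move=> x s; apply: prodr_ge0 => a _; exact: (mult_ge0 mf).
  - move=> x s; have -> : B ^+ n = \prod_(a < n) B by rewrite prodr_const card_ord.
    by apply: ler_prod => a _; rewrite (mult_ge0 mf) (mult_le mf).
have bm n V : cone V -> bmf (fun x : n.-tuple X => F (fun s => V s * \prod_(a < n) f (tnth x a) s)).
  by move=> cV; exact: (mult_bmf (mprod n) nF cV).
elim: m W => [|m IH] W cW; (split; first exact: bm).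
  have [m0 _] := bm 0%N _ cW.
  rewrite [RHS](@Ex_iid0 R _ _ mu (fun x => F (fun s => W s * \prod_(a < 0) f (tnth x a) s)) m0) /=.
  by congr F; apply/funext => s; rewrite big_ord0 mulr1.
rewrite Ex_iidS; last exact: bm.
rewrite iterS /op; congr (Rintegral _ _ _); apply/funext => x.
have [_ ->] := IH _ (mult_cone mf x cW).
congr (Rintegral _ _ _); apply/funext => t; congr F; apply/funext => s.
rewrite big_ord_recl -mulrA; congr (_ * (_ * _)).
by apply: eq_bigr => a _; rewrite /tcons tnthS.
Qed.

End op.

(** An intertwining principle: when [Phi] carries one family of multipliers to another, iterates on
    the larger configuration space are computed on the smaller one. It separates a new variable from
    the old ones. *)
Lemma iter_op_map {R : realType} {S1 S2 : finType} d (X : measurableType d)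
    (mu : probability X R) (f1 : X -> S1 -> R) (f2 : X -> S2 -> R)
    (Phi : (S1 -> R) -> (S2 -> R)) m F W :
  (forall V x, Phi (fun s => V s * f1 x s) = fun s => Phi V s * f2 x s) ->
  iter m (op mu f2) F (Phi W) = iter m (op mu f1) (F \o Phi) W.
Proof.
move=> H; elim: m W => [//|m IH] W; rewrite !iterS /op.
by congr (Rintegral _ _ _); apply/funext => x; rewrite -H IH.
Qed.

(** * Elementary estimates for [t ln t] *)

Section Lambda.
Context {R : realType}.
Implicit Types x y b : R.

Lemma LambdaM x y : 0 <= x -> 0 <= y ->
  Lambda (x * y) = x * Lambda y + Lambda x * y.
Proof.
rewrite /Lambda !le_eqVlt => /predU1P[<-|x0]; first by rewrite !mul0r add0r.
move=> /predU1P[<-|y0]; first by rewrite !(mulr0, mul0r) add0r.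
by rewrite lnM ?posrE//; ring.
Qed.

Lemma Lambda1 : Lambda 1 = 0 :> R.
Proof. by rewrite /Lambda ln1 mulr0. Qed.

Lemma Lambda0 : Lambda 0 = 0 :> R.
Proof. by rewrite /Lambda mul0r. Qed.

Lemma ln_le x : 0 < x -> ln x <= x - 1.
Proof.
move=> x0; have := @le_ln1Dx _ (x - 1); rewrite addrCA subrr addr0; apply; lra.
Qed.

Lemma Lambda_ge x : 0 <= x -> x - 1 <= Lambda x.
Proof.
rewrite le_eqVlt => /predU1P[<-|x0]; first by rewrite Lambda0; lra.
have := ln_le (_ : 0 < x^-1); rewrite invr_gt0 => /(_ x0).
rewrite lnV ?posrE// => /(ler_wpM2l (ltW x0)).
by rewrite mulrN mulrBr mulfV ?gt_eqF// mulr1 /Lambda; lra.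
Qed.

(** The tangent plane at [(z0, 1)] of the convex function [z ln (z / y)], which is homogeneous of
    degree one; hence there is no constant term. *)
Lemma Lambda_tangent z y z0 : 0 < z0 -> 0 < y -> 0 < z ->
  (1 + ln z0) * z - y * z0 <= z * ln (z / y).
Proof.
move=> z00 y0 z0'.
have := ln_le (_ : 0 < y * z0 / z); rewrite divr_gt0 ?mulr_gt0// => /(_ isT).
rewrite !lnM ?posrE ?mulr_gt0 ?invr_gt0// !lnV ?posrE// => /(ler_wpM2l (ltW z0')).
have -> : z * (y * z0 / z - 1) = y * z0 - z by field; rewrite gt_eqF.
lra.
Qed.

Lemma ln_abs b x : 1 <= b -> b^-1 <= x -> x <= b -> `|ln x| <= ln b.
Proof.
move=> b1 bx xb; have b0 : 0 < b by lra.
have x0 : 0 < x by apply: lt_le_trans bx; rewrite invr_gt0.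
by rewrite ler_norml -lnV ?posrE// !ler_ln ?posrE ?invr_gt0// bx xb.
Qed.

(** The derivative [1 + ln t] is at most [1 + ln b <= b] in absolute value on the interval from
    [1 / b] to [b]. *)
Lemma Lambda_lip b x y : 1 <= b -> b^-1 <= x -> x <= b -> b^-1 <= y -> y <= b ->
  `|Lambda x - Lambda y| <= b * `|x - y|.
Proof.
move=> b1; have b0 : 0 < b by lra.
have lnb : 1 + ln b <= b by have := ln_le b0; lra.
wlog xy : x y / y <= x => [H bx xb bY yb|bx xb bY yb].
  case: (leP y x) => [|/ltW] xy; first exact: H.
  by rewrite distrC [`|x - y|]distrC; apply: H.
have x0 : 0 < x by apply: lt_le_trans bx; rewrite invr_gt0.
have y0 : 0 < y by apply: lt_le_trans bY; rewrite invr_gt0.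
have lx := ln_abs b1 bx xb.
have yx1 : 0 <= y * ln (x / y).
  by apply: mulr_ge0; [exact: ltW|rewrite ln_ge0// ler_pdivlMr// mul1r].
have yx2 : y * ln (x / y) <= x - y.
  have := ln_le (divr_gt0 x0 y0) => /(ler_wpM2l (ltW y0)).
  by rewrite mulrBr mulr1 [y * (x / y)]mulrC divfK ?gt_eqF.
have -> : Lambda x - Lambda y = (x - y) * ln x + y * ln (x / y).
  by rewrite /Lambda lnM ?posrE ?invr_gt0// lnV ?posrE//; ring.
rewrite [`|x - y|]ger0_norm ?subr_ge0//.
have xy0 : 0 <= x - y by rewrite subr_ge0.
apply: le_trans (ler_normD _ _) _; rewrite normrM (ger0_norm xy0) (ger0_norm yx1).
have := ler_wpM2l xy0 lx; have := ler_wpM2l xy0 lnb; lra.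
Qed.

Lemma Lambda_abs x : 0 <= x -> `|Lambda x| <= 1 + x ^+ 2.
Proof.
rewrite le_eqVlt => /predU1P[<-|x0].
  by rewrite Lambda0 normr0 addr_ge0// sqr_ge0.
have h1 := Lambda_ge (ltW x0).
have h2 : Lambda x <= x * (x - 1) by apply: ler_wpM2l; [exact: ltW|exact: ln_le].
rewrite ler_norml; apply/andP; split; nra.
Qed.

End Lambda.

(** * The functional [Z ln Z] and its increments *)

Section free_energy.
Context {R : realType} {S : finType}.
Implicit Types (W : S -> R).

(** With the prior and the factors as weight, [tot W] is a partition function, and the planted
    expectation of its logarithm is the null expectation of [Lh]. *)
Definition Lh W : R := Lambda (tot W).
(** The Gibbs average of [g]; when the weight vanishes the division by zero makes it [0], which is
    consistent with [tot_mul]. *)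
Definition br W (g : S -> R) : R := (\sum_s W s * g s) / tot W.

Lemma nice_Lh : nice Lh.
Proof.
split.
  move=> d X g mg; apply: measurable_funM.
    exact: measurable_sum.
  by apply: measurableT_comp => //; exact: measurable_sum.
exists 1 => // W cW; rewrite mul1r; have t0 := tot_ge0 cW.
apply: le_trans (Lambda_abs t0) _; nra.
Qed.

Lemma tot_mul W g : cone W -> tot (fun s => W s * g s) = tot W * br W g.
Proof.
move=> cW; have [t0|t0] := eqVneq (tot W) 0.
  by rewrite t0 mul0r /tot big1// => s _; rewrite tot_eq0 ?mul0r.
by rewrite /br mulrC divfK.
Qed.

Lemma br_ge0 W g : cone W -> cone g -> 0 <= br W g.
Proof.
move=> cW cg; apply: divr_ge0; last exact: tot_ge0.
by apply: sumr_ge0 => s _; exact: mulr_ge0.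
Qed.

Lemma br_between W g a b : cone W -> 0 < tot W -> (forall s, a <= g s <= b) ->
  a <= br W g <= b.
Proof.
move=> cW t0 ab; rewrite /br ler_pdivlMr// ler_pdivrMr//.
rewrite -!lin_cst; apply/andP; split; apply: lin_le => // s; by case/andP: (ab s).
Qed.

Lemma brB W g h : br W (fun s => g s - h s) = br W g - br W h.
Proof.
by rewrite /br -mulrBl -sumrB; congr (_ / _); apply: eq_bigr => s _; rewrite mulrBr.
Qed.

Lemma br_norm W g : cone W -> `|br W g| <= br W (fun s => `|g s|).
Proof.
move=> cW; have t0 : 0 <= (tot W)^-1 by rewrite invr_ge0 tot_ge0.
rewrite /br normrM (ger0_norm t0) ler_wpM2r// (le_trans (ler_norm_sum _ _ _))//.
by apply: ler_sum => s _; rewrite normrM ger0_norm.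
Qed.

Lemma tot_br W g : cone W -> tot W * br W g = lin g W.
Proof. by move=> cW; rewrite -tot_mul. Qed.

Section op_Lh.
Context d (X : measurableType d) (mu : probability X R) (B : R) (f : X -> S -> R).
Hypothesis mf : mult B f.
Hypothesis B0 : 0 <= B.
Hypothesis mean1 : forall s, \int[mu]_x f x s = 1.

Lemma bmf_br W : cone W -> bmf (fun x => br W (f x)).
Proof.
move=> cW; under eq_fun do rewrite /br mulrC.
apply: bmfZ; apply: bmf_sum => s; apply: bmfZ; exact: (mult_ev_bmf mf).
Qed.

Lemma br_leB W x : cone W -> br W (f x) <= B.
Proof.
move=> cW; have := tot_ge0 cW; rewrite le_eqVlt => /predU1P[t0|t0].
  by rewrite /br -t0 invr0 mulr0.
by have /andP[] := br_between cW t0 (fun s => introT andP (conj (mult_ge0 mf x s) (mult_le mf x s))).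
Qed.

Lemma bmf_Lambda_br W : cone W -> bmf (fun x => Lambda (br W (f x))).
Proof.
move=> cW; have [mb _] := bmf_br cW; split.
  by apply: measurable_funM => //; apply: measurableT_comp.
have b0 x : 0 <= br W (f x) by rewrite br_ge0//; exact: (mult_ge0 mf).
exists (1 + B ^+ 2) => x; apply: le_trans (Lambda_abs (b0 x)) _.
by rewrite lerD2l; apply: lerXn2r; rewrite ?nnegrE ?br_leB.
Qed.

Lemma Ex_br W : cone W -> 0 < tot W -> \int[mu]_x br W (f x) = 1.
Proof.
move=> cW t0; rewrite /br ExZr; last first.
  by apply: bmf_sum => s; apply: bmfZ; exact: (mult_ev_bmf mf).
rewrite Ex_sum; last by move=> s; apply: bmfZ; exact: (mult_ev_bmf mf).
rewrite (eq_bigr W) ?mulfV ?gt_eqF// => s _.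
by rewrite ExZ ?mean1 ?mulr1//; exact: (mult_ev_bmf mf).
Qed.

(** By [LambdaM] the new value is [tot W * Lambda y + Lh W * y] with [y] the Gibbs average of the
    multiplier, and [y] has mean one. So the increment is the total mass times the mean of
    [Lambda y]. *)
Lemma op_Lh W : cone W ->
  op mu f Lh W = Lh W + tot W * \int[mu]_x Lambda (br W (f x)).
Proof.
move=> cW; have := tot_ge0 cW; rewrite le_eqVlt => /predU1P[t0|t0].
  rewrite -t0 mul0r addr0 /op /Lh -t0 (_ : Lambda 0 = 0) ?Lambda0//.
  rewrite -[RHS](Ex_cst mu 0); congr (Rintegral _ _ _); apply/funext => x.
  by rewrite tot_mul// -t0 mul0r Lambda0.
have E : (fun x => Lh (fun s => W s * f x s)) =
    (fun x => tot W * Lambda (br W (f x)) + Lh W * br W (f x)).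
  apply/funext => x; rewrite /Lh tot_mul// LambdaM ?(ltW t0)// br_ge0//.
  exact: (mult_ge0 mf).
have bL := bmf_Lambda_br cW; have bb := bmf_br cW.
rewrite /op E (ExD _ (bmfZ _ bL) (bmfZ _ bb)) (ExZ _ _ bL) (ExZ _ _ bb).
by rewrite Ex_br// mulr1 addrC.
Qed.

Lemma Lh_le_op W : cone W -> Lh W <= op mu f Lh W.
Proof.
move=> cW; rewrite op_Lh// lerDl.
have := tot_ge0 cW; rewrite le_eqVlt => /predU1P[<-|t0]; first by rewrite mul0r.
apply: mulr_ge0 => //; first exact: ltW.
have -> : 0 = \int[mu]_x (br W (f x) - 1).
  by rewrite ExB ?Ex_br ?Ex_cst ?subrr//; [exact: bmf_br|exact: bmf_cst].
apply: Ex_le; [apply: bmfB; [exact: bmf_br|exact: bmf_cst]|exact: bmf_Lambda_br|].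
by move=> x; apply: Lambda_ge; rewrite br_ge0//; exact: (mult_ge0 mf).
Qed.

Hypotheses (B1 : 1 <= B) (f_ge : forall x s, B^-1 <= f x s).

Lemma br_bounds W x : cone W -> 0 < tot W -> B^-1 <= br W (f x) <= B.
Proof.
move=> cW t0; apply: br_between => // s.
by rewrite f_ge (mult_le mf).
Qed.

(* The increment [op Lh - Lh] is an f-divergence, so it is convex in W and can
   only grow when W is replaced by a mean one multiple of it. *)
Lemma op_Lh_incr W : cone W ->
  op mu f Lh W - Lh W <= op mu f (fun V => op mu f Lh V - Lh V) W.
Proof.
move=> cW; have gA := good_op mf mean1 B0.
have nA : nice (op mu f Lh) := good_nice gA nice_Lh.
have nI : nice (fun V => op mu f Lh V - Lh V) by apply: niceB => //; exact: nice_Lh.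
have Bi : 0 < B^-1 by rewrite invr_gt0 (lt_le_trans ltr01 B1).
have incr0 V : cone V -> tot V = 0 -> op mu f Lh V - Lh V = 0.
  by move=> cV tV; rewrite op_Lh// tV mul0r addr0 subrr.
have := tot_ge0 cW; rewrite le_eqVlt => /predU1P[t0|t0].
  rewrite incr0// {2}/op.
  rewrite -(Ex_cst mu 0); apply: Ex_le; [exact: bmf_cst|exact: (mult_bmf mf nI cW)|].
  by move=> x; rewrite incr0//; [exact: (mult_cone mf)|rewrite tot_mul// -t0 mul0r].
pose z0 x := br W (f x).
have z0b x : B^-1 <= z0 x <= B := br_bounds x cW t0.
have z00 x : 0 < z0 x by case/andP: (z0b x) => /(lt_le_trans Bi).
have bz0 : bmf z0 by exact: bmf_br.
have blz : bmf (fun x => 1 + ln (z0 x)).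
  apply: bmfD; first exact: bmf_cst.
  split; first by apply: measurableT_comp => //; case: bz0.
  by exists (ln B) => x; case/andP: (z0b x) => z1 z2; exact: ln_abs.
have bfs s : bmf (f ^~ s) by exact: (mult_ev_bmf mf).
have bes s : bmf (fun x => (1 + ln (z0 x)) * f x s - z0 x) by apply: bmfB => //; exact: bmfM.
(* [lin e] is a supporting hyperplane of the increment at [W]: equal to it at [W], below it
   elsewhere by [Lambda_tangent]. The operator fixes [lin e], which gives the claim. *)
pose e s := \int[mu]_x ((1 + ln (z0 x)) * f x s - z0 x).
have linE V : lin e V = \int[mu]_x (\sum_s V s * ((1 + ln (z0 x)) * f x s - z0 x)).
  rewrite Ex_sum; last by move=> s; exact: bmfZ.
  by apply: eq_bigr => s _; rewrite ExZ.
have bsum V : bmf (fun x => \sum_s V s * ((1 + ln (z0 x)) * f x s - z0 x)).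
  by apply: bmf_sum => s; exact: bmfZ.
have sumE V x : cone V -> \sum_s V s * ((1 + ln (z0 x)) * f x s - z0 x) =
    (1 + ln (z0 x)) * (tot V * br V (f x)) - tot V * z0 x.
  move=> cV; rewrite -tot_mul// /tot mulr_sumr mulr_suml -sumrB.
  by apply: eq_bigr => s _; ring.
have incrE V : cone V -> op mu f Lh V - Lh V = \int[mu]_x (tot V * Lambda (br V (f x))).
  by move=> cV; rewrite op_Lh// addrC addKr ExZ//; exact: bmf_Lambda_br.
have -> : op mu f Lh W - Lh W = lin e W.
  rewrite incrE// linE; congr (Rintegral _ _ _); apply/funext => x.
  by rewrite sumE// -/(z0 x) /Lambda; ring.
rewrite -[leLHS](good_lin gA)//; apply: (good_mono gA) => //; first exact: nice_lin.
move=> V cV; have := tot_ge0 cV; rewrite le_eqVlt => /predU1P[tV|tV].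
  rewrite incr0// /lin big1// => s _; by rewrite tot_eq0 ?mul0r.
rewrite incrE// linE; apply: Ex_le => //; first by apply: bmfZ; exact: bmf_Lambda_br.
move=> x; rewrite sumE// mulrCA -mulrBr ler_wpM2l ?(ltW tV)//.
have /andP[b1 b2] := br_bounds x cV tV.
have := Lambda_tangent (z00 x) ltr01 (lt_le_trans Bi b1).
by rewrite divr1 mul1r /Lambda; lra.
Qed.

(** Convexity in the number of steps: increments do not decrease, so [j] steps gain at least [j]
    times the first one. *)
Lemma iter_op_Lh j W : cone W ->
  Lh W + j%:R * (op mu f Lh W - Lh W) <= iter j (op mu f) Lh W.
Proof.
have gA := good_op mf mean1 B0; have nA := good_nice gA nice_Lh.
have nI : nice (fun V => op mu f Lh V - Lh V) by apply: niceB => //; exact: nice_Lh.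
elim: j W => [|j IH] W cW; first by rewrite mul0r addr0.
have := good_mono gA (niceD nice_Lh (niceZ j%:R nI)) (good_nice (good_iter j gA) nice_Lh) IH cW.
rewrite iterS (good_D gA)//; [|exact: nice_Lh|exact: niceZ].
rewrite (good_Z gA)//; apply: le_trans.
have := op_Lh_incr cW => h; have := ler_wpM2l (ler0n R j) h.
by rewrite -natr1 mulrDl mul1r; lra.
Qed.

End op_Lh.

End free_energy.

Section finite.
Context {R : realType}.

Lemma bmf_fin_fst d1 d2 (T : finMeasurableType d1) (Y : measurableType d2)
    (f : T * Y -> R) : (forall A : set T, measurable A) ->
  (forall t, bmf (fun y => f (t, y))) -> bmf f.
Proof.
move=> mT bf.
have -> : f = fun z => \sum_(t : T) \1_[set t] z.1 * f (t, z.2).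
  apply/funext => -[t y] /=; rewrite (bigD1 t)//= indicE mem_set// mul1r.
  rewrite big1 ?addr0// => t' tt'; rewrite indicE memNset ?mul0r//=.
  by move=> E; rewrite E eqxx in tt'.
apply: bmf_sum => t; apply: bmfM.
  apply: (@bmf_comp _ _ _ _ _ (\1_[set t]) fst); first exact: measurable_fst.
  split; first exact: measurable_indic.
  by exists 1 => x; rewrite indicE; case: (_ \in _); rewrite ?normr1 ?normr0.
exact: (@bmf_comp _ _ _ _ _ (fun y => f (t, y)) snd).
Qed.

Lemma Ex_unif_prod d1 d2 (T : finMeasurableType d1) (Y : measurableType d2)
    (P : probability Y R) (f : T * Y -> R) : bmf f ->
  \int[(unif T R \x P)%E]_z f z = #|T|%:R^-1 * \sum_(t : T) \int[P]_y f (t, y).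
Proof.
by move=> bf; rewrite Ex_prod// Ex_unif//; case: (bmf_Ex (unif T R) P bf).
Qed.

Lemma big_tupleS (T : finType) L (F : L.+1.-tuple T -> R) :
  \sum_(v : L.+1.-tuple T) F v = \sum_(j : T) \sum_(v : L.-tuple T) F [tuple of j :: v].
Proof.
rewrite pair_big/= (reindex (fun x : T * L.-tuple T => [tuple of x.1 :: x.2]))//=.
exists (fun v => (thead v, [tuple of behead v])) => [[j v] _|v _] /=.
  by congr pair; apply: val_inj.
by rewrite -tuple_eta.
Qed.

Lemma big_tuple0 (T : finType) (F : 0.-tuple T -> R) :
  \sum_(v : 0.-tuple T) F v = F [tuple].
Proof.
by rewrite (eq_bigr (fun=> F [tuple])) => [|v _]; rewrite ?sumr_const ?card_tuple// tuple0.
Qed.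

End finite.

Section op_extra.
Context {R : realType} {S : finType}.
Context d (X : measurableType d) (mu : probability X R) (B : R) (f : X -> S -> R).
Hypothesis mf : mult B f.
Hypothesis B0 : 0 <= B.

Lemma nice_op F : nice F -> nice (op mu f F).
Proof.
move=> nF; have [mF [C C0 bF]] := nF; split.
  move=> d' Y g mg.
  apply: (@measurable_integral_fst _ _ _ _ _ mu
    (fun z : Y * X => F (fun s => g z.1 s * f z.2 s))).
  apply: mF => s; apply: measurable_funM.
    by apply: (measurableT_comp (mg s)).
  by apply: (measurableT_comp (mult_measurable mf s)).
exists (C * (1 + B) ^+ 2); first by rewrite mulr_ge0// sqr_ge0.
move=> W cW; apply: Ex_bound => [|x]; first exact: (mult_bmf mf nF cW).
apply: le_trans (bF _ (mult_cone mf x cW)) _.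
rewrite -mulrA ler_wpM2l// -exprMn; have t0 := tot_ge0 cW.
have t1 := tot_ge0 (mult_cone mf x cW); have t2 := mult_tot mf x cW.
have bt := mulr_ge0 B0 t0.
apply: lerXn2r; rewrite ?nnegrE; [lra|by rewrite mulr_ge0// addr_ge0|].
rewrite mulrDl !mul1r mulrDr mulr1; move: t2 bt t0 B0.
by set a := B * _; set b := tot W; set c := tot _ => *; lra.
Qed.

Lemma nice_iter_op m F : nice F -> nice (iter m (op mu f) F).
Proof. by move=> nF; elim: m => [//|m IH]; exact: nice_op. Qed.

End op_extra.

(** * Coupling two families of multipliers *)

Section iter_diff.
Context {R : realType} {S : finType}.
Context d (X : measurableType d) (mu : probability X R) (B : R) (f g : X -> S -> R).
Hypotheses (mf : mult B f) (mg : mult B g) (B1 : 1 <= B).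
Let B0 : 0 <= B. Proof. by apply: le_trans B1. Qed.

(** A coupling: both families are driven by the same sample, and a pair of weights is a single
    weight on the disjoint sum, so the theory of one operator applies. *)
Definition fsum (S1 S2 : finType) (Y : Type) (f1 : Y -> S1 -> R) (f2 : Y -> S2 -> R)
    (x : Y) (s : S1 + S2) : R :=
  match s with inl a => f1 x a | inr a => f2 x a end.

Lemma mult_fsum d' (Y : measurableType d') (S1 S2 : finType) (C : R)
    (f1 : Y -> S1 -> R) (f2 : Y -> S2 -> R) :
  mult C f1 -> mult C f2 -> mult C (fsum f1 f2).
Proof.
move=> m1 m2; split.
- by move=> [a|a]; [exact: (mult_measurable m1)|exact: (mult_measurable m2)].
- by move=> x [a|a]; [exact: (mult_ge0 m1)|exact: (mult_ge0 m2)].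
- by move=> x [a|a]; [exact: (mult_le m1)|exact: (mult_le m2)].
Qed.

Definition l1dist (V : S + S -> R) : R := \sum_s `|V (inl s) - V (inr s)|.

Lemma nice_l1dist : nice l1dist.
Proof. by apply: nice_sum => s; apply: nice_abs; apply: niceB; exact: nice_ev. Qed.

(** Each step enlarges the present discrepancy by at most the factor [B] and adds a fresh one,
    proportional to the second weight, which itself grows by at most [B] per step. *)
Lemma iter_l1dist m V : cone V ->
  iter m (op mu (fsum f g)) l1dist V <=
  B ^+ m * (l1dist V + m%:R * \sum_s V (inr s) * \int[mu]_x `|f x s - g x s|).
Proof.
have mfg := mult_fsum mf mg; have nI m' := nice_iter_op mu mfg B0 m' nice_l1dist.
have bfg s : bmf (fun x => `|f x s - g x s|).
  by apply: bmf_norm; apply: bmfB; [exact: (mult_ev_bmf mf)|exact: (mult_ev_bmf mg)].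
have e0 s : 0 <= \int[mu]_x `|f x s - g x s| by exact: Ex_ge0.
elim: m V => [|m IH] V cV; first by rewrite mul0r addr0 expr0 mul1r.
set e := fun s => \int[mu]_x `|f x s - g x s| in IH *.
have A0 : 0 <= \sum_s V (inr s) * e s by apply: sumr_ge0 => s _; exact: (mulr_ge0 (cV _) (e0 s)).
have bs : bmf (fun x => \sum_s V (inr s) * `|f x s - g x s|).
  by apply: bmf_sum => s; exact: (bmfZ _ (bfg s)).
pose G1 x := B * l1dist V + \sum_s V (inr s) * `|f x s - g x s|.
pose G2 x := G1 x + m%:R * (B * \sum_s V (inr s) * e s).
have bG1 : bmf G1 by apply: bmfD => //; exact: bmf_cst.
have bG2 : bmf G2 by apply: bmfD => //; exact: bmf_cst.
apply: (@le_trans _ _ (\int[mu]_x (B ^+ m * G2 x))).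
  rewrite iterS; apply: Ex_le; [exact: (mult_bmf mfg (nI m) cV)|exact: bmfZ|].
  move=> x; apply: le_trans (IH _ (mult_cone mfg x cV)) _.
  rewrite /G2 /G1 ler_wpM2l ?exprn_ge0// lerD//.
    rewrite /l1dist mulr_sumr -big_split/=; apply: ler_sum => s _.
    have -> : V (inl s) * f x s - V (inr s) * g x s =
      f x s * (V (inl s) - V (inr s)) + V (inr s) * (f x s - g x s) by ring.
    rewrite (le_trans (ler_normD _ _))// !normrM (ger0_norm (cV _)) lerD2r.
    by rewrite ler_wpM2r// ger0_norm ?(mult_le mf)// (mult_ge0 mf).
  rewrite ler_wpM2l// mulr_sumr; apply: ler_sum => s _.
  by rewrite mulrA (mulrC B) ler_wpM2r// ler_wpM2l// (mult_le mg).
rewrite (ExZ _ _ bG2) /G2 (ExD _ bG1 (bmf_cst _ _)) /G1 (ExD _ (bmf_cst _ _) bs) !Ex_cst.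
rewrite (@Ex_sum _ _ _ mu _ _ _ (fun s x => V (inr s) * `|f x s - g x s|)); last by move=> s; exact: (bmfZ _ (bfg s)).
rewrite (eq_bigr (fun s => V (inr s) * e s)); last by move=> s _; rewrite (ExZ _ _ (bfg s)).
rewrite exprSr -mulrA ler_wpM2l ?exprn_ge0// -natr1.
have := ler_wpM2r A0 B1; set A := \sum_s _; lra.
Qed.

End iter_diff.

Definition homog {R : realType} {S : finType} (F : (S -> R) -> R) :=
  forall c W, 0 <= c -> cone W -> F (fun s => c * W s) = c * F W.

Lemma eq_refl_le {R : numDomainType} (x y : R) : x = y -> x <= y.
Proof. by move->. Qed.

Lemma good_ge0 {R : realType} {S : finType} (E : ((S -> R) -> R) -> (S -> R) -> R) F W :
  good E -> nice F -> (forall V, cone V -> 0 <= F V) -> cone W -> 0 <= E F W.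
Proof.
move=> gE nF F0 cW; rewrite -(mul0r (E F W)) -(good_Z gE)//.
by apply: (good_mono gE) => //; [exact: niceZ|move=> V cV; rewrite mul0r F0].
Qed.

(** * Pinning random coordinates *)

Section pin.
Context {R : realType} {q n : nat}.
Local Notation color := 'I_q.+1.
Local Notation cfg := (n.+1.-tuple color).
Local Notation Q := (q.+1%:R : R).
Local Notation N := (n.+1%:R : R).
Implicit Types (W U : cfg -> R) (j : 'I_n.+1) (z : color).

(** The factor [Q] makes the indicator mean one under a uniform colour. On unnormalised weights this
    is the revealing of a coordinate: each outcome keeps its own probability as mass. *)
Definition pinf (x : 'I_n.+1 * color) (s : cfg) : R := Q * (tnth s x.1 == x.2)%:R.

Definition pinop : ((cfg -> R) -> R) -> (cfg -> R) -> R :=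
  op (unif 'I_n.+1 R \x unif color R)%E pinf.

Definition restr W j z : cfg -> R := fun s => W s * (tnth s j == z)%:R.
Definition mrg W j z : R := tot (restr W j z).

Lemma bmf_ord m (f : 'I_m.+1 -> R) : bmf f.
Proof.
split; first by move=> _ B mB.
by exists (\sum_i `|f i|) => i; rewrite (bigD1 i)//= lerDl sumr_ge0.
Qed.

Lemma bmf_ord2 m m' (f : 'I_m.+1 * 'I_m'.+1 -> R) : bmf f.
Proof. by apply: bmf_fin_fst => [A //|t]; exact: bmf_ord. Qed.

Lemma Q_gt0 : 0 < Q. Proof. by []. Qed.
Lemma N_gt0 : 0 < N. Proof. by []. Qed.

Lemma mult_pin : mult Q pinf.
Proof.
split.
- by move=> s; case: (bmf_ord2 (pinf ^~ s)).
- by move=> x s; rewrite /pinf mulr_ge0.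
- by move=> x s; rewrite /pinf; case: (_ == _); rewrite ?mulr1 ?mulr0.
Qed.

Lemma Ex_pin (f : 'I_n.+1 * color -> R) :
  \int[(unif 'I_n.+1 R \x unif color R)%E]_x f x = N^-1 * \sum_j (Q^-1 * \sum_z f (j, z)).
Proof.
rewrite Ex_unif_prod; last exact: bmf_ord2.
rewrite card_ord; congr (_ * _); apply: eq_bigr => j _.
by rewrite Ex_unif ?card_ord.
Qed.

Lemma sum_eq1 (T : finType) (a : T) : \sum_z (a == z)%:R = 1 :> R.
Proof.
rewrite (bigD1 a)//= eqxx big1 ?addr0// => z za.
by rewrite eq_sym (negbTE za).
Qed.

Lemma avgN1 (c : R) : N^-1 * \sum_(j : 'I_n.+1) c = c.
Proof. by rewrite sumr_const card_ord -[c *+ _]mulr_natl mulrA mulVf ?mul1r ?gt_eqF ?N_gt0. Qed.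

Lemma pin_mean1 s : \int[(unif 'I_n.+1 R \x unif color R)%E]_x pinf x s = 1.
Proof.
rewrite Ex_pin -[RHS]avgN1; congr (_ * _); apply: eq_bigr => j _.
by rewrite /pinf/= -mulr_sumr sum_eq1 mulr1 mulVf ?gt_eqF ?Q_gt0.
Qed.

Lemma good_pin : good pinop.
Proof. exact: (good_op mult_pin pin_mean1 (ltW Q_gt0)). Qed.

Lemma restr_cone W j z : cone W -> cone (restr W j z).
Proof. by move=> cW s; rewrite mulr_ge0. Qed.

(** Homogeneity cancels [Q] against the probability of a colour and leaves the plain sum over the
    outcomes of the revealed coordinate. *)
Lemma pinE F W : homog F -> cone W -> pinop F W = N^-1 * \sum_j \sum_z F (restr W j z).
Proof.
move=> hF cW; rewrite /pinop /op Ex_pin; congr (_ * _); apply: eq_bigr => j _.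
rewrite mulr_sumr; apply: eq_bigr => z _.
rewrite (_ : (fun s => _) = fun s => Q * restr W j z s); last first.
  by apply/funext => s; rewrite /pinf/= mulrCA.
by rewrite hF ?mulrA ?mulVf ?mul1r ?gt_eqF ?Q_gt0//; exact: restr_cone.
Qed.

Lemma hom_pin F : homog F -> homog (pinop F).
Proof.
move=> hF c W c0 cW; rewrite !pinE//; last by move=> s; rewrite mulr_ge0.
rewrite mulrCA; congr (_ * _).
rewrite mulr_sumr; apply: eq_bigr => j _; rewrite mulr_sumr; apply: eq_bigr => z _.
rewrite -hF//; last exact: restr_cone.
by congr F; apply/funext => s; rewrite /restr mulrA.
Qed.

Lemma mrg_sum W j : \sum_z mrg W j z = tot W.
Proof.
rewrite /mrg /tot exchange_big/=; apply: eq_bigr => s _.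
by rewrite -mulr_sumr sum_eq1 mulr1.
Qed.

Lemma mrg_ge0 W j z : cone W -> 0 <= mrg W j z.
Proof. by move=> cW; apply: tot_ge0; exact: restr_cone. Qed.

Lemma mrg_le W j z : cone W -> mrg W j z <= tot W.
Proof.
move=> cW; rewrite -(mrg_sum W j) (bigD1 z)//= lerDl sumr_ge0// => z' _.
exact: mrg_ge0.
Qed.

Lemma mrg_lin W j z : mrg W j z = lin (fun s => (tnth s j == z)%:R) W.
Proof. by []. Qed.

Lemma tot_hom : homog (@tot R cfg).
Proof. by move=> c W _ _; rewrite /tot mulr_sumr. Qed.

(* On the cone this is avg_j sum_z mrg^2 / tot; the real power replaces the
   inverse because it is known to be measurable. *)
Definition energy W : R := N^-1 * \sum_j \sum_z mrg W j z ^+ 2 * (tot W) `^ (-1).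

Definition mu W j z : R := mrg W j z / tot W.

Lemma tot_powR W : cone W -> (tot W) `^ (-1) = (tot W)^-1.
Proof. by move=> cW; rewrite powR_inv1// tot_ge0. Qed.

Lemma energy_ge0 W : cone W -> 0 <= energy W.
Proof.
move=> cW; apply: mulr_ge0 => //; apply: sumr_ge0 => j _; apply: sumr_ge0 => z _.
by rewrite mulr_ge0 ?sqr_ge0// powR_ge0.
Qed.

Lemma energy_le W : cone W -> energy W <= tot W.
Proof.
move=> cW; rewrite -[leRHS]avgN1 ler_wpM2l//; apply: ler_sum => j _.
rewrite -[leRHS](mrg_sum W j); apply: ler_sum => z _.
rewrite tot_powR//; have m0 := mrg_ge0 j z cW; have ml := mrg_le j z cW.
have [t0|t0] := eqVneq (tot W) 0; first by rewrite t0 invr0 mulr0.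
have tp : 0 < tot W by rewrite lt_neqAle eq_sym t0 tot_ge0.
by rewrite ler_pdivrMr// expr2 ler_wpM2l.
Qed.

Lemma nice_energy : nice energy.
Proof.
split.
  move=> d X g mg; apply: measurable_funM => //.
  apply: measurable_sum => j; apply: measurable_sum => z; apply: measurable_funM.
    apply: measurable_funX; apply: measurable_sum => s; exact: measurable_funM.
  apply: (@measurableT_comp _ _ _ _ _ _ (fun y : R => y `^ (-1)) _ (fun x => tot (g x))).
    exact: measurable_powR.
  exact: measurable_sum.
exists 1 => // W cW; rewrite mul1r ger0_norm ?energy_ge0//.
have t0 := tot_ge0 cW; apply: le_trans (energy_le cW) _; nra.
Qed.

(** The drift of the marginals of [U] from those of a reference weight [W], multiplied by the mass
    of [U]; summed over the outcomes of pins of [W] it is the mean drift caused by them. *)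
Definition dev W U : R := N^-1 * \sum_j \sum_z `|mrg U j z - tot U * mu W j z|.

Lemma nice_mrg j z : nice (fun W => mrg W j z).
Proof. exact: nice_lin. Qed.

Lemma nice_dev W : nice (dev W).
Proof.
apply: niceZ; apply: nice_sum => j; apply: nice_sum => z; apply: nice_abs.
apply: niceB; first exact: nice_mrg.
by under eq_fun do rewrite mulrC; apply: niceZ; exact: nice_tot.
Qed.

(* AM-GM: |m - t x| = t |m/t - x| <= t (eta/2 + (m/t - x)^2 / (2 eta)). *)
Lemma dev_term (eta m t x : R) : 0 < eta -> 0 <= m -> m <= t ->
  `|m - t * x| <= eta / 2 * t + (2 * eta)^-1 * (m ^+ 2 * t^-1 - 2 * x * m + x ^+ 2 * t).
Proof.
move=> e0 m0 mt; have [t0|t0] := eqVneq t 0.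
  have -> : m = 0 by apply/eqP; rewrite eq_le m0 andbT -t0.
  by rewrite t0 expr2 !(mul0r, mulr0, subr0, addr0) normr0.
have tp : 0 < t by rewrite lt_neqAle eq_sym t0 (le_trans m0).
have -> : m - t * x = t * (m / t - x) by field.
have -> : m ^+ 2 / t - 2 * x * m + x ^+ 2 * t = t * (m / t - x) ^+ 2 by field.
rewrite normrM (ger0_norm (ltW tp)); set y := m / t - x.
have -> : eta / 2 * t + (2 * eta)^-1 * (t * y ^+ 2) = t * ((eta ^+ 2 + `|y| ^+ 2) / (2 * eta)).
  by rewrite real_normK ?num_real//; field; rewrite gt_eqF.
rewrite ler_wpM2l ?(ltW tp)// ler_pdivlMr ?mulr_gt0//.
by have := sqr_ge0 (eta - `|y|); lra.
Qed.

(** The bound for the drift after [l] pins: a term free of correlations plus the gain of energy over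
    [2 eta]. The parameter [eta] is chosen only at the very end. *)
Definition perr eta l W := eta * Q / 2 * tot W + (2 * eta)^-1 * (iter l pinop energy W - energy W).

Lemma nice_perr eta l : nice (perr eta l).
Proof.
apply: niceD; apply: niceZ; first exact: nice_tot.
apply: niceB; last exact: nice_energy.
by apply: good_nice nice_energy; apply: good_iter; exact: good_pin.
Qed.

(** After [dev_term] the square is expanded around the marginals of [W]. The parts linear in [U] are
    fixed by pinning, and what remains is the energy after [l] pins minus the energy of [W]. *)
Lemma iter_dev eta l W : 0 < eta -> cone W -> iter l pinop (dev W) W <= perr eta l W.
Proof.
move=> e0 cW; have gl := good_iter l good_pin.
pose G U := eta * Q / 2 * tot U + (2 * eta)^-1 * (energy U -
  lin (fun s => N^-1 * \sum_j \sum_z (2 * mu W j z * (tnth s j == z)%:R - mu W j z ^+ 2)) U).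
have nl := nice_lin (fun s : cfg => N^-1 * \sum_j \sum_z (2 * mu W j z * (tnth s j == z)%:R - mu W j z ^+ 2)).
have nt := nice_tot (R := R) (S := cfg).
have ne := nice_energy.
have nG : nice G by apply: niceD; apply: niceZ => //; exact: niceB.
have linE U : lin (fun s => N^-1 * \sum_j \sum_z (2 * mu W j z * (tnth s j == z)%:R - mu W j z ^+ 2)) U =
   N^-1 * \sum_j \sum_z (2 * mu W j z * mrg U j z - mu W j z ^+ 2 * tot U).
  rewrite linZ; congr (_ * _); rewrite /lin.
  under eq_bigr do rewrite mulr_sumr.
  rewrite exchange_big/=; apply: eq_bigr => j _.
  under eq_bigr do rewrite mulr_sumr.
  rewrite exchange_big/=; apply: eq_bigr => z _.
  rewrite mrg_lin /tot /lin !mulr_sumr -sumrB; apply: eq_bigr => s _; ring.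
have le1 U : cone U -> dev W U <= G U.
  move=> cU; rewrite /G linE /energy /dev tot_powR//.
  rewrite -mulrBr -sumrB (mulrCA _ N^-1) -[X in X + _ * _]avgN1 -mulrDr ler_wpM2l//.
  rewrite [X in _ + X]mulr_sumr -big_split/=; apply: ler_sum => j _.
  rewrite -sumrB [X in _ + X]mulr_sumr (_ : eta * Q / 2 * tot U = \sum_(z : color) eta / 2 * tot U); last first.
    by rewrite sumr_const card_ord -[RHS]mulr_natl; ring.
  rewrite -big_split/=; apply: ler_sum => z _.
  have := dev_term (mu W j z) e0 (mrg_ge0 j z cU) (mrg_le j z cU).
  by move/le_trans; apply; apply: eq_refl_le; ring.
apply: le_trans (good_mono gl (nice_dev W) nG le1 cW) _.
rewrite (good_D gl)//; [|exact: niceZ|by apply: niceZ; exact: niceB].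
rewrite !(good_Z gl)//; last exact: niceB.
rewrite (good_tot gl)// (good_B gl)// (good_lin gl)// /perr.
rewrite lerD2l ler_wpM2l ?invr_ge0 ?mulr_ge0 ?(ltW e0)// lerD2l lerN2.
rewrite linE /energy tot_powR// ler_wpM2l//; apply: ler_sum => j _; apply: ler_sum => z _.
rewrite /mu; have [t0|t0] := eqVneq (tot W) 0; first by rewrite t0 invr0 !(mulr0, mul0r) subr0.
by rewrite le_eqVlt; apply/orP; left; apply/eqP; field.
Qed.

(** The pinning lemma: the energy stays between [0] and [tot W], so its gain over [l] pins, averaged
    over a uniform starting time below [T], telescopes to at most [l / T] of the mass. *)
Lemma avg_perr eta l T W : 0 < eta -> (0 < T)%N -> cone W ->
  avgE T pinop (perr eta l) W <= (eta * Q / 2 + (2 * eta)^-1 * (l%:R / T%:R)) * tot W.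
Proof.
move=> e0 T0 cW; have gA := good_avg T0 good_pin; have gl t := good_iter t good_pin.
have ne := nice_energy; have nel t := good_nice (gl t) ne.
rewrite /perr (good_D gA)//; [|apply: niceZ; exact: nice_tot|apply: niceZ; exact: niceB].
rewrite !(good_Z gA)//; [|exact: niceB|exact: nice_tot].
rewrite (good_tot gA)// [leRHS]mulrDl lerD2l -[leRHS]mulrA ler_wpM2l//.
  by rewrite invr_ge0 mulr_ge0// ltW.
pose h t := iter t pinop energy W.
rewrite /avgE (eq_bigr (fun t : 'I_T => h (t + l)%N - h t)); last first.
  by move=> t _; rewrite (good_B (gl t))// -iterD.
rewrite mulrAC mulrC ler_wpM2r ?invr_ge0//.
have h0 t : 0 <= h t := good_ge0 (gl t) ne energy_ge0 cW.
have ht t : h t <= tot W.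
  by rewrite -(good_tot (gl t) cW); exact: (good_mono (gl t) ne (@nice_tot R cfg) energy_le cW).
elim: l => [|l IH]; first by rewrite big1 ?mul0r// => t _; rewrite addn0 subrr.
rewrite (eq_bigr (fun t : 'I_T => (h (t + l.+1)%N - h (t + l)%N) + (h (t + l)%N - h t))); last first.
  by move=> t _; ring.
rewrite big_split/= -natr1 mulrDl mul1r addrC lerD//.
rewrite -(big_mkord xpredT (fun t => h (t + l.+1)%N - h (t + l)%N)).
under eq_bigr do rewrite addnS -addSn.
rewrite telescope_sumr// add0n; have := h0 l; have := ht (T + l)%N; lra.
Qed.

End pin.

(** * From pinning to asymptotic independence *)

Section decoupling.
Context {R : realType} {q n : nat}.
Local Notation color := 'I_q.+1.
Local Notation cfg := (n.+1.-tuple color).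
Local Notation Q := (q.+1%:R : R).
Local Notation N := (n.+1%:R : R).
Local Notation pinop := (@pinop R q n).
Implicit Types (W U : cfg -> R).

Definition atc L (s : cfg) (v : L.-tuple 'I_n.+1) : L.-tuple color :=
  [tuple tnth s (tnth v h) | h < L].

Definition restrt L U (v : L.-tuple 'I_n.+1) (t : L.-tuple color) : cfg -> R :=
  fun s => U s * (atc s v == t)%:R.

Definition pm L W (v : L.-tuple 'I_n.+1) (t : L.-tuple color) : R :=
  \prod_(h < L) mu W (tnth v h) (tnth t h).

(** The product of marginals is taken for a reference [W] that stays fixed while [U] is pinned; this
    is what makes the recursion [TV_S] close. *)
Definition TV L W U : R := (N ^+ L)^-1 *
  \sum_(v : L.-tuple 'I_n.+1) \sum_(t : L.-tuple color) `|tot (restrt U v t) - tot U * pm W v t|.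

Lemma atc_cons L s j (v : L.-tuple 'I_n.+1) :
  atc s [tuple of j :: v] = [tuple of tnth s j :: atc s v].
Proof.
apply: eq_from_tnth => h; rewrite tnth_mktuple.
by have [h' ->|->] := unliftP ord0 h; rewrite ?tnth0 ?tnthS ?tnth_mktuple.
Qed.

Lemma restrt_cons L U j z (v : L.-tuple 'I_n.+1) (t : L.-tuple color) :
  restrt U [tuple of j :: v] [tuple of z :: t] = restrt (restr U j z) v t.
Proof.
apply/funext => s; rewrite /restrt /restr atc_cons -mulrA -natrM mulnb.
by congr (_ * _%:R); congr (nat_of_bool _); rewrite -val_eqE/= eqseq_cons.
Qed.

Lemma restrt0 U (v : 0.-tuple 'I_n.+1) (t : 0.-tuple color) : restrt U v t = U.
Proof.
by apply/funext => s; rewrite /restrt (tuple0 t) (tuple0 (atc _ _)) eqxx mulr1.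
Qed.

Lemma restrt_cone L U (v : L.-tuple 'I_n.+1) (t : L.-tuple color) : cone U -> cone (restrt U v t).
Proof. by move=> cU s; rewrite mulr_ge0. Qed.

Lemma pm_cons L W j z (v : L.-tuple 'I_n.+1) (t : L.-tuple color) :
  pm W [tuple of j :: v] [tuple of z :: t] = mu W j z * pm W v t.
Proof.
rewrite /pm big_ord_recl !tnth0; congr (_ * _).
by apply: eq_bigr => h _; rewrite !tnthS.
Qed.

Lemma mu_ge0 W j z : cone W -> 0 <= mu W j z.
Proof. by move=> cW; rewrite divr_ge0 ?mrg_ge0 ?tot_ge0. Qed.

Lemma mu_sum W j : 0 < tot W -> \sum_z mu W j z = 1.
Proof. by move=> t0; rewrite /mu -mulr_suml mrg_sum mulfV ?gt_eqF. Qed.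

Lemma pm_ge0 L W (v : L.-tuple 'I_n.+1) (t : L.-tuple color) : cone W -> 0 <= pm W v t.
Proof. by move=> cW; apply: prodr_ge0 => h _; exact: mu_ge0. Qed.

Lemma pm_sum L W (v : L.-tuple 'I_n.+1) : 0 < tot W -> \sum_t pm W v t = 1.
Proof.
move=> t0; elim: L v => [|L IH] v; first by rewrite big_tuple0 /pm big_ord0.
rewrite (tuple_eta v) big_tupleS -[RHS](mu_sum (thead v) t0); apply: eq_bigr => z _.
under eq_bigr do rewrite pm_cons.
by rewrite -mulr_sumr IH mulr1.
Qed.

Lemma hom_iter_pin L F : homog F -> homog (iter L pinop F).
Proof. by move=> hF; elim: L => [//|L IH]; exact: hom_pin. Qed.

Lemma iter_pinE L F U : homog F -> cone U -> iter L pinop F U =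
  (N ^+ L)^-1 * \sum_(v : L.-tuple 'I_n.+1) \sum_(t : L.-tuple color) F (restrt U v t).
Proof.
move=> hF; elim: L U => [|L IH] U cU.
  by rewrite !big_tuple0 restrt0 expr0 invr1 mul1r.
rewrite iterS pinE//; last exact: hom_iter_pin.
rewrite big_tupleS exprS invfM -mulrA; congr (_ * _).
rewrite mulr_sumr; apply: eq_bigr => j _.
under [in RHS]eq_bigr do rewrite big_tupleS.
rewrite exchange_big/= mulr_sumr; apply: eq_bigr => z _.
rewrite IH; last exact: restr_cone.
congr (_ * _); apply: eq_bigr => v _; apply: eq_bigr => t _.
by rewrite restrt_cons.
Qed.

Lemma hom_TV L W : homog (TV L W).
Proof.
move=> c U c0 cU; rewrite /TV mulrCA; congr (_ * _).
rewrite mulr_sumr; apply: eq_bigr => v _; rewrite mulr_sumr; apply: eq_bigr => t _.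
rewrite -[X in X * `|_|](ger0_norm c0) -normrM; congr `|_|.
rewrite tot_hom// mulrBr mulrA; congr (_ - _).
by rewrite /tot mulr_sumr; apply: eq_bigr => s _; rewrite /restrt mulrA.
Qed.

Lemma nice_TV L W : nice (TV L W).
Proof.
apply: niceZ; apply: nice_sum => v; apply: nice_sum => t; apply: nice_abs.
apply: niceB; first exact: nice_lin.
by under eq_fun do rewrite mulrC; apply: niceZ; exact: nice_tot.
Qed.

(** Chain rule: revealing the first entry of the tuple is a pin of [U], and replacing its law by the
    marginal of [W] costs one drift. *)
Lemma TV_S L W U : cone W -> 0 < tot W -> cone U ->
  TV L.+1 W U <= pinop (TV L W) U + dev W U.
Proof.
move=> cW t0 cU; rewrite pinE//; last exact: hom_TV.
rewrite /TV /dev -mulrDr big_tupleS exprS invfM -mulrA ler_wpM2l//.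
rewrite mulr_sumr -big_split/=; apply: ler_sum => j _.
under eq_bigr do rewrite big_tupleS.
rewrite exchange_big/= mulr_sumr -big_split/=; apply: ler_sum => z _.
have NL : (N ^+ L)^-1 * \sum_(v : L.-tuple 'I_n.+1) `|mrg U j z - tot U * mu W j z| =
   `|mrg U j z - tot U * mu W j z|.
  by rewrite sumr_const card_tuple card_ord -[X in _ * X]mulr_natl natrX mulrA mulVf ?mul1r// expf_neq0.
rewrite -[X in _ <= _ + X]NL -mulrDr ler_wpM2l ?invr_ge0 ?exprn_ge0//.
rewrite -big_split/=; apply: ler_sum => v _.
rewrite -[X in _ <= _ + X]mulr1 -[X in _ <= _ + _ * X](pm_sum v t0) mulr_sumr -big_split/=.
apply: ler_sum => t _; rewrite restrt_cons pm_cons.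
have -> : tot (restrt (restr U j z) v t) - tot U * (mu W j z * pm W v t) =
  (tot (restrt (restr U j z) v t) - mrg U j z * pm W v t) +
  (mrg U j z - tot U * mu W j z) * pm W v t by ring.
apply: le_trans (ler_normD _ _) _; rewrite lerD2l normrM.
by rewrite (ger0_norm (pm_ge0 v t cW)).
Qed.

Lemma TV_le L W U : cone W -> 0 < tot W -> cone U ->
  TV L W U <= \sum_(i < L) iter i pinop (dev W) U.
Proof.
move=> cW t0; elim: L U => [|L IH] U cU.
  by rewrite big_ord0 /TV !big_tuple0 restrt0 /pm big_ord0 mulr1 subrr normr0 mulr0.
apply: le_trans (TV_S _ cW t0 cU) _; rewrite big_ord_recl/= addrC lerD2l.
have nd i : nice (iter i pinop (dev W)).
  by apply: good_nice (nice_dev W); apply: good_iter; exact: good_pin.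
rewrite -(good_sum good_pin)//.
apply: (good_mono good_pin) => //; [exact: nice_TV|exact: nice_sum].
Qed.

Section product_multipliers.
Context d (Y : measurableType d) (nu : probability Y R) (b : R) (L : nat).
Variables (g : Y -> L.-tuple color -> R) (W : cfg -> R).
Hypotheses (mg : mult b g) (b1 : 1 <= b) (cW : cone W) (t0 : 0 < tot W).
Let b0 : 0 <= b. Proof. exact: le_trans b1. Qed.

Definition locf (x : L.-tuple 'I_n.+1 * Y) (s : cfg) : R := g x.2 (atc s x.1).
(** The mean-field value of [locf], under the product of the marginals of [W]. It does not depend on
    the configuration and is put on [unit] so that [fsum] can couple it with [locf]. *)
Definition mff (x : L.-tuple 'I_n.+1 * Y) (_ : unit) : R := \sum_t g x.2 t * pm W x.1 t.

Definition locmu : probability (L.-tuple 'I_n.+1 * Y)%type R :=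
  (unif (L.-tuple 'I_n.+1) R \x nu)%E.

Lemma bmf_loc (h : L.-tuple 'I_n.+1 * Y -> R) : (forall v, bmf (fun y => h (v, y))) -> bmf h.
Proof. by move=> bh; apply: bmf_fin_fst => // A; exact: measurable_tuple_ord. Qed.

Lemma Ex_loc (h : L.-tuple 'I_n.+1 * Y -> R) : bmf h ->
  \int[locmu]_x h x = (N ^+ L)^-1 * \sum_v \int[nu]_y h (v, y).
Proof.
move=> bh; rewrite Ex_unif_prod//.
by rewrite card_tuple card_ord natrX.
Qed.

Lemma mult_locf : mult b locf.
Proof.
split.
- by move=> s; case: (@bmf_loc (locf ^~ s)) => // v; exact: (mult_ev_bmf mg (atc s v)).
- by move=> x s; exact: (mult_ge0 mg).
- by move=> x s; exact: (mult_le mg).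
Qed.

Lemma mult_mff : mult b mff.
Proof.
split.
- move=> s; case: (@bmf_loc (mff ^~ s)) => // v; apply: bmf_sum => t.
  by apply: bmfM; [exact: (mult_ev_bmf mg t)|exact: (bmf_cst _ (pm W v t))].
- move=> x s; apply: sumr_ge0 => t _; apply: mulr_ge0; first exact: (mult_ge0 mg).
  exact: pm_ge0.
- move=> x s; rewrite -[leRHS]mulr1 -(pm_sum x.1 t0) mulr_sumr.
  by apply: ler_sum => t _; rewrite ler_wpM2r ?pm_ge0// (mult_le mg).
Qed.

Let mfs := mult_fsum mult_locf mult_mff.

Definition pr (U : cfg -> R) (c : R) (s : cfg + unit) : R :=
  match s with inl s => U s | inr _ => c end.

Definition gap (V : cfg + unit -> R) : R := `|\sum_s V (inl s) - V (inr tt)|.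

(** The mean distance, after [m] common samples, between the mass of [U] multiplied by the true
    multipliers and the number [c] multiplied by the mean-field ones. *)
Definition gapm m U c : R := iter m (op locmu (fsum locf mff)) gap (pr U c).

Lemma pr_cone U c : cone U -> 0 <= c -> cone (pr U c).
Proof. by move=> cU c0 [s|[]]/=. Qed.

Lemma nice_gap : nice gap.
Proof.
apply: nice_abs; apply: niceB; last exact: nice_ev.
by apply: nice_sum => s; exact: nice_ev.
Qed.

Lemma pr_mul U c x : (fun s => pr U c s * fsum locf mff x s) =
  pr (fun s => U s * locf x s) (c * mff x tt).
Proof. by apply/funext => -[s|[]]. Qed.

Lemma gapmS m U c : gapm m.+1 U c =
  \int[locmu]_x gapm m (fun s => U s * locf x s) (c * mff x tt).
Proof. by rewrite /gapm iterS /op; under eq_Rintegral do rewrite pr_mul. Qed.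

Lemma bmf_gapm m U c : cone U -> 0 <= c ->
  bmf (fun x => gapm m (fun s => U s * locf x s) (c * mff x tt)).
Proof.
move=> cU c0; have := mult_bmf mfs (nice_iter_op locmu mfs b0 m nice_gap) (pr_cone cU c0).
by under eq_fun do rewrite pr_mul.
Qed.

Lemma locf_cone U x : cone U -> cone (fun s => U s * locf x s).
Proof. by move=> cU; exact: (mult_cone mult_locf). Qed.

Lemma mff_ge0 x c : 0 <= c -> 0 <= c * mff x tt.
Proof. by move=> c0; rewrite mulr_ge0// (mult_ge0 mult_mff). Qed.

Lemma gapm_lip m U c c' : cone U -> 0 <= c -> 0 <= c' ->
  gapm m U c <= gapm m U c' + b ^+ m * `|c - c'|.
Proof.
elim: m U c c' => [|m IH] U c c' cU c0 c'0.
  rewrite /gapm/= /gap/= expr0 mul1r.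
  have -> : \sum_s U s - c = (\sum_s U s - c') + (c' - c) by ring.
  by rewrite [`|c - c'|]distrC ler_normD.
rewrite !gapmS -[X in _ <= _ + X](Ex_cst locmu) -ExD//; last exact: bmf_cst; last exact: bmf_gapm.
apply: Ex_le => [||x].
- exact: bmf_gapm.
- by apply: bmfD; [exact: bmf_gapm|exact: bmf_cst].
apply: le_trans (IH _ _ _ (locf_cone x cU) (mff_ge0 x c0) (mff_ge0 x c'0)) _.
rewrite lerD2l exprSr -mulrA ler_wpM2l ?exprn_ge0// -mulrBl normrM mulrC.
by rewrite ler_wpM2r// ger0_norm ?(mult_le mult_mff)// (mult_ge0 mult_mff).
Qed.

Lemma gapm_ge0 m U c : cone U -> 0 <= c -> 0 <= gapm m U c.
Proof.
move=> cU c0; elim: m U c cU c0 => [|m IH] U c cU c0; first exact: normr_ge0.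
rewrite gapmS; apply: Ex_ge0 => x; apply: IH; [exact: locf_cone|exact: mff_ge0].
Qed.

Lemma gapm_sub m (I : Type) (r : seq I) (a : I -> R) (U : I -> cfg -> R) (c : I -> R) :
  (forall i, 0 <= a i) -> (forall i, cone (U i)) -> (forall i, 0 <= c i) ->
  gapm m (fun s => \sum_(i <- r) a i * U i s) (\sum_(i <- r) a i * c i) <=
  \sum_(i <- r) a i * gapm m (U i) (c i).
Proof.
elim: m U c => [|m IH] U c a0 cU c0.
  rewrite /gapm/= /gap/= exchange_big/= -sumrB (le_trans (ler_norm_sum _ _ _))//.
  by apply: ler_sum => i _; rewrite -mulr_sumr -mulrBr normrM ger0_norm.
rewrite gapmS; under [leRHS]eq_bigr do rewrite gapmS.
have -> : \sum_(i <- r) a i * \int[locmu]_x gapm m (fun s => U i s * locf x s) (c i * mff x tt) =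
  \int[locmu]_x (\sum_(i <- r) a i * gapm m (fun s => U i s * locf x s) (c i * mff x tt)).
  rewrite Ex_sum; last by move=> i; apply: bmfZ; exact: bmf_gapm.
  by apply: eq_bigr => i _; rewrite ExZ//; exact: bmf_gapm.
apply: Ex_le => [||x].
- apply: bmf_gapm.
    by move=> s; apply: sumr_ge0 => i _; rewrite mulr_ge0//; exact: cU.
  by apply: sumr_ge0 => i _; rewrite mulr_ge0.
- by apply: bmf_sum => i; apply: bmfZ; exact: bmf_gapm.
have := IH (fun i s => U i s * locf x s) (fun i => c i * mff x tt) a0
  (fun i => locf_cone x (cU i)) (fun i => mff_ge0 x (c0 i)).
apply: le_trans; apply: eq_refl_le; congr (gapm m _ _).
  by apply/funext => s; rewrite mulr_suml; apply: eq_bigr => i _; rewrite mulrA.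
by rewrite mulr_suml; apply: eq_bigr => i _; rewrite mulrA.
Qed.

Definition em m U := gapm m U (tot U).

Lemma hom_gapm m e U c : 0 <= e -> cone U -> 0 <= c ->
  gapm m (fun s => e * U s) (e * c) = e * gapm m U c.
Proof.
move=> e0; elim: m U c => [|m IH] U c cU c0.
  by rewrite /gapm/= /gap/= -mulr_sumr -mulrBr normrM ger0_norm.
rewrite !gapmS -ExZ; last exact: bmf_gapm.
congr (Rintegral _ _ _); apply/funext => x.
rewrite -IH; [|exact: locf_cone|exact: mff_ge0].
by rewrite mulrA; congr (gapm m _ _); apply/funext => s; rewrite mulrA.
Qed.

Lemma hom_em m : homog (em m).
Proof. by move=> c U c0 cU; rewrite /em tot_hom// hom_gapm// tot_ge0. Qed.

Lemma nice_em m : nice (em m).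
Proof.
have [mG [C C0 bG]] := nice_iter_op locmu mfs b0 m nice_gap; split.
  move=> d' X h mh; apply: (mG _ X (fun x => pr (h x) (tot (h x)))) => -[s|[]].
    exact: mh.
  exact: measurable_sum.
exists (C * 4) => [|U cU]; first by rewrite mulr_ge0.
have tU := tot_ge0 cU.
apply: le_trans (bG _ (pr_cone cU tU)) _; rewrite -mulrA ler_wpM2l//.
have -> : tot (pr U (tot U)) = tot U + tot U.
  rewrite /tot big_sumType/=; congr (_ + _).
  by rewrite (eq_bigl (pred1 tt)) ?big_pred1_eq//; case.
nra.
Qed.

(** A local multiplier reads [L] sites. Splitting [U] according to their colours is [L] pins, which
    yields the first term; moving the second coordinate from its mean-field value to the true mass
    costs [TV]. *)
Lemma em_S m U : cone U ->
  em m.+1 U <= b * iter L pinop (em m) U + b ^+ m.+1 * TV L W U.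
Proof.
move=> cU; have tU := tot_ge0 cU.
rewrite iter_pinE//; last exact: hom_em.
pose h (v : L.-tuple 'I_n.+1) := b * \sum_t em m (restrt U v t) +
  b ^+ m.+1 * \sum_t `|tot (restrt U v t) - tot U * pm W v t|.
apply: (@le_trans _ _ (\int[locmu]_x h x.1)).
  rewrite /em gapmS; apply: Ex_le => [||[v y]]; first exact: bmf_gapm.
    by apply: bmf_loc => v; exact: (bmf_cst _ (h v)).
  have g0 t : 0 <= g y t by exact: (mult_ge0 mg).
  have cr t : cone (restrt U v t) by exact: restrt_cone.
  (* Given the tuple, the multiplier only depends on its colours, so the new weight is a combination
     of restrictions with coefficients at most [b], and [gapm_sub] applies. *)
  have UE : (fun s => U s * locf (v, y) s) = fun s => \sum_t g y t * restrt U v t s.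
    apply/funext => s; rewrite (bigD1 (atc s v))//= /restrt eqxx mulr1 mulrC.
    rewrite big1 ?addr0// => t tv; rewrite eq_sym (negbTE tv) !mulr0//.
  have tE : tot (fun s => U s * locf (v, y) s) = \sum_t g y t * tot (restrt U v t).
    rewrite UE /tot exchange_big/=; apply: eq_bigr => t _.
    by rewrite mulr_sumr.
  have c1 := locf_cone (v, y) cU.
  apply: le_trans (gapm_lip m c1 (mff_ge0 (v, y) tU) (tot_ge0 c1)) _.
  rewrite /h/= lerD//.
    rewrite tE UE; apply: le_trans (gapm_sub _ _ _ _ _) _ => //.
      by move=> t; exact/tot_ge0/cr.
    rewrite mulr_sumr; apply: ler_sum => t _; rewrite ler_wpM2r ?(mult_le mg)//.
    by rewrite gapm_ge0// tot_ge0.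
  rewrite exprSr -mulrA ler_wpM2l ?exprn_ge0// tE /mff mulr_sumr -sumrB.
  rewrite (le_trans (ler_norm_sum _ _ _))// mulr_sumr; apply: ler_sum => t _ /=.
  rewrite mulrCA -mulrBr normrM distrC ger0_norm// ler_wpM2r//.
  exact: (mult_le mg).
rewrite Ex_loc; last by apply: bmf_loc => v; exact: (bmf_cst _ (h v)).
rewrite (eq_bigr h) => [|v _]; last exact: (Ex_cst nu (h v)).
rewrite /h big_split/= -!mulr_sumr /TV; apply: eq_refl_le; ring.
Qed.

(** [m] multipliers read [m * L] sites one after the other, so all drifts up to [m * L] pins are
    paid, each magnified by at most [b ^+ m]. *)
Lemma em_le m U : cone U ->
  em m U <= b ^+ m * \sum_(i < m * L) iter i pinop (dev W) U.
Proof.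
have nd i : nice (iter i pinop (dev W)).
  by apply: good_nice (nice_dev W); apply: good_iter; exact: good_pin.
elim: m U => [|m IH] U cU.
  by rewrite mul0n big_ord0 mulr0 /em /gapm/= /gap/= subrr normr0.
apply: le_trans (em_S m cU) _.
have gL := good_iter L (@good_pin R q n).
have := good_mono gL (nice_em m) (niceZ (b ^+ m) (nice_sum (index_enum 'I_(m * L)) xpredT nd)) IH cU.
rewrite (good_Z gL)//; last exact: nice_sum.
rewrite (good_sum gL)// => /(ler_wpM2l b0) h1.
have h2 := ler_wpM2l (exprn_ge0 m.+1 b0) (TV_le L cW t0 cU).
apply: le_trans (lerD h1 h2) _; rewrite mulrA -exprS -mulrDr ler_wpM2l ?exprn_ge0//.
rewrite mulSn addrC -!(big_mkord xpredT (fun i => iter i pinop (dev W) U)).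
rewrite [leRHS](@big_cat_nat _ _ _ L)//= ?leq_addr// lerD2l.
rewrite [leRHS](_ : _ = \sum_(0 <= i < m * L) iter (i + L) pinop (dev W) U); last first.
  by rewrite -{1}[L]add0n big_addn addKn.
rewrite big_mkord; apply: eq_refl_le.
by apply: eq_bigr => i _; rewrite addnC iterD.
Qed.

End product_multipliers.

End decoupling.

(** * Multilinear forms in colour distributions *)

Section multilinear.
Context {R : realType} {q : nat}.
Local Notation color := 'I_q.+1.

Definition dist (g : color -> R) := (forall z, 0 <= g z) /\ \sum_z g z = 1.
Definition l1 (g g' : color -> R) : R := \sum_z `|g z - g' z|.
Definition delta (s : color) (z : color) : R := (z == s)%:R.

(** The expectation of [c] under the product of the laws [G h]; the factor functions [Zf] and [Zfm]
    and all normalisers below are instances. *)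
Definition ml L (c : L.-tuple color -> R) (G : 'I_L -> color -> R) : R :=
  \sum_t c t * \prod_(h < L) G h (tnth t h).

Definition upd (I : eqType) (T : Type) (G : I -> T) (h : I) (y : T) : I -> T :=
  fun h' => if h' == h then y else G h'.

Lemma sum_prod (T : finType) L (a : 'I_L -> T -> R) :
  \sum_(v : L.-tuple T) \prod_(h < L) a h (tnth v h) = \prod_(h < L) \sum_j a h j.
Proof.
elim: L a => [|L IH] a; first by rewrite big_tuple0 !big_ord0.
rewrite big_tupleS big_ord_recl mulr_suml; apply: eq_bigr => j _.
rewrite -IH mulr_sumr; apply: eq_bigr => v _.
rewrite big_ord_recl tnth0; congr (_ * _).
by apply: eq_bigr => h _; rewrite tnthS.
Qed.

Lemma dist_sum_prod L (G : 'I_L -> color -> R) : (forall h, dist (G h)) ->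
  \sum_(v : L.-tuple color) \prod_(h < L) G h (tnth v h) = 1.
Proof. by move=> dG; rewrite sum_prod big1// => h _; case: (dG h). Qed.

Lemma dist_prod_ge0 L (G : 'I_L -> color -> R) t : (forall h, dist (G h)) ->
  0 <= \prod_(h < L) G h (tnth t h).
Proof. by move=> dG; apply: prodr_ge0 => h _; case: (dG h). Qed.

Lemma ml_between L c (G : 'I_L -> color -> R) a b : (forall h, dist (G h)) ->
  (forall t, a <= c t <= b) -> a <= ml c G <= b.
Proof.
move=> dG cab; rewrite -[a]mulr1 -[b]mulr1 -(dist_sum_prod dG) !mulr_sumr.
apply/andP; split; apply: ler_sum => t _; apply: ler_wpM2r; rewrite ?dist_prod_ge0//;
  by case/andP: (cab t).
Qed.

Lemma prod_lip L (G G' : 'I_L -> color -> R) : (forall h, dist (G h)) ->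
  (forall h, dist (G' h)) ->
  \sum_(t : L.-tuple color) `|\prod_(h < L) G h (tnth t h) - \prod_(h < L) G' h (tnth t h)| <=
  \sum_(h < L) l1 (G h) (G' h).
Proof.
elim: L G G' => [|L IH] G G' dG dG'.
  by rewrite big_tuple0 !big_ord0 subrr normr0.
have dGl h : dist (G (lift ord0 h)) by [].
have dGl' h : dist (G' (lift ord0 h)) by [].
rewrite [leRHS]big_ord_recl big_tupleS.
apply: (@le_trans _ _ (\sum_z (`|G ord0 z - G' ord0 z| +
   G' ord0 z * \sum_(h < L) l1 (G (lift ord0 h)) (G' (lift ord0 h))))); last first.
  by rewrite big_split/= -mulr_suml (proj2 (dG' ord0)) mul1r.
apply: ler_sum => z _.
have G0 : 0 <= G' ord0 z by case: (dG' ord0).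
have := ler_wpM2l G0 (IH _ _ dGl dGl'); rewrite -(lerD2l `|G ord0 z - G' ord0 z|).
apply: le_trans; rewrite -[X in _ <= X + _]mulr1 -[X in _ <= _ * X + _](dist_sum_prod dGl) !mulr_sumr -big_split/=.
apply: ler_sum => t _; rewrite !big_ord_recl !tnth0.
have E (H : 'I_L.+1 -> color -> R) :
    \prod_(h < L) H (lift ord0 h) (tnth [tuple of z :: t] (lift ord0 h)) =
    \prod_(h < L) H (lift ord0 h) (tnth t h).
  by apply: eq_bigr => h _; rewrite tnthS.
rewrite !E.
set A := \prod_(i < L) _; set B := \prod_(i < L) _.
have A0 : 0 <= A by exact: (dist_prod_ge0 t dGl).
have -> : G ord0 z * A - G' ord0 z * B = (G ord0 z - G' ord0 z) * A + G' ord0 z * (A - B) by ring.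
by rewrite (le_trans (ler_normD _ _))// !normrM (ger0_norm A0) (ger0_norm G0).
Qed.

Lemma ml_lip L c (G G' : 'I_L -> color -> R) C : (forall h, dist (G h)) ->
  (forall h, dist (G' h)) -> (forall t, `|c t| <= C) ->
  `|ml c G - ml c G'| <= C * \sum_(h < L) l1 (G h) (G' h).
Proof.
move=> dG dG' cC; have C0 : 0 <= C.
  by apply: le_trans (cC [tuple of nseq L ord0]); exact: normr_ge0.
apply: le_trans (ler_wpM2l C0 (prod_lip dG dG')).
rewrite /ml -sumrB (le_trans (ler_norm_sum _ _ _))// mulr_sumr; apply: ler_sum => t _.
by rewrite -mulrBr normrM ler_wpM2r.
Qed.

Lemma prod_upd L (G : 'I_L -> color -> R) h y (t : L.-tuple color) :
  \prod_(h' < L) upd G h y h' (tnth t h') =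
  y (tnth t h) * \prod_(h' < L | h' != h) G h' (tnth t h').
Proof.
rewrite (bigD1 h)//= /upd eqxx; congr (_ * _).
by apply: eq_bigr => h' /negbTE ->.
Qed.

Lemma ml_upd L c (G : 'I_L -> color -> R) h y :
  \sum_s y s * ml c (upd G h (delta s)) = ml c (upd G h y).
Proof.
rewrite /ml; under eq_bigr do rewrite mulr_sumr.
rewrite exchange_big/=; apply: eq_bigr => t _.
under eq_bigr do rewrite prod_upd /delta.
rewrite (bigD1 (tnth t h))//= eqxx [X in _ + X]big1 ?addr0.
  by rewrite prod_upd mulr1n; ring.
by move=> s st; rewrite eq_sym (negbTE st) mul0r !mulr0.
Qed.

Lemma dist_delta s : dist (delta s).
Proof.
split=> [z|]; first by [].
by rewrite /delta (bigD1 s)//= eqxx big1 ?addr0// => z /negbTE ->.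
Qed.

Lemma dist_upd L (G : 'I_L -> color -> R) h y : (forall h, dist (G h)) -> dist y ->
  forall h', dist (upd G h y h').
Proof. by move=> dG dy h'; rewrite /upd; case: ifP. Qed.

Lemma l1_ge0 g g' : 0 <= l1 g g'.
Proof. by apply: sumr_ge0. Qed.

Lemma l1xx g : l1 g g = 0.
Proof. by rewrite /l1 big1// => z _; rewrite subrr normr0. Qed.

Lemma l1_le2 g g' : dist g -> dist g' -> l1 g g' <= 2.
Proof.
move=> [g0 g1] [g'0 g'1]; rewrite (_ : 2 = \sum_z (g z + g' z)); last by rewrite big_split/= g1 g'1.
apply: ler_sum => z _; rewrite (le_trans (ler_normB _ _))//.
by rewrite !ger0_norm.
Qed.

Lemma ml_eq L c (G G' : 'I_L -> color -> R) : (forall h z, G h z = G' h z) -> ml c G = ml c G'.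
Proof. by move=> E; apply: eq_bigr => t _; congr (_ * _); apply: eq_bigr => h _; rewrite E. Qed.

Lemma ml_avg (T : finType) (M : R) L (c : L.-tuple color -> R) (m : T -> color -> R) :
  M ^+ L * \sum_(v : L.-tuple T) ml c (fun h => m (tnth v h)) =
  ml c (fun _ z => M * \sum_j m j z).
Proof.
rewrite /ml exchange_big/= mulr_sumr; apply: eq_bigr => t _.
rewrite -mulr_sumr mulrCA; congr (_ * _).
rewrite (sum_prod (fun h j => m j (tnth t h))).
by rewrite big_split/= prodr_const card_ord.
Qed.

Definition emp n (s : n.+1.-tuple color) (z : color) : R :=
  n.+1%:R^-1 * \sum_j (tnth s j == z)%:R.

Lemma dist_emp n (s : n.+1.-tuple color) : dist (emp s).
Proof.
split=> [z|]; first by rewrite mulr_ge0// sumr_ge0.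
rewrite -mulr_sumr exchange_big/= -[RHS](@avgN1 R n); congr (_ * _).
by apply: eq_bigr => j _; rewrite sum_eq1.
Qed.

(** Sites are drawn with replacement, so the colours of a random tuple are exactly i.i.d. from the
    empirical law, with no correction term. *)
Lemma ml_atc n L (c : L.-tuple color -> R) (s : n.+1.-tuple color) :
  (n.+1%:R ^+ L)^-1 * \sum_(v : L.-tuple 'I_n.+1) c (atc s v) = ml c (fun _ => emp s).
Proof.
rewrite -exprVn -(ml_avg n.+1%:R^-1 c (fun j z => (tnth s j == z)%:R)).
congr (_ * _); apply: eq_bigr => v _; rewrite /ml (bigD1 (atc s v))//=.
rewrite big1 ?mulr1 => [|h _]; last by rewrite tnth_mktuple eqxx.
rewrite big1 ?addr0// => t tv.
have [h hP] : exists h, tnth s (tnth v h) != tnth t h.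
  apply/existsP; rewrite -negb_forall; apply: contra tv => /forallP H.
  by apply/eqP/eq_from_tnth => h; rewrite tnth_mktuple; apply/esym/eqP.
by rewrite (bigD1 h)//= (negbTE hP) mul0r mulr0.
Qed.

Lemma prod_add_ge L (a b : 'I_L -> R) : (forall i, 0 <= a i) -> (forall i, 0 <= b i) ->
  \prod_i a i + \sum_i \prod_j upd a i (b i) j <= \prod_i (a i + b i).
Proof.
elim: L a b => [|L IH] a b a0 b0; first by rewrite !big_ord0 addr0.
rewrite !big_ord_recl.
have := IH (fun i => a (lift ord0 i)) (fun i => b (lift ord0 i)) (fun=> a0 _) (fun=> b0 _).
set A := \prod_i a _; set P := \prod_i (a _ + _) => h.
have ab0 : 0 <= a ord0 + b ord0 by rewrite addr_ge0.
apply: le_trans (ler_wpM2l ab0 h).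
rewrite {1}/upd eqxx.
have -> : \sum_(i < L) \prod_j upd a (lift ord0 i) (b (lift ord0 i)) j =
   a ord0 * \sum_(i < L) \prod_j upd (fun i => a (lift ord0 i)) i (b (lift ord0 i)) j.
  rewrite mulr_sumr; apply: eq_bigr => i _; rewrite big_ord_recl {1}/upd/=; congr (_ * _).
set S := \sum_(i < L) _.
have S0 : 0 <= S.
  apply: sumr_ge0 => i _; apply: prodr_ge0 => j _; rewrite /upd; case: ifP => _; [exact: b0|exact: a0].
have := mulr_ge0 (b0 ord0) S0; lra.
Qed.

Lemma prodr_scale L (t : R) (F : 'I_L -> R) : \prod_i (t * F i) = t ^+ L * \prod_i F i.
Proof. by rewrite big_split/= prodr_const card_ord. Qed.

(** Only the terms of degree at most one in [y] are kept; the others are nonnegative. This is the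
    first-order lower bound with which the maximality of [Zbar] is tested. *)
Lemma ml_convex L (c : L.+1.-tuple color -> R) (g y : color -> R) t :
  (forall s, 0 <= c s) -> dist g -> dist y -> 0 <= t <= 1 ->
  (1 - t) ^+ L.+1 * ml c (fun=> g) + t * (1 - t) ^+ L * \sum_h ml c (upd (fun=> g) h y) <=
  ml c (fun _ z => (1 - t) * g z + t * y z).
Proof.
move=> c0 [g0 _] [y0 _] /andP[t0 t1]; have s0 : 0 <= 1 - t by rewrite subr_ge0.
rewrite /ml exchange_big/= !mulr_sumr -big_split/=; apply: ler_sum => s _.
rewrite -mulr_sumr mulrCA [X in _ + X]mulrCA -mulrDr ler_wpM2l//.
apply: le_trans (prod_add_ge _ _); last 2 first.
- by move=> h; rewrite mulr_ge0.
- by move=> h; rewrite mulr_ge0.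
rewrite prodr_scale lerD2l mulr_sumr; apply: ler_sum => h _; apply: eq_refl_le.
rewrite prod_upd [RHS](bigD1 h)//= {1}/upd eqxx.
rewrite [X in _ = _ * X](eq_bigr (fun i : 'I_L.+1 => (1 - t) * g (tnth s i))); last first.
  by move=> i /negbTE ih; rewrite /upd ih.
rewrite big_split/= prodr_const (_ : #|_| = L); first by ring.
by rewrite cardC1 card_ord.
Qed.

End multilinear.

(** * Probability vectors as points of the simplex *)

Section simplex.
Context {R : realType} {q : nat}.
Local Notation color := 'I_q.+1.
Local Notation simplex := (pprobability 'I_q.+1 R).

Lemma mass_ge0 (g : simplex) z : 0 <= mass g z.
Proof. by rewrite fine_ge0. Qed.

Lemma Ex_simplex (g : simplex) (f : color -> R) :
  \int[g : probability _ _]_z f z = \sum_z mass g z * f z.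
Proof.
have bi z : bmf (\1_[set z] : color -> R) by exact: bmf_ord.
transitivity (\int[g : probability _ _]_x (\sum_z f z * \1_[set z] x)).
  congr (Rintegral _ _ _); apply/funext => x; rewrite (bigD1 x)//= indicE mem_set// mulr1.
  rewrite big1 ?addr0// => z zx; rewrite indicE memNset ?mulr0//=.
  by move=> E; rewrite E eqxx in zx.
rewrite Ex_sum; last by move=> z; exact: bmfZ.
apply: eq_bigr => z _; rewrite ExZ// mulrC; congr (_ * _).
rewrite /Rintegral integral_indic// setIT; congr fine.
Qed.

Lemma dist_mass (g : simplex) : dist (mass g).
Proof.
split; first exact: mass_ge0.
have := Ex_simplex g (fun=> 1); rewrite Ex_cst => E; rewrite [RHS]E.
by apply: eq_bigr => z _; rewrite mulr1.
Qed.

Lemma Ex_iid_simplex (g : simplex) n (f : n.-tuple color -> R) :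
  \int[iid (g : probability _ _) n]_s f s = \sum_s (\prod_(i < n) mass g (tnth s i)) * f s.
Proof.
have bf m (h : m.-tuple color -> R) : bmf h.
  split; first by move=> _ B mB; exact: measurable_tuple_ord.
  by exists (\sum_i `|h i|) => i; rewrite (bigD1 i)//= lerDl sumr_ge0.
elim: n f => [|n IH] f.
  by rewrite Ex_iid0 ?big_tuple0 ?big_ord0 ?mul1r//; case: (bf _ f).
rewrite Ex_iidS//.
rewrite (Ex_simplex g (fun x => \int[iid (g : probability _ _) n]_t f (tcons (x, t)))).
rewrite big_tupleS; apply: eq_bigr => z _; rewrite IH mulr_sumr; apply: eq_bigr => t _.
rewrite mulrA big_ord_recl tnth0; congr (_ * _ * _).
by apply: eq_bigr => i _; rewrite tnthS.
Qed.

Lemma bmf_mass z : bmf (fun g : simplex => mass g z).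
Proof.
split; last first.
  exists 1 => g; rewrite ger0_norm ?mass_ge0//.
  have [m0 <-] := dist_mass g; rewrite (bigD1 z)//= lerDl sumr_ge0//.
apply: measurableT_comp => //.
exact: (measurable_kernel (kprobability (@measurable_id _ simplex setT)) [set z] I).
Qed.

Variable g : color -> R.

(** A Dirac mass is substituted for vectors that are not distributions, so that [mkp] is a total
    function. *)
Definition mkw (z : color) : R := if `[< dist g >] then g z else delta ord0 z.

Lemma dist_mkw : dist mkw.
Proof.
rewrite /mkw; case: asboolP => // _; exact: dist_delta.
Qed.

Definition mkm (A : set color) : \bar R := (\sum_(z : color) (mkw z)%:E * \d_z A)%E.

Let mkm0 : mkm set0 = 0%E.
Proof. by rewrite /mkm big1// => z _; rewrite measure0 mule0. Qed.

Let mkm_ge0 A : (0 <= mkm A)%E.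
Proof.
by apply: sume_ge0 => z _; rewrite mule_ge0// lee_fin; case: dist_mkw.
Qed.

Let mkm_sigma_additive : semi_sigma_additive mkm.
Proof.
move=> F mF tF mUF.
rewrite [X in X @ _ --> _](_ : _ = fun n =>
    \sum_(z : color) (\sum_(0 <= i < n) (mkw z)%:E * \d_z (F i))%E); last first.
  by apply/funext => n; rewrite /mkm exchange_big.
have mz z : 0 <= mkw z by case: dist_mkw.
rewrite /mkm; apply: cvg_nnesum => [z _|z _].
  by apply: nearW => n; apply: sume_ge0 => i _; apply: mule_ge0 => //; rewrite lee_fin.
under eq_fun do rewrite -ge0_sume_distrr//.
apply: cvgeZl => //; exact: measure_semi_sigma_additive.
Qed.

HB.instance Definition _ := isMeasure.Build _ _ _ mkm mkm0 mkm_ge0 mkm_sigma_additive.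

Let mkm_setT : mkm setT = 1%E.
Proof.
rewrite /mkm; under eq_bigr do rewrite diracT mule1.
by rewrite sumEFin; case: dist_mkw => _ ->.
Qed.

HB.instance Definition _ := Measure_isProbability.Build _ _ _ mkm mkm_setT.

Definition mkp : simplex := (mkm : probability color R).

Lemma mass_mkp z : dist g -> mass mkp z = g z.
Proof.
move=> dg; rewrite /mass /= /mkm (bigD1 z)//= big1 ?adde0.
  by rewrite diracE mem_set// mule1 /= /mkw; case: asboolP.
by move=> z' z'z; rewrite diracE memNset ?mule0// => /= E; rewrite E eqxx in z'z.
Qed.

End simplex.

Section more_integrals.
Context {R : realType}.

(** Serves to exchange the factor weights for clipped ones, which agree with them only on the box
    charged by [p]. *)
Lemma Ex_as d (T : measurableType d) (P : probability T R) (B : set T) (f g : T -> R) :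
  measurable B -> P B = 1%E -> measurable_fun setT f -> measurable_fun setT g ->
  (forall x, B x -> f x = g x) -> \int[P]_x f x = \int[P]_x g x.
Proof.
move=> mB PB mf mg fg; rewrite /Rintegral; congr fine.
apply: ae_eq_integral => //; [exact/measurable_EFinP..|].
exists (~` B); split; first exact: measurableC.
  have PC : P (~` B) = 0%E by rewrite probability_setC// PB subee.
  exact: PC.
by move=> x /= /not_implyP[_] h Bx; apply: h; rewrite fg.
Qed.

Lemma bmf_iid_prod d (T : measurableType d) L (phi : 'I_L -> T -> R) :
  (forall h, bmf (phi h)) -> bmf (fun g : L.-tuple T => \prod_(h < L) phi h (tnth g h)).
Proof.
move=> bphi; apply: bmf_prod => h.
by apply: (@bmf_comp _ _ _ _ _ (phi h) (fun g : L.-tuple T => tnth g h)) => //; exact: measurable_tnth.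
Qed.

Lemma Ex_iid_prod d (T : measurableType d) (P : probability T R) L (phi : 'I_L -> T -> R) :
  (forall h, bmf (phi h)) ->
  \int[iid P L]_g \prod_(h < L) phi h (tnth g h) = \prod_(h < L) \int[P]_x phi h x.
Proof.
elim: L phi => [|L IH] phi bphi.
  rewrite Ex_iid0 ?big_ord0//; by case: (bmf_iid_prod bphi).
rewrite Ex_iidS; last exact: bmf_iid_prod.
rewrite big_ord_recl -IH// -ExZr; last by [].
congr (Rintegral _ _ _); apply/funext => x; rewrite -ExZ; last by apply: (@bmf_iid_prod _ _ _ (fun h => phi (lift ord0 h))).
congr (Rintegral _ _ _); apply/funext => t.
rewrite big_ord_recl /tcons tnth0; congr (_ * _).
by apply: eq_bigr => h _; rewrite tnthS.
Qed.

Lemma bmf_fst d1 d2 (T1 : measurableType d1) (T2 : measurableType d2) (f : T1 -> R) :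
  bmf f -> bmf (fun x : T1 * T2 => f x.1).
Proof. exact: (@bmf_comp _ _ _ _ _ f fst measurable_fst). Qed.

Lemma bmf_snd d1 d2 (T1 : measurableType d1) (T2 : measurableType d2) (f : T2 -> R) :
  bmf f -> bmf (fun x : T1 * T2 => f x.2).
Proof. exact: (@bmf_comp _ _ _ _ _ f snd measurable_snd). Qed.

End more_integrals.

(** * Normalised multipliers of the model *)

Section model.
Context {R : realType} {q k : nat}.
Variables (psidn : R) (psidn_gt0 : 0 < psidn) (psidn_lt : psidn < (q.+1%:R)^-1).
Variables (p : probability (weight R q k) R) (gam : pprobability 'I_q.+1 R).
Hypothesis adm : admissible psidn p gam.
Local Notation color := 'I_q.+1.
Local Notation asg := (k.+1.-tuple color).
Local Notation simplex := (pprobability 'I_q.+1 R).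
Local Notation W := (weight R q k).
Local Notation K := (k.+1%:R : R).

Definition psiup : R := psidn^-1.
(** A quotient of two numbers between [psidn] and its inverse lies between [1 / bb] and [bb]; every
    factor and half-edge multiplier is such a quotient. *)
Definition bb : R := psiup ^+ 2.
Local Notation D := psiup.

Lemma psidn_le1 : psidn <= 1.
Proof.
apply/ltW/(lt_le_trans psidn_lt); rewrite invf_le1// ler1n//.
Qed.

Lemma D_ge1 : 1 <= D.
Proof. by rewrite /psiup invf_ge1// psidn_le1. Qed.

Lemma D_gt0 : 0 < D. Proof. by rewrite invr_gt0. Qed.

Lemma psidnE : psidn = D^-1. Proof. by rewrite /psiup invrK. Qed.

Lemma bb_ge1 : 1 <= bb.
Proof. by rewrite exprn_ege1// D_ge1. Qed.

Lemma ratio_bounds (x y : R) : psidn <= x <= D -> psidn <= y <= D -> bb^-1 <= x / y <= bb.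
Proof.
rewrite psidnE => /andP[x1 x2] /andP[y1 y2]; have D0 := D_gt0.
have Di : 0 < D^-1 by rewrite invr_gt0.
have x0 : 0 < x by apply: lt_le_trans x1.
have y0 : 0 < y by apply: lt_le_trans y1.
have yi0 : 0 < y^-1 by rewrite invr_gt0.
have yi1 : D^-1 <= y^-1 by rewrite lef_pV2 ?posrE.
have yi2 : y^-1 <= D by rewrite -[D]invrK lef_pV2 ?posrE.
by rewrite /bb expr2 invfM; apply/andP; split; apply: ler_pM; rewrite // ltW.
Qed.

(** Clipping changes nothing on the box, hence nothing almost surely, and makes all bounds valid for
    every weight function. *)
Definition cl (psi : W) (t : asg) : R := Num.max psidn (Num.min D (weight_eval psi t)).

Lemma cl_bounds psi t : psidn <= cl psi t <= D.
Proof.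
rewrite /cl le_max lexx/= ge_max ge_min lexx/= andbT.
by apply: le_trans psidn_le1 D_ge1.
Qed.

Lemma cl_abs psi t : `|cl psi t| <= D.
Proof.
have /andP[c1 c2] := cl_bounds psi t.
by rewrite ger0_norm// (le_trans (ltW psidn_gt0)).
Qed.

Lemma bmf_cl t : bmf (cl ^~ t).
Proof.
split; last by exists D => psi; exact: cl_abs.
apply: measurable_maxr => //; apply: measurable_minr => //.
exact: measurable_weight_eval.
Qed.

Definition box : set W := [set psi | forall tau, psidn <= (psi tau)%:num <= psidn^-1].

Lemma p_box : p box = 1%E. Proof. by case: adm. Qed.

Lemma cl_box psi : box psi -> forall t, cl psi t = (psi t)%:num.
Proof.
move=> bx t; have /andP[b1 b2] := bx t.
by rewrite /cl /weight_eval (min_r b2) (max_r b1).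
Qed.

Lemma measurable_box : measurable box.
Proof.
have -> : box = \bigcap_(t in [set: asg])
    ((@weight_eval R q k ^~ t) @^-1` [set` `[psidn, psidn^-1]]).
  apply/seteqP; split => [psi bx t _|psi bx t] /=; first by rewrite in_itv; exact: bx.
  by have := bx t I; rewrite /= in_itv.
apply: fin_bigcap_measurable; first exact: finite_finset.
move=> t _; rewrite -[X in measurable X]setTI.
by apply: measurable_weight_eval.
Qed.

Definition psb (t : asg) : R := \int[p]_psi cl psi t.

Lemma psb_bounds t : psidn <= psb t <= D.
Proof.
rewrite /psb -[X in X <= _ <= _](Ex_cst p) -[X in _ <= _ <= X](Ex_cst p).
by apply/andP; split; apply: Ex_le; try exact: bmf_cst; try exact: bmf_cl;
  move=> psi; case/andP: (cl_bounds psi t).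
Qed.

Lemma psb_abs t : `|psb t| <= D.
Proof. by apply: Ex_bound => [|psi]; [exact: bmf_cl|exact: cl_abs]. Qed.

Lemma Ex_ml (G : 'I_k.+1 -> color -> R) : \int[p]_psi ml (cl psi) G = ml psb G.
Proof.
rewrite /ml Ex_sum => [|t]; last by apply: bmfM; [exact: bmf_cl|exact: bmf_cst].
by apply: eq_bigr => t _; rewrite ExZr//; exact: bmf_cl.
Qed.

Lemma bmf_ml (G : 'I_k.+1 -> color -> R) : bmf (fun psi => ml (cl psi) G).
Proof. by apply: bmf_sum => t; apply: bmfM; [exact: bmf_cl|exact: bmf_cst]. Qed.

Definition xi_ : R := ml psb (fun=> mass gam).

Lemma ZbarE g : Zbar p g = ml psb (fun=> mass g).
Proof.
rewrite -Ex_ml /Zbar; apply: (Ex_as measurable_box p_box).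
- rewrite /Zf; apply: measurable_sum => t; apply: measurable_funM => //.
  exact: measurable_weight_eval.
- by case: (bmf_ml (fun=> mass g)).
- move=> psi bx; apply: eq_bigr => t _; rewrite cl_box//; congr (_ * _).
  by apply: eq_bigr => h _; rewrite tnth_nseq.
Qed.

Lemma xiE : xi p = xi_.
Proof. by case: adm => _ _ <- _; rewrite ZbarE. Qed.

Lemma ml_psb_bounds (G : 'I_k.+1 -> color -> R) : (forall h, dist (G h)) ->
  psidn <= ml psb G <= D.
Proof. by move=> dG; apply: ml_between => // t; exact: psb_bounds. Qed.

Lemma xi_bounds : psidn <= xi_ <= D.
Proof. by apply: ml_psb_bounds => h; exact: dist_mass. Qed.

Lemma xi_gt0 : 0 < xi_.
Proof. by case/andP: xi_bounds => /(lt_le_trans psidn_gt0). Qed.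

Lemma ml_le_xi g : dist g -> ml psb (fun=> g) <= xi_.
Proof.
move=> dg; rewrite -xiE (_ : ml _ _ = Zbar p (mkp g)).
  apply: ub_le_sup; last by exists (mkp g).
  exists D => _ [g' _ <-]; rewrite ZbarE.
  by case/andP: (ml_psb_bounds (fun=> dist_mass g')).
by rewrite ZbarE; apply: ml_eq => h z; rewrite mass_mkp.
Qed.

(** [K * cc g s] is the partial derivative of the form [ml psb] at [g, ..., g] in the coordinate
    [s]: constancy of [cc] is the first-order condition for a maximiser of [Zbar]. *)
Definition cc (g : color -> R) (s : color) : R :=
  K^-1 * \sum_h ml psb (upd (fun=> g) h (delta s)).

Lemma K_gt0 : 0 < K. Proof. by []. Qed.

Lemma bernoulli (t : R) m : 0 <= t <= 1 -> 1 - m%:R * t <= (1 - t) ^+ m.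
Proof.
move=> /andP[t0 t1]; elim: m => [|m IH]; first by rewrite mul0r subr0.
rewrite exprS -natr1; have s0 : 0 <= 1 - t by lra.
apply: le_trans (ler_wpM2l s0 IH).
have : 0 <= m%:R * t ^+ 2 by rewrite mulr_ge0 ?sqr_ge0.
by lra.
Qed.

(** Otherwise moving [gam] slightly towards the Dirac mass at [s] would raise [Zbar] above its
    maximum; [ml_convex] and Bernoulli's inequality make this quantitative. *)
Lemma cc_le s : cc (mass gam) s <= xi_.
Proof.
rewrite leNgt; apply/negP => H; have x0 := xi_gt0.
set c := cc _ _ in H; have c0 : 0 < c by apply: lt_trans H.
(* With this step size [(1 - k t) c = xi_ + t c], whereas maximality gives [(1 - k t) c <= xi_]. *)
pose t := (c - xi_) / (c * K).
have t0 : 0 < t by rewrite divr_gt0 ?subr_gt0// mulr_gt0// K_gt0.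
have tK : t * K * c = c - xi_ by rewrite /t; field; rewrite !gt_eqF// K_gt0.
have K1 : 1 <= K by rewrite ler1n.
have t1 : t <= 1.
  have cK : 0 < c * K by rewrite mulr_gt0// K_gt0.
  rewrite /t (ler_pdivrMr _ _ cK) mul1r.
  have := ler_wpM2l (ltW c0) K1; rewrite mulr1; lra.
have t01 : 0 <= t <= 1 by rewrite (ltW t0) t1.
have dg := dist_mass gam.
have psb0 u : 0 <= psb u by case/andP: (psb_bounds u) => /(le_trans (ltW psidn_gt0)).
have := ml_convex (y := delta s) psb0 dg (dist_delta s) t01.
have dt : dist (fun z => (1 - t) * mass gam z + t * delta s z).
  have [g0 g1] := dg; have [d0 d1] := dist_delta (R := R) s; split.
    move=> z; apply: addr_ge0; apply: mulr_ge0 => //; last exact: ltW.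
    by rewrite subr_ge0.
  by rewrite big_split/= -!mulr_sumr g1 d1; ring.
move=> /le_trans /(_ (ml_le_xi dt)).
rewrite -/xi_ (_ : \sum_h _ = K * c); last by rewrite /c /cc mulVKf// gt_eqF// K_gt0.
have := bernoulli k.+1 t01; have := bernoulli k t01.
have : 0 <= (1 - t) ^+ k by rewrite exprn_ge0// subr_ge0.
set B := (1 - t) ^+ k; set A := (1 - t) ^+ k.+1 => B0 hB hA h.
have h1 := ler_wpM2r (ltW x0) hA.
have h2 : t * (1 - k%:R * t) * (K * c) <= t * B * (K * c).
  apply: ler_wpM2r; first by apply: mulr_ge0 => //; exact: ltW.
  by apply: ler_wpM2l => //; exact: ltW.
have kK : k%:R = K - 1 :> R by rewrite -natr1; ring.
have h3 : t * (1 - k%:R * t) * (K * c) <= K * t * xi_ by lra.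
have h4 : (c - xi_) * ((1 - k%:R * t) * c) <= (c - xi_) * xi_.
  by have := ler_wpM2r (ltW c0) h3; rewrite -tK; lra.
rewrite ler_pM2l ?subr_gt0// in h4.
have E4 : k%:R * t * c = c - xi_ - t * c by rewrite kK -tK; ring.
have := mulr_gt0 t0 c0; lra.
Qed.

(** The mean of [cc] under [gam] is [xi_] by multilinearity, and [cc] never exceeds [xi_]. So both
    agree wherever [gam] has mass, that is at all colours since [gam] is at least [psidn]. *)
Lemma ccE s : cc (mass gam) s = xi_.
Proof.
have sE : \sum_s mass gam s * cc (mass gam) s = xi_.
  rewrite /cc; under eq_bigr do rewrite mulrCA mulr_sumr.
  rewrite -mulr_sumr exchange_big/=.
  rewrite (eq_bigr (fun=> xi_)) => [|h _].
    by rewrite sumr_const card_ord -[xi_ *+ _]mulr_natl mulrA mulVf ?mul1r// gt_eqF ?K_gt0.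
  by rewrite ml_upd; apply: ml_eq => h' z; rewrite /upd; case: ifP.
have [m0 m1] := dist_mass gam.
have : \sum_s mass gam s * (xi_ - cc (mass gam) s) = 0.
  under eq_bigr do rewrite mulrBr.
  by rewrite sumrB sE -mulr_suml m1 mul1r subrr.
move/eqP; rewrite psumr_eq0 => [/allP/(_ s)|z _]; last first.
  by rewrite mulr_ge0// subr_ge0 cc_le.
rewrite mem_index_enum => /(_ isT)/eqP/eqP; rewrite mulf_eq0 subr_eq0 => /orP[/eqP ms|/eqP ->//].
by case: adm => _ /(_ s); rewrite ms leNgt psidn_gt0.
Qed.

Lemma cc_lip g : dist g -> forall s, `|cc g s - xi_| <= D * K * l1 g (mass gam).
Proof.
move=> dg s; rewrite -(ccE s) /cc -mulrBr -sumrB normrM ger0_norm//.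
rewrite ler_pdivrMl ?K_gt0// (le_trans (ler_norm_sum _ _ _))//.
rewrite (_ : K * _ = \sum_(h < k.+1) D * K * l1 g (mass gam)); last first.
  by rewrite sumr_const card_ord -[RHS]mulr_natl; ring.
apply: ler_sum => h _.
apply: le_trans (ml_lip (dist_upd h (fun=> dg) (dist_delta s))
  (dist_upd h (fun=> dist_mass gam) (dist_delta s)) psb_abs) _.
rewrite -mulrA ler_wpM2l ?(ltW D_gt0)//.
rewrite (_ : K * _ = \sum_(h' < k.+1) l1 g (mass gam)); last first.
  by rewrite sumr_const card_ord -[RHS]mulr_natl.
apply: ler_sum => h' _; rewrite /upd; case: ifP => // _.
by rewrite l1xx l1_ge0.
Qed.

(** The mean weight of one random factor under the ground truth [s]; its [m]-th power is the
    normaliser of the teacher-student density. *)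
Definition nrm n (s : n.+1.-tuple color) : R := ml psb (fun=> emp s).

Lemma nrm_bounds n (s : n.+1.-tuple color) : psidn <= nrm s <= D.
Proof. by apply: ml_psb_bounds => h; exact: dist_emp. Qed.

Definition er n (s : n.+1.-tuple color) : R := l1 (emp s) (mass gam).

Lemma nrm_lip n (s : n.+1.-tuple color) : `|nrm s - xi_| <= D * K * er s.
Proof.
apply: le_trans (ml_lip (fun=> dist_emp s) (fun=> dist_mass gam) psb_abs) _.
by rewrite sumr_const card_ord -[_ *+ _]mulr_natl /er; apply: eq_refl_le; ring.
Qed.

Definition muA n : probability (k.+1.-tuple 'I_n.+1 * W)%type R :=
  (unif (k.+1.-tuple 'I_n.+1) R \x p)%E.

(** The density of one planted factor with respect to a null one, so that [m] steps of [opA] add [m]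
    planted factors. *)
Definition fA n (x : k.+1.-tuple 'I_n.+1 * W) (s : n.+1.-tuple color) : R :=
  cl x.2 (atc s x.1) / nrm s.

Lemma fA_bounds n x s : bb^-1 <= @fA n x s <= bb.
Proof. by apply: ratio_bounds; [exact: cl_bounds|exact: nrm_bounds]. Qed.

Lemma bbi_gt0 : 0 < bb^-1.
Proof. by rewrite invr_gt0 (lt_le_trans ltr01 bb_ge1). Qed.

Lemma mult_fA n : mult bb (@fA n).
Proof.
split.
- move=> s; case: (@bmf_loc R n _ W k.+1 ((@fA n)^~ s)) => // v.
  rewrite /fA/=; under eq_fun do rewrite mulrC.
  by apply: bmfZ; exact: bmf_cl.
- by move=> x s; case/andP: (fA_bounds x s) => /(le_trans (ltW bbi_gt0)).
- by move=> x s; case/andP: (fA_bounds x s).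
Qed.

Lemma mean1_fA n s : \int[muA n]_x fA x s = 1.
Proof.
rewrite (@Ex_loc R n _ W p k.+1 (fun x => fA x s)); last exact: (mult_ev_bmf (@mult_fA n) s).
rewrite (eq_bigr (fun v => psb (atc s v) / nrm s)) => [|v _].
  by rewrite -mulr_suml mulrA ml_atc mulfV// gt_eqF//; case/andP: (nrm_bounds s) => /(lt_le_trans psidn_gt0).
by rewrite /fA (ExZr _ _ (bmf_cl (atc s v))).
Qed.

Definition opA n : ((n.+1.-tuple color -> R) -> R) -> (n.+1.-tuple color -> R) -> R :=
  op (muA n) (@fA n).

Lemma good_opA n : good (@opA n).
Proof.
apply: (good_op (@mult_fA n) (@mean1_fA n)).
exact: le_trans bb_ge1.
Qed.

Definition muS (pi : probability simplex R) :
    probability (W * 'I_k.+1 * k.+1.-tuple simplex)%type R :=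
  (p \x unif 'I_k.+1 R \x iid pi k.+1)%E.

Definition wf (psi : W) (h : 'I_k.+1) (g : 'I_k.+1 -> color -> R) (s : color) : R :=
  ml (cl psi) (upd g h (delta s)).

Definition masses (g : k.+1.-tuple simplex) (h : 'I_k.+1) : color -> R := mass (tnth g h).

Lemma dist_masses g h : dist (masses g h).
Proof. exact: dist_mass. Qed.

Lemma bmf_masses (h : 'I_k.+1) z : bmf (fun g : k.+1.-tuple simplex => masses g h z).
Proof.
apply: (@bmf_comp _ _ _ _ _ (fun g : simplex => mass g z) (fun g : k.+1.-tuple simplex => tnth g h)).
  exact: measurable_tnth.
exact: bmf_mass.
Qed.

Lemma bmf_ml_masses (y : 'I_k.+1 -> color -> R) :
  bmf (fun x : W * 'I_k.+1 * k.+1.-tuple simplex =>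
    ml (cl x.1.1) (upd (masses x.2) x.1.2 (y x.1.2))).
Proof.
apply: bmf_sum => t; apply: bmfM.
  by apply: (@bmf_fst _ _ _ _ _ (fun x => cl x.1 t)); apply: (@bmf_fst _ _ _ _ _ (cl^~ t)); exact: bmf_cl.
apply: bmf_prod => h'.
rewrite (_ : (fun x => _) = fun x : W * 'I_k.+1 * k.+1.-tuple simplex =>
   (h' == x.1.2)%:R * y x.1.2 (tnth t h') + (h' != x.1.2)%:R * masses x.2 h' (tnth t h')); last first.
  by apply/funext => x; rewrite /upd; case: eqP => _ /=; rewrite ?mul1r ?mul0r ?addr0 ?add0r.
have b1 (f : 'I_k.+1 -> R) : bmf (fun x : W * 'I_k.+1 * k.+1.-tuple simplex => f x.1.2).
  apply: (@bmf_fst _ _ _ _ _ (fun x : W * 'I_k.+1 => f x.2)); apply: (@bmf_snd _ _ _ _ _ f); exact: bmf_ord.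
apply: bmfD; first exact: (b1 (fun h => (h' == h)%:R * y h (tnth t h'))).
apply: bmfM; first exact: (b1 (fun h => (h' != h)%:R)).
by apply: (@bmf_snd _ _ _ _ _ (fun g => masses g h' (tnth t h'))); exact: bmf_masses.
Qed.

(** A half-edge: a factor attached to a variable by its slot [h], the other slots being fed with
    independent messages instead of variables. *)
Definition fb (x : W * 'I_k.+1 * k.+1.-tuple simplex) (s : color) : R :=
  wf x.1.1 x.1.2 (masses x.2) s / xi_.

Lemma wf_bounds psi h g s : (forall h, dist (g h)) -> psidn <= wf psi h g s <= D.
Proof.
move=> dg; apply: ml_between => [h'|t]; last exact: cl_bounds.
by apply: dist_upd => //; exact: dist_delta.
Qed.

Lemma fb_bounds x s : bb^-1 <= fb x s <= bb.
Proof.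
by apply: ratio_bounds; [apply: wf_bounds; exact: dist_masses|exact: xi_bounds].
Qed.

Lemma mult_fb : mult bb fb.
Proof.
split.
- move=> s; apply: measurable_funM => //.
  by case: (bmf_ml_masses (fun=> delta s)).
- by move=> x s; case/andP: (fb_bounds x s) => /(le_trans (ltW bbi_gt0)).
- by move=> x s; case/andP: (fb_bounds x s).
Qed.

Definition fB n (x : 'I_n.+1 * (W * 'I_k.+1 * k.+1.-tuple simplex)) (s : n.+1.-tuple color) : R :=
  fb x.2 (tnth s x.1).

Lemma mult_fB n : mult bb (@fB n).
Proof.
split.
- move=> s; case: (@bmf_fin_fst R _ _ 'I_n.+1 _ ((@fB n)^~ s)) => // j.
  exact: (mult_ev_bmf mult_fb (tnth s j)).
- by move=> x s; exact: (mult_ge0 mult_fb).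
- by move=> x s; exact: (mult_le mult_fb).
Qed.

Section has_mean.
Variable pi : probability simplex R.

Lemma Ex_muS F : bmf F -> \int[muS pi]_x F x =
  \int[p]_psi (K^-1 * \sum_h \int[iid pi k.+1]_g F (psi, h, g)).
Proof.
move=> bF; rewrite /muS Ex_prod//.
rewrite (@Ex_prod _ _ _ _ _ p (unif 'I_k.+1 R) (fun x => \int[iid pi k.+1]_g F (x, g))); last first.
  exact: (bmf_Ex (p \x unif 'I_k.+1 R)%E (iid pi k.+1) bF).
congr (Rintegral _ _ _); apply/funext => psi.
by rewrite Ex_unif ?card_ord.
Qed.

Definition muB n : probability ('I_n.+1 * (W * 'I_k.+1 * k.+1.-tuple simplex))%type R :=
  (unif 'I_n.+1 R \x muS pi)%E.

Lemma Ex_muB n (F : 'I_n.+1 * (W * 'I_k.+1 * k.+1.-tuple simplex) -> R) : bmf F ->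
  \int[muB n]_x F x = n.+1%:R^-1 * \sum_j \int[muS pi]_x F (j, x).
Proof. by move=> bF; rewrite /muB Ex_unif_prod// card_ord. Qed.

Hypothesis pi_mean : has_mean pi gam.

(** The [option] marks the slots whose law is frozen. The other slots carry independent messages,
    and multilinearity replaces them by their mean [gam]. *)
Lemma Ex_ml_masses (c : asg -> R) (y : 'I_k.+1 -> option (color -> R)) :
  \int[iid pi k.+1]_g ml c (fun h => if y h is Some z then z else masses g h) =
  ml c (fun h => if y h is Some z then z else mass gam).
Proof.
have b h (t : asg) : bmf (fun g : simplex => (if y h is Some z then z else mass g) (tnth t h)).
  by case: (y h) => [z|]; [exact: bmf_cst|exact: bmf_mass].
have E g : ml c (fun h => if y h is Some z then z else masses g h) =
   \sum_t c t * \prod_(h < k.+1) (if y h is Some z then z else mass (tnth g h)) (tnth t h) by [].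
under eq_Rintegral do rewrite E.
rewrite Ex_sum => [|t]; last first.
  by apply: bmfZ; apply: (@bmf_iid_prod _ _ _ _ (fun h (g : simplex) => (if y h is Some z then z else mass g) (tnth t h))) => h; exact: b.
apply: eq_bigr => t _; rewrite ExZ; last first.
  by apply: (@bmf_iid_prod _ _ _ _ (fun h (g : simplex) => (if y h is Some z then z else mass g) (tnth t h))) => h; exact: b.
congr (_ * _).
rewrite (@Ex_iid_prod _ _ _ pi _ (fun h (g : simplex) => (if y h is Some z then z else mass g) (tnth t h)))//.
apply: eq_bigr => h _; case: (y h) => [z|]; [exact: Ex_cst|exact: pi_mean].
Qed.

Lemma Ex_wf psi h s : \int[iid pi k.+1]_g wf psi h (masses g) s = wf psi h (fun=> mass gam) s.
Proof.
have := Ex_ml_masses (cl psi) (fun h' => if h' == h then Some (delta s) else None).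
rewrite /wf /upd => E; transitivity (ml (cl psi) (fun h' => if (if h' == h then Some (delta s) else None) is Some z then z else mass gam)).
  rewrite -E; congr (Rintegral _ _ _); apply/funext => g.
  by apply: ml_eq => h' z; case: ifP.
by apply: ml_eq => h' z; case: ifP.
Qed.

(** Averaging the messages, the slot and the weight function yields [cc (mass gam) s / xi_]; it is
    [1] for every colour exactly because of [ccE]. *)
Lemma mean1_fb s : \int[muS pi]_x fb x s = 1.
Proof.
rewrite Ex_muS; last exact: (mult_ev_bmf mult_fb).
have E psi : K^-1 * \sum_h \int[iid pi k.+1]_g fb (psi, h, g) s =
    xi_^-1 * (K^-1 * \sum_h wf psi h (fun=> mass gam) s).
  rewrite mulrCA; congr (_ * _); rewrite mulr_sumr; apply: eq_bigr => h _.
  rewrite -Ex_wf -ExZ.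
    by congr (Rintegral _ _ _); apply/funext => g; rewrite /fb mulrC.
  have b1 : bmf (fun x : W * 'I_k.+1 * k.+1.-tuple simplex => wf x.1.1 x.1.2 (masses x.2) s).
    exact: (bmf_ml_masses (fun=> delta s)).
  exact: (bmf_pair1 b1 (psi, h)).
under eq_Rintegral do rewrite E.
have bw h : bmf (fun psi => wf psi h (fun=> mass gam) s) by exact: bmf_ml.
rewrite ExZ; last by apply: bmfZ; apply: bmf_sum => h; exact: bw.
rewrite ExZ; last by apply: bmf_sum => h; exact: bw.
rewrite Ex_sum//; under eq_bigr do rewrite Ex_ml.
by rewrite -/(cc (mass gam) s) ccE mulVf// gt_eqF// xi_gt0.
Qed.

Definition opb : ((color -> R) -> R) -> (color -> R) -> R := op (muS pi) fb.

Lemma good_opb : good opb.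
Proof. by apply: (good_op mult_fb mean1_fb); exact: le_trans bb_ge1. Qed.

Lemma mean1_fB n s : \int[muB n]_x fB x s = 1.
Proof.
rewrite Ex_muB; last exact: (mult_ev_bmf (@mult_fB n) s).
rewrite -[RHS](@avgN1 R n); congr (_ * _); apply: eq_bigr => j _; exact: (mean1_fb (tnth s j)).
Qed.

Definition opB n : ((n.+1.-tuple color -> R) -> R) -> (n.+1.-tuple color -> R) -> R :=
  op (muB n) (@fB n).

Lemma good_opB n : good (@opB n).
Proof. by apply: (good_op (@mult_fB n) (@mean1_fB n)); exact: le_trans bb_ge1. Qed.

End has_mean.

(** * Corrected marginals and the effect of one factor *)

Section config.
Variable n : nat.
Local Notation cfg := (n.+1.-tuple color).
Local Notation N := (n.+1%:R : R).
Implicit Types (V : cfg -> R) (s : cfg) (j : 'I_n.+1) (z : color).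

Definition W0 : cfg -> R := fun s => \prod_(i < n.+1) mass gam (tnth s i).

Lemma cone_W0 : cone W0.
Proof. by move=> s; apply: prodr_ge0 => i _; exact: mass_ge0. Qed.

Lemma tot_W0 : tot W0 = 1.
Proof. by apply: (dist_sum_prod (G := fun=> mass gam)) => h; exact: dist_mass. Qed.

Definition gbar V z : R := N^-1 * \sum_j mu V j z.
(** The amount of shrinking that keeps the corrected marginals nonnegative: [D] bounds the inverse
    of each [mass gam z], and the cap at [1] covers averages far from [gam]. *)
Definition eps V : R := Num.min 1 (l1 (gbar V) (mass gam) * D).
(** The average marginal is replaced by [gam], and the individual fluctuation around it is kept up
    to the factor [1 - eps V]. For a zero weight this is [gam] itself. *)
Definition mup V j z : R := mass gam z + (1 - eps V) * (mu V j z - gbar V z).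
Definition C0 : R := 1 + 2 * D.

Lemma eps01 V : 0 <= eps V <= 1.
Proof.
rewrite /eps ge_min lexx/= andbT le_min ler01/= mulr_ge0 ?l1_ge0//.
exact: ltW D_gt0.
Qed.

Lemma gbar_emp V : cone V -> 0 < tot V -> forall z, gbar V z = br V (fun s => emp s z).
Proof.
move=> cV t0 z; rewrite /gbar /br /mu -mulr_suml mulrA; congr (_ / _).
rewrite /mrg /tot exchange_big/= mulr_sumr; apply: eq_bigr => s _.
by rewrite /restr -mulr_sumr /emp; ring.
Qed.

Lemma dist_gbar V : cone V -> 0 < tot V -> dist (gbar V).
Proof.
move=> cV t0; split=> [z|].
  by rewrite /gbar mulr_ge0// sumr_ge0// => j _; exact: mu_ge0.
rewrite /gbar -mulr_sumr exchange_big/= -[RHS](@avgN1 R n); congr (_ * _).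
by apply: eq_bigr => j _; rewrite mu_sum.
Qed.

Lemma mu0 V j z : tot V = 0 -> mu V j z = 0.
Proof. by move=> t0; rewrite /mu t0 invr0 mulr0. Qed.

Lemma gam_ge z : psidn <= mass gam z.
Proof. by case: adm. Qed.

Lemma dist_mu V j : cone V -> 0 < tot V -> dist (mu V j).
Proof. by move=> cV t0; split=> [z|]; [exact: mu_ge0|exact: mu_sum]. Qed.

Lemma dist_mup V j : cone V -> dist (mup V j).
Proof.
move=> cV; have [g0 g1] := dist_mass gam; have /andP[e0 e1] := eps01 V.
have := tot_ge0 cV; rewrite le_eqVlt => /predU1P[t0|t0].
  have mE z : mup V j z = mass gam z.
    rewrite /mup /gbar mu0// big1 ?mulr0 ?subrr ?mulr0 ?addr0// => i _.
    by rewrite mu0.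
  by split=> [z|]; [rewrite mE|rewrite -[RHS]g1; apply: eq_bigr => z _].
have [b0 b1] := dist_gbar cV t0.
have [m0 m1] := dist_mu j cV t0.
split=> [z|]; last first.
  rewrite /mup big_split/= -mulr_sumr sumrB g1 m1 b1; ring.
(* This leaves [mup] at least [(1 - eps V) * mu]. Where [gbar] exceeds [gam], the excess is at most
   the [l1] distance, which is at most [eps V * gbar] because [psidn] bounds [gam] from below. *)
have key : (1 - eps V) * gbar V z <= mass gam z.
  have [le|lt] := leP 1 (l1 (gbar V) (mass gam) * D).
    by rewrite /eps (min_l le) subrr mul0r.
  have eE : eps V = l1 (gbar V) (mass gam) * D by rewrite /eps (min_r (ltW lt)).
  have [le|/ltW ge] := leP (gbar V z) (mass gam z).
    apply: le_trans le; rewrite -[leRHS]mul1r ler_wpM2r// gerBl//.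
  have : gbar V z - mass gam z <= l1 (gbar V) (mass gam).
    rewrite /l1 (bigD1 z)//= (le_trans (ler_norm _))// lerDl sumr_ge0//.
  have h : l1 (gbar V) (mass gam) <= eps V * gbar V z.
    rewrite eE -[leLHS]mulr1 -mulrA ler_wpM2l ?l1_ge0//.
    by rewrite -ler_pdivrMl ?D_gt0// mulr1 /psiup invrK (le_trans (gam_ge z)).
  by lra.
have := mulr_ge0 (_ : 0 <= 1 - eps V) (m0 z); rewrite subr_ge0 => /(_ e1).
rewrite /mup; lra.
Qed.

Lemma mup_mean V z : cone V -> N^-1 * \sum_j mup V j z = mass gam z.
Proof.
move=> cV; rewrite /mup big_split/= mulrDr avgN1 -mulr_sumr sumrB.
rewrite mulrCA mulrBr (_ : N^-1 * \sum_j mu V j z = gbar V z)//.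
by rewrite avgN1 subrr mulr0 addr0.
Qed.

Lemma mup_close V j : cone V -> 0 < tot V ->
  l1 (mu V j) (mup V j) <= C0 * l1 (gbar V) (mass gam).
Proof.
move=> cV t0; have /andP[e0 _] := eps01 V.
have eD : eps V <= l1 (gbar V) (mass gam) * D by rewrite /eps ge_min lexx orbT.
apply: (@le_trans _ _ (\sum_z (`|gbar V z - mass gam z| + eps V * `|mu V j z - gbar V z|))).
  apply: ler_sum => z _; rewrite -(ger0_norm e0) -normrM.
  apply: le_trans (ler_normD _ _); apply: eq_refl_le; congr `|_|.
  by rewrite /mup; ring.
rewrite big_split/= -mulr_sumr -/(l1 (gbar V) (mass gam)) -/(l1 (mu V j) (gbar V)).
have := l1_le2 (dist_mu j cV t0) (dist_gbar cV t0) => h2.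
have := ler_wpM2l e0 h2; rewrite /C0; lra.
Qed.

(** The average marginal is the Gibbs average of the empirical colour law, so its distance to [gam]
    is at most the Gibbs average of [er]: a functional linear in the weight. *)
Lemma tot_gbar V : cone V -> 0 < tot V -> tot V * l1 (gbar V) (mass gam) <= lin (@er n) V.
Proof.
move=> cV t0; rewrite /l1 mulr_sumr /lin /er.
under [leRHS]eq_bigr do rewrite /l1 mulr_sumr.
rewrite exchange_big/=; apply: ler_sum => z _.
rewrite gbar_emp//.
rewrite [leRHS](_ : _ = tot V * br V (fun s => `|emp s z - mass gam z|)); last by rewrite (tot_br _ cV).
rewrite (ler_pM2l t0).
rewrite [X in `|_ - X|](_ : mass gam z = br V (fun=> mass gam z)); last first.
  by rewrite /br -mulr_suml mulrAC mulfV ?mul1r// gt_eqF.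
by rewrite -brB br_norm.
Qed.

Definition mkj V j : simplex := mkp (mup V j).

Lemma measurable_mkj V : measurable_fun setT (mkj V).
Proof. by move=> _ B mB. Qed.

HB.instance Definition _ V := isMeasurableFun.Build _ _ _ _ (mkj V) (measurable_mkj V).

Definition piW V : probability simplex R := distribution (unif 'I_n.+1 R) (mkj V).

Lemma Ex_piW V f : bmf f -> \int[piW V]_g f g = N^-1 * \sum_j f (mkj V j).
Proof. by move=> bf; rewrite /piW Ex_distribution// Ex_unif ?card_ord. Qed.

Lemma mass_mkj V j z : cone V -> mass (mkj V j) z = mup V j z.
Proof. by move=> cV; rewrite mass_mkp//; exact: dist_mup. Qed.

Lemma piW_mean V : cone V -> has_mean (piW V) gam.
Proof.
move=> cV z; rewrite Ex_piW; last exact: bmf_mass.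
by rewrite -(mup_mean z cV); congr (_ * _); apply: eq_bigr => j _; rewrite mass_mkj.
Qed.

Lemma Ex_iid_piW V L (F : L.-tuple simplex -> R) : bmf F ->
  \int[iid (piW V) L]_g F g =
  (N ^+ L)^-1 * \sum_(v : L.-tuple 'I_n.+1) F [tuple mkj V (tnth v h) | h < L].
Proof.
elim: L F => [|L IH] F bF.
  rewrite Ex_iid0; last by case: bF.
  by rewrite big_tuple0 expr0 invr1 mul1r; congr F; exact/esym/tuple0.
have bF' x : bmf (fun t => F (tcons (x, t))) := bmf_pair1 (bmf_tcons bF) x.
rewrite Ex_iidS// Ex_piW; last exact: (bmf_Ex (piW V) (iid (piW V) L) (bmf_tcons bF)).
rewrite big_tupleS exprS invfM -mulrA; congr (_ * _).
rewrite mulr_sumr; apply: eq_bigr => j _; rewrite IH//; congr (_ * _).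
apply: eq_bigr => v _; congr F; apply: eq_from_tnth => h.
by have [h' ->|->] := unliftP ord0 h; rewrite /tcons ?tnthS ?tnth0 !tnth_mktuple ?tnthS ?tnth0.
Qed.

Definition yA psi g : R := ml (cl psi) (masses g) / xi_.
(** The edge term of the Bethe functional with the scale [xi_] removed. *)
Definition aA (pi : probability simplex R) : R :=
  \int[(p \x iid pi k.+1)%E]_x Lambda (yA x.1 x.2).

Lemma yA_bounds psi g : bb^-1 <= yA psi g <= bb.
Proof.
apply: ratio_bounds; last exact: xi_bounds.
by apply: ml_between => [h|t]; [exact: dist_masses|exact: cl_bounds].
Qed.

Lemma bmf_Lambda d (T : measurableType d) (f : T -> R) :
  bmf f -> (forall x, 0 <= f x) -> bmf (fun x => Lambda (f x)).
Proof.
move=> [mf [C fC]] f0; split.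
  by apply: measurable_funM => //; apply: measurableT_comp.
exists (1 + C ^+ 2) => x; apply: le_trans (Lambda_abs (f0 x)) _.
rewrite lerD2l; apply: lerXn2r; rewrite ?nnegrE//.
  by apply: le_trans (fC x).
by apply: le_trans (fC x); exact: ler_norm.
Qed.

Lemma bmf_yA : bmf (fun x : W * k.+1.-tuple simplex => yA x.1 x.2).
Proof.
under eq_fun do rewrite /yA mulrC; apply: bmfZ; apply: bmf_sum => t; apply: bmfM.
  exact: (@bmf_fst _ _ _ _ _ (cl^~ t) (bmf_cl t)).
by apply: bmf_prod => h; exact: (@bmf_snd _ _ _ _ _ (fun g => masses g h (tnth t h)) (bmf_masses h (tnth t h))).
Qed.

Lemma yA_ge0 psi g : 0 <= yA psi g.
Proof. by case/andP: (yA_bounds psi g) => /(le_trans (ltW bbi_gt0)). Qed.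

Lemma bmf_LyA : bmf (fun x : W * k.+1.-tuple simplex => Lambda (yA x.1 x.2)).
Proof. by apply: bmf_Lambda => [|x]; [exact: bmf_yA|exact: yA_ge0]. Qed.

Lemma aA_piW V : cone V -> aA (piW V) = (N ^+ k.+1)^-1 *
  \sum_(v : k.+1.-tuple 'I_n.+1) \int[p]_psi Lambda (ml (cl psi) (fun h => mup V (tnth v h)) / xi_).
Proof.
move=> cV; rewrite /aA Ex_prod2; last exact: bmf_LyA.
rewrite Ex_iid_piW.
  congr (_ * _); apply: eq_bigr => v _; congr (Rintegral _ _ _); apply/funext => psi.
  congr (Lambda (_ / _)); apply: ml_eq => h z.
  by rewrite /masses tnth_mktuple mass_mkj.
have := bmf_Ex (iid (piW V) k.+1) p (f := fun w => Lambda (yA w.2 w.1)).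
apply; apply: bmf_Lambda => [|x]; last exact: yA_ge0.
under eq_fun do rewrite /yA mulrC; apply: bmfZ; apply: bmf_sum => t; apply: bmfM.
  exact: (@bmf_snd _ _ _ _ _ (cl^~ t) (bmf_cl t)).
by apply: bmf_prod => h; exact: (@bmf_fst _ _ _ _ _ (fun g => masses g h (tnth t h)) (bmf_masses h (tnth t h))).
Qed.

Lemma inv_diff (x y : R) : psidn <= x -> psidn <= y -> `|x^-1 - y^-1| <= D ^+ 2 * `|x - y|.
Proof.
move=> hx hy; have x0 : 0 < x by apply: lt_le_trans hx.
have y0 : 0 < y by apply: lt_le_trans hy.
have xi1 : x^-1 <= D by rewrite lef_pV2 ?posrE.
have yi1 : y^-1 <= D by rewrite lef_pV2 ?posrE.
have -> : x^-1 - y^-1 = x^-1 * y^-1 * (y - x) by field; rewrite !gt_eqF.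
rewrite normrM distrC ger0_norm ?mulr_ge0 ?invr_ge0 ?(ltW x0) ?(ltW y0)//.
rewrite ler_wpM2r// expr2; apply: ler_pM => //; rewrite invr_ge0; exact: ltW.
Qed.

(** The Lipschitz constant [bb] of [Lambda] times the cost [D ^+ 4 * K] of replacing [nrm] by [xi_]
    and the cost [D ^+ 2 * K * C0] of correcting the marginals. *)
Definition CA : R := bb * (D ^+ 4 * K + D ^+ 2 * K * C0).

(* Replaces the pushforward of the Gibbs measure along a uniformly random tuple
   by the product of the corrected marginals. *)
Lemma fA_approx V x : cone V -> 0 < tot V ->
  `|Lambda (br V (fA x)) - Lambda (ml (cl x.2) (fun h => mup V (tnth x.1 h)) / xi_)| <=
  CA * (lin (@er n) V / tot V) +
  bb * D ^+ 2 * ((\sum_t `|tot (restrt V x.1 t) - tot V * pm V x.1 t|) / tot V).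
Proof.
case: x => v psi /= cV t0.
have /andP[x1 x2] := xi_bounds; have D0 := ltW D_gt0.
have dmu h : dist (mu V (tnth v h)) by exact: dist_mu.
have dmup h : dist (mup V (tnth v h)) by exact: dist_mup.
have /andP[b1 b2] := br_bounds (@mult_fA n) (fun x s => proj1 (andP (fA_bounds x s))) (v, psi) cV t0.
have /andP[m1 m2] : bb^-1 <= ml (cl psi) (fun h => mup V (tnth v h)) / xi_ <= bb.
  by apply: ratio_bounds; [apply: ml_between => // t; exact: cl_bounds|exact: xi_bounds].
apply: le_trans (Lambda_lip bb_ge1 b1 b2 m1 m2) _.
have -> : CA * (lin (@er n) V / tot V) + bb * D ^+ 2 * ((\sum_t `|tot (restrt V v t) - tot V * pm V v t|) / tot V) =
  bb * (D ^+ 4 * K * (lin (@er n) V / tot V) + D ^+ 2 * ((\sum_t `|tot (restrt V v t) - tot V * pm V v t|) / tot V)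
   + D ^+ 2 * K * C0 * (lin (@er n) V / tot V)) by rewrite /CA; ring.
apply: ler_wpM2l; first exact: le_trans bb_ge1.
have xiD : xi_^-1 <= D by rewrite lef_pV2 ?posrE// xi_gt0.
have xi0 : 0 <= xi_^-1 by rewrite invr_ge0 (ltW xi_gt0).
have -> : br V (fA (v, psi)) - ml (cl psi) (fun h => mup V (tnth v h)) / xi_ =
   (br V (fA (v, psi)) - br V (fun s => cl psi (atc s v) / xi_)) +
   (br V (fun s => cl psi (atc s v) / xi_) - ml (cl psi) (fun h => mu V (tnth v h)) / xi_) +
   (ml (cl psi) (fun h => mu V (tnth v h)) / xi_ - ml (cl psi) (fun h => mup V (tnth v h)) / xi_) by ring.
apply: le_trans (ler_normD _ _) _; apply: lerD; first apply: le_trans (ler_normD _ _) _; first apply: lerD.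
- rewrite -brB (le_trans (br_norm _ cV))// /br mulrA ler_pM2r ?invr_gt0// /lin mulr_sumr.
  apply: ler_sum => s _; rewrite mulrCA ler_wpM2l// /fA/= -mulrBr normrM.
  have /andP[n1 _] := nrm_bounds s.
  apply: le_trans (ler_pM (normr_ge0 _) (normr_ge0 _) (cl_abs _ _) (inv_diff n1 x1)) _.
  have := ler_wpM2l (exprn_ge0 3 D0) (nrm_lip s); rewrite !exprS expr0; lra.
- have -> : br V (fun s => cl psi (atc s v) / xi_) - ml (cl psi) (fun h => mu V (tnth v h)) / xi_ =
     xi_^-1 * ((\sum_t cl psi t * (tot (restrt V v t) - tot V * pm V v t)) / tot V).
    have -> : ml (cl psi) (fun h => mu V (tnth v h)) = (\sum_t cl psi t * (tot V * pm V v t)) / tot V.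
      rewrite /ml mulr_suml; apply: eq_bigr => t _; rewrite -/(pm V v t); field; rewrite gt_eqF//.
    have -> : br V (fun s => cl psi (atc s v) / xi_) = xi_^-1 * ((\sum_t cl psi t * tot (restrt V v t)) / tot V).
      rewrite /br mulrA; congr (_ / _); rewrite mulr_sumr.
      under [in RHS]eq_bigr do rewrite /tot mulr_sumr mulr_sumr.
      rewrite exchange_big/=; apply: eq_bigr => s _.
      rewrite (bigD1 (atc s v))//= /restrt eqxx big1 ?addr0; first by rewrite mulr1; ring.
      by move=> t tv; rewrite eq_sym (negbTE tv) !mulr0.
    rewrite [X in _ - X]mulrC -mulrBr -mulrBl -sumrB; congr (_ * (_ / _)).
    by apply: eq_bigr => t _; ring.
  rewrite normrM ger0_norm// expr2 -mulrA.
  apply: ler_pM => //.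
  rewrite normrM [`|_^-1|]ger0_norm ?invr_ge0 ?(ltW t0)// mulrA ler_wpM2r ?invr_ge0 ?(ltW t0)//.
  rewrite (le_trans (ler_norm_sum _ _ _))// mulr_sumr; apply: ler_sum => t _.
  by rewrite normrM ler_wpM2r// cl_abs.
- rewrite -mulrBl normrM [`|_^-1|]ger0_norm//.
  have h1 := ml_lip dmu dmup (cl_abs psi).
  have h2 : \sum_(h < k.+1) l1 (mu V (tnth v h)) (mup V (tnth v h)) <= K * (C0 * (lin (@er n) V / tot V)).
    rewrite (_ : K * _ = \sum_(h < k.+1) (C0 * (lin (@er n) V / tot V))); last first.
      by rewrite sumr_const card_ord -[RHS]mulr_natl.
    apply: ler_sum => h _; apply: le_trans (mup_close _ cV t0) _.
    apply: ler_wpM2l; first by rewrite /C0; lra.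
    by rewrite ler_pdivlMr// mulrC tot_gbar.
  have := ler_pM (normr_ge0 _) xi0 (le_trans h1 (ler_wpM2l D0 h2)) xiD.
  by move/le_trans; apply; apply: eq_refl_le; rewrite expr2; ring.
Qed.

Lemma lin_er_ge0 V : cone V -> 0 <= lin (@er n) V.
Proof. by move=> cV; apply: sumr_ge0 => s _; rewrite mulr_ge0// l1_ge0. Qed.

Lemma dev_ge0 V U : 0 <= dev V U.
Proof.
by rewrite /dev mulr_ge0// sumr_ge0// => j _; rewrite sumr_ge0.
Qed.

Lemma perr_ge0 eta l V : 0 < eta -> cone V -> 0 <= perr eta l V.
Proof.
move=> e0 cV; apply: le_trans (iter_dev l e0 cV).
apply: (good_ge0 (good_iter l (@good_pin R q n)) (nice_dev V) _ cV).
by move=> U _; exact: dev_ge0.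
Qed.

(** The increment due to one factor is the edge term at the empirical law of the corrected
    marginals. Averaging [fA_approx] over the tuple turns its second error into [TV], which the
    drifts bound. *)
Lemma opA_approx V eta : cone V -> 0 < eta ->
  `|opA Lh V - Lh V - tot V * aA (piW V)| <=
  CA * lin (@er n) V + bb * D ^+ 2 * \sum_(l < k.+1) perr eta l V.
Proof.
move=> cV e0; have b0 : 0 <= bb by apply: le_trans bb_ge1.
have D0 := ltW D_gt0.
have CA0 : 0 <= CA by rewrite /CA /C0; rewrite !(mulr_ge0, addr_ge0, exprn_ge0).
have P0 : 0 <= \sum_(l < k.+1) perr eta l V by apply: sumr_ge0 => l _; exact: perr_ge0.
rewrite /opA (op_Lh (@mult_fA n) b0 (@mean1_fA n) cV) [Lh V + _]addrC addrK -mulrBr.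
have := tot_ge0 cV; rewrite le_eqVlt => /predU1P[<-|t0].
  rewrite mul0r normr0 addr_ge0// mulr_ge0 ?lin_er_ge0//.
  by rewrite mulr_ge0// exprn_ge0.
have bL := bmf_Lambda_br (@mult_fA n) b0 cV.
rewrite (@Ex_loc R n _ W p k.+1 _ bL) aA_piW// -mulrBr -sumrB.
rewrite normrM (gtr0_norm t0) normrM (ger0_norm (_ : 0 <= (N ^+ k.+1)^-1)) ?invr_ge0 ?exprn_ge0//.
pose G (v : k.+1.-tuple 'I_n.+1) := CA * (lin (@er n) V / tot V) +
  bb * D ^+ 2 * ((\sum_t `|tot (restrt V v t) - tot V * pm V v t|) / tot V).
have b2 v : bmf (fun psi => Lambda (ml (cl psi) (fun h => mup V (tnth v h)) / xi_)).
  apply: bmf_Lambda => [|psi].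
    by under eq_fun do rewrite mulrC; apply: bmfZ; exact: bmf_ml.
  rewrite divr_ge0 ?(ltW xi_gt0)//.
  have /andP[c1 _] : psidn <= ml (cl psi) (fun h => mup V (tnth v h)) <= D.
    by apply: ml_between => [h|t]; [exact: dist_mup|exact: cl_bounds].
  exact: le_trans (ltW psidn_gt0) c1.
have le1 : `|\sum_v (\int[p]_psi Lambda (br V (fA (v, psi))) -
    \int[p]_psi Lambda (ml (cl psi) (fun h => mup V (tnth v h)) / xi_))| <= \sum_v G v.
  rewrite (le_trans (ler_norm_sum _ _ _))//; apply: ler_sum => v _.
  have b1 := bmf_pair1 bL v.
  rewrite -ExB//; apply: Ex_bound => [|psi]; first exact: bmfB.
  exact: (fA_approx (v, psi) cV t0).
have Ni : 0 <= (N ^+ k.+1)^-1 by rewrite invr_ge0 exprn_ge0.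
apply: le_trans (ler_wpM2l (ltW t0) (ler_wpM2l Ni le1)) _.
have -> : \sum_v G v = N ^+ k.+1 * (CA * (lin (@er n) V / tot V)) +
   bb * D ^+ 2 * ((\sum_(v : k.+1.-tuple 'I_n.+1) \sum_t `|tot (restrt V v t) - tot V * pm V v t|) / tot V).
  rewrite /G big_split/=; congr (_ + _); last by rewrite -mulr_sumr -mulr_suml.
  by rewrite sumr_const card_tuple card_ord -[LHS]mulr_natl natrX.
have -> : tot V * ((N ^+ k.+1)^-1 * (N ^+ k.+1 * (CA * (lin (@er n) V / tot V)) +
   bb * D ^+ 2 * ((\sum_(v : k.+1.-tuple 'I_n.+1) \sum_t `|tot (restrt V v t) - tot V * pm V v t|) / tot V))) =
   CA * lin (@er n) V + bb * D ^+ 2 * TV k.+1 V V.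
  have c0 : N ^+ k.+1 != 0 by rewrite expf_neq0.
  have t0' : tot V != 0 by rewrite gt_eqF//.
  rewrite /TV; move: (N ^+ _) c0 (tot V) t0' => c c0 u u0; field; by rewrite c0 u0.
rewrite lerD2l ler_wpM2l ?mulr_ge0 ?exprn_ge0//.
apply: le_trans (TV_le _ cV t0 cV) _; apply: ler_sum => l _; exact: iter_dev.
Qed.

(** The variance of a sum of [L] independent centred variables bounded by one; in the recursion the
    cross term vanishes because [y] has mean zero under [G]. *)
Lemma var_tuple (G y : color -> R) L : dist G -> \sum_c G c * y c = 0 ->
  (forall c, `|y c| <= 1) ->
  \sum_(v : L.-tuple color) (\prod_(h < L) G (tnth v h)) * (\sum_(h < L) y (tnth v h)) ^+ 2 <= L%:R.
Proof.
move=> dG y0 y1; have [G0 G1] := dG; elim: L => [|L IH].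
  by rewrite big_tuple0 !big_ord0 expr0n mulr0.
rewrite big_tupleS.
pose P (v : L.-tuple color) := \prod_(h < L) G (tnth v h).
pose S (v : L.-tuple color) := \sum_(h < L) y (tnth v h).
rewrite (eq_bigr (fun c => G c * y c ^+ 2 + (G c * y c) * (2 * \sum_v P v * S v) +
   G c * \sum_v P v * S v ^+ 2)) => [|c _]; last first.
  have P1 : \sum_v P v = 1 by apply: (dist_sum_prod (G := fun=> G)).
  rewrite -[X in X + _ + _]mulr1 -[X in _ * X + _ + _]P1 !mulr_sumr -!big_split/=; apply: eq_bigr => v _.
  have -> : \prod_(h < L.+1) G (tnth [tuple of c :: v] h) = G c * P v.
    by rewrite big_ord_recl tnth0; congr (_ * _); apply: eq_bigr => h _; rewrite tnthS.
  have -> : \sum_(h < L.+1) y (tnth [tuple of c :: v] h) = y c + S v.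
    by rewrite big_ord_recl tnth0; congr (_ + _); apply: eq_bigr => h _; rewrite tnthS.
  ring.
rewrite !big_split/= -!mulr_suml y0 mul0r addr0 G1 mul1r -natr1 addrC lerD//.
rewrite -G1; apply: ler_sum => c _; rewrite ler_piMr//.
by rewrite -real_normK ?num_real// expr_le1.
Qed.

(** Under the prior the colours are i.i.d. from [gam], so each empirical frequency fluctuates by at
    most about [N^(-1/2)], and there are [q.+1] of them. *)
Lemma lin_er_W0 : lin (@er n) W0 <= q.+1%:R / Num.sqrt N.
Proof.
set a := Num.sqrt N; have a0 : 0 < a by rewrite sqrtr_gt0.
have aN : a ^+ 2 = N by rewrite sqr_sqrtr.
rewrite /lin /er; under eq_bigr do rewrite mulr_sumr.
rewrite exchange_big/=.
have -> : q.+1%:R / a = \sum_(z : color) a^-1 by rewrite sumr_const card_ord -[RHS]mulr_natl.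
apply: ler_sum => z _.
pose y c : R := (c == z)%:R - mass gam z.
have E s : emp s z - mass gam z = N^-1 * \sum_(j < n.+1) y (tnth s j).
  by rewrite /emp /y sumrB mulrBr avgN1.
(* Linearising [|x|] by its square with slope [a = sqrt N], balanced at [|x| = 1 / a], is enough to
   pass from the variance to the first moment. *)
have amgm (x : R) : `|x| <= a / 2 * x ^+ 2 + (2 * a)^-1.
  have := sqr_ge0 (a * `|x| - 1); rewrite -[x ^+ 2]real_normK ?num_real// => h.
  rewrite -(ler_pM2l (_ : 0 < 2 * a)); last by rewrite mulr_gt0.
  have -> : 2 * a * (a / 2 * `|x| ^+ 2 + (2 * a)^-1) = a ^+ 2 * `|x| ^+ 2 + 1.
    by field; rewrite gt_eqF.
  by lra.
apply: le_trans (ler_sum _ (fun s _ => ler_wpM2l (cone_W0 s) (amgm _))) _.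
under eq_bigr do rewrite E mulrDr.
rewrite big_split/= -mulr_suml -/(tot W0) tot_W0 mul1r.
rewrite (eq_bigr (fun s => a / 2 * N ^- 2 * (W0 s * (\sum_(j < n.+1) y (tnth s j)) ^+ 2))) => [|s _]; last first.
  by rewrite exprMn exprVn; ring.
rewrite -mulr_sumr.
have dg := dist_mass gam; have [g0 g1] := dg.
have gz : mass gam z <= 1 by rewrite -g1 (bigD1 z)//= lerDl sumr_ge0.
have y0 : \sum_c mass gam c * y c = 0.
  rewrite /y; under eq_bigr do rewrite mulrBr; rewrite sumrB -mulr_suml g1 mul1r.
  rewrite (bigD1 z)//= eqxx mulr1 big1 ?addr0 ?subrr// => c /negbTE ->; exact: mulr0.
have y1 c : `|y c| <= 1.
  have z0 := g0 z; rewrite /y ler_norml; case: eqP => _ /=; rewrite ?mulr1n ?mulr0n; lra.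
have h := var_tuple n.+1 dg y0 y1.
have c0 : 0 <= a / 2 * N ^- 2 by rewrite mulr_ge0 ?invr_ge0 ?exprn_ge0 ?divr_ge0// ltW.
have h2 := ler_wpM2l c0 h.
apply: le_trans (_ : a / 2 * N ^- 2 * N + (2 * a)^-1 <= _); first by rewrite lerD2r.
by apply: eq_refl_le; rewrite -aN; field; rewrite gt_eqF.
Qed.

Lemma bmf_mass_fb : bmf (fun w : (W * 'I_k.+1 * k.+1.-tuple simplex) * simplex =>
  \sum_s mass w.2 s * fb w.1 s).
Proof.
apply: bmf_sum => c; apply: bmfM; last exact: (@bmf_fst _ _ _ _ _ (fb^~ c) (mult_ev_bmf mult_fb c)).
exact: (@bmf_snd _ _ _ _ _ (fun g => mass g c) (bmf_mass c)).
Qed.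

Lemma dist_fb_bounds (g : color -> R) x : dist g -> bb^-1 <= \sum_s g s * fb x s <= bb.
Proof.
move=> [g0 g1]; rewrite -[X in X <= _ <= _]mul1r -[X in _ <= _ <= X]mul1r -g1 !mulr_suml.
by apply/andP; split; apply: ler_sum => c _; apply: ler_wpM2l => //; case/andP: (fb_bounds x c).
Qed.

Lemma mass_fb_ge0 (w : (W * 'I_k.+1 * k.+1.-tuple simplex) * simplex) :
  0 <= \sum_s mass w.2 s * fb w.1 s.
Proof. by have /andP[/(le_trans (ltW bbi_gt0))] := dist_fb_bounds w.1 (dist_mass w.2). Qed.

(** The mixed term of [nabla] on the scale [xi_], see [mass_fbE]. Only the slot [h] of the first
    tuple of messages enters [Zfm], so one draw from [pi1] suffices. *)
Definition mM (pi1 pi2 : probability simplex R) : R :=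
  \int[muS pi2]_x \int[pi1]_g Lambda (\sum_s mass g s * fb x s).

Lemma Ex_iid_tnth d (T : measurableType d) (P : probability T R) L (h : 'I_L) F :
  bmf F -> \int[iid P L]_g F (tnth g h) = \int[P]_x F x.
Proof.
move=> bF; pose phi h' : T -> R := if h' == h then F else fun=> 1.
have bphi h' : bmf (phi h') by rewrite /phi; case: ifP => // _; exact: bmf_cst.
have := Ex_iid_prod P bphi.
rewrite [RHS](bigD1 h)//= {2}/phi eqxx big1 ?mulr1 => [<-|h' /negbTE hh']; last first.
  by rewrite /phi hh' Ex_cst.
congr (Rintegral _ _ _); apply/funext => g.
rewrite (bigD1 h)//= /phi eqxx big1 ?mulr1// => h' /negbTE hh'.
by rewrite hh'.
Qed.

Lemma mass_fbE psi h g1 g2 : \sum_s masses g1 h s * fb (psi, h, g2) s =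
  ml (cl psi) (upd (masses g2) h (masses g1 h)) / xi_.
Proof. by rewrite /fb/= /wf -ml_upd mulr_suml; apply: eq_bigr => c _; rewrite mulrA. Qed.

Lemma measurable_ml_weight d (T : measurableType d) (X : T -> W) (G : T -> 'I_k.+1 -> color -> R) :
  measurable_fun setT X -> (forall h z, measurable_fun setT (fun x => G x h z)) ->
  measurable_fun setT (fun x => ml (fun t => (X x t)%:num) (G x)).
Proof.
move=> mX mG; apply: measurable_sum => t; apply: measurable_funM; last first.
  by apply: measurable_prod => h _; exact: mG.
exact: (measurableT_comp (measurable_weight_eval t) mX).
Qed.

Lemma ZfE psi (g : k.+1.-tuple simplex) : box psi -> Zf psi g = xi_ * yA psi g.
Proof.
move=> bx; rewrite /yA mulrCA mulfV ?mulr1 ?gt_eqF ?xi_gt0//.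
by apply: eq_bigr => t _; rewrite cl_box.
Qed.

Lemma ZfmE psi h (g g' : k.+1.-tuple simplex) : Zfm psi h g g' =
  ml (fun t => (psi t)%:num) (upd (masses g') h (masses g h)).
Proof. by apply: eq_bigr => t _; rewrite prod_upd mulrA. Qed.

Lemma LambdaMxi y : 0 <= y -> Lambda (xi_ * y) = xi_ * Lambda y + Lambda xi_ * y.
Proof. by move=> y0; rewrite LambdaM// ltW// xi_gt0. Qed.

Lemma Ex_comb d (T : measurableType d) (P : probability T R) (a b : R) (f1 f2 f3 : T -> R) :
  bmf f1 -> bmf f2 -> bmf f3 -> \int[P]_x (f1 x + a * f2 x - b * f3 x) =
   \int[P]_x f1 x + a * \int[P]_x f2 x - b * \int[P]_x f3 x.
Proof.
move=> h1 h2 h3; rewrite (ExB P (bmfD h1 (bmfZ a h2)) (bmfZ b h3)).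
by rewrite (ExD P h1 (bmfZ a h2)) (ExZ P a h2) (ExZ P b h3).
Qed.

(** * The assumption on [nabla] in normalised form *)

Section nabla.
Variables pi1 pi2 : probability simplex R.
Hypotheses (m1 : has_mean pi1 gam) (m2 : has_mean pi2 gam).
Local Notation X4 := (W * 'I_k.+1 * k.+1.-tuple simplex * k.+1.-tuple simplex)%type.
Let mu4 := (p \x unif 'I_k.+1 R \x iid pi1 k.+1 \x iid pi2 k.+1)%E.

Let Ex4 (F : X4 -> R) : bmf F ->
  \int[mu4]_x F x = \int[(p \x unif 'I_k.+1 R)%E]_x \int[iid pi1 k.+1]_g1 \int[iid pi2 k.+1]_g2 F (x, g1, g2).
Proof.
move=> bF; rewrite /mu4 Ex_prod//.
by rewrite (@Ex_prod _ _ _ _ _ (p \x unif 'I_k.+1 R)%E (iid pi1 k.+1) (fun x => \int[iid pi2 k.+1]_g2 F (x, g2)))//; exact: (bmf_Ex (p \x unif 'I_k.+1 R \x iid pi1 k.+1)%E (iid pi2 k.+1) bF).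
Qed.

Lemma Ex_yA pi : has_mean pi gam -> \int[(p \x iid pi k.+1)%E]_x yA x.1 x.2 = 1.
Proof.
move=> m; rewrite Ex_prod; last exact: bmf_yA.
have E psi : \int[iid pi k.+1]_g yA psi g = xi_^-1 * ml (cl psi) (fun=> mass gam).
  have := Ex_ml_masses m (cl psi) (fun=> None); rewrite /= => <-.
  rewrite -ExZ; first by congr (Rintegral _ _ _); apply/funext => g; rewrite mulrC.
  apply: bmf_sum => t; apply: bmfZ; apply: bmf_prod => h; exact: bmf_masses.
under eq_Rintegral do rewrite E.
by rewrite ExZ ?Ex_ml ?mulVf ?gt_eqF ?xi_gt0//; exact: bmf_ml.
Qed.

Lemma Ex_mass_fb : \int[muS pi2]_x \int[pi1]_g \sum_s mass g s * fb x s = 1.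
Proof.
have b1 x c : bmf (fun g : simplex => mass g c * fb x c) by apply: bmfM; [exact: bmf_mass|exact: bmf_cst].
have E x : \int[pi1]_g \sum_s mass g s * fb x s = \sum_s mass gam s * fb x s.
  rewrite Ex_sum//; apply: eq_bigr => c _; rewrite ExZr ?m1//; exact: bmf_mass.
under eq_Rintegral do rewrite E.
rewrite Ex_sum => [|c]; last by apply: bmfZ; exact: (mult_ev_bmf mult_fb c).
have [_ <-] := dist_mass gam; apply: eq_bigr => c _.
by rewrite ExZ ?(mean1_fb m2) ?mulr1//; exact: (mult_ev_bmf mult_fb c).
Qed.

Let mW : measurable_fun setT (fun x : X4 => x.1.1.1).
Proof. exact: (measurableT_comp measurable_fst (measurableT_comp measurable_fst measurable_fst)). Qed.

Let mh : measurable_fun setT (fun x : X4 => x.1.1.2).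
Proof. exact: (measurableT_comp measurable_snd (measurableT_comp measurable_fst measurable_fst)). Qed.

Let mg1 : measurable_fun setT (fun x : X4 => x.1.2).
Proof. exact: (measurableT_comp measurable_snd measurable_fst). Qed.

Let bI1 (f : W * k.+1.-tuple simplex -> R) : bmf f -> bmf (fun x : X4 => f (x.1.1.1, x.1.2)).
Proof. apply: bmf_comp; exact: measurable_fun_pair. Qed.

Let bI2 (f : W * k.+1.-tuple simplex -> R) : bmf f -> bmf (fun x : X4 => f (x.1.1.1, x.2)).
Proof. apply: bmf_comp; exact: (measurable_fun_pair mW measurable_snd). Qed.

Let bI3 (f : (W * 'I_k.+1 * k.+1.-tuple simplex) * simplex -> R) : bmf f ->
  bmf (fun x : X4 => f ((x.1.1, x.2), tnth x.1.2 x.1.1.2)).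
Proof.
move=> bf; rewrite (_ : (fun x => _) = fun x : X4 =>
  \sum_h (x.1.1.2 == h)%:R * f ((x.1.1, x.2), tnth x.1.2 h)); last first.
  apply/funext => x; rewrite (bigD1 x.1.1.2)//= eqxx mul1r big1 ?addr0// => h.
  by rewrite eq_sym => /negbTE ->; rewrite mul0r.
apply: bmf_sum => h; apply: bmfM.
  exact: (@bmf_comp _ _ _ _ _ (fun h' : 'I_k.+1 => (h' == h)%:R) _ mh (bmf_ord _)).
apply: (@bmf_comp _ _ _ _ _ f (fun x : X4 => ((x.1.1, x.2), tnth x.1.2 h))) => //.
apply: measurable_fun_pair; last exact: (measurableT_comp (measurable_tnth _) mg1).
exact: (measurable_fun_pair (measurableT_comp measurable_fst measurable_fst) measurable_snd).
Qed.

Let I1 (f : W * k.+1.-tuple simplex -> R) : bmf f ->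
  \int[mu4]_x f (x.1.1.1, x.1.2) = \int[(p \x iid pi1 k.+1)%E]_x f x.
Proof.
move=> bf; transitivity (\int[(p \x unif 'I_k.+1 R)%E]_x \int[iid pi1 k.+1]_g f (x.1, g)).
  rewrite Ex4; last exact: bI1.
  congr (Rintegral _ _ _); apply/funext => x.
  congr (Rintegral _ _ _); apply/funext => g1; exact: (Ex_cst (iid pi2 k.+1) (f (x.1, g1))).
rewrite (@Ex_prod _ _ _ _ _ p (unif 'I_k.+1 R) (fun x => \int[iid pi1 k.+1]_g f (x.1, g))); last first.
  by apply: (@bmf_fst _ _ _ _ _ (fun x => \int[iid pi1 k.+1]_g f (x, g))); exact: (bmf_Ex p (iid pi1 k.+1) bf).
rewrite Ex_prod//; congr (Rintegral _ _ _); apply/funext => psi; exact: (Ex_cst (unif 'I_k.+1 R) (\int[iid pi1 k.+1]_g f (psi, g))).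
Qed.

Let I2 (f : W * k.+1.-tuple simplex -> R) : bmf f ->
  \int[mu4]_x f (x.1.1.1, x.2) = \int[(p \x iid pi2 k.+1)%E]_x f x.
Proof.
move=> bf; transitivity (\int[(p \x unif 'I_k.+1 R)%E]_x \int[iid pi2 k.+1]_g f (x.1, g)).
  rewrite Ex4; last exact: bI2.
  congr (Rintegral _ _ _); apply/funext => x.
  exact: (Ex_cst (iid pi1 k.+1) (\int[iid pi2 k.+1]_g f (x.1, g))).
rewrite (@Ex_prod _ _ _ _ _ p (unif 'I_k.+1 R) (fun x => \int[iid pi2 k.+1]_g f (x.1, g))); last first.
  by apply: (@bmf_fst _ _ _ _ _ (fun x => \int[iid pi2 k.+1]_g f (x, g))); exact: (bmf_Ex p (iid pi2 k.+1) bf).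
rewrite Ex_prod//; congr (Rintegral _ _ _); apply/funext => psi; exact: (Ex_cst (unif 'I_k.+1 R) (\int[iid pi2 k.+1]_g f (psi, g))).
Qed.

Let I3 (f : (W * 'I_k.+1 * k.+1.-tuple simplex) * simplex -> R) : bmf f ->
  \int[mu4]_x f ((x.1.1, x.2), tnth x.1.2 x.1.1.2) = \int[muS pi2]_x \int[pi1]_g f (x, g).
Proof.
move=> bf; rewrite Ex4; last exact: bI3.
rewrite [RHS](@Ex_prod _ _ _ _ _ (p \x unif 'I_k.+1 R)%E (iid pi2 k.+1) (fun x => \int[pi1]_g f (x, g))); last first.
  exact: (bmf_Ex (muS pi2) pi1 bf).
congr (Rintegral _ _ _); apply/funext => x /=.
have bs : bmf (fun z : k.+1.-tuple simplex * k.+1.-tuple simplex => f ((x, z.2), tnth z.1 x.2)).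
  apply: (@bmf_comp _ _ _ _ _ f (fun z : k.+1.-tuple simplex * k.+1.-tuple simplex => ((x, z.2), tnth z.1 x.2))) => //.
  apply: measurable_fun_pair; last exact: (measurableT_comp (measurable_tnth _) measurable_fst).
  exact: (measurable_fun_pair (measurable_cst _) measurable_snd).
have E := @Ex_swap _ _ _ _ _ (iid pi1 k.+1) (iid pi2 k.+1) (fun g1 g2 => f ((x, g2), tnth g1 x.2)) bs.
rewrite E {E}.
congr (Rintegral _ _ _); apply/funext => g2.
by rewrite (@Ex_iid_tnth _ _ pi1 _ x.2 (fun g => f ((x, g2), g)))//; exact: bmf_pair1.
Qed.

Let box4 : set X4 := box `*` setT `*` setT `*` setT.

Let m_box4 : measurable box4.
Proof. by rewrite /box4; do 3 apply: measurableX => //; exact: measurable_box. Qed.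

Let p_box4 : mu4 box4 = 1%E.
Proof.
have mb := measurable_box.
rewrite (_ : mu4 box4 = (p \x unif 'I_k.+1 R \x iid pi1 k.+1)%E (box `*` setT `*` setT) * iid pi2 k.+1 setT)%E; last first.
  by apply: product_measure1E => //; do 2 apply: measurableX => //.
rewrite (_ : (p \x unif 'I_k.+1 R \x iid pi1 k.+1)%E (box `*` setT `*` setT) =
    (p \x unif 'I_k.+1 R)%E (box `*` setT) * iid pi1 k.+1 setT)%E; last first.
  by apply: product_measure1E => //; apply: measurableX.
rewrite (_ : (p \x unif 'I_k.+1 R)%E (box `*` setT) = p box * unif 'I_k.+1 R setT)%E; last exact: product_measure1E.
by rewrite p_box !probability_setT !mule1.
Qed.

(** Extracting [xi_] from [Lambda (xi_ * y)] leaves terms [Lambda xi_ * y]. All three kinds of [y]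
    have mean one, so these terms cancel, as [1 + (K - 1) - K = 0]. *)
Lemma nabla_le : K * mM pi1 pi2 <= aA pi1 + (K - 1) * aA pi2.
Proof.
have xi0 := xi_gt0.
pose u (x : W * k.+1.-tuple simplex) := yA x.1 x.2.
pose w (x : (W * 'I_k.+1 * k.+1.-tuple simplex) * simplex) := \sum_s mass x.2 s * fb x.1 s.
pose a1 (x : X4) := u (x.1.1.1, x.1.2).
pose a2 (x : X4) := u (x.1.1.1, x.2).
pose a3 (x : X4) := w ((x.1.1, x.2), tnth x.1.2 x.1.1.2).
have bLw : bmf (fun x => Lambda (w x)).
  by apply: bmf_Lambda => [|x]; [exact: bmf_mass_fb|exact: mass_fb_ge0].
have b1 : bmf a1 by apply: (bI1 bmf_yA).
have b2 : bmf a2 by apply: (bI2 bmf_yA).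
have b3 : bmf a3 by apply: (bI3 bmf_mass_fb).
have c1 : bmf (fun x => Lambda (a1 x)) by apply: (bI1 bmf_LyA).
have c2 : bmf (fun x => Lambda (a2 x)) by apply: (bI2 bmf_LyA).
have c3 : bmf (fun x => Lambda (a3 x)) by apply: (bI3 bLw).
pose H x := xi_ * (Lambda (a1 x) + (K - 1) * Lambda (a2 x) - K * Lambda (a3 x)) +
  Lambda xi_ * (a1 x + (K - 1) * a2 x - K * a3 x).
have bS f1 f2 f3 : bmf f1 -> bmf f2 -> bmf f3 -> bmf (fun x : X4 => f1 x + (K - 1) * f2 x - K * f3 x).
  by move=> ? ? ?; apply: bmfB; [apply: bmfD => //; exact: bmfZ|exact: bmfZ].
have nE : nabla p pi1 pi2 = \int[mu4]_x H x.
  apply: (Ex_as m_box4 p_box4).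
  - have E : (fun x : X4 => let '(psi, h, g1, g2) := x in
       Lambda (Zf psi g1) + (K - 1) * Lambda (Zf psi g2) - K * Lambda (Zfm psi h g1 g2)) =
      fun x => Lambda (ml (fun t => (x.1.1.1 t)%:num) (masses x.1.2)) +
       (K - 1) * Lambda (ml (fun t => (x.1.1.1 t)%:num) (masses x.2)) -
       K * Lambda (ml (fun t => (x.1.1.1 t)%:num) (upd (masses x.2) x.1.1.2 (masses x.1.2 x.1.1.2))).
      by apply/funext => -[[[psi h] g1] g2]/=; rewrite ZfmE.
    rewrite E; have mL (f : X4 -> R) : measurable_fun setT f -> measurable_fun setT (fun x => Lambda (f x)).
      by move=> mf; apply: measurable_funM => //; apply: measurableT_comp.
    have mm h z (f : X4 -> k.+1.-tuple simplex) : measurable_fun setT f -> measurable_fun setT (fun x => masses (f x) h z).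
      by move=> mf; have [mm _] := bmf_masses h z; exact: (measurableT_comp mm mf).
    have mS (f1 f2 f3 : X4 -> R) : measurable_fun setT f1 -> measurable_fun setT f2 -> measurable_fun setT f3 ->
        measurable_fun setT (fun x => Lambda (f1 x) + (K - 1) * Lambda (f2 x) - K * Lambda (f3 x)).
      move=> m1' m2' m3'; apply: measurable_funB; first apply: measurable_funD; first exact: mL.
        by apply: measurable_funM => //; exact: mL.
      by apply: measurable_funM => //; exact: mL.
    apply: mS; apply: measurable_ml_weight => // h z.
    - exact: mm.
    - exact: mm.
    rewrite /upd.
    have -> : (fun x : X4 => (if h == x.1.1.2 then masses x.1.2 x.1.1.2 else masses x.2 h) z) =
      fun x => (h == x.1.1.2)%:R * masses x.1.2 h z + (h != x.1.1.2)%:R * masses x.2 h z.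
      by apply/funext => x; case: eqP => [<-|_]/=; rewrite ?mul1r ?mul0r ?addr0 ?add0r.
    have mi (f : 'I_k.+1 -> R) : measurable_fun setT (fun x : X4 => f x.1.1.2).
      by have [] := bmf_comp mh (bmf_ord f).
    apply: measurable_funD.
      apply: measurable_funM; [exact: (mi (fun h' => (h == h')%:R))|exact: mm].
    apply: measurable_funM; [exact: (mi (fun h' => (h != h')%:R))|exact: mm].
  - by rewrite /H; have [] : bmf H by apply: bmfD; apply: bmfZ; exact: bS.
  move=> [[[psi h] g1] g2] [[[bx _] _] _]; rewrite /H !ZfE// !LambdaMxi ?yA_ge0//.
  have -> : Zfm psi h g1 g2 = xi_ * a3 (psi, h, g1, g2).
    rewrite ZfmE /a3 /w/= mass_fbE mulrCA mulfV ?mulr1 ?gt_eqF//.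
    by apply: eq_bigr => t _; rewrite cl_box.
  rewrite LambdaMxi ?mass_fb_ge0// /a1 /a2 /u/=; ring.
have I : \int[mu4]_x H x = xi_ * (aA pi1 + (K - 1) * aA pi2 - K * mM pi1 pi2).
  rewrite ExD; [|by apply: bmfZ; exact: bS..].
  rewrite !ExZ; [|exact: bS..].
  have J1 : \int[mu4]_x Lambda (a1 x) = aA pi1 by exact: (I1 bmf_LyA).
  have J2 : \int[mu4]_x Lambda (a2 x) = aA pi2 by exact: (I2 bmf_LyA).
  have J3 : \int[mu4]_x Lambda (a3 x) = mM pi1 pi2 by exact: (I3 bLw).
  have J4 : \int[mu4]_x a1 x = 1 by rewrite -(Ex_yA m1); exact: (I1 bmf_yA).
  have J5 : \int[mu4]_x a2 x = 1 by rewrite -(Ex_yA m2); exact: (I2 bmf_yA).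
  have J6 : \int[mu4]_x a3 x = 1 by rewrite -Ex_mass_fb; exact: (I3 bmf_mass_fb).
  rewrite (Ex_comb mu4 (K - 1) K c1 c2 c3) (Ex_comb mu4 (K - 1) K b1 b2 b3) J1 J2 J3 J4 J5 J6.
  by move: (aA pi1) (aA pi2) (mM pi1 pi2) (xi_) (Lambda _) => A1 A2 M X L; ring.
have : 0 <= nabla p pi1 pi2 by case: adm => _ _ _; apply.
by rewrite nE I (pmulr_rge0 _ xi0) subr_ge0.
Qed.

End nabla.

(** * Lower bound: one interpolation step *)

Section lower.
Variable pi : probability simplex R.
Hypothesis pi_mean : has_mean pi gam.

Lemma br_fB V j x : br V (fB (j, x)) = \sum_s mu V j s * fb x s.
Proof.
rewrite /br /fB/= /mu; under [RHS]eq_bigr do rewrite /mrg /tot !mulr_suml.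
rewrite exchange_big/= mulr_suml; apply: eq_bigr => s _.
have E : restr V j (tnth s j) s = V s by rewrite /restr eqxx mulr1.
rewrite [RHS](bigD1 (tnth s j))//= E [X in _ + X]big1 ?addr0; last first.
  by move=> z; rewrite eq_sym /restr => /negbTE ->; rewrite mulr0 !mul0r.
rewrite -/(tot V).
by rewrite mulrAC.
Qed.

(** Lipschitz constant of [Lambda], bound on the multiplier, and [C0] for the correction of one
    marginal. *)
Definition CB : R := bb * (bb * C0).

Lemma br_fB_approx V j x : cone V -> 0 < tot V ->
  `|Lambda (br V (fB (j, x))) - Lambda (\sum_s mup V j s * fb x s)| <=
  CB * (lin (@er n) V / tot V).
Proof.
move=> cV t0; rewrite br_fB.
have /andP[b1 b2] := dist_fb_bounds x (dist_mu j cV t0).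
have /andP[d1 d2] := dist_fb_bounds x (dist_mup j cV).
have b0 : 0 <= bb by apply: le_trans bb_ge1.
apply: le_trans (Lambda_lip bb_ge1 b1 b2 d1 d2) _.
rewrite /CB -mulrA; apply: ler_wpM2l => //; rewrite -mulrA -sumrB.
apply: le_trans (ler_norm_sum _ _ _) _.
apply: (@le_trans _ _ (bb * l1 (mu V j) (mup V j))).
  rewrite /l1 mulr_sumr; apply: ler_sum => c _.
  rewrite -mulrBl normrM mulrC ler_wpM2r// ger0_norm; last exact: (mult_ge0 mult_fb).
  exact: (mult_le mult_fb).
apply: ler_wpM2l => //; apply: le_trans (mup_close j cV t0) _.
apply: ler_wpM2l; first by rewrite /C0; have := D_gt0; lra.
by rewrite ler_pdivlMr// mulrC tot_gbar.
Qed.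

Lemma mM_piW V : cone V -> mM (piW V) pi =
  N^-1 * \sum_j \int[muS pi]_x Lambda (\sum_s mup V j s * fb x s).
Proof.
move=> cV.
have bL g : bmf (fun x => Lambda (\sum_s mass g s * fb x s)).
  apply: bmf_Lambda => [|x]; last exact: (mass_fb_ge0 (x, g)).
  by apply: bmf_sum => c; apply: bmfZ; exact: (mult_ev_bmf mult_fb c).
rewrite -[RHS]/(_ * _); under [in RHS]eq_bigr => j _.
  rewrite (_ : (fun x => _) = fun x => Lambda (\sum_s mass (mkj V j) s * fb x s)); last first.
    by apply/funext => x; congr Lambda; apply: eq_bigr => c _; rewrite mass_mkj.
  over.
rewrite -Ex_sum// -ExZ; last by apply: bmf_sum => j; exact: bL.
rewrite /mM; congr (Rintegral _ _ _); apply/funext => x.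
rewrite Ex_piW//; apply: bmf_Lambda => [|g]; last exact: (mass_fb_ge0 (x, g)).
by apply: bmf_sum => c; apply: bmfM; [exact: bmf_mass|exact: bmf_cst].
Qed.

Lemma opB_approx V : cone V ->
  opB pi Lh V <= Lh V + tot V * mM (piW V) pi + CB * lin (@er n) V.
Proof.
move=> cV; have b0 : 0 <= bb by apply: le_trans bb_ge1.
have CB0 : 0 <= CB by have D0 := D_gt0; rewrite /CB; apply: mulr_ge0 => //; apply: mulr_ge0 => //; rewrite /C0; lra.
rewrite /opB (op_Lh (@mult_fB n) b0 (@mean1_fB pi pi_mean n) cV) -addrA lerD2l.
have := tot_ge0 cV; rewrite le_eqVlt => /predU1P[<-|t0].
  by rewrite !mul0r add0r mulr_ge0// lin_er_ge0.
have -> : CB * lin (@er n) V = tot V * (CB * (lin (@er n) V / tot V)).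
  by field; rewrite gt_eqF.
rewrite -mulrDr ler_pM2l// mM_piW//.
have bL := bmf_Lambda_br (@mult_fB n) b0 cV.
rewrite Ex_muB// -[X in _ + X](@avgN1 R n) -mulrDr ler_wpM2l// -big_split/=.
apply: ler_sum => j _; rewrite -[X in _ + X](Ex_cst (muS pi)) -ExD; last 2 first.
- apply: bmf_Lambda => [|x].
    by apply: bmf_sum => c; apply: bmfZ; exact: (mult_ev_bmf mult_fb c).
  by have /andP[/(le_trans (ltW bbi_gt0))] := dist_fb_bounds x (dist_mup j cV).
- exact: (bmf_cst _ (CB * (lin (@er n) V / tot V))).
apply: Ex_le => [||x]; first exact: (bmf_pair1 bL j).
  apply: bmfD; last exact: (bmf_cst _ (CB * (lin (@er n) V / tot V))).
  apply: bmf_Lambda => [|x].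
    by apply: bmf_sum => c; apply: bmfZ; exact: (mult_ev_bmf mult_fb c).
  by have /andP[/(le_trans (ltW bbi_gt0))] := dist_fb_bounds x (dist_mup j cV).
have := br_fB_approx j x cV t0; rewrite ler_norml => /andP[_]; lra.
Qed.

Definition CP : R := bb * D ^+ 2.

Let abs_le3 (a b c d : R) : `|a - b - c| <= d -> c <= a - b + d.
Proof. rewrite ler_norml => /andP[h _]; lra. Qed.

Let lower_arith2 (t A a M Ki : R) :
  t * (Ki * (A + (M - 1) * a)) = Ki * (t * A) + (M * Ki - Ki) * (a * t).
Proof. by ring. Qed.

Let lower_arith (L A tM ta u l S Ki a b : R) :
  tM <= Ki * ta + (1 - Ki) * u -> Ki * ta <= Ki * (A - L + (a * l + S)) ->
  Ki * (a * l + S) <= a * l + S ->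
  L + tM + b * l <= Ki * A + (1 - Ki) * L + (1 - Ki) * u + (a + b) * l + S.
Proof. by move=> h1 h2 h3; lra. Qed.

(** This is [nabla_le] for the empirical law of the corrected marginals against [pi], divided by
    [K]: a half-edge gains at most what a factor present with probability [1 / K] gains, plus a
    constant edge term. *)
Lemma lower_step V eta : cone V -> 0 < eta ->
  opB pi Lh V <= mixE K^-1 (@opA n) idE Lh V + (1 - K^-1) * aA pi * tot V +
    (CA + CB) * lin (@er n) V + CP * \sum_(l < k.+1) perr eta l V.
Proof.
move=> cV e0; apply: le_trans (opB_approx cV) _.
have t0 := tot_ge0 cV.
have Ki0 : 0 < K^-1 by rewrite invr_gt0.
have Ki1 : K^-1 <= 1 by rewrite invf_le1// ler1n.
have KK : K * K^-1 = 1 by rewrite mulfV.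
have h1 := nabla_le (piW_mean cV) pi_mean.
have h2 := opA_approx cV e0.
have P0 : 0 <= \sum_(l < k.+1) perr eta l V by apply: sumr_ge0 => l _; exact: perr_ge0.
have C0' : 0 <= CA * lin (@er n) V.
  rewrite mulr_ge0 ?lin_er_ge0// /CA /C0; have D0 := ltW D_gt0.
  have b0 : 0 <= bb by apply: le_trans bb_ge1.
  by rewrite !(mulr_ge0, addr_ge0, exprn_ge0).
have CP0 : 0 <= CP * \sum_(l < k.+1) perr eta l V.
  apply: mulr_ge0 => //; apply: mulr_ge0; last exact: exprn_ge0 (ltW D_gt0).
  exact: le_trans ler01 bb_ge1.
have h3 : tot V * aA (piW V) <= opA Lh V - Lh V + (CA * lin (@er n) V + CP * \sum_(l < k.+1) perr eta l V).
  exact: abs_le3.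
have h4 := ler_wpM2l t0 (ler_wpM2l (ltW Ki0) h1).
have h5 := ler_wpM2l (ltW Ki0) h3.
have h6 : K^-1 * (CA * lin (@er n) V + CP * \sum_(l < k.+1) perr eta l V) <=
   CA * lin (@er n) V + CP * \sum_(l < k.+1) perr eta l V.
  by rewrite ler_piMl// addr_ge0.
have E1 : tot V * (K^-1 * (K * mM (piW V) pi)) = tot V * mM (piW V) pi by rewrite mulKf.
have E2 : tot V * (K^-1 * (aA (piW V) + (K - 1) * aA pi)) =
  K^-1 * (tot V * aA (piW V)) + (K * K^-1 - K^-1) * (aA pi * tot V) by exact: lower_arith2.
rewrite E1 E2 KK in h4; rewrite -[_ * aA pi * _]mulrA; exact: lower_arith h4 h5 h6.
Qed.

(** For a given weight [perr] need not be small; its average over a uniform number of pins is. The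
    pins commute with both operators, so the step may be compared inside their average, which turns
    all errors into linear ones. *)
Lemma lower_step_avg V (eta : R) T : cone V -> 0 < eta -> (0 < T)%N ->
  let F := avgE T (@pinop R q n) Lh in
  opB pi F V <= mixE K^-1 (@opA n) idE F V +
   lin (fun s => (1 - K^-1) * aA pi + (CA + CB) * er s +
     CP * (K * (eta * q.+1%:R / 2 + (2 * eta)^-1 * (K / T%:R)))) V.
Proof.
move=> cV e0 T0 /=; have b0 : 0 <= bb by apply: le_trans bb_ge1.
have gP := @good_pin R q n; have gav := good_avg T0 gP.
have gA := @good_opA n; have gB := good_opB pi_mean n.
have Q0 : 0 <= q.+1%:R :> R by [].
have cAP : commutes (avgE T (@pinop R q n)) (@opA n).
  by apply: commutesC; apply: commutes_avg => //; exact: (commutes_op _ _ (@mult_fA n) (@mult_pin R q n) b0 Q0).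
have cBP : commutes (avgE T (@pinop R q n)) (opB pi (n := n)).
  by apply: commutesC; apply: commutes_avg => //; exact: (commutes_op _ _ (@mult_fB n) (@mult_pin R q n) b0 Q0).
have K01 : 0 <= K^-1 <= 1 by rewrite invr_ge0 ler0n/= invf_le1// ler1n.
have gm := good_mix K01 gA (@good_id R _).
have cm : commutes (avgE T (@pinop R q n)) (mixE K^-1 (@opA n) idE).
  by apply: commutes_mix => //; exact: good_id.
have nL := @nice_Lh R (n.+1.-tuple color).
rewrite -(cBP _ _ nL cV) -(cm _ _ nL cV).
have nS : nice (fun V => CP * \sum_(l < k.+1) perr eta l V : R).
  by apply: niceZ; apply: nice_sum => l; exact: nice_perr.
have nE : nice (fun V : n.+1.-tuple color -> R => (1 - K^-1) * aA pi * tot V) by apply: niceZ; exact: nice_tot.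
have nR : nice (fun V => (CA + CB) * lin (@er n) V) by apply: niceZ; exact: nice_lin.
have nm : nice (mixE K^-1 (@opA n) idE Lh) by exact: good_nice.
have H V' : cone V' -> opB pi Lh V' <= mixE K^-1 (@opA n) idE Lh V' + (1 - K^-1) * aA pi * tot V' +
    (CA + CB) * lin (@er n) V' + CP * \sum_(l < k.+1) perr eta l V'.
  by move=> cV'; exact: lower_step.
have := good_mono gav (good_nice gB nL) (niceD (niceD (niceD nm nE) nR) nS) H cV.
rewrite (good_D gav _ nS cV); last by apply: niceD nR; exact: niceD.
rewrite (good_D gav _ nR cV); last exact: niceD.
rewrite (good_D gav nm nE cV) (good_Z gav _ (nice_tot) cV) (good_Z gav _ (nice_lin _) cV).
rewrite (good_tot gav cV) (good_lin gav _ cV) (good_Z gav) //; last by apply: nice_sum => l; exact: nice_perr.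
rewrite (good_sum gav)//; last by move=> l; exact: nice_perr.
move=> /le_trans; apply; rewrite -!addrA lerD2l.
rewrite !linD lin_cst lin_cst linZ -addrA !lerD2l -[leRHS]mulrA; apply: ler_wpM2l.
  by rewrite /CP; apply: mulr_ge0 => //; exact: exprn_ge0 (ltW D_gt0).
apply: (@le_trans _ _ (\sum_(l < k.+1) (eta * q.+1%:R / 2 + (2 * eta)^-1 * (K / T%:R)) * tot V)).
  apply: ler_sum => l _; apply: le_trans (avg_perr l e0 T0 cV) _.
  apply: ler_wpM2r; first exact: tot_ge0.
  rewrite lerD2l ler_wpM2l ?invr_ge0 ?mulr_ge0 ?(ltW e0)// ler_wpM2r ?invr_ge0//.
  by rewrite ler_nat ltnW.
by rewrite sumr_const card_ord -[leLHS]mulr_natl; apply: eq_refl_le; ring.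
Qed.

End lower.
End config.

Lemma bb_ge0 : 0 <= bb.
Proof. exact: le_trans ler01 bb_ge1. Qed.

Lemma iter_ext (S : finType) (E E' : ((S -> R) -> R) -> (S -> R) -> R) m F W : good E -> good E' ->
  (forall F W, nice F -> cone W -> E F W = E' F W) -> nice F -> cone W ->
  iter m E F W = iter m E' F W.
Proof.
move=> gE gE' EE nF; elim: m W => [//|m IH] W cW; rewrite !iterS.
have nI : nice (iter m E F) by apply: good_nice => //; exact: good_iter.
have nI' : nice (iter m E' F) by apply: good_nice => //; exact: good_iter.
by rewrite EE//; apply: (good_ext gE').
Qed.

Lemma iter_op_cone (S : finType) d (X : measurableType d) (mu : probability X R) B f m
    (F G : (S -> R) -> R) W : mult B f ->
  (forall V, cone V -> F V = G V) -> cone W -> iter m (op mu f) F W = iter m (op mu f) G W.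
Proof.
move=> mf FG; elim: m W => [|m IH] W cW; first exact: FG.
rewrite !iterS /op; congr (Rintegral _ _ _); apply/funext => x.
by rewrite -/(op mu f) IH//; exact: (mult_cone mf).
Qed.

(** [Lambda y <= y * ln B] for [y <= B], and the Gibbs average [y] of the multiplier has mean
    one. *)
Lemma op_le_Lh (S : finType) d (X : measurableType d) (mu : probability X R) B (f : X -> S -> R) V :
  mult B f -> (forall s, \int[mu]_x f x s = 1) -> 0 <= B -> cone V ->
  op mu f Lh V <= Lh V + ln B * tot V.
Proof.
move=> mf m1 B0 cV; have t0 := tot_ge0 cV.
rewrite (op_Lh mf B0 m1 cV) lerD2l mulrC.
move: t0; rewrite le_eqVlt => /predU1P[<-|t0]; first by rewrite !mulr0.
apply: ler_wpM2r; first exact: ltW.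
have bb1 := bmf_br mf cV.
have e1 := Ex_br mf m1 cV t0.
rewrite -[leRHS]mulr1 -[X in _ <= _ * X]e1 -ExZ//.
apply: Ex_le => [||x]; [exact: (bmf_Lambda_br mf B0 cV)|exact: bmfZ|].
have y0 : 0 <= br V (f x) by apply: br_ge0 => // s; exact: (mult_ge0 mf).
have yQ : br V (f x) <= B by exact: (br_leB mf B0 _ cV).
rewrite /Lambda mulrC; move: y0; rewrite le_eqVlt => /predU1P[<-|y0]; first by rewrite !mulr0.
by apply: ler_wpM2r; [exact: ltW|rewrite ler_ln ?posrE// (lt_le_trans y0)].
Qed.

Section pin_bounds.
Variable n : nat.
Local Notation cfg := (n.+1.-tuple color).
Local Notation Q := (q.+1%:R : R).

Lemma lnQ_ge0 : 0 <= ln Q.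
Proof. by rewrite ln_ge0// ler1n. Qed.

Lemma Lh_le_pin (V : cfg -> R) : cone V -> Lh V <= @pinop R q n Lh V.
Proof.
move=> cV; exact: (Lh_le_op (@mult_pin R q n) (ler0n _ _) (@pin_mean1 R q n) cV).
Qed.

Lemma pin_le_Lh (V : cfg -> R) : cone V -> @pinop R q n Lh V <= Lh V + ln Q * tot V.
Proof. exact: (op_le_Lh (@mult_pin R q n) (@pin_mean1 R q n) (ler0n _ _)). Qed.

Lemma iter_pin_bounds t (V : cfg -> R) : cone V ->
  Lh V <= iter t (@pinop R q n) Lh V <= Lh V + t%:R * ln Q * tot V.
Proof.
have nL := @nice_Lh R cfg; have gP := @good_pin R q n.
elim: t V => [|t IH] V cV; first by rewrite /= mul0r mul0r addr0 lexx.
have nI : nice (iter t (@pinop R q n) Lh) by apply: good_nice => //; exact: good_iter.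
have nT : nice (fun V : cfg -> R => t%:R * ln Q * tot V) by apply: niceZ; exact: nice_tot.
apply/andP; split; rewrite iterS.
  apply: le_trans (Lh_le_pin cV) _.
  by apply: (good_mono gP) => // V' /IH /andP[].
have := good_mono gP nI (niceD nL nT) (fun V' cV' => proj2 (andP (IH V' cV'))) cV.
rewrite (good_D gP nL nT cV) (good_Z gP _ (@nice_tot R cfg) cV) (good_tot gP cV) => /le_trans; apply.
have := pin_le_Lh cV; rewrite -natr1; lra.
Qed.

Lemma avg_pin_bounds T (V : cfg -> R) : (0 < T)%N -> cone V ->
  Lh V <= avgE T (@pinop R q n) Lh V <= Lh V + T%:R * ln Q * tot V.
Proof.
move=> T0 cV; have Tn : T%:R != 0 :> R by rewrite pnatr_eq0 -lt0n.
have Ti : 0 <= T%:R^-1 :> R by rewrite invr_ge0.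
have cT (c : R) : c = T%:R^-1 * \sum_(t < T) c.
  by rewrite sumr_const card_ord -[c *+ T]mulr_natl mulKf.
rewrite /avgE [X in X <= _](cT (Lh V)) [X in _ <= _ <= X](cT (Lh V + T%:R * ln Q * tot V)).
apply/andP; split; apply: ler_wpM2l => //; apply: ler_sum => t _; have /andP[h1 h2] := iter_pin_bounds t cV => //.
apply: le_trans h2 _; rewrite lerD2l; apply: ler_wpM2r; first exact: tot_ge0.
by apply: ler_wpM2r; [exact: lnQ_ge0|rewrite ler_nat ltnW].
Qed.

End pin_bounds.

(** * Half-edges only: independent variables *)

Section tensor.
Variable n : nat.
Local Notation cfg := (n.+1.-tuple color).
Local Notation cfg' := (n.+2.-tuple color).
Implicit Types (u : color -> R) (V : cfg -> R).

Definition tl (s : cfg') : cfg := [tuple tnth s (lift ord0 j) | j < n.+1].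
Definition tens u V : cfg' -> R := fun s => u (tnth s ord0) * V (tl s).

Lemma tl_cons c (s : cfg) : tl [tuple of c :: s] = s.
Proof. by apply: eq_from_tnth => j; rewrite tnth_mktuple tnthS. Qed.

Lemma sum_tens (F : color -> cfg -> R) :
  \sum_(s : cfg') F (tnth s ord0) (tl s) = \sum_c \sum_s F c s.
Proof.
by rewrite big_tupleS; apply: eq_bigr => c _; apply: eq_bigr => s _; rewrite tl_cons tnth0.
Qed.

Lemma tot_tens u V : tot (tens u V) = tot u * tot V.
Proof.
rewrite /tot (sum_tens (fun c s => u c * V s)) mulr_suml.
by apply: eq_bigr => c _; rewrite mulr_sumr.
Qed.

Lemma cone_tens u V : cone u -> cone V -> cone (tens u V).
Proof. by move=> cu cV s; exact: mulr_ge0. Qed.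

Lemma Lh_tens u V : cone u -> cone V -> Lh (tens u V) = tot u * Lh V + tot V * Lh u.
Proof. by move=> cu cV; rewrite /Lh tot_tens LambdaM ?tot_ge0// [tot V * _]mulrC. Qed.

Lemma W0_tens : @W0 n.+1 = tens (mass gam) (@W0 n).
Proof.
apply/funext => s; rewrite /W0 big_ord_recl; congr (_ * _).
by apply: eq_bigr => j _; rewrite tnth_mktuple.
Qed.

Variable pi : probability simplex R.
Hypothesis pi_mean : has_mean pi gam.

Definition f1 (x : W * 'I_k.+1 * k.+1.-tuple simplex) (s : cfg') : R := fb x (tnth s ord0).
Definition f2 (x : 'I_n.+1 * (W * 'I_k.+1 * k.+1.-tuple simplex)) (s : cfg') : R := fB x (tl s).

Lemma mult_f1 : mult bb f1.
Proof.
by split=> [s|x s|x s]; [exact: (mult_measurable mult_fb)|exact: (mult_ge0 mult_fb)|exact: (mult_le mult_fb)].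
Qed.

Lemma mult_f2 : mult bb f2.
Proof.
by split=> [s|x s|x s]; [exact: (mult_measurable (@mult_fB n))|exact: (mult_ge0 (@mult_fB n))|exact: (mult_le (@mult_fB n))].
Qed.

Lemma good_op1 : good (op (muS pi) f1).
Proof. by apply: (good_op mult_f1 _ bb_ge0) => s; exact: mean1_fb. Qed.

Lemma good_op2 : good (op (muB pi n) f2).
Proof. by apply: (good_op mult_f2 _ bb_ge0) => s; exact: mean1_fB. Qed.

Lemma opB_mix F (V : cfg' -> R) : nice F -> cone V ->
  opB pi F V = mixE n.+2%:R^-1 (op (muS pi) f1) (op (muB pi n) f2) F V.
Proof.
move=> nF cV; rewrite /opB /op (Ex_muB pi (mult_bmf (@mult_fB n.+1) nF cV)).
rewrite big_ord_recl mulrDr; congr (_ + _).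
rewrite (Ex_muB pi (mult_bmf mult_f2 nF cV)) mulrA; congr (_ * _).
  have h : n.+2%:R = n.+1%:R + 1 :> R by rewrite natr1.
  have nz : n.+1%:R + 1 != 0 :> R by rewrite -h pnatr_eq0.
  have nz1 : n.+1%:R != 0 :> R by rewrite pnatr_eq0.
  by rewrite h; move: (n.+1%:R) nz nz1 => a nz nz1; field; rewrite nz nz1.
apply: eq_bigr => j _; congr (Rintegral _ _ _); apply/funext => x.
by congr (F _); apply/funext => s; rewrite /f2 /fB/= tnth_mktuple.
Qed.

Lemma iter_op2_tens j u V : cone u -> cone V ->
  iter j (op (muB pi n) f2) Lh (tens u V) = tot u * iter j (@opB pi n) Lh V + tot V * Lh u.
Proof.
move=> cu cV; rewrite (@iter_op_map R _ _ _ _ (muB pi n) (@fB n) f2 (tens u)); last first.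
  by move=> U x; apply/funext => s; rewrite /tens mulrA.
have nL := @nice_Lh R cfg; have gB := good_iter j (@good_opB pi pi_mean n).
rewrite (iter_op_cone (G := fun U => tot u * Lh U + Lh u * tot U) _ _ (@mult_fB n))//; last first.
  by move=> U cU; rewrite /= Lh_tens// [Lh u * _]mulrC.
rewrite -/(@opB pi n) (good_D gB)//; [|exact: niceZ|by apply: niceZ; exact: nice_tot].
by rewrite !(good_Z gB)//; [rewrite (good_tot gB)// [Lh u * _]mulrC|exact: nice_tot].
Qed.

Lemma iter_op12_tens i j u V : cone u -> cone V ->
  iter i (op (muS pi) f1) (iter j (op (muB pi n) f2) Lh) (tens u V) =
  tot u * iter j (@opB pi n) Lh V + tot V * iter i (opb pi) Lh u.
Proof.
move=> cu cV; rewrite (@iter_op_map R _ _ _ _ (muS pi) fb f1 (fun u => tens u V)); last first.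
  by move=> U x; apply/funext => s; rewrite /tens mulrAC.
have nL := @nice_Lh R color; have gb := good_iter i (good_opb pi_mean).
set c := iter j _ Lh V.
rewrite (iter_op_cone (G := fun U => c * tot U + tot V * Lh U) _ _ mult_fb)//; last first.
  by move=> U cU; rewrite /= iter_op2_tens// [c * _]mulrC.
rewrite -/(opb pi) (good_D gb)//; [|by apply: niceZ; exact: nice_tot|exact: niceZ].
by rewrite !(good_Z gb)//; [rewrite (good_tot gb)// [c * _]mulrC|exact: nice_tot].
Qed.

End tensor.

(** The variable term of the Bethe functional with the powers of [xi_] absorbed into the
    multipliers. *)
Definition bF (pi : probability simplex R) (d : R) : R :=
  PoE d (fun m => iter m (opb pi) Lh (mass gam)).

Lemma cone_mass : cone (mass gam). Proof. by move=> z; exact: mass_ge0. Qed.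

Lemma tot_mass : tot (mass gam) = 1. Proof. by case: (dist_mass gam). Qed.

Lemma opB0_iter pi m : has_mean pi gam ->
  iter m (@opB pi 0) Lh (@W0 0) = iter m (opb pi) Lh (mass gam).
Proof.
move=> pm; have b0 := bb_ge0.
pose f x (s : 1.-tuple color) := fb x (tnth s ord0).
have mf : mult bb f.
  by split=> [s|x s|x s]; [exact: (mult_measurable mult_fb)|exact: (mult_ge0 mult_fb)|exact: (mult_le mult_fb)].
have gf : good (op (muS pi) f) by apply: (good_op mf) => // s; exact: mean1_fb.
rewrite (iter_ext (E' := op (muS pi) f) _ (@good_opB pi pm 0) gf); last 3 first.
- move=> F W nF cW; rewrite /opB /op (Ex_muB pi (mult_bmf (@mult_fB 0) nF cW)).
  by rewrite big_ord1 invr1 mul1r.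
- exact: nice_Lh.
- exact: cone_W0.
pose Phi (u : color -> R) (s : 1.-tuple color) := u (tnth s ord0).
have -> : @W0 0 = Phi (mass gam) by apply/funext => s; rewrite /W0 big_ord1.
rewrite (@iter_op_map R _ _ _ _ (muS pi) fb f Phi)//.
congr (iter _ _ _ _); apply/funext => u; rewrite /Lh/= /Phi; congr Lambda.
rewrite /tot big_tupleS; apply: eq_bigr => c _.
by rewrite big_tuple0 tnth0.
Qed.

(** Half-edges do not connect variables. Splitting the Poisson number gives one variable its own
    [Po(d)] half-edges, and [Lh] of a tensor product is additive when masses are one in the mean;
    induction peels off the variables. *)
Lemma PoE_opB pi d n : has_mean pi gam -> 0 <= d ->
  PoE (d * n.+1%:R) (fun m => iter m (@opB pi n) Lh (@W0 n)) = n.+1%:R * bF pi d.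
Proof.
move=> pm d0; elim: n => [|n IH].
  by rewrite mulr1 mul1r; congr PoE; apply/funext => m; exact: opB0_iter.
have cW := @cone_W0 n; have nL := @nice_Lh R (n.+2.-tuple color).
have g1 := @good_op1 n pi pm; have g2 := @good_op2 n pi pm.
have r01 : 0 <= (n.+2%:R : R)^-1 <= 1 by rewrite invr_ge0 ler0n/= invf_le1// ler1n.
have dn : 0 <= d * n.+2%:R by rewrite mulr_ge0.
have gb := good_opb pm; have gB := @good_opB pi pm n.
have ge1 : geo (fun m => iter m (@opB pi n) Lh (@W0 n)) by apply: geo_iter => //; exact: nice_Lh.
have ge2 : geo (fun m => iter m (opb pi) Lh (mass gam)).
  by apply: geo_iter => //; [exact: nice_Lh|exact: cone_mass].
transitivity (PoE (d * n.+2%:R) (fun m => iter m (mixE n.+2%:R^-1 (op (muS pi) (@f1 n)) (op (muB pi n) (@f2 n))) Lh (@W0 n.+1))).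
  congr PoE; apply/funext => m; apply: (iter_ext m (@good_opB pi pm n.+1) (good_mix r01 g1 g2) _ nL (@cone_W0 n.+1)).
  by move=> F V nF cV; exact: opB_mix.
rewrite (PoE_mix dn r01 g1 g2 _ nL (@cone_W0 n.+1)); last first.
  by apply: (commutes_op _ _ (@mult_f1 n) (@mult_f2 n)); exact: le_trans ler01 bb_ge1.
rewrite W0_tens.
have -> : (fun i => PoE ((1 - n.+2%:R^-1) * (d * n.+2%:R)) (fun j =>
    iter i (op (muS pi) (@f1 n)) (iter j (op (muB pi n) (@f2 n)) Lh) (tens (mass gam) (@W0 n)))) =
  fun i => n.+1%:R * bF pi d + iter i (opb pi) Lh (mass gam).
  apply/funext => i.
  have -> : (1 - n.+2%:R^-1) * (d * n.+2%:R) = d * n.+1%:R.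
    have h : n.+2%:R = n.+1%:R + 1 :> R by rewrite natr1.
    have nz : n.+1%:R + 1 != 0 :> R by rewrite -h pnatr_eq0.
    by rewrite h; move: (n.+1%:R) nz => a nz; field.
  under eq_fun do rewrite (iter_op12_tens pm _ _ cone_mass cW) tot_mass tot_W0 !mul1r.
  have dn1 : 0 <= d * n.+1%:R by rewrite mulr_ge0.
  by rewrite (PoED dn1 ge1 (geo_cst _)) PoE_cst IH.
have -> : n.+2%:R^-1 * (d * n.+2%:R) = d by rewrite mulrCA mulVf ?mulr1// pnatr_eq0.
by rewrite (PoED d0 (geo_cst _) ge2) PoE_cst -/(bF pi d) -[n.+2%:R]natr1; ring.
Qed.

Lemma PoE_affine l g (c : R) : 0 <= l -> geo g ->
  PoE l (fun m => g m + c * m%:R) = PoE l g + c * l.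
Proof.
move=> l0 gg; rewrite (PoED l0 gg (geoZ c (@geo_id R))).
by rewrite (PoEZ l0 _ (@geo_id R)) (PoE_id l0).
Qed.

(** The planted free entropy times the number of variables, with [nrm s] frozen into the
    multipliers; the remaining contribution of [ln xi_] is restored in [expected_phi_bounds]. *)
Definition Tn n d : R := PoE (d * n.+1%:R / K) (fun m => iter m (@opA n) Lh (@W0 n)).

Lemma CA_ge0 : 0 <= CA.
Proof.
have b0 := bb_ge0.
have D0 := ltW D_gt0; rewrite /CA; apply: mulr_ge0 => //; apply: addr_ge0.
  by apply: mulr_ge0 => //; exact: exprn_ge0.
apply: mulr_ge0; first by apply: mulr_ge0 => //; exact: exprn_ge0.
by rewrite /C0; lra.
Qed.

Lemma CB_ge0 : 0 <= CB.
Proof.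
have b0 := bb_ge0.
have D0 := ltW D_gt0; rewrite /CB; apply: mulr_ge0 => //; apply: mulr_ge0 => //.
by rewrite /C0; lra.
Qed.

(** All [Po(d N)] half-edges are exchanged by [tele] for factors present with probability [1 / K];
    thinning leaves [Po(d N / K)] factors, the number in the model. The last term pays for removing
    the pins. *)
Lemma lower_bound n pi d (eta : R) T : has_mean pi gam -> 0 <= d -> 0 < eta -> (0 < T)%N ->
  n.+1%:R * bF pi d - d * n.+1%:R * ((1 - K^-1) * aA pi + (CA + CB) * (q.+1%:R / Num.sqrt n.+1%:R) +
    CP * (K * (eta * q.+1%:R / 2 + (2 * eta)^-1 * (K / T%:R)))) - T%:R * ln q.+1%:R <= Tn n d.
Proof.
move=> pm d0 e0 T0.
have cW := @cone_W0 n; have nL := @nice_Lh R (n.+1.-tuple color).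
have b0 := bb_ge0.
have gP := @good_pin R q n; have gav := good_avg T0 gP.
have gA := @good_opA n; have gB := @good_opB pi pm n.
have dn : 0 <= d * n.+1%:R by rewrite mulr_ge0.
have K01 : 0 <= K^-1 <= 1 by rewrite invr_ge0 ler0n/= invf_le1// ler1n.
pose F := avgE T (@pinop R q n) Lh.
have nF : nice F by exact: good_nice.
have gm := good_mix K01 gA (@good_id R _).
have cBA : commutes (@opB pi n) (mixE K^-1 (@opA n) idE).
  apply: commutes_mix => //; first exact: good_id.
  exact: (commutes_op _ _ (@mult_fB n) (@mult_fA n) b0 b0).
pose e (s : n.+1.-tuple color) := (1 - K^-1) * aA pi + (CA + CB) * er s +
  CP * (K * (eta * q.+1%:R / 2 + (2 * eta)^-1 * (K / T%:R))).
have H1 V : cone V -> opB pi F V <= mixE K^-1 (@opA n) idE F V + lin e V.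
  by move=> cV; exact: (lower_step_avg pm cV e0 T0).
have H2 m := tele gB gm cBA nF H1 m cW.
have gi E F' : good E -> nice F' -> geo (fun m => iter m E F' (@W0 n)) by move=> ? ?; exact: geo_iter.
have H3 : PoE (d * n.+1%:R) (fun m => iter m (@opB pi n) Lh (@W0 n)) <=
   PoE (d * n.+1%:R) (fun m => iter m (mixE K^-1 (@opA n) idE) F (@W0 n) + lin e (@W0 n) * m%:R).
  apply: PoE_le => //; [exact: gi| |].
    by apply: geoD; [exact: gi|apply: geoZ; exact: geo_id].
  move=> m; rewrite [X in _ + X]mulrC; apply: le_trans (H2 m).
  by apply: (good_mono (good_iter m gB)) => // V cV; case/andP: (avg_pin_bounds T0 cV).
have {}H3 : n.+1%:R * bF pi d <=
    PoE (K^-1 * (d * n.+1%:R)) (fun i => iter i (@opA n) F (@W0 n)) + lin e (@W0 n) * (d * n.+1%:R).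
  rewrite -(PoE_opB n pm d0) -(PoE_thin dn K01 gA nF cW).
  rewrite -(PoE_affine (lin e (@W0 n)) dn (gi _ _ gm nF)).
  exact: H3.
have H4 : PoE (K^-1 * (d * n.+1%:R)) (fun i => iter i (@opA n) F (@W0 n)) <= Tn n d + T%:R * ln q.+1%:R.
  have dk : 0 <= d * n.+1%:R / K by rewrite mulr_ge0// invr_ge0.
  rewrite mulrC -[T%:R * ln q.+1%:R](PoE_cst (d * n.+1%:R / K)) /Tn -(PoED dk); [|exact: gi|exact: geo_cst].
  apply: (PoE_le dk (gi _ _ gA nF)).
    by apply: geoD; [exact: (gi _ _ gA nL)|exact: geo_cst].
  move=> m.
  have gAm := good_iter m gA.
  have nT : nice (fun V : n.+1.-tuple color -> R => T%:R * ln q.+1%:R * tot V) by apply: niceZ; exact: nice_tot.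
  have := good_mono gAm nF (niceD nL nT) (fun V cV => proj2 (andP (avg_pin_bounds T0 cV))) cW.
  by rewrite (good_D gAm nL nT cW) (good_Z gAm _ (@nice_tot R _) cW) (good_tot gAm cW) tot_W0 mulr1.
have H5 : lin e (@W0 n) <= (1 - K^-1) * aA pi + (CA + CB) * (q.+1%:R / Num.sqrt n.+1%:R) +
    CP * (K * (eta * q.+1%:R / 2 + (2 * eta)^-1 * (K / T%:R))).
  rewrite /e !linD !lin_cst linZ tot_W0 !mulr1 lerD2r lerD2l; apply: ler_wpM2l.
    by apply: addr_ge0; [exact: CA_ge0|exact: CB_ge0].
  exact: lin_er_W0.
have := ler_wpM2l dn H5; move: H3 H4; rewrite [d * _ * lin _ _]mulrC.
move: (lin e _) (PoE (K^-1 * _) _) (d * _ * _) (Tn _ _) => x1 x2 x3 x4; lra.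
Qed.

(** * Upper bound: tuples with and without a new variable *)

Section avg_split.
Variable n : nat.
Local Notation N := (n.+1%:R : R).
Local Notation N' := (n.+2%:R : R).
Local Notation de := (N'^-1).

(** The new variable is [ord0] and the old ones are shifted: [lft] avoids the new variable, [put h]
    has it at the slot [h] and nowhere else. *)
Definition lft L (v : L.-tuple 'I_n.+1) : L.-tuple 'I_n.+2 :=
  [tuple lift ord0 (tnth v h) | h < L].
Definition put L (h : 'I_L) (v : L.-tuple 'I_n.+1) : L.-tuple 'I_n.+2 :=
  [tuple if h' == h then ord0 else lift ord0 (tnth v h') | h' < L].

Definition avn L (G : L.-tuple 'I_n.+2 -> R) := (N' ^+ L)^-1 * \sum_v G v.
Definition avo L (G : L.-tuple 'I_n.+2 -> R) := (N ^+ L)^-1 * \sum_v G (lft v).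
Definition avp L (G : L.-tuple 'I_n.+2 -> R) :=
  \sum_h (N ^+ L)^-1 * \sum_v G (put h v).

Lemma avg_bound (T : finType) (M b : R) (F : T -> R) : 0 < M -> #|T|%:R = M ->
  (forall v, `|F v| <= b) -> `|M^-1 * \sum_v F v| <= b.
Proof.
move=> M0 cT Fb; rewrite normrM gtr0_norm ?invr_gt0// ler_pdivrMl//.
apply: le_trans (ler_norm_sum _ _ _) _.
apply: (@le_trans _ _ (\sum_(v : T) b)); first by apply: ler_sum => v _.
by rewrite sumr_const -[b *+ _]mulr_natl cT.
Qed.

Lemma card_NL L : #|{: L.-tuple 'I_n.+1}|%:R = N ^+ L.
Proof. by rewrite card_tuple card_ord natrX. Qed.

Lemma lft_cons L j (v : L.-tuple 'I_n.+1) : lft [tuple of j :: v] = [tuple of lift ord0 j :: lft v].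
Proof.
apply: eq_from_tnth => h; rewrite tnth_mktuple.
by have [h' ->|->] := unliftP ord0 h; rewrite ?tnthS ?tnth0 ?tnth_mktuple.
Qed.

Lemma put0_cons L j (v : L.-tuple 'I_n.+1) : put ord0 [tuple of j :: v] = [tuple of ord0 :: lft v].
Proof.
apply: eq_from_tnth => h; rewrite tnth_mktuple.
by have [h' ->|->] := unliftP ord0 h; rewrite ?tnthS ?tnth0 ?tnth_mktuple.
Qed.

Lemma putS_cons L h j (v : L.-tuple 'I_n.+1) :
  put (lift ord0 h) [tuple of j :: v] = [tuple of lift ord0 j :: put h v].
Proof.
apply: eq_from_tnth => h1; rewrite tnth_mktuple.
by have [h' ->|->] := unliftP ord0 h1; rewrite ?tnthS ?tnth0 ?tnth_mktuple.
Qed.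

Lemma avg_split_step (a a0 o0 c0 O Cc S M L d b r : R) : 0 <= d -> d * M = 1 - d -> 0 <= M -> 0 <= L ->
  `|a0 - (1 - L * d) * o0 - d * c0| <= r -> `|S - (1 - L * d) * O - d * Cc| <= r ->
  `|o0| <= b -> `|O| <= b -> `|c0| <= L * b -> `|Cc| <= L * b ->
  a = d * a0 + d * (M * S) ->
  `|a - (1 - (L + 1) * d) * O - d * (o0 + Cc)| <= r + 4 * L * d ^+ 2 * b.
Proof.
move=> d0 dM M0 L0 h1 h2 h3 h4 h5 h6 ->.
have -> : d * a0 + d * (M * S) - (1 - (L + 1) * d) * O - d * (o0 + Cc) =
  (d * (a0 - (1 - L * d) * o0 - d * c0) + d * M * (S - (1 - L * d) * O - d * Cc)) +
  d ^+ 2 * (L * (O - o0) + (c0 - Cc)).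
  by rewrite mulrA dM; ring.
have s0 : 0 <= 1 - d by rewrite -dM mulr_ge0.
apply: le_trans (ler_normD _ _) _; apply: lerD.
  apply: le_trans (ler_normD _ _) _; rewrite dM !normrM (ger0_norm d0) (ger0_norm s0).
  have := ler_wpM2l d0 h1; have := ler_wpM2l s0 h2; lra.
have -> : 4 * L * d ^+ 2 * b = d ^+ 2 * (4 * L * b) by ring.
rewrite normrM ger0_norm ?exprn_ge0//; apply: ler_wpM2l; first exact: exprn_ge0.
apply: le_trans (ler_normD _ _) _; rewrite normrM (ger0_norm L0).
have := ler_wpM2l L0 (le_trans (ler_normB O o0) (lerD h4 h3)).
have := le_trans (ler_normB c0 Cc) (lerD h5 h6); lra.
Qed.

Lemma avo_bound L (G : L.-tuple 'I_n.+2 -> R) b : (forall v, `|G v| <= b) -> `|avo G| <= b.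
Proof.
move=> Gb; apply: avg_bound; [by rewrite exprn_gt0|exact: card_NL|by move=> v].
Qed.

Lemma avp_bound L (G : L.-tuple 'I_n.+2 -> R) b : (forall v, `|G v| <= b) -> `|avp G| <= L%:R * b.
Proof.
move=> Gb; apply: le_trans (ler_norm_sum _ _ _) _.
have -> : L%:R * b = \sum_(h < L) b by rewrite sumr_const card_ord -[RHS]mulr_natl.
apply: ler_sum => h _; apply: avg_bound; [by rewrite exprn_gt0|exact: card_NL|by move=> v].
Qed.

(** First-order expansion in [de], the probability that a given slot holds the new variable. The
    remainder is of second order: the new variable occurring twice, and the linearisation of the
    weight of [avo]. *)
Lemma avg_split L (G : L.-tuple 'I_n.+2 -> R) b : (forall v, `|G v| <= b) ->
  `|avn G - (1 - L%:R * de) * avo G - de * avp G| <= 2 * L%:R ^+ 2 * de ^+ 2 * b.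
Proof.
elim: L G => [|L IH] G Gb.
  rewrite /avn /avo /avp !big_tuple0 big_ord0 expr0 invr1 !mul1r mul0r subr0 !mul1r mulr0 subr0.
  by rewrite (tuple0 (lft _)) subrr normr0 expr0n/= mulr0 !mul0r.
pose Gc (x : 'I_n.+2) (v : L.-tuple 'I_n.+2) := G [tuple of x :: v].
have Gcb x v : `|Gc x v| <= b by exact: Gb.
pose a0 := avn (Gc ord0).
pose aj j := avn (Gc (lift ord0 j)).
pose o0 := avo (Gc ord0).
pose c0 := avp (Gc ord0).
have b0 : 0 <= b by apply: le_trans (Gcb ord0 [tuple of nseq L ord0]).
have hN : N' = N + 1 by rewrite natr1.
have nz : N + 1 != 0 by rewrite -hN pnatr_eq0.
have nz1 : N != 0 by rewrite pnatr_eq0.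
have EO : avo G = N^-1 * \sum_j avo (Gc (lift ord0 j)).
  rewrite [LHS]/avo big_tupleS exprS invfM -mulrA; congr (_ * _); rewrite mulr_sumr.
  by apply: eq_bigr => j _; congr (_ * _); apply: eq_bigr => v _; rewrite lft_cons.
have EC : avp G = o0 + N^-1 * \sum_j avp (Gc (lift ord0 j)).
  rewrite /avp big_ord_recl; congr (_ + _).
    rewrite big_tupleS /o0 /avo -[RHS](@avgN1 R n) exprS invfM -mulrA; congr (_ * _); rewrite mulr_sumr.
    by apply: eq_bigr => j _; congr (_ * _); apply: eq_bigr => v _; rewrite put0_cons.
  rewrite exchange_big/= mulr_sumr; apply: eq_bigr => h _.
  rewrite big_tupleS exprS invfM -mulrA; congr (_ * _); rewrite mulr_sumr.
  by apply: eq_bigr => j _; congr (_ * _); apply: eq_bigr => v _; rewrite putS_cons.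
have r1 (x : R) : N^-1 * \sum_(j < n.+1) x = x by exact: avgN1.
rewrite EC -[L.+1%:R]natr1.
apply: (@le_trans _ _ (2 * L%:R ^+ 2 * de ^+ 2 * b + 4 * L%:R * de ^+ 2 * b)); last first.
  have y0 : 0 <= de ^+ 2 * b by rewrite mulr_ge0 ?exprn_ge0 ?invr_ge0.
  have -> : 2 * (L%:R + 1) ^+ 2 * de ^+ 2 * b = 2 * L%:R ^+ 2 * de ^+ 2 * b + 4 * L%:R * de ^+ 2 * b +
    2 * (de ^+ 2 * b) by ring.
  by rewrite lerDl mulr_ge0.
apply: (@avg_split_step (avn G) a0 o0 c0 (avo G)
  (N^-1 * \sum_j avp (Gc (lift ord0 j))) (N^-1 * \sum_j aj j) N L%:R de b) => //.
- by rewrite hN; move: N nz nz1 => x nz nz1; field.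
- exact: IH.
- rewrite EO.
  have -> : N^-1 * (\sum_j aj j) - (1 - L%:R / N') * (N^-1 * \sum_j avo (Gc (lift ord0 j))) -
     N'^-1 * (N^-1 * \sum_j avp (Gc (lift ord0 j))) =
     N^-1 * \sum_j (aj j - (1 - L%:R / N') * avo (Gc (lift ord0 j)) -
       N'^-1 * avp (Gc (lift ord0 j))).
    by rewrite !sumrB -!mulr_sumr; ring.
  apply: avg_bound => //; first by rewrite card_ord.
  by move=> j; apply: IH.
- exact: avo_bound.
- exact: avo_bound.
- exact: avp_bound.
- by apply: avg_bound => //; [rewrite card_ord|move=> j; exact: avp_bound].
- rewrite /avn big_tupleS big_ord_recl mulrDr exprS invfM -!mulrA; congr (_ + _).
  by rewrite mulVKf// mulr_sumr.
Qed.

End avg_split.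

Definition setc L (h : 'I_L) (z : color) (t : L.-tuple color) : L.-tuple color :=
  [tuple if h' == h then z else tnth t h' | h' < L].

(** Once the entry at [h] is overwritten, the law at that slot only enters through its total mass,
    so it may be traded for a Dirac mass. *)
Lemma ml_setc L (c : L.-tuple color -> R) (G : 'I_L -> color -> R) h z :
  \sum_y G h y = 1 ->
  ml (fun t => c (setc h z t)) G = ml c (upd G h (delta z)).
Proof.
move=> G1.
have E y : ml (fun t => c (setc h z t)) (upd G h (delta y)) = ml c (upd G h (delta z)).
  pose Phi (t : L.-tuple color) := c t * \prod_(h' < L | h' != h) G h' (tnth t h').
  have mE c' x : ml c' (upd G h (delta x)) =
      \sum_(t | tnth t h == x) c' t * \prod_(h' < L | h' != h) G h' (tnth t h').
    rewrite [RHS]big_mkcond; apply: eq_bigr => t _; rewrite prod_upd /delta.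
    by case: eqP => _; rewrite ?mul1r// mul0r mulr0.
  rewrite !mE (reindex_onto (setc h y) (setc h z)) => [|t /eqP ty]; last first.
    apply: eq_from_tnth => h'; rewrite !tnth_mktuple; case: eqP => [->|//].
    exact/esym.
  apply: eq_big => [t|t /andP[_ /eqP st]].
    apply/andP/eqP => [[_ /eqP <-]|tz]; first by rewrite tnth_mktuple eqxx.
    split; first by rewrite tnth_mktuple eqxx.
    by apply/eqP/eq_from_tnth => h'; rewrite !tnth_mktuple; case: eqP => [->|].
  rewrite st; congr (_ * _).
  by apply: eq_bigr => h' /negbTE hh; rewrite tnth_mktuple hh.
have := ml_upd (fun t => c (setc h z t)) G h (G h).
rewrite (ml_eq _ (G' := G)) => [<-|h' x]; last by rewrite /upd; case: eqP => [->|].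
under eq_bigr do rewrite E.
by rewrite -mulr_suml G1 mul1r.
Qed.

Lemma bmf_pu (F : 'I_k.+1 -> W -> R) : (forall h, bmf (F h)) ->
  bmf (fun y : W * 'I_k.+1 => F y.2 y.1).
Proof.
move=> bF; rewrite (_ : (fun y => _) = fun y : W * 'I_k.+1 => \sum_h (h == y.2)%:R * F h y.1).
  apply: bmf_sum => h; apply: bmfM; last exact: (@bmf_fst _ _ _ _ _ (F h) (bF h)).
  exact: (@bmf_snd _ _ _ _ _ (fun h' : 'I_k.+1 => (h == h')%:R) (bmf_ord _)).
apply/funext => y; rewrite (bigD1 y.2)//= eqxx mul1r big1 ?addr0// => h /negbTE ->.
exact: mul0r.
Qed.

Lemma Ex_pu (F : 'I_k.+1 -> W -> R) : (forall h, bmf (F h)) ->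
  \int[(p \x unif 'I_k.+1 R)%E]_y F y.2 y.1 = K^-1 * \sum_h \int[p]_psi F h psi.
Proof.
move=> bF; rewrite Ex_prod; last exact: bmf_pu.
rewrite -Ex_sum// -ExZ; last exact: bmf_sum.
congr (Rintegral _ _ _); apply/funext => psi.
by rewrite Ex_unif ?card_ord//; case: (bmf_ord (R := R) (fun h : 'I_k.+1 => F h psi)).
Qed.

(** * Factors that contain the new variable *)

Section newvar.
Variable n : nat.
Local Notation N := (n.+1%:R : R).
Local Notation N' := (n.+2%:R : R).
Local Notation de := (N'^-1).
Local Notation cfg := (n.+1.-tuple color).
Local Notation cfg' := (n.+2.-tuple color).
Local Notation XC := (k.+1.-tuple 'I_n.+1 * (W * 'I_k.+1))%type.

Lemma atc_lft L (s : cfg') (v : L.-tuple 'I_n.+1) : atc s (lft v) = atc (tl s) v.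
Proof. by apply: eq_from_tnth => h; rewrite !tnth_mktuple. Qed.

Lemma atc_put L (s : cfg') h (v : L.-tuple 'I_n.+1) :
  atc s (put h v) = setc h (tnth s ord0) (atc (tl s) v).
Proof. by apply: eq_from_tnth => h'; rewrite !tnth_mktuple; case: eqP. Qed.

Lemma avo_ml L (c : L.-tuple color -> R) (s : cfg') :
  avo (fun v => c (atc s v)) = ml c (fun=> emp (tl s)).
Proof. by rewrite -ml_atc /avo; congr (_ * _); apply: eq_bigr => v _; rewrite atc_lft. Qed.

Lemma avp_ml L (c : L.-tuple color -> R) (s : cfg') :
  avp (fun v => c (atc s v)) = \sum_h ml c (upd (fun=> emp (tl s)) h (delta (tnth s ord0))).
Proof.
apply: eq_bigr => h _; rewrite -ml_setc; last by case: (dist_emp (R := R) (tl s)).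
by rewrite -ml_atc; congr (_ * _); apply: eq_bigr => v _; rewrite atc_put.
Qed.

Definition n1 (s : cfg') : R := cc (emp (tl s)) (tnth s ord0).

Lemma n1_bounds s : psidn <= n1 s <= D.
Proof.
have b h : psidn <= ml psb (upd (fun=> emp (tl s)) h (delta (tnth s ord0))) <= D.
  by apply: ml_psb_bounds => h'; apply: dist_upd; [move=> ?; exact: dist_emp|exact: dist_delta].
rewrite /n1 /cc -[X in X <= _ <= _](@avgN1 R k) -[X in _ <= _ <= X](@avgN1 R k).
apply/andP; split; (apply: ler_wpM2l; [by rewrite invr_ge0|]); apply: ler_sum => h _; by case/andP: (b h).
Qed.

Definition En (s : cfg') : R := 2 * K ^+ 2 * D * (de * er (tl s) + de ^+ 2).

Lemma n1_nrm (s : cfg') : `|n1 s - nrm (tl s)| <= 2 * D * K * er (tl s).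
Proof.
have h1 := cc_lip (dist_emp (R := R) (tl s)) (tnth s ord0).
have h2 := nrm_lip (tl s).
have -> : n1 s - nrm (tl s) = (n1 s - xi_) - (nrm (tl s) - xi_) by ring.
apply: le_trans (ler_normB _ _) _; have := lerD h1 h2; rewrite -/(n1 s) -/(er (tl s)); lra.
Qed.

(** The first-order change of the normaliser is [K * de * (n1 s - nrm (tl s))], and both normalisers
    are within order [er] of [xi_], the first one by the constancy of [cc]. A change of order [de]
    would not be affordable. *)
Lemma nrm_split (s : cfg') : `|nrm s - nrm (tl s)| <= En s.
Proof.
have := @avg_split n k.+1 (fun v => psb (atc s v)) D (fun v => psb_abs _).
rewrite avo_ml avp_ml /avn ml_atc -/(nrm s) -/(nrm (tl s)).
have -> : \sum_h ml psb (upd (fun=> emp (tl s)) h (delta (tnth s ord0))) = K * n1 s.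
  by rewrite /n1 /cc mulVKf.
have K1 : 1 <= K by rewrite ler1n.
have h1 := n1_nrm s; have d0 : 0 <= de by rewrite invr_ge0.
have e0 : 0 <= er (tl s) by exact: l1_ge0.
move=> h2.
have -> : nrm s - nrm (tl s) = (nrm s - (1 - K * de) * nrm (tl s) - de * (K * n1 s)) +
   K * de * (n1 s - nrm (tl s)) by ring.
apply: le_trans (ler_normD _ _) _; rewrite normrM (ger0_norm (_ : 0 <= K * de)) ?mulr_ge0//.
have := ler_wpM2l (mulr_ge0 (ler0n _ k.+1) d0) h1; rewrite /En; move: h2.
move: `|_ - _ - _| (K * de * `|_|) => x y h2 h3.
have -> : 2 * K ^+ 2 * D * (de * er (tl s) + de ^+ 2) =
   K * de * (2 * D * K * er (tl s)) + 2 * K ^+ 2 * de ^+ 2 * D by ring.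
by rewrite addrC lerD.
Qed.

Definition muC : probability XC R :=
  (unif (k.+1.-tuple 'I_n.+1) R \x (p \x unif 'I_k.+1 R))%E.

(** A factor with the new variable in exactly one slot. It is divided by its own mean [n1 s], not by
    [nrm s], so that it has mean one for each configuration. *)
Definition fC (x : XC) (s : cfg') : R := cl x.2.1 (atc s (put x.2.2 x.1)) / n1 s.
Definition f0 (x : k.+1.-tuple 'I_n.+1 * W) (s : cfg') : R := fA x (tl s).

Lemma fC_bounds x s : bb^-1 <= fC x s <= bb.
Proof. by apply: ratio_bounds; [exact: cl_bounds|exact: n1_bounds]. Qed.

Lemma mult_fC : mult bb fC.
Proof.
split=> [s|x s|x s]; last by case/andP: (fC_bounds x s).
  case: (@bmf_loc R n _ (W * 'I_k.+1)%type k.+1 (fC^~ s)) => // v.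
  apply: (@bmf_pu (fun h psi => cl psi (atc s (put h v)) / n1 s)) => h.
  by under eq_fun do rewrite mulrC; apply: bmfZ; exact: bmf_cl.
by case/andP: (fC_bounds x s) => /(le_trans (ltW bbi_gt0)).
Qed.

Lemma mean1_fC s : \int[muC]_x fC x s = 1.
Proof.
rewrite (@Ex_loc R n _ (W * 'I_k.+1)%type (p \x unif 'I_k.+1 R)%E k.+1); last exact: (mult_ev_bmf mult_fC s).
have bF v h : bmf (fun psi => cl psi (atc s (put h v)) / n1 s).
  by under eq_fun do rewrite mulrC; apply: bmfZ; exact: bmf_cl.
under eq_bigr => v _ do rewrite (@Ex_pu (fun h psi => cl psi (atc s (put h v)) / n1 s) (bF v)).
have n10 : n1 s != 0.
  by rewrite gt_eqF//; case/andP: (n1_bounds s) => /(lt_le_trans psidn_gt0).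
apply: (mulfI n10); rewrite mulr1 [in RHS]/n1 /cc -(avp_ml psb s) /avp.
rewrite -mulr_sumr exchange_big/= -mulr_sumr.
rewrite (eq_bigr (fun v => (\sum_h psb (atc s (put h v))) / n1 s)) => [|v _]; last first.
  by rewrite mulr_suml; apply: eq_bigr => h _; rewrite ExZr//; exact: bmf_cl.
rewrite -mulr_suml; move: (\sum_ _ _) (N ^- _) K^-1 => x y z; field; exact: n10.
Qed.

Lemma mult_f0 : mult bb f0.
Proof.
by split=> [s|x s|x s]; [exact: (mult_measurable (@mult_fA n))|exact: (mult_ge0 (@mult_fA n))|exact: (mult_le (@mult_fA n))].
Qed.

Lemma mean1_f0 s : \int[muA n]_x f0 x s = 1.
Proof. exact: mean1_fA. Qed.

Definition opC : ((cfg' -> R) -> R) -> (cfg' -> R) -> R := op muC fC.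
Definition op0 : ((cfg' -> R) -> R) -> (cfg' -> R) -> R := op (muA n) f0.

Lemma good_opC : good opC. Proof. exact: (good_op mult_fC mean1_fC bb_ge0). Qed.
Lemma good_op0 : good op0. Proof. exact: (good_op mult_f0 mean1_f0 bb_ge0). Qed.

End newvar.

Lemma cl_div_close psi t x y : psidn <= x -> psidn <= y ->
  `|cl psi t / x - cl psi t / y| <= D ^+ 3 * `|x - y|.
Proof.
move=> hx hy; rewrite -mulrBr normrM exprS -mulrA.
by apply: ler_pM => //; [exact: cl_abs|exact: inv_diff].
Qed.

Section newvar_step.
Variable n : nat.
Local Notation N := (n.+1%:R : R).
Local Notation N' := (n.+2%:R : R).
Local Notation de := (N'^-1).
Local Notation cfg := (n.+1.-tuple color).
Local Notation cfg' := (n.+2.-tuple color).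
Local Notation XC := (k.+1.-tuple 'I_n.+1 * (W * 'I_k.+1))%type.

Let D0 : 0 <= D. Proof. exact: ltW D_gt0. Qed.

Lemma Lambda_br_close (V f g a : cfg' -> R) : cone V -> 0 < tot V ->
  (forall s, bb^-1 <= f s <= bb) -> (forall s, bb^-1 <= g s <= bb) ->
  (forall s, `|f s - g s| <= D ^+ 3 * a s) ->
  `|Lambda (br V f) - Lambda (br V g)| <= bb * D ^+ 3 * (lin a V / tot V).
Proof.
move=> cV t0 hf hg fg.
have /andP[f1' f2'] := br_between cV t0 hf; have /andP[g1' g2'] := br_between cV t0 hg.
apply: le_trans (Lambda_lip bb_ge1 f1' f2' g1' g2') _.
rewrite -mulrA; apply: ler_wpM2l; first exact: bb_ge0.
rewrite -brB; apply: le_trans (br_norm _ cV) _; rewrite /br mulrA ler_pM2r ?invr_gt0//.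
rewrite /lin mulr_sumr; apply: ler_sum => s _; rewrite mulrCA; exact: ler_wpM2l.
Qed.

Definition CS : R := 6 * bb * D ^+ 4 * K ^+ 2 + 2 * K ^+ 2 * bb ^+ 2.

Let A_arith (t L a o c I0 IC r x B e1 e2 : R) : 0 <= t -> 0 <= r -> 0 <= x -> r + x = 1 ->
  a <= r * o + x * c + B -> t * o <= t * I0 + e1 -> t * c <= t * IC + e2 ->
  L + t * a <= r * (L + t * I0) + x * (L + t * IC) + (r * e1 + x * e2 + B * t).
Proof.
move=> t0 r0 x0 rx h1 h2 h3; have := ler_wpM2l t0 h1; have := ler_wpM2l r0 h2; have := ler_wpM2l x0 h3.
have -> : r * (L + t * I0) + x * (L + t * IC) = (r + x) * L + r * (t * I0) + x * (t * IC) by ring.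
rewrite rx; lra.
Qed.

Let e_arith (d er' K' D' b : R) : 0 <= d -> K' * d <= 1 -> 0 <= K' -> 0 <= er' -> 0 <= D' -> 0 <= b ->
  (1 - K' * d) * (b * D' ^+ 3 * (2 * K' ^+ 2 * D' * (d * er' + d ^+ 2))) +
  K' * d * (b * D' ^+ 3 * (2 * K' ^+ 2 * D' * (d * er' + d ^+ 2) + 2 * D' * K' * er')) +
  2 * K' ^+ 2 * d ^+ 2 * b ^+ 2 <=
  (6 * b * D' ^+ 4 * K' ^+ 2 + 2 * K' ^+ 2 * b ^+ 2) * (d * er' + d ^+ 2).
Proof.
move=> d0 Kd K0 e0 D1 b1.
have h (x y z w : R) : 0 <= x -> 0 <= y -> 0 <= z -> 0 <= w -> 0 <= x * y * z * w by move=> *; rewrite !mulr_ge0.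
have p1 : 0 <= b * D' ^+ 4 * K' ^+ 2 * (d * er') by rewrite !mulr_ge0 ?exprn_ge0.
have p2 : 0 <= b * D' ^+ 4 * K' ^+ 2 * d ^+ 2 by rewrite !mulr_ge0 ?exprn_ge0.
have p3 : 0 <= K' ^+ 2 * b ^+ 2 * (d * er') by rewrite !mulr_ge0 ?exprn_ge0.
rewrite -subr_ge0.
have -> : (6 * b * D' ^+ 4 * K' ^+ 2 + 2 * K' ^+ 2 * b ^+ 2) * (d * er' + d ^+ 2) -
 ((1 - K' * d) * (b * D' ^+ 3 * (2 * K' ^+ 2 * D' * (d * er' + d ^+ 2))) +
  K' * d * (b * D' ^+ 3 * (2 * K' ^+ 2 * D' * (d * er' + d ^+ 2) + 2 * D' * K' * er')) +
  2 * K' ^+ 2 * d ^+ 2 * b ^+ 2) =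
  2 * (b * D' ^+ 4 * K' ^+ 2 * (d * er')) + 4 * (b * D' ^+ 4 * K' ^+ 2 * d ^+ 2) + 2 * (K' ^+ 2 * b ^+ 2 * (d * er')) by ring.
by rewrite !addr_ge0// mulr_ge0.
Qed.

Definition eA (s : cfg') : R := CS * (de * er (tl s) + de ^+ 2).

(** A factor of the larger graph avoids the new variable or contains it once, up to probability of
    order [de ^+ 2]. The error is of order [de * er + de ^+ 2], hence small even when summed over
    order [n] factors. *)
Lemma A_step (V : cfg' -> R) : (k <= n.+1)%N -> cone V ->
  opA Lh V <= mixE (1 - K * de) (@op0 n) (@opC n) Lh V + lin eA V.
Proof.
move=> kn cV; have t0 := tot_ge0 cV.
have d0 : 0 <= de by rewrite invr_ge0.
(* Here the arity must not exceed the number of variables, so that [K * de] is a probability. *)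
have Kd : K * de <= 1 by rewrite ler_pdivrMr// mul1r ler_nat.
have Kd0 : 0 <= K * de by rewrite mulr_ge0.
have s0 : 0 <= 1 - K * de by rewrite subr_ge0.
have er0 (s : cfg') : 0 <= er (tl s) by exact: l1_ge0.
have En0 (s : cfg') : 0 <= En s.
  by rewrite /En; apply: mulr_ge0; [rewrite !mulr_ge0 ?exprn_ge0|rewrite addr_ge0 ?mulr_ge0 ?exprn_ge0].
rewrite /mixE /opA /op0 /opC.
rewrite (op_Lh (@mult_fA n.+1) bb_ge0 (@mean1_fA n.+1) cV) (op_Lh (@mult_f0 n) bb_ge0 (@mean1_f0 n) cV).
rewrite (op_Lh (@mult_fC n) bb_ge0 (@mean1_fC n) cV) subKr.
have bA := bmf_Lambda_br (@mult_fA n.+1) bb_ge0 cV.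
have b00 := bmf_Lambda_br (@mult_f0 n) bb_ge0 cV.
have bC := bmf_Lambda_br (@mult_fC n) bb_ge0 cV.
have c0 : 0 <= bb * D ^+ 3 by exact: mulr_ge0 bb_ge0 (exprn_ge0 3 D0).
pose e1 (s : cfg') := bb * D ^+ 3 * En s.
pose e2 (s : cfg') := bb * D ^+ 3 * (En s + 2 * D * K * er (tl s)).
set y := (1 - K * de) * (Lh V + tot V * \int[muA n]_x Lambda (br V (f0 x))) +
   K * de * (Lh V + tot V * \int[muC n]_x Lambda (br V (fC x))).
suff H : Lh V + tot V * \int[muA n.+1]_x Lambda (br V (fA x)) <= y +
   ((1 - K * de) * lin e1 V + K * de * lin e2 V + 2 * K ^+ 2 * de ^+ 2 * bb ^+ 2 * tot V).
  apply: (le_trans H); rewrite lerD2l -!linZ -lin_cst -!linD; apply: lin_le => // s.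
  by apply: (e_arith d0 Kd (ler0n _ _) (er0 s) D0 bb_ge0).
rewrite /y {y}.
move: t0; rewrite le_eqVlt => /predU1P[t0|t0].
  rewrite -t0 !mul0r !addr0 mulr0 addr0 -mulrDl subrK mul1r lerDl.
  apply: addr_ge0; apply: mulr_ge0 => //; apply: sumr_ge0 => s _; apply: mulr_ge0 => //.
    exact: mulr_ge0 c0 (En0 s).
  apply: mulr_ge0 c0 (addr_ge0 (En0 s) _); apply: mulr_ge0 (er0 s).
  by apply: mulr_ge0 => //; apply: mulr_ge0.
pose G (v : k.+1.-tuple 'I_n.+2) := \int[p]_psi Lambda (br V (fA (v, psi))).
have Gb v : `|G v| <= bb ^+ 2.
  apply: Ex_bound => [|psi]; first exact: (bmf_pair1 bA v).
  have /andP[x1 x2] := br_between cV t0 (fun s => fA_bounds (v, psi) s).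
  have b1 : bb^-1 <= 1 by rewrite invf_le1 ?bb_ge1// (lt_le_trans ltr01 bb_ge1).
  have := Lambda_lip bb_ge1 x1 x2 b1 bb_ge1; rewrite Lambda1 subr0 => /le_trans; apply.
  rewrite expr2; apply: ler_wpM2l; first exact: bb_ge0.
  rewrite ler_norml; move: bbi_gt0 bb_ge1; lra.
have EA : \int[muA n.+1]_x Lambda (br V (fA x)) = avn G by exact: (@Ex_loc R n.+1 _ W p k.+1 _ bA).
rewrite EA.
pose IC h := (N ^+ k.+1)^-1 * \sum_v \int[p]_psi Lambda (br V (fC (v, (psi, h)))).
have EC : \int[muC n]_x Lambda (br V (fC x)) = K^-1 * \sum_h IC h.
  rewrite (@Ex_loc R n _ (W * 'I_k.+1)%type (p \x unif 'I_k.+1 R)%E k.+1 _ bC) /IC.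
  rewrite (eq_bigr (fun v => K^-1 * \sum_h \int[p]_psi Lambda (br V (fC (v, (psi, h)))))) => [|v _]; last first.
    rewrite -(@Ex_pu (fun h psi => Lambda (br V (fC (v, (psi, h)))))) => [|h]; last first.
      exact: (bmf_pair2 (bmf_pair1 bC v) h).
    by congr (Rintegral _ _ _); apply/funext => -[].
  by rewrite -!mulr_sumr exchange_big/= mulrCA.
have E0 : \int[muA n]_x Lambda (br V (f0 x)) =
    (N ^+ k.+1)^-1 * \sum_v \int[p]_psi Lambda (br V (f0 (v, psi))) by exact: (@Ex_loc R n _ W p k.+1 _ b00).
have nb (s : cfg') : psidn <= nrm s by case/andP: (nrm_bounds s).
have nb' (s : cfg') : psidn <= nrm (tl s) by case/andP: (nrm_bounds (tl s)).
have n1b (s : cfg') : psidn <= n1 s by case/andP: (n1_bounds s).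
have cmp (F H : W -> cfg' -> R) (e : cfg' -> R) : bmf (fun psi => Lambda (br V (F psi))) ->
    bmf (fun psi => Lambda (br V (H psi))) ->
    (forall psi s, bb^-1 <= F psi s <= bb) -> (forall psi s, bb^-1 <= H psi s <= bb) ->
    (forall psi s, `|F psi s - H psi s| <= D ^+ 3 * e s) ->
    tot V * \int[p]_psi Lambda (br V (F psi)) <=
    tot V * \int[p]_psi Lambda (br V (H psi)) + bb * D ^+ 3 * lin e V.
  move=> bF bH hF hH FH.
  have -> : bb * D ^+ 3 * lin e V = tot V * (bb * D ^+ 3 * (lin e V / tot V)).
    by field; rewrite gt_eqF.
  rewrite -mulrDr ler_pM2l// -(Ex_cst p (bb * D ^+ 3 * (lin e V / tot V))) -ExD//; last exact: bmf_cst.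
  apply: Ex_le => // [|psi]; first by apply: bmfD => //; exact: bmf_cst.
  by have := Lambda_br_close cV t0 (hF psi) (hH psi) (FH psi); rewrite ler_norml => /andP[_]; lra.
have avle (f1 f2 : k.+1.-tuple 'I_n.+1 -> R) (e : R) :
    (forall v, tot V * f1 v <= tot V * f2 v + e) ->
    tot V * ((N ^+ k.+1)^-1 * \sum_v f1 v) <= tot V * ((N ^+ k.+1)^-1 * \sum_v f2 v) + e.
  move=> H; have Nz : 0 < N ^+ k.+1 by rewrite exprn_gt0.
  have -> : e = (N ^+ k.+1)^-1 * \sum_(v : k.+1.-tuple 'I_n.+1) e.
    by rewrite sumr_const -[e *+ _]mulr_natl card_NL mulKf// gt_eqF.
  rewrite ![tot V * (_ * _)]mulrCA -mulrDr ler_wpM2l ?invr_ge0 ?(ltW Nz)//.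
  by rewrite !mulr_sumr -big_split/=; apply: ler_sum.
apply: (@A_arith (tot V) (Lh V) (avn G) (avo G) (K^-1 * avp G) _ _ _ _ (2 * K ^+ 2 * de ^+ 2 * bb ^+ 2)) => //; first exact: ltW.
- by rewrite subrK.
- have := avg_split Gb; rewrite ler_norml => /andP[_].
  have -> : K * de * (K^-1 * avp G) = de * avp G by rewrite mulrACA mulfV ?mul1r.
  rewrite 2!lerBlDr => /le_trans; apply; apply: eq_refl_le; ring.
- rewrite E0 /avo /e1 linZ; apply: avle => v; apply: (cmp _ _ (@En n)) => //.
  + exact: (bmf_pair1 bA (lft v)).
  + exact: (bmf_pair1 b00 v).
  + by move=> psi s; exact: fA_bounds.
  + by move=> psi s; exact: fA_bounds.
  move=> psi s; rewrite /f0 /fA/= atc_lft; apply: le_trans (cl_div_close _ _ (nb s) (nb' s)) _.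
  by apply: ler_wpM2l; [exact: exprn_ge0|exact: nrm_split].
rewrite EC /avp /e2 !mulr_sumr -[X in _ + X](@avgN1 R k) mulr_sumr -big_split/=.
apply: ler_sum => h _; rewrite mulrCA [tot V * (K^-1 * _)]mulrCA -mulrDr ler_wpM2l ?invr_ge0//.
rewrite linZ; apply: avle => v; apply: (cmp _ _ (fun s => En s + 2 * D * K * er (tl s))) => //.
+ exact: (bmf_pair1 bA (put h v)).
+ exact: (bmf_pair2 (bmf_pair1 bC v) h).
+ by move=> psi s; exact: fA_bounds.
+ by move=> psi s; exact: fC_bounds.
move=> psi s; rewrite /fC /fA/=; apply: le_trans (cl_div_close _ _ (nb s) (n1b s)) _.
apply: ler_wpM2l; first exact: exprn_ge0.
have -> : nrm s - n1 s = (nrm s - nrm (tl s)) - (n1 s - nrm (tl s)) by ring.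
by apply: le_trans (ler_normB _ _) _; apply: lerD; [exact: nrm_split|exact: n1_nrm].
Qed.

End newvar_step.

Section product_ops.
Context d (X : measurableType d) (mu : probability X R) (S : finType).
Implicit Types (f g : X -> S -> R).

Definition prodf f j (x : j.-tuple X) (s : S) : R := \prod_(a < j) f (tnth x a) s.

Lemma bmf_prodf B f j s : mult B f -> bmf (fun x => @prodf f j x s).
Proof. by move=> mf; apply: (@bmf_iid_prod _ _ _ _ (fun _ x => f x s)) => a; exact: (mult_ev_bmf mf s). Qed.

Lemma mult_prodf B f j : mult B f -> mult (B ^+ j) (@prodf f j).
Proof.
move=> mf; split=> [s|x s|x s].
- by case: (bmf_prodf j s mf).
- by apply: prodr_ge0 => a _; exact: (mult_ge0 mf).
rewrite /prodf -[in leRHS](card_ord j) -prodr_const; apply: ler_prod => a _.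
by rewrite (mult_ge0 mf) (mult_le mf).
Qed.

Lemma prodf_ge B f j x s : 0 < B -> (forall x s, B^-1 <= f x s) -> (B ^+ j)^-1 <= @prodf f j x s.
Proof.
move=> B0 fB; rewrite -exprVn -[in leLHS](card_ord j) -prodr_const; apply: ler_prod => a _.
by rewrite fB invr_ge0 (ltW B0).
Qed.

Lemma mean1_prodf B f j s : mult B f -> (forall s, \int[mu]_x f x s = 1) ->
  \int[iid mu j]_x @prodf f j x s = 1.
Proof.
move=> mf m1; rewrite (@Ex_iid_prod _ _ _ mu j (fun _ x => f x s)); last by move=> a; exact: (mult_ev_bmf mf s).
by rewrite big1.
Qed.

Lemma iter_opE B f j F V : mult B f -> 0 <= B -> nice F -> cone V ->
  iter j (op mu f) F V = op (iid mu j) (@prodf f j) F V.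
Proof. by move=> mf B0 nF cV; have [_ ->] := iter_op_iid mu j mf B0 nF cV. Qed.

Lemma l1_prod B f g j V : mult B f -> mult B g -> 1 <= B -> cone V ->
  \int[iid mu j]_x \sum_s V s * `|prodf f x s - prodf g x s| <=
  B ^+ j * (j%:R * \sum_s V s * \int[mu]_x `|f x s - g x s|).
Proof.
move=> mf mg B1 cV; have B0 : 0 <= B by exact: le_trans B1.
pose U (s : S + S) := match s with inl s => V s | inr s => V s end.
have cU : cone U by move=> [].
have := iter_l1dist mu mf mg B1 j cU.
have [_ ->] := iter_op_iid mu j (mult_fsum mf mg) B0 (@nice_l1dist R S) cU.
rewrite [in leRHS]/l1dist big1 ?add0r => [|s _]; last by rewrite /= subrr normr0.
apply: le_trans; apply: eq_refl_le; congr (Rintegral _ _ _); apply/funext => x.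
by apply: eq_bigr => s _; rewrite /= -mulrBr normrM ger0_norm.
Qed.

End product_ops.

(** * The new variable sees independent messages *)

Section C_estimate.
Variable n : nat.
Local Notation N := (n.+1%:R : R).
Local Notation cfg := (n.+1.-tuple color).
Local Notation cfg' := (n.+2.-tuple color).
Local Notation XC := (k.+1.-tuple 'I_n.+1 * (W * 'I_k.+1))%type.
Local Notation muC := (@muC n).

Definition fX (x : XC) (s : cfg') : R := cl x.2.1 (atc s (put x.2.2 x.1)) / xi_.
(** The message of a new factor to the new variable when the neighbours have independent colours
    with laws [G]. *)
Definition mm (G : 'I_n.+1 -> color -> R) (x : XC) (z : color) : R :=
  wf x.2.1 x.2.2 (fun h => G (tnth x.1 h)) z / xi_.

Lemma fX_bounds x s : bb^-1 <= fX x s <= bb.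
Proof. by apply: ratio_bounds; [exact: cl_bounds|exact: xi_bounds]. Qed.

Lemma mm_bounds G x z : (forall j, dist (G j)) -> bb^-1 <= mm G x z <= bb.
Proof. by move=> dG; apply: ratio_bounds; [apply: wf_bounds => h; exact: dG|exact: xi_bounds]. Qed.

Lemma mult_fX : mult bb fX.
Proof.
split=> [s|x s|x s]; last by case/andP: (fX_bounds x s).
  case: (@bmf_loc R n _ (W * 'I_k.+1)%type k.+1 (fX^~ s)) => // v.
  apply: (@bmf_pu (fun h psi => cl psi (atc s (put h v)) / xi_)) => h.
  by under eq_fun do rewrite mulrC; apply: bmfZ; exact: bmf_cl.
by case/andP: (fX_bounds x s) => /(le_trans (ltW bbi_gt0)).
Qed.

Lemma mult_mm G : (forall j, dist (G j)) -> mult bb (mm G).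
Proof.
move=> dG; split=> [z|x z|x z]; last by case/andP: (mm_bounds x z dG).
  case: (@bmf_loc R n _ (W * 'I_k.+1)%type k.+1 ((mm G)^~ z)) => // v.
  apply: (@bmf_pu (fun h psi => wf psi h (fun h => G (tnth v h)) z / xi_)) => h.
  by under eq_fun do rewrite mulrC; apply: bmfZ; exact: bmf_ml.
by case/andP: (mm_bounds x z dG) => /(le_trans (ltW bbi_gt0)).
Qed.

(** An exact identity: drawing the tuple of sites uniformly and reading corrected marginals is
    drawing i.i.d. messages from [piW V]. *)
Lemma op_mm V F u : cone V -> nice F -> cone u ->
  op muC (mm (mup V)) F u = opb (piW V) F u.
Proof.
move=> cV nF cu; have dG j : dist (mup V j) := dist_mup j cV.
have bm := mult_bmf (mult_mm dG) nF cu; have bS := mult_bmf mult_fb nF cu.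
rewrite /opb /op (Ex_muS _ bS) (@Ex_loc R n _ (W * 'I_k.+1)%type (p \x unif 'I_k.+1 R)%E k.+1 _ bm).
under [RHS]eq_Rintegral => psi _.
  under eq_bigr => h _ do rewrite (Ex_iid_piW V (bmf_pair1 bS (psi, h))).
  over.
have bh v h : bmf (fun psi => F (fun s => u s * mm (mup V) (v, (psi, h)) s)).
  exact: (bmf_pair2 (bmf_pair1 bm v) h).
under eq_bigr => v _ do rewrite (@Ex_pu (fun h psi => F (fun s => u s * mm (mup V) (v, (psi, h)) s)) (bh v)).
have E v h psi : F (fun s => u s * fb (psi, h, [tuple mkj V (tnth v h') | h' < k.+1]) s) =
    F (fun s => u s * mm (mup V) (v, (psi, h)) s).
  congr F; apply/funext => s; congr (_ * (_ / _)); apply: ml_eq => h' z.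
  by rewrite /upd; case: ifP => // _; rewrite /masses tnth_mktuple mass_mkj.
under [RHS]eq_Rintegral => psi _.
  under eq_bigr => h _ do under eq_bigr => v _ do rewrite E.
  over.
have bs h : bmf (fun psi => \sum_v F (fun s => u s * mm (mup V) (v, (psi, h)) s)).
  by apply: bmf_sum => v; exact: bh.
rewrite ExZ; last by apply: bmf_sum => h; apply: bmfZ; exact: bs.
rewrite Ex_sum; last by move=> h; apply: bmfZ; exact: bs.
rewrite -mulr_sumr mulrCA exchange_big/=; congr (_ * _); rewrite mulr_sumr; apply: eq_bigr => h _.
by rewrite ExZ//; rewrite Ex_sum.
Qed.

Lemma good_mm V : cone V -> good (op muC (mm (mup V))).
Proof.
move=> cV; have dG j : dist (mup V j) := dist_mup j cV.
apply: (good_op (mult_mm dG)) => // [z|]; last exact: bb_ge0.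
have c1 : cone (fun _ : color => 1 : R) by [].
have := op_mm cV (@nice_ev R color z) c1.
rewrite (good_ev (good_opb (piW_mean cV)) z c1) /op => <-.
by congr (Rintegral _ _ _); apply/funext => x; rewrite mul1r.
Qed.

Lemma iter_opb_mm V j : cone V -> iter j (opb (piW V)) Lh (mass gam) =
  \int[iid muC j]_x Lambda (\sum_z mass gam z * prodf (mm (mup V)) x z).
Proof.
move=> cV; have dG i : dist (mup V i) := dist_mup i cV.
rewrite -(iter_ext j (good_mm cV) (good_opb (piW_mean cV)) (fun F u nF cu => op_mm cV nF cu) (@nice_Lh R color) cone_mass).
by rewrite (iter_opE _ j (mult_mm dG) bb_ge0 (@nice_Lh R color) cone_mass).
Qed.

Definition C4 : R := D ^+ 4 * K + D ^+ 2 * K * C0.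

(** First replacement, of the normaliser [n1] by [xi_]; by [cc_lip] it costs order [er]. *)
Lemma C_gap1 V j : cone V ->
  \int[iid muC j]_x \sum_s tens (mass gam) V s * `|prodf (@fC n) x s - prodf fX x s| <=
  bb ^+ j * (j%:R * (D ^+ 4 * K * lin (@er n) V)).
Proof.
move=> cV; have cT := cone_tens cone_mass cV.
apply: le_trans (l1_prod muC j (@mult_fC n) mult_fX bb_ge1 cT) _.
apply: ler_wpM2l; first exact: exprn_ge0 bb_ge0.
apply: ler_wpM2l => //.
have -> : D ^+ 4 * K * lin (@er n) V = \sum_s tens (mass gam) V s * (D ^+ 4 * K * er (tl s)).
  rewrite (sum_tens (fun c s => mass gam c * V s * (D ^+ 4 * K * er s))).
  under eq_bigr => c _.
    rewrite (_ : \sum_s _ = mass gam c * (D ^+ 4 * K * lin (@er n) V)); first by over.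
    by rewrite /lin !mulr_sumr; apply: eq_bigr => s _; ring.
  by rewrite -mulr_suml; case: (dist_mass gam) => _ ->; rewrite mul1r.
apply: ler_sum => s _; apply: ler_wpM2l => //.
have bn := bmf_norm (bmfB (mult_ev_bmf (@mult_fC n) s) (mult_ev_bmf mult_fX s)).
rewrite -[leRHS](Ex_cst muC); apply: Ex_le => [//||x]; first exact: bmf_cst.
rewrite /fC /fX; have /andP[h1 _] := n1_bounds s; have /andP[h2 _] := xi_bounds.
apply: le_trans (cl_div_close _ _ h1 h2) _.
apply: le_trans (ler_wpM2l (exprn_ge0 3 (ltW D_gt0)) (cc_lip (dist_emp (R := R) (tl s)) (tnth s ord0))) _.
by apply: eq_refl_le; rewrite -/(er (tl s)); ring.
Qed.

(** Second replacement, of the joint law of all neighbours of the new variable by the product of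
    their marginals. The [j] new factors read [j * k.+1] sites, whence the range of the sum. *)
Lemma C_gap2 V j eta : cone V -> 0 < tot V -> 0 < eta ->
  \int[iid muC j]_x `|\sum_s tens (mass gam) V s * prodf fX x s -
     tot V * \sum_z mass gam z * prodf (mm (mu V)) x z| <=
  bb ^+ j * \sum_(i < j * k.+1) perr eta i V.
Proof.
move=> cV t0 e0.
have dG i : dist (mu V i) := dist_mu i cV t0.
(* For a fixed colour [z] of the new variable, a new factor is a local multiplier of the old sites,
   so that [em_le] applies colour by colour. *)
pose g z (y : W * 'I_k.+1) (t : asg) := cl y.1 (setc y.2 z t) / xi_.
have mg z : mult bb (g z).
  have gb y t : bb^-1 <= g z y t <= bb by apply: ratio_bounds; [exact: cl_bounds|exact: xi_bounds].
  split=> [t|y t|y t]; last by case/andP: (gb y t).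
    case: (@bmf_pu (fun h psi => cl psi (setc h z t) / xi_)) => // h.
    by under eq_fun do rewrite mulrC; apply: bmfZ; exact: bmf_cl.
  by case/andP: (gb y t) => /(le_trans (ltW bbi_gt0)).
pose T z (x : j.-tuple XC) := `|\sum_s V s * prodf (locf (n := n) (g z)) x s -
   tot V * prodf (mff (n := n) (g z) V) x tt|.
have ml z := mult_locf (n := n) (mg z); have mm' z := mult_mff (mg z) cV t0.
have bl z s : bmf (fun x => @prodf _ _ _ (locf (n := n) (g z)) j x s) by exact: bmf_prodf (ml z).
have bm z : bmf (fun x => @prodf _ _ _ (mff (n := n) (g z) V) j x tt) by exact: bmf_prodf (mm' z).
have bT z : bmf (T z).
  apply: bmf_norm; apply: bmfB; last exact: bmfZ.
  by apply: bmf_sum => s; exact: bmfZ.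
have eT z : \int[iid muC j]_x T z x <= bb ^+ j * \sum_(i < j * k.+1) perr eta i V.
  apply: (@le_trans _ _ (em (p \x unif 'I_k.+1 R)%E (g z) V j V)); last first.
    apply: le_trans (em_le _ (mg z) bb_ge1 cV t0 j cV) _.
    apply: ler_wpM2l; first exact: exprn_ge0 bb_ge0.
    by apply: ler_sum => i _; exact: iter_dev.
  apply: eq_refl_le; rewrite /em /gapm.
  have cpr := pr_cone cV (ltW t0).
  have [_ ->] := iter_op_iid (@locmu R n _ _ (p \x unif 'I_k.+1 R)%E k.+1) j (mult_fsum (ml z) (mm' z)) bb_ge0 (nice_gap (q := q) (n := n)) cpr.
  by [].
have mE z (x : XC) : mff (n := n) (g z) V x tt = mm (mu V) x z.
  rewrite /mff /mm /wf /g -ml_setc; last by case: (dG (tnth x.1 x.2.2)).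
  by rewrite /ml mulr_suml; apply: eq_bigr => t _; rewrite /pm; ring.
apply: (@le_trans _ _ (\int[iid muC j]_x \sum_z mass gam z * T z x)); last first.
  rewrite Ex_sum => [|z]; last exact: bmfZ.
  have [g0 g1] := dist_mass gam.
  rewrite -[leRHS]mul1r -[X in _ <= X * _]g1 mulr_suml; apply: ler_sum => z _.
  by rewrite ExZ//; apply: ler_wpM2l.
apply: Ex_le => [||x].
- apply: bmf_norm; apply: bmfB.
    by apply: bmf_sum => s; apply: bmfZ; exact: (bmf_prodf j s mult_fX).
  by apply: bmfZ; apply: bmf_sum => z; apply: bmfZ; exact: (bmf_prodf j z (mult_mm dG)).
- by apply: bmf_sum => z; exact: bmfZ.
have -> : \sum_s tens (mass gam) V s * prodf fX x s =
    \sum_z mass gam z * \sum_s V s * prodf (locf (n := n) (g z)) x s.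
  have E (s : cfg') : tens (mass gam) V s * prodf fX x s = mass gam (tnth s ord0) *
      (V (tl s) * prodf (locf (n := n) (g (tnth s ord0))) x (tl s)).
    rewrite /tens -mulrA; congr (_ * (_ * _)); apply: eq_bigr => a _.
    by rewrite /fX /locf /g atc_put.
  under eq_bigr do rewrite E.
  rewrite (sum_tens (fun z s => mass gam z * (V s * prodf (locf (n := n) (g z)) x s))).
  by apply: eq_bigr => z _; rewrite mulr_sumr.
rewrite mulr_sumr -sumrB; apply: le_trans (ler_norm_sum _ _ _) _; apply: ler_sum => z _.
rewrite mulrCA -mulrBr normrM ger0_norm ?mass_ge0//; apply: ler_wpM2l; first exact: mass_ge0.
apply: eq_refl_le; rewrite /T; congr `|_ - _ * _|; apply: eq_bigr => a _.
by rewrite mE.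
Qed.

(** Third replacement, of the marginals by the corrected ones, through [mup_close]. *)
Lemma C_gap3 V j : cone V -> 0 < tot V ->
  tot V * \int[iid muC j]_x \sum_z mass gam z * `|prodf (mm (mu V)) x z - prodf (mm (mup V)) x z| <=
  bb ^+ j * (j%:R * (D ^+ 2 * K * C0 * lin (@er n) V)).
Proof.
move=> cV t0.
have dG i : dist (mu V i) := dist_mu i cV t0; have dG' i : dist (mup V i) := dist_mup i cV.
apply: le_trans (ler_wpM2l (ltW t0) (l1_prod muC j (mult_mm dG) (mult_mm dG') bb_ge1 cone_mass)) _.
rewrite mulrCA; apply: ler_wpM2l; first exact: exprn_ge0 bb_ge0.
rewrite mulrCA; apply: ler_wpM2l => //.
have [g0 g1] := dist_mass gam.
rewrite -[leRHS]mul1r -[X in _ <= X * _]g1 [leRHS]mulr_suml [leLHS]mulr_sumr; apply: ler_sum => z _.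
rewrite mulrCA; apply: ler_wpM2l => //.
have -> : D ^+ 2 * K * C0 * lin (@er n) V = tot V * (D ^+ 2 * K * C0 * (lin (@er n) V / tot V)).
  by field; rewrite gt_eqF.
rewrite ler_pM2l// -[leRHS](Ex_cst muC).
have bn := bmf_norm (bmfB (mult_ev_bmf (mult_mm dG) z) (mult_ev_bmf (mult_mm dG') z)).
apply: Ex_le => [//||x]; first exact: bmf_cst.
have /andP[x1 x2] := xi_bounds.
have xiD : xi_^-1 <= D by rewrite lef_pV2 ?posrE// xi_gt0.
have xi0 : 0 <= xi_^-1 by rewrite invr_ge0 (ltW xi_gt0).
rewrite /mm -mulrBl normrM [`|_^-1|]ger0_norm//.
have du (H : 'I_n.+1 -> color -> R) (dH : forall i, dist (H i)) (h' : 'I_k.+1) : dist (upd (fun h => H (tnth x.1 h)) x.2.2 (delta z) h').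
  by apply: dist_upd; [move=> ?; exact: dH|exact: dist_delta].
have h1 := ml_lip (du _ dG) (du _ dG') (cl_abs x.2.1).
have h2 : \sum_(h < k.+1) l1 (upd (fun h => mu V (tnth x.1 h)) x.2.2 (delta z) h)
    (upd (fun h => mup V (tnth x.1 h)) x.2.2 (delta z) h) <= K * (C0 * (lin (@er n) V / tot V)).
  rewrite (_ : K * _ = \sum_(h < k.+1) (C0 * (lin (@er n) V / tot V))); last first.
    by rewrite sumr_const card_ord -[RHS]mulr_natl.
  have c0 : 0 <= C0 * (lin (@er n) V / tot V).
    apply: mulr_ge0; first by rewrite /C0; have := D_gt0; lra.
    by apply: divr_ge0; [exact: lin_er_ge0|exact: ltW].
  apply: ler_sum => h _; rewrite /upd; case: ifP => _; first by rewrite l1xx.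
  apply: le_trans (mup_close _ cV t0) _.
  apply: ler_wpM2l; first by rewrite /C0; have := D_gt0; lra.
  by rewrite ler_pdivlMr// mulrC tot_gbar.
have := ler_pM (normr_ge0 _) xi0 (le_trans h1 (ler_wpM2l (ltW D_gt0) h2)) xiD.
by move/le_trans; apply; apply: eq_refl_le; rewrite expr2; ring.
Qed.

Let gap_arith (t y y' A B : R) : t != 0 ->
  y - y' = t^-1 * (t * y - A) + t^-1 * (A - t * B) + (B - y').
Proof. by move=> t0; field. Qed.

Let C_arith (t b J S x1 x2 x3 L0 L3 I1 I2 I3 e p1 p2 : R) : 0 <= t -> 0 <= b ->
  L0 <= L3 + b * (I1 + I2 + I3) -> t * I1 <= b * (J * (p1 * e)) -> t * I2 <= b * S ->
  t * I3 <= b * (J * (p2 * e)) ->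
  t * L0 <= t * L3 + b * b * (J * ((p1 + p2) * e) + S).
Proof.
move=> t0 bp h h1 h2 h3; have H := ler_wpM2l t0 h.
have := ler_wpM2l bp h1; have := ler_wpM2l bp h2; have := ler_wpM2l bp h3; lra.
Qed.

(** The product of [j] multipliers lies between [bb ^- j] and [bb ^+ j]. One power [bb ^+ j] is the
    Lipschitz constant of [Lambda] there, the other comes from the three replacements. *)
Lemma C_est V j eta : cone V -> 0 < eta ->
  iter j (@opC n) Lh (tens (mass gam) V) <= Lh V + tot V * iter j (opb (piW V)) Lh (mass gam) +
  bb ^+ j * bb ^+ j * (j%:R * (C4 * lin (@er n) V) + \sum_(i < j * k.+1) perr eta i V).
Proof.
move=> cV e0; have cT := cone_tens cone_mass cV.
have mC := mult_prodf j (@mult_fC n); have mX := mult_prodf j mult_fX.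
have B1 : 1 <= bb ^+ j by rewrite exprn_ege1// bb_ge1.
have B0 : 0 <= bb ^+ j by exact: exprn_ge0 bb_ge0.
have bbp : 0 < bb by exact: lt_le_trans ltr01 bb_ge1.
have P0 : 0 <= \sum_(l < j * k.+1) perr eta l V by apply: sumr_ge0 => l _; exact: perr_ge0.
have C40 : 0 <= C4.
  have D0 := ltW D_gt0; rewrite /C4; apply: addr_ge0; apply: mulr_ge0 => //; rewrite ?mulr_ge0 ?exprn_ge0//.
  by rewrite /C0; lra.
rewrite /opC (iter_opE _ j (@mult_fC n) bb_ge0 (@nice_Lh R cfg') cT).
have mn s := mean1_prodf (mu := muC) j s (@mult_fC n) (@mean1_fC n).
rewrite (op_Lh mC B0 mn cT).
rewrite (Lh_tens cone_mass cV).
rewrite (tot_tens (mass gam) V) tot_mass !mul1r.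
have -> : Lh (mass gam) = 0 by rewrite /Lh tot_mass Lambda1.
rewrite mulr0 addr0 -!addrA lerD2l.
have := tot_ge0 cV; rewrite le_eqVlt => /predU1P[<-|t0].
  rewrite !mul0r add0r; apply: mulr_ge0; first exact: mulr_ge0.
  apply: addr_ge0 => //; apply: mulr_ge0 => //; apply: mulr_ge0 => //; exact: lin_er_ge0.
have dG i : dist (mu V i) := dist_mu i cV t0; have dG' i : dist (mup V i) := dist_mup i cV.
have t1 : 0 < tot (tens (mass gam) V) by rewrite tot_tens tot_mass mul1r.
rewrite iter_opb_mm//.
have m1 := mult_prodf j (mult_mm dG); have m2 := mult_prodf j (mult_mm dG').
have bC s := bmf_prodf j s (@mult_fC n); have bX s := bmf_prodf j s mult_fX.
have b1 z := bmf_prodf j z (mult_mm dG); have b2 z := bmf_prodf j z (mult_mm dG').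
pose y0 (x : j.-tuple XC) := br (tens (mass gam) V) (prodf (@fC n) x).
pose y3 (x : j.-tuple XC) := \sum_z mass gam z * prodf (mm (mup V)) x z.
pose i1 (x : j.-tuple XC) := (tot V)^-1 * \sum_s tens (mass gam) V s * `|prodf (@fC n) x s - prodf fX x s|.
pose i2 (x : j.-tuple XC) := (tot V)^-1 * `|\sum_s tens (mass gam) V s * prodf fX x s -
     tot V * \sum_z mass gam z * prodf (mm (mu V)) x z|.
pose i3 (x : j.-tuple XC) := \sum_z mass gam z * `|prodf (mm (mu V)) x z - prodf (mm (mup V)) x z|.
have bi1 : bmf i1.
  by apply: bmfZ; apply: bmf_sum => s; apply: bmfZ; apply: bmf_norm; exact: bmfB.
have bi2 : bmf i2.
  apply: bmfZ; apply: bmf_norm; apply: bmfB; first by apply: bmf_sum => s; exact: bmfZ.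
  by apply: bmfZ; apply: bmf_sum => z; exact: bmfZ.
have bi3 : bmf i3.
  by apply: bmf_sum => z; apply: bmfZ; apply: bmf_norm; exact: bmfB.
have ge3 x : (bb ^+ j)^-1 <= y3 x /\ y3 x <= bb ^+ j.
  have [g0 g1] := dist_mass gam; split; rewrite /y3.
    rewrite -[leLHS]mul1r -[X in X * _ <= _]g1 mulr_suml; apply: ler_sum => z _; apply: ler_wpM2l => //.
    by apply: prodf_ge => // x' s'; case/andP: (mm_bounds x' s' dG').
  rewrite -[leRHS]mul1r -[X in _ <= X * _]g1 mulr_suml; apply: ler_sum => z _; apply: ler_wpM2l => //.
  exact: (mult_le m2).
have by3 : bmf y3 by apply: bmf_sum => z; exact: bmfZ.
have p3 x : 0 <= y3 x by case: (ge3 x) => + _; apply: le_trans; rewrite invr_ge0.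
have b3 : bmf (fun x => Lambda (y3 x)) by apply: bmf_Lambda.
apply: (@C_arith (tot V) (bb ^+ j) j%:R (\sum_(i < j * k.+1) perr eta i V) 0 0 0
  (\int[iid muC j]_x Lambda (y0 x)) (\int[iid muC j]_x Lambda (y3 x))
  (\int[iid muC j]_x i1 x) (\int[iid muC j]_x i2 x) (\int[iid muC j]_x i3 x)
  (lin (@er n) V) (D ^+ 4 * K) (D ^+ 2 * K * C0)) => //; first exact: ltW.
- rewrite -!ExD//; last exact: bmfD.
  rewrite -ExZ; last by apply: bmfD => //; exact: bmfD.
  rewrite -ExD//; last by apply: bmfZ; apply: bmfD => //; exact: bmfD.
  apply: Ex_le => [||x].
  + exact: (bmf_Lambda_br mC B0 cT).
  + by apply: bmfD => //; apply: bmfZ; apply: bmfD => //; exact: bmfD.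
  have ge x' s' : (bb ^+ j)^-1 <= prodf (@fC n) (j := j) x' s'.
    by apply: prodf_ge => // x'' s''; case/andP: (fC_bounds x'' s'').
  have /andP[l0 u0] := br_bounds mC ge x cT t1; have [l3 u3] := ge3 x.
  have := Lambda_lip B1 l0 u0 l3 u3; rewrite -/(y0 x) => HL.
  have HY : `|y0 x - y3 x| <= i1 x + i2 x + i3 x.
    have tn : tot V != 0 by rewrite gt_eqF.
    have -> : y0 x - y3 x = (tot V)^-1 * (\sum_s tens (mass gam) V s * (prodf (@fC n) x s - prodf fX x s)) +
       (tot V)^-1 * (\sum_s tens (mass gam) V s * prodf fX x s - tot V * \sum_z mass gam z * prodf (mm (mu V)) x z) +
       \sum_z mass gam z * (prodf (mm (mu V)) x z - prodf (mm (mup V)) x z).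
      have -> : \sum_s tens (mass gam) V s * (prodf (@fC n) x s - prodf fX x s) =
         tot V * y0 x - \sum_s tens (mass gam) V s * prodf fX x s.
        rewrite /y0 /br tot_tens tot_mass mul1r mulrCA mulfV// mulr1 -sumrB.
        by apply: eq_bigr => s _; rewrite mulrBr.
      have -> : \sum_z mass gam z * (prodf (mm (mu V)) x z - prodf (mm (mup V)) x z) =
         \sum_z mass gam z * prodf (mm (mu V)) x z - y3 x.
        by rewrite -sumrB; apply: eq_bigr => z _; rewrite mulrBr.
      exact: gap_arith.
    have ti : 0 <= (tot V)^-1 by rewrite invr_ge0 ltW.
    apply: le_trans (ler_normD _ _) _; apply: lerD; first apply: le_trans (ler_normD _ _) _; first apply: lerD.
    - rewrite normrM ger0_norm// ler_wpM2l// (le_trans (ler_norm_sum _ _ _))//.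
      by apply: ler_sum => s _; rewrite normrM ger0_norm.
    - by rewrite normrM ger0_norm.
    - rewrite (le_trans (ler_norm_sum _ _ _))//.
      by apply: ler_sum => z _; rewrite normrM ger0_norm ?mass_ge0.
  have := le_trans HL (ler_wpM2l B0 HY); rewrite ler_norml => /andP[_]; lra.
- rewrite ExZ; last by apply: bmf_sum => s; apply: bmfZ; apply: bmf_norm; exact: bmfB.
  by rewrite mulVKf ?gt_eqF//; exact: C_gap1.
- rewrite ExZ; last first.
    apply: bmf_norm; apply: bmfB; first by apply: bmf_sum => s; exact: bmfZ.
    by apply: bmfZ; apply: bmf_sum => z; exact: bmfZ.
  by rewrite mulVKf ?gt_eqF//; exact: C_gap2.
- exact: C_gap3.
Qed.

End C_estimate.

Lemma C4_ge0 : 0 <= C4.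
Proof.
have D1 := ltW D_gt0; rewrite /C4; apply: addr_ge0; apply: mulr_ge0 => //; rewrite ?mulr_ge0 ?exprn_ge0//.
by rewrite /C0; lra.
Qed.

Lemma CP_ge0 : 0 <= CP.
Proof. by rewrite /CP mulr_ge0 ?bb_ge0// exprn_ge0// ltW ?D_gt0. Qed.

Lemma CS_ge0 : 0 <= CS.
Proof.
have b0 := bb_ge0; have D1 := ltW D_gt0; rewrite /CS; apply: addr_ge0.
  by apply: mulr_ge0; [apply: mulr_ge0; [apply: mulr_ge0|exact: exprn_ge0]|exact: exprn_ge0].
by apply: mulr_ge0; [apply: mulr_ge0 => //; exact: exprn_ge0|exact: exprn_ge0].
Qed.

Lemma good_comp (S : finType) (E E' : ((S -> R) -> R) -> (S -> R) -> R) :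
  good E -> good E' -> good (fun F => E (E' F)).
Proof.
move=> gE gE'; split.
- by move=> F nF; apply: (good_nice gE); exact: good_nice.
- move=> F G V nF nG cV; rewrite -(good_D gE)//; [|exact: good_nice..].
  by apply: (good_ext gE) => //; [apply: good_nice => //; exact: niceD
    |by apply: niceD; apply: good_nice|move=> V' cV'; exact: good_D].
- move=> c F V nF cV; rewrite -(good_Z gE)//; last exact: good_nice.
  by apply: (good_ext gE) => //; [apply: good_nice => //; exact: niceZ
    |by apply: niceZ; apply: good_nice|move=> V' cV'; exact: good_Z].
- move=> F G nF nG FG V cV; apply: (good_mono gE) => //; [exact: good_nice..|].
  exact: good_mono.
- move=> s V cV; rewrite -[RHS](good_ev gE)//.
  apply: (good_ext gE) => //; [exact/good_nice/nice_ev|exact: nice_ev|].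
  by move=> V' cV'; exact: good_ev.
- have [L L0 HL] := good_growth gE; have [L' L'0 HL'] := good_growth gE'.
  exists (L' * L); first exact: mulr_ge0.
  move=> C F C1 nF bF; rewrite mulrA; apply: HL; rewrite ?mulr_ge0//.
    exact: good_nice.
  exact: HL'.
Qed.

Lemma geo_PoE_iter (S : finType) (E E' : ((S -> R) -> R) -> (S -> R) -> R) F V l :
  good E -> good E' -> nice F -> cone V -> 0 <= l ->
  geo (fun i => PoE l (fun j => iter i E (iter j E' F) V)).
Proof.
move=> gE gE' nF cV l0; have [L L0 HL] := iter_growth gE; have [L' L'0 HL'] := iter_growth gE'.
have [_ [C C1 bF]] := nF.
exists (C * (1 + tot V) ^+ 2 * expR (l * L' - l)), L; split => //.
  exact: mulr_ge0 (mulr_ge0 C1 (sqr_ge0 _)) (expR_ge0 _).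
move=> i; rewrite mulrAC; apply: PoE_geo_le => //.
  exact: mulr_ge0 (mulr_ge0 C1 (sqr_ge0 _)) (exprn_ge0 _ L0).
move=> j; have nj : nice (iter j E' F) by apply: good_nice => //; exact: good_iter.
have := HL _ _ i (mulr_ge0 C1 (exprn_ge0 j L'0)) nj (HL' C F j C1 nF bF) V cV.
by move=> /le_trans; apply; apply: eq_refl_le; ring.
Qed.

Lemma pois_partial_le l (g : nat -> R) J : 0 <= l -> (forall m, 0 <= g m) -> geo g ->
  \sum_(m < J) pois l m * g m <= PoE l g.
Proof.
move=> l0 g0 gg.
have gd (i : nat) : geo (fun m => (m == i)%:R : R).
  by apply: geo_le (geo_cst (1 : R)) _ => m; case: eqP => _; rewrite /= ?mulr1n ?mulr0n ?normr1 ?normr0.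
have -> : \sum_(m < J) pois l m * g m = PoE l (fun i => \sum_(m < J) g m * (i == m)%:R).
  rewrite PoE_sum//; last by move=> m; exact: geoZ.
  by apply: eq_bigr => m _; rewrite PoEZ// PoE_delta// mulrC.
apply: PoE_le => //; first by apply: geo_sum => m; exact: geoZ.
move=> i; have [iJ|Ji] := ltnP i J.
  rewrite (bigD1 (Ordinal iJ))//= eqxx mulr1 big1 ?addr0// => m /eqP mi.
  by case: eqP => [E|_]; [case: mi; exact/val_inj/esym|rewrite mulr0].
rewrite big1 ?g0// => m _; case: eqP => [E|_]; last by rewrite mulr0.
by move: (ltn_ord m); rewrite -E ltnNge Ji.
Qed.

Lemma nice_tens n F : nice F -> nice (fun V : n.+1.-tuple color -> R => F (tens (mass gam) V)).
Proof.
move=> [mF [C C1 bF]]; split.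
  move=> d X g mg; apply: mF => s; apply: measurable_funM => //; exact: mg.
exists C => // V cV; have := bF _ (cone_tens cone_mass cV).
by rewrite tot_tens tot_mass mul1r.
Qed.

(** * Upper bound: the cost of one more variable *)

Section tau_step.
Variables (n T : nat) (d eta BS : R).
Local Notation N := (n.+1%:R : R).
Local Notation N' := (n.+2%:R : R).
Local Notation de := (N'^-1).
Local Notation Q := (q.+1%:R : R).
Local Notation cfg := (n.+1.-tuple color).
Local Notation cfg' := (n.+2.-tuple color).
Hypotheses (kn : (k <= n.+1)%N) (T0 : (0 < T)%N) (d0 : 0 <= d) (e0 : 0 < eta).

Definition pino : ((cfg' -> R) -> R) -> (cfg' -> R) -> R :=
  op (unif 'I_n.+1 R \x unif color R)%E (fun x s => pinf x (tl s)).
Definition pinn : ((cfg' -> R) -> R) -> (cfg' -> R) -> R :=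
  op (unif color R) (fun z s => Q * (tnth s ord0 == z)%:R).

Lemma mult_pino : mult Q (fun x (s : cfg') => @pinf R q n x (tl s)).
Proof.
by split=> [s|x s|x s]; [exact: (mult_measurable (@mult_pin R q n))|exact: (mult_ge0 (@mult_pin R q n))|exact: (mult_le (@mult_pin R q n))].
Qed.

Lemma mean1_pino (s : cfg') : \int[(unif 'I_n.+1 R \x unif color R)%E]_x pinf x (tl s) = 1.
Proof. exact: (@pin_mean1 R q n). Qed.

Lemma good_pino : good pino.
Proof. exact: (good_op mult_pino mean1_pino (ler0n _ _)). Qed.

Lemma mult_pinn : mult Q (fun z (s : cfg') => Q * (tnth s ord0 == z)%:R).
Proof.
split=> [s|x s|x s]; first by case: (bmf_ord (R := R) (fun z : color => Q * (tnth s ord0 == z)%:R)).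
  by rewrite mulr_ge0.
by rewrite ler_piMr//; case: eqP.
Qed.

Lemma mean1_pinn (s : cfg') : \int[unif color R]_z (Q * (tnth s ord0 == z)%:R) = 1.
Proof.
rewrite Ex_unif ?card_ord; last by case: (bmf_ord (R := R) (fun z : color => Q * (tnth s ord0 == z)%:R)).
by rewrite -mulr_sumr sum_eq1 mulr1 mulVf.
Qed.

Lemma pin_mix F V : nice F -> cone V -> @pinop R q n.+1 F V = mixE de pinn pino F V.
Proof.
move=> nF cV; rewrite /pinop /op /mixE /pinn /pino /op Ex_pin.
rewrite (Ex_pin (fun x => F (fun s => V s * pinf x (tl s)))).
rewrite Ex_unif ?card_ord; last first.
  by case: (bmf_ord (R := R) (fun z : color => F (fun s => V s * (Q * (tnth s ord0 == z)%:R)))).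
rewrite big_ord_recl mulrDr; congr (_ + _); rewrite mulrA; congr (_ * _).
  have h : N' = N + 1 by rewrite natr1.
  have nz : N + 1 != 0 by rewrite -h pnatr_eq0.
  have nz1 : N != 0 by rewrite pnatr_eq0.
  by rewrite h; move: N nz nz1 => a nz nz1; field; rewrite nz nz1.
apply: eq_bigr => j _; congr (_ * _); apply: eq_bigr => z _; congr F; apply/funext => s.
by rewrite /pinf/= tnth_mktuple.
Qed.

Let pin_arith (x p1 p2 L c : R) : 0 <= x -> p1 <= L + c -> L <= p2 ->
  x * p1 + (1 - x) * p2 <= p2 + x * c.
Proof. by move=> x0 h1 h2; have := ler_wpM2l x0 h1; have := ler_wpM2l x0 h2; lra. Qed.

(** A pin hits the new variable with probability [de], and then raises [Lh] by at most [ln Q] times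
    the mass. *)
Lemma pin_le_pino V : cone V ->
  avgE T (@pinop R q n.+1) Lh V <= avgE T pino Lh V + T%:R * (de * ln Q) * tot V.
Proof.
move=> cV; have nL := @nice_Lh R cfg'; have gP := @good_pin R q n.+1; have gO := good_pino.
have Q0 : 0 <= Q by [].
have d1 : 0 <= de by rewrite invr_ge0.
have H V' : cone V' -> @pinop R q n.+1 Lh V' <= pino Lh V' + lin (fun=> de * ln Q) V'.
  move=> cV'; rewrite (pin_mix nL cV') /mixE lin_cst.
  have h1 := op_le_Lh mult_pinn mean1_pinn Q0 cV'.
  have h2 := Lh_le_op mult_pino Q0 mean1_pino cV'.
  rewrite -mulrA; exact: pin_arith d1 h1 h2.
have cPO : commutes (@pinop R q n.+1) pino by exact: (commutes_op _ _ (@mult_pin R q n.+1) mult_pino Q0 Q0).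
have Ti : 0 <= T%:R^-1 :> R by rewrite invr_ge0.
have Tn : T%:R != 0 :> R by rewrite pnatr_eq0 -lt0n.
have -> : T%:R * (de * ln Q) * tot V = T%:R^-1 * \sum_(t < T) T%:R * (de * ln Q) * tot V.
  by rewrite sumr_const card_ord -[(_ * tot V) *+ T]mulr_natl mulKf.
rewrite /avgE -mulrDr -big_split/=; apply: ler_wpM2l => //; apply: ler_sum => t _.
apply: le_trans (tele gP gO cPO nL H t cV) _; rewrite lerD2l lin_cst mulrA.
apply: ler_wpM2r; first exact: tot_ge0.
apply: ler_wpM2r; first by rewrite mulr_ge0// lnQ_ge0.
by rewrite ler_nat ltnW.
Qed.

Definition Lop i : ((cfg -> R) -> R) -> (cfg -> R) -> R :=
  fun F => iter i (@opA n) (avgE T (@pinop R q n) F).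
Definition aL i : R := Lop i Lh (@W0 n).
Definition Gj j (V : cfg -> R) : R := iter j (@opC n) Lh (tens (mass gam) V).

Lemma good_Lop i : good (Lop i).
Proof. by apply: good_comp; [exact/good_iter/good_opA|exact/good_avg/good_pin]. Qed.

Lemma nice_Gj j : nice (Gj j).
Proof.
by apply: nice_tens; apply: good_nice (@nice_Lh R cfg'); exact/good_iter/good_opC.
Qed.

(** The operators [op0] and [pino] act on the old coordinates only, so they pass through the tensor
    product with the prior of the new variable; commutation first places the pins outside the new
    factors. *)
Lemma iter_split i j : iter i (@op0 n) (iter j (@opC n) (avgE T pino Lh)) (@W0 n.+1) = Lop i (Gj j) (@W0 n).
Proof.
have cT := cone_tens cone_mass (@cone_W0 n); have nL := @nice_Lh R cfg'.
have gC := @good_opC n; have gO := good_pino.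
have cOC : commutes (avgE T pino) (iter j (@opC n)).
  apply: commutesC; apply: commutes_avg => //; first exact: good_iter.
  apply: commutesC; apply: commutes_iter => //.
  by exact: (commutes_op _ _ mult_pino (@mult_fC n) (ler0n _ _) bb_ge0).
rewrite W0_tens /op0 (iter_op_cone (G := avgE T pino (iter j (@opC n) Lh)) _ _ (@mult_f0 n))//; last first.
  by move=> V cV; rewrite cOC.
rewrite (@iter_op_map R _ _ _ _ (muA n) (@fA n) (@f0 n) (tens (mass gam))); last first.
  by move=> U x; apply/funext => s; rewrite /tens mulrA.
congr (iter _ _ _ _); apply/funext => V; rewrite /= /avgE; congr (_ * _); apply: eq_bigr => t _.
rewrite /pino (@iter_op_map R _ _ _ _ (unif 'I_n.+1 R \x unif color R)%E (@pinf R q n) _ (tens (mass gam)))//.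
by move=> U x; apply/funext => s; rewrite /tens mulrA.
Qed.

Lemma aLD i j : aL (i + j) = Lop i (iter j (@opA n) Lh) (@W0 n).
Proof.
have nL := @nice_Lh R cfg; have gA := @good_opA n; have gP := @good_pin R q n.
have cAP : commutes (avgE T (@pinop R q n)) (iter j (@opA n)).
  apply: commutesC; apply: commutes_avg => //; first exact: good_iter.
  apply: commutesC; apply: commutes_iter => //.
  by exact: (commutes_op _ _ (@mult_pin R q n) (@mult_fA n) (ler0n _ _) bb_ge0).
rewrite /aL /Lop iterD /opA; apply: (iter_op_cone _ _ (@mult_fA n)) (@cone_W0 n) => V cV.
by rewrite -/(@opA n) cAP.
Qed.

Lemma aL_convex i j : aL i + j%:R * (aL i.+1 - aL i) <= aL (i + j).
Proof.
have nL := @nice_Lh R cfg; have gA := @good_opA n; have gL := good_Lop i; have cW := @cone_W0 n.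
have nA : nice (fun V : cfg -> R => opA Lh V - Lh V) by apply: niceB => //; exact: good_nice.
have E1 : aL i.+1 = Lop i (opA Lh) (@W0 n) by rewrite -[i.+1]addn1 aLD.
rewrite aLD E1 /aL -(good_B gL _ nL cW); last exact: good_nice.
rewrite -(good_Z gL _ nA cW) -(good_D gL nL _ cW); last exact: niceZ.
apply: (good_mono gL) => //; first by apply: niceD => //; exact: niceZ.
  by apply: good_nice nL; exact: good_iter.
move=> V cV; exact: (iter_op_Lh (@mult_fA n) bb_ge0 (@mean1_fA n) bb_ge1 (fun x s => proj1 (andP (fA_bounds x s))) j cV).
Qed.

(** The mean number of factors by which the smaller graph exceeds the old part of the larger one,
    see [lamE2]; it is also the coefficient of the edge term in the Bethe functional. *)
Let muu : R := d * (1 - K^-1).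
(** The Poisson moment of [(4 * bb ^+ 2) ^+ j]: the errors of [C_est] grow like [bb ^+ (2 * j)]
    times [j] or [j ^+ 2], and [4 ^+ j] dominates both. *)
Let M0 : R := expR (d * (4 * (bb * bb)) - d).
Let h0 : R := K * Q * eta + K ^+ 2 / (eta * T%:R).
Let le := lin (@er n) (@W0 n).

Hypothesis HBS : forall pi, has_mean pi gam -> bF pi d - muu * aA pi <= BS.

Let Ki1 : K^-1 <= 1. Proof. by rewrite invf_le1// ler1n. Qed.
Let muu0 : 0 <= muu. Proof. by rewrite mulr_ge0// subr_ge0. Qed.

Lemma iter_opb_ge0 pi j : has_mean pi gam -> 0 <= iter j (opb pi) Lh (mass gam).
Proof.
move=> pm; have := iter_op_Lh mult_fb bb_ge0 (mean1_fb pm) bb_ge1 (fun x s => proj1 (andP (fb_bounds x s))) j cone_mass.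
apply: le_trans; have -> : Lh (mass gam) = 0 by rewrite /Lh tot_mass Lambda1.
rewrite add0r subr0; apply: mulr_ge0 => //.
have := Lh_le_op mult_fb bb_ge0 (mean1_fb pm) cone_mass.
by rewrite {1}/Lh tot_mass Lambda1.
Qed.

Let dl j : R := pois d j * (bb ^+ j * bb ^+ j).

Let gj_arith (t a A L e P S1 C X Sb c1 c2 : R) :
  muu * (t * a) <= muu * (A - L + (c1 * e + c2 * P)) -> t * Sb <= t * (BS + muu * a) ->
  t * Sb + (S1 * C * e + X) <=
  BS * t + muu * (A - L) + (muu * c1 + S1 * C) * e + (muu * c2 * P + X).
Proof. by move: muu => m h1 h2; lra. Qed.

(** By [C_est] the new variable contributes the variable term at [piW V], and [HBS] trades it for
    [BS] plus [muu] edge terms. By [opA_approx] the mass times an edge term is the increment due to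
    one more factor. *)
Lemma Gj_partial J V : cone V -> \sum_(j < J) pois d j * (Gj j V - Lh V) <=
  BS * tot V + muu * (opA Lh V - Lh V) + (muu * CA + (\sum_(j < J) dl j * j%:R) * C4) * lin (@er n) V +
  (muu * CP * \sum_(l < k.+1) perr eta l V + \sum_(j < J) dl j * \sum_(l < j * k.+1) perr eta l V).
Proof.
move=> cV; have t0 := tot_ge0 cV; have pm := piW_mean cV.
have gb : geo (fun j => iter j (opb (piW V)) Lh (mass gam)).
  by apply: geo_iter; [exact: good_opb|exact: nice_Lh|exact: cone_mass].
have H1 : \sum_(j < J) pois d j * iter j (opb (piW V)) Lh (mass gam) <= BS + muu * aA (piW V).
  apply: le_trans (pois_partial_le J d0 (fun j => iter_opb_ge0 j pm) gb) _.
  by have := HBS pm; rewrite /bF; lra.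
have H2 : tot V * aA (piW V) <= opA Lh V - Lh V + (CA * lin (@er n) V + CP * \sum_(l < k.+1) perr eta l V).
  by have := opA_approx cV e0; rewrite ler_norml /CP => /andP[h _]; move: h; rewrite lerNl opprB lerBlDr addrC.
apply: (@le_trans _ _ (\sum_(j < J) (tot V * (pois d j * iter j (opb (piW V)) Lh (mass gam)) +
    (dl j * j%:R * C4 * lin (@er n) V + dl j * \sum_(l < j * k.+1) perr eta l V)))).
  apply: ler_sum => j _; have := C_est j cV e0; rewrite -/(Gj j V) -addrA -lerBlDl => h.
  have := ler_wpM2l (pois_ge0 j d0) h => /le_trans; apply; apply: eq_refl_le; rewrite /dl; ring.
rewrite big_split big_split/= -mulr_sumr -!mulr_suml.
exact: gj_arith (ler_wpM2l muu0 H2) (ler_wpM2l t0 H1).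
Qed.

Let hl (l : nat) : R := eta * Q / 2 + (2 * eta)^-1 * (l%:R / T%:R).

Lemma Lop_perr i l : Lop i (perr eta l) (@W0 n) <= hl l.
Proof.
have gI := good_iter i (@good_opA n); have gav := good_avg T0 (@good_pin R q n).
have nP := @nice_perr R q n eta l; have cW := @cone_W0 n.
have := good_mono gI (good_nice gav nP) (niceZ (hl l) (@nice_tot R cfg)) (fun V cV => avg_perr l e0 T0 cV) cW.
by rewrite (good_Z gI _ (@nice_tot R cfg) cW) (good_tot gI cW) tot_W0 mulr1.
Qed.

Let nat4 (j : nat) : j%:R <= 4 ^+ j :> R.
Proof. by rewrite -natrX ler_nat ltnW// ltn_expl. Qed.

Let sq4 (j : nat) : j%:R * j%:R <= 4 ^+ j :> R.
Proof.
rewrite -natrM -natrX ler_nat (_ : 4 = 2 * 2)%N// expnMn leq_mul//; exact/ltnW/ltn_expl.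
Qed.

Let h00 : 0 <= K * Q * eta. Proof. by rewrite !mulr_ge0// ltW. Qed.
Let h01 : 0 <= K ^+ 2 / (eta * T%:R).
Proof. by rewrite divr_ge0 ?exprn_ge0 ?mulr_ge0// ltW. Qed.

Let sum_hl (j : nat) : \sum_(l < j * k.+1) hl l <= 4 ^+ j * h0.
Proof.
have Tn : T%:R != 0 :> R by rewrite pnatr_eq0 -lt0n.
have en : eta != 0 by rewrite gt_eqF.
apply: (@le_trans _ _ (\sum_(l < j * k.+1) hl (j * k.+1))).
  apply: ler_sum => l _; rewrite /hl lerD2l; apply: ler_wpM2l; first by rewrite invr_ge0 mulr_ge0// ltW.
  by apply: ler_wpM2r; rewrite ?invr_ge0// ler_nat ltnW.
rewrite sumr_const card_ord -[leLHS]mulr_natl natrM /hl.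
have -> : j%:R * K * (eta * Q / 2 + (2 * eta)^-1 * ((j * k.+1)%:R / T%:R)) =
  j%:R * (K * Q * eta) / 2 + (j%:R * j%:R) * (K ^+ 2 / (eta * T%:R)) / 2.
  by rewrite natrM; move: (T%:R) Tn => c cn; field; rewrite cn en.
have := ler_wpM2r h00 (nat4 j); have := ler_wpM2r h01 (sq4 j).
have p1 := mulr_ge0 (exprn_ge0 j (ler0n R 4)) h00; have p2 := mulr_ge0 (exprn_ge0 j (ler0n R 4)) h01.
rewrite /h0; lra.
Qed.

Let dl0 j : 0 <= dl j.
Proof. exact: mulr_ge0 (pois_ge0 _ d0) (mulr_ge0 (exprn_ge0 _ bb_ge0) (exprn_ge0 _ bb_ge0)). Qed.

Let sum_dl J : \sum_(j < J) dl j * 4 ^+ j <= M0.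
Proof.
have c0 : 0 <= 4 * (bb * bb) by exact: mulr_ge0 (ler0n _ 4) (mulr_ge0 bb_ge0 bb_ge0).
rewrite /M0 -PoEX//.
apply: le_trans (pois_partial_le J d0 (fun j => exprn_ge0 j c0) _); last first.
  by have := @geoX R 1 _ c0; under eq_fun do rewrite mul1r.
by apply: ler_sum => j _; apply: eq_refl_le; rewrite /dl !exprMn; ring.
Qed.

Let E0 : R := (muu * CA + M0 * C4) * le + (muu * CP + M0) * h0.

Let step_arith (S1 S2 S3 p3 x : R) : 0 <= le -> S1 <= M0 -> S2 <= h0 -> S3 <= M0 * h0 ->
  p3 <= BS + x + (muu * CA + S1 * C4) * le + (muu * CP * S2 + S3) -> p3 <= BS + x + E0.
Proof.
move=> le0 h1 h2 h3 /le_trans; apply; rewrite /E0 -!addrA lerD2l lerD2l.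
have := ler_wpM2r le0 (ler_wpM2r C4_ge0 h1).
have := ler_wpM2l (mulr_ge0 muu0 CP_ge0) h2; lra.
Qed.

(** [Lop i] integrates the previous bound: linear terms keep their value at the product weight, and
    the drifts are averaged over the number of pins. *)
Lemma Lop_partial i J :
  \sum_(j < J) pois d j * (Lop i (Gj j) (@W0 n) - aL i) <= BS + muu * (aL i.+1 - aL i) + E0.
Proof.
have cW := @cone_W0 n; have gL := good_Lop i; have nL := @nice_Lh R cfg.
have nA : nice (fun V : cfg -> R => opA Lh V - Lh V) by apply: niceB => //; apply: good_nice nL; exact: good_opA.
have nG j : nice (fun V : cfg -> R => Gj j V - Lh V) by apply: niceB => //; exact: nice_Gj.
have nS : nice (fun V : cfg -> R => \sum_(l < k.+1) perr eta l V : R) by apply: nice_sum => l; exact: nice_perr.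
have nS2 (j : nat) : nice (fun V : cfg -> R => \sum_(l < j * k.+1) perr eta l V : R) by apply: nice_sum => l; exact: nice_perr.
have nl : nice (lin (@er n)) by exact: nice_lin.
have nt : nice (@tot R cfg) by exact: nice_tot.
set S1 := \sum_(j < J) dl j * j%:R.
have n1' : nice (fun V : cfg -> R => BS * tot V + muu * (opA Lh V - Lh V) + (muu * CA + S1 * C4) * lin (@er n) V).
  by apply: niceD; [apply: niceD; exact: niceZ|exact: niceZ].
have n2' : nice (fun V : cfg -> R => \sum_(j < J) dl j * \sum_(l < j * k.+1) perr eta l V : R).
  by apply: nice_sum => j; exact: niceZ.
have n3' : nice (fun V : cfg -> R => muu * CP * (\sum_(l < k.+1) perr eta l V) + \sum_(j < J) dl j * \sum_(l < j * k.+1) perr eta l V : R).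
  by apply: niceD => //; exact: niceZ.
have nS0 : nice (fun V : cfg -> R => \sum_(j < J) pois d j * (Gj j V - Lh V)).
  by apply: nice_sum => j; exact: niceZ.
have := good_mono gL nS0 (niceD n1' n3') (fun V cV => Gj_partial J cV) cW.
rewrite (good_sum gL)//; last by move=> j; exact: niceZ.
rewrite (good_D gL n1' n3' cW) (good_D gL _ (niceZ _ nl) cW); last by apply: niceD; exact: niceZ.
rewrite (good_D gL (niceZ _ nt) (niceZ _ nA) cW) !(good_Z gL)// (good_tot gL cW) (good_lin gL _ cW) tot_W0 mulr1.
rewrite (good_B gL _ nL cW); last by apply: good_nice nL; exact: good_opA.
rewrite (good_D gL (niceZ _ nS) n2' cW) (good_Z gL _ nS cW).
rewrite (good_sum gL _ _ (fun l : 'I_k.+1 => @nice_perr R q n eta l) cW).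
rewrite (good_sum gL _ _ (fun j : 'I_J => niceZ (dl j) (nS2 j)) cW).
have -> : Lop i (opA Lh) (@W0 n) = aL i.+1 by rewrite -[i.+1]addn1 aLD.
under [X in X <= _ -> _]eq_bigr => j _ do rewrite (good_Z gL _ (nG j) cW) (good_B gL (nice_Gj j) nL cW).
apply: step_arith.
- exact: lin_er_ge0.
- apply: le_trans (sum_dl J); apply: ler_sum => j _; apply: ler_wpM2l => //; exact: nat4.
- apply: (@le_trans _ _ (\sum_(l < k.+1) hl l)); first by apply: ler_sum => l _; exact: Lop_perr.
  have Tn : T%:R != 0 :> R by rewrite pnatr_eq0 -lt0n.
  have en : eta != 0 by rewrite gt_eqF.
  apply: (@le_trans _ _ (\sum_(l < k.+1) hl k.+1)).
    apply: ler_sum => l _; rewrite /hl lerD2l; apply: ler_wpM2l; first by rewrite invr_ge0 mulr_ge0// ltW.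
    by apply: ler_wpM2r; rewrite ?invr_ge0// ler_nat ltnW.
  rewrite sumr_const card_ord -[leLHS]mulr_natl /hl.
  have -> : K * (eta * Q / 2 + (2 * eta)^-1 * (K / T%:R)) = (K * Q * eta) / 2 + (K ^+ 2 / (eta * T%:R)) / 2.
    by move: (T%:R) Tn => c cn; field; rewrite cn en.
  by move: h00 h01; rewrite /h0; lra.
have hh0 : 0 <= h0 by exact: addr_ge0.
apply: le_trans (ler_wpM2r hh0 (sum_dl J)); rewrite mulr_suml; apply: ler_sum => j _.
rewrite (good_Z gL _ (nS2 j) cW) -[leRHS]mulrA; apply: ler_wpM2l; first exact: dl0.
rewrite (good_sum gL _ _ (fun l : 'I_(j * k.+1) => @nice_perr R q n eta l) cW).
apply: le_trans (sum_hl j); apply: ler_sum => l _; exact: Lop_perr.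
Qed.

Let F : (cfg' -> R) -> R := avgE T pino Lh.
Let lam : R := d * N' / K.

Let lam0 : 0 <= lam. Proof. by rewrite /lam mulr_ge0 ?mulr_ge0 ?invr_ge0. Qed.
Let Kd1 : K * de <= 1. Proof. by rewrite ler_pdivrMr// mul1r ler_nat. Qed.
Let Kd0 : 0 <= K * de. Proof. by rewrite mulr_ge0 ?invr_ge0. Qed.
Let r01 : 0 <= 1 - K * de <= 1. Proof. by rewrite subr_ge0 Kd1/= gerBl. Qed.

Let A2 : ((cfg' -> R) -> R) -> (cfg' -> R) -> R := mixE (1 - K * de) (@op0 n) (@opC n).

Let good_F : good (avgE T pino). Proof. exact: good_avg T0 good_pino. Qed.
Let nF : nice F. Proof. exact: good_nice good_F _ (@nice_Lh R cfg'). Qed.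
Let good_A2 : good A2. Proof. by apply: good_mix; [exact: r01|exact: good_op0|exact: good_opC]. Qed.

Lemma A_step_avg V : cone V -> opA F V <= A2 F V + lin (@eA n) V.
Proof.
move=> cV; have nL := @nice_Lh R cfg'; have Q0 : 0 <= Q by [].
have gA := @good_opA n.+1; have gO := good_pino.
have cA : commutes (avgE T pino) (@opA n.+1).
  by apply: commutesC; apply: commutes_avg => //; exact: (commutes_op _ _ (@mult_fA n.+1) mult_pino bb_ge0 Q0).
have c0 : commutes (avgE T pino) (@op0 n).
  by apply: commutesC; apply: commutes_avg => //; [exact: good_op0|exact: (commutes_op _ _ (@mult_f0 n) mult_pino bb_ge0 Q0)].
have cC : commutes (avgE T pino) (@opC n).
  by apply: commutesC; apply: commutes_avg => //; [exact: good_opC|exact: (commutes_op _ _ (@mult_fC n) mult_pino bb_ge0 Q0)].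
have c2 : commutes (avgE T pino) A2.
  by rewrite /A2; apply: commutes_mix => //; [exact: good_op0|exact: good_opC].
rewrite /F -(cA _ _ nL cV) -(c2 _ _ nL cV) -(good_lin good_F (@eA n) cV).
have nA2 : nice (A2 Lh) by exact: good_nice good_A2 _ nL.
rewrite -(good_D good_F nA2 (nice_lin _) cV).
apply: (good_mono good_F _ (niceD nA2 (nice_lin _))) => //; first exact: good_nice gA _ nL.
by move=> V' cV'; exact: A_step.
Qed.

Lemma lin_eA_W0 : lin (@eA n) (@W0 n.+1) = CS * (de * le + de ^+ 2).
Proof.
rewrite W0_tens /lin (sum_tens (fun c (s : cfg) => mass gam c * W0 s * (CS * (de * er s + de ^+ 2)))).
have E c : \sum_(s : cfg) mass gam c * W0 s * (CS * (de * er s + de ^+ 2)) = mass gam c * (CS * (de * le + de ^+ 2)).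
  rewrite -[de ^+ 2 in RHS]mulr1 -[X in _ + _ * X](@tot_W0 n) /le /lin /tot !mulr_sumr -big_split/= !mulr_sumr.
  by apply: eq_bigr => s _; ring.
under eq_bigr do rewrite E.
by rewrite -mulr_suml; case: (dist_mass gam) => _ ->; rewrite mul1r.
Qed.

Let lamE : (1 - (1 - K * de)) * lam = d.
Proof.
have nz : N' != 0 by rewrite pnatr_eq0.
have kz : K != 0 by rewrite pnatr_eq0.
by rewrite /lam; move: K N' kz nz => x y xn yn; field; rewrite xn yn.
Qed.

Let lamE2 : (1 - K * de) * lam + muu = d * N / K.
Proof.
have h : N' = N + 1 by rewrite natr1.
have nz : N + 1 != 0 by rewrite -h pnatr_eq0.
have kz : K != 0 by rewrite pnatr_eq0.
by rewrite /lam /muu h; move: K N kz nz => x y xn yn; field; rewrite xn yn.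
Qed.

Let l00 : 0 <= (1 - K * de) * lam.
Proof. by apply: mulr_ge0 lam0; case/andP: r01. Qed.

(** By convexity [muu] times one increment is at most the mean effect of [Po(muu)] further factors.
    These complete the old factors to the Poisson number of the smaller graph. *)
Lemma tau_convex : PoE ((1 - K * de) * lam) (fun i => aL i + muu * (aL i.+1 - aL i)) <= PoE (d * N / K) aL.
Proof.
have nL := @nice_Lh R cfg; have gA := @good_opA n; have gav := good_avg T0 (@good_pin R q n); have cW := @cone_W0 n.
pose H : (cfg -> R) -> R := avgE T (@pinop R q n) Lh.
have nH : nice H by exact: good_nice.
have ga : geo aL by exact: geo_iter.
rewrite -lamE2; set l0 := (1 - K * de) * lam.
(* The proportion that splits the total rate into [l0] and [muu]; if both vanish, division by zero
   gives [0] and the identities below still hold. *)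
pose r := l0 / (l0 + muu).
have rr : 0 <= r <= 1 /\ (r * (l0 + muu) = l0 /\ (1 - r) * (l0 + muu) = muu).
  have := addr_ge0 l00 muu0; rewrite -/l0 le_eqVlt => /predU1P[z|z].
    have l0z : l0 = 0 by move: l00 muu0; rewrite -/l0; lra.
    have mz : muu = 0 by move: l00 muu0; rewrite -/l0; lra.
    by rewrite /r l0z mz mul0r lexx ler01 !mul0r addr0 mulr0.
  have zn : l0 + muu != 0 by rewrite gt_eqF.
  split; first by rewrite divr_ge0 ?(ltW z)//= ler_pdivrMr// mul1r lerDl.
  by rewrite /r; split; move: (l0) (muu) zn => x y zn; field.
have [r1 [rE1 rE2]] := rr.
(* Mixing [opA] with itself changes nothing but allows the Poisson number of steps to be split. *)
have E : PoE (l0 + muu) aL = PoE (l0 + muu) (fun m => iter m (mixE r (@opA n) (@opA n)) H (@W0 n)).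
  congr PoE; apply/funext => m; rewrite /aL /Lop.
  apply: (iter_ext m gA (good_mix r1 gA gA) _ nH cW) => G V nG cV.
  by rewrite /mixE -mulrDl addrC subrK mul1r.
rewrite E (PoE_mix (addr_ge0 l00 muu0) r1 gA gA (fun _ _ _ _ => erefl) nH cW) rE1 rE2.
have gS : geo (fun i => aL i.+1) .
  rewrite (_ : (fun i => aL i.+1) = fun i => iter i (@opA n) (opA H) (@W0 n)); last by apply/funext => i; rewrite /aL /Lop iterSr.
  by apply: geo_iter => //; exact: good_nice.
apply: PoE_le => //.
- by apply: geoD => //; apply: geoZ; exact: geoB.
- exact: geo_PoE_iter.
move=> i.
have -> : aL i + muu * (aL i.+1 - aL i) = PoE muu (fun j => aL i + (aL i.+1 - aL i) * j%:R).
  by rewrite (PoE_affine _ muu0 (geo_cst (aL i))) PoE_cst [muu * _]mulrC.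
apply: PoE_le => //; first by apply: geoD; [exact: geo_cst|apply: geoZ; exact: geo_id].
  have : geo (fun j => iter j (@opA n) (iter i (@opA n) H) (@W0 n)).
    by apply: geo_iter => //; apply: good_nice nH; exact: good_iter.
  by under eq_fun do rewrite -iterD addnC iterD.
move=> j; have := aL_convex i j; rewrite mulrC => /le_trans; apply.
by rewrite /aL /Lop iterD.
Qed.

(** Recursion in the number of variables for the pinned free entropy. The factors are split by
    [A_step_avg] into [Po(d)] with the new variable and the rest; their joint effect is bounded by
    [Lop_partial] and [tau_convex]. *)
Lemma tau_step : PoE lam (fun m => iter m (@opA n.+1) (avgE T (@pinop R q n.+1) Lh) (@W0 n.+1)) <=
  PoE (d * N / K) aL + BS + (T%:R * (de * ln Q) + lam * (CS * (de * le + de ^+ 2)) + E0).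
Proof.
have nL := @nice_Lh R cfg'; have gA := @good_opA n.+1; have cW := @cone_W0 n.+1.
have gav := good_avg T0 (@good_pin R q n.+1).
have cAA : commutes (@opA n.+1) A2.
  apply: commutes_mix => //; [exact: good_op0|exact: good_opC| |].
    by exact: (commutes_op _ _ (@mult_fA n.+1) (@mult_f0 n) bb_ge0 bb_ge0).
  by exact: (commutes_op _ _ (@mult_fA n.+1) (@mult_fC n) bb_ge0 bb_ge0).
set c1 := T%:R * (de * ln Q).
have S1 m : iter m (@opA n.+1) (avgE T (@pinop R q n.+1) Lh) (@W0 n.+1) <=
    iter m A2 F (@W0 n.+1) + c1 + lin (@eA n) (@W0 n.+1) * m%:R.
  have gI := good_iter m gA; have nt : nice (fun V : cfg' -> R => c1 * tot V) by apply: niceZ; exact: nice_tot.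
  have := good_mono gI (good_nice gav nL) (niceD nF nt) (fun V cV => pin_le_pino cV) cW.
  rewrite (good_D gI nF nt cW) (good_Z gI _ (@nice_tot R cfg') cW) (good_tot gI cW) tot_W0 mulr1.
  move=> /le_trans; apply; have := tele gA good_A2 cAA nF A_step_avg m cW.
  rewrite [m%:R * _]mulrC; move: (iter _ _ _ _) (iter _ _ _ _) (lin _ _ * _) => x y z; lra.
have g2 : geo (fun m => iter m A2 F (@W0 n.+1)) by exact: geo_iter.
have g3 : geo (fun m => iter m A2 F (@W0 n.+1) + c1) by apply: geoD => //; exact: geo_cst.
have g1 : geo (fun m => iter m (@opA n.+1) (avgE T (@pinop R q n.+1) Lh) (@W0 n.+1)).
  by apply: geo_iter => //; exact: good_nice.
apply: le_trans (PoE_le lam0 g1 (geoD g3 (geoZ _ (@geo_id R))) S1) _.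
rewrite (PoE_affine _ lam0 g3) (PoED lam0 g2 (geo_cst c1)) PoE_cst lin_eA_W0.
rewrite (PoE_mix lam0 r01 (@good_op0 n) (@good_opC n) _ nF cW); last first.
  by exact: (commutes_op _ _ (@mult_f0 n) (@mult_fC n) bb_ge0 bb_ge0).
rewrite lamE.
have S2 i : PoE d (fun j => iter i (@op0 n) (iter j (@opC n) F) (@W0 n.+1)) <=
    aL i + muu * (aL i.+1 - aL i) + (BS + E0).
  have gj : geo (fun j => iter i (@op0 n) (iter j (@opC n) F) (@W0 n.+1)).
    have gi0 := good_iter i (@good_op0 n).
    have : geo (fun j => iter j (@opC n) (iter i (@op0 n) F) (@W0 n.+1)).
      by apply: geo_iter => //; [exact: good_opC|exact: good_nice].
    have E j : iter j (@opC n) (iter i (@op0 n) F) (@W0 n.+1) = iter i (@op0 n) (iter j (@opC n) F) (@W0 n.+1).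
      apply/esym/(commutes_iter j (@good_opC n) gi0) => //.
      apply: commutesC; apply: commutes_iter => //; [exact: good_op0|exact: good_opC|].
      by exact: (commutes_op _ _ (@mult_fC n) (@mult_f0 n) bb_ge0 bb_ge0).
    by under eq_fun do rewrite E.
  have gd : geo (fun j => iter i (@op0 n) (iter j (@opC n) F) (@W0 n.+1) - aL i).
    by apply: geoB => //; exact: geo_cst.
  have -> : PoE d (fun j => iter i (@op0 n) (iter j (@opC n) F) (@W0 n.+1)) =
     PoE d (fun j => iter i (@op0 n) (iter j (@opC n) F) (@W0 n.+1) - aL i) + aL i.
    by rewrite (PoEB d0 gj (geo_cst _)) PoE_cst subrK.
  (* The bound of the partial sums holds exactly, so the tail allowance is taken to be [0]. *)
  have := @PoE_le_partial R d d0 _ (BS + muu * (aL i.+1 - aL i) + E0) 0 0 (lexx 0) gd.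
  move=> H; rewrite addrC -addrA lerD2l; apply: le_trans (H _) _ => [J|].
    rewrite mul0r addr0; apply: le_trans (Lop_partial i J); apply: eq_refl_le.
    by apply: eq_bigr => j _; rewrite iter_split.
  by rewrite [BS + _]addrC -addrA.
have gS2 : geo (fun i => aL i + muu * (aL i.+1 - aL i)).
  have gA' := @good_opA n; have nH : nice (avgE T (@pinop R q n) Lh : (cfg -> R) -> R).
    by apply: good_nice (@nice_Lh R cfg); exact: good_avg T0 (@good_pin R q n).
  have ga : geo aL by apply: geo_iter => //; exact: cone_W0.
  have gS : geo (fun i => aL i.+1).
    rewrite (_ : (fun i => aL i.+1) = fun i => iter i (@opA n) (opA (avgE T (@pinop R q n) Lh)) (@W0 n)); last by apply/funext => i; rewrite /aL /Lop iterSr.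
    by apply: geo_iter => //; [exact: good_nice|exact: cone_W0].
  by apply: geoD => //; apply: geoZ; exact: geoB.
have gP := geo_PoE_iter (@good_op0 n) (@good_opC n) nF cW d0.
have := PoE_le l00 gP (geoD gS2 (geo_cst (BS + E0))) S2.
rewrite (PoED l00 gS2 (geo_cst _)) PoE_cst => S3.
have := tau_convex; move: S3; set c3 := CS * _; rewrite [c3 * lam]mulrC.
move: (PoE _ _) (PoE _ _) (PoE _ _) (lam * c3) => x1 x2 x3 x4; lra.
Qed.

End tau_step.

Definition tau T n d : R :=
  PoE (d * n.+1%:R / K) (fun m => iter m (@opA n) (avgE T (@pinop R q n) Lh) (@W0 n)).

Lemma Tn_le n d : 0 <= d -> Tn n d <= d * n.+1%:R / K * ln bb.
Proof.
move=> d0; have gA := @good_opA n; have cW := @cone_W0 n; have nL := @nice_Lh R (n.+1.-tuple color).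
have l0 : 0 <= d * n.+1%:R / K by rewrite mulr_ge0 ?mulr_ge0 ?invr_ge0.
have H (V : n.+1.-tuple color -> R) : cone V -> opA Lh V <= idE Lh V + lin (fun=> ln bb) V.
  move=> cV; rewrite lin_cst; exact: (op_le_Lh (@mult_fA n) (@mean1_fA n) bb_ge0 cV).
have S m : iter m (@opA n) Lh (@W0 n) <= 0 + ln bb * m%:R.
  have := tele gA (@good_id R _) (@commutes_id R _ (@opA n)) nL H m cW.
  have -> : iter m idE Lh (@W0 n) = 0.
    have -> : iter m idE (@Lh R (n.+1.-tuple color)) = Lh by elim: m => // m /= ->.
    by rewrite /Lh tot_W0 Lambda1.
  by rewrite lin_cst tot_W0 mulr1 [m%:R * _]mulrC.
rewrite /Tn; apply: le_trans (PoE_le l0 (geo_iter gA nL cW) (geoD (geo_cst 0) (geoZ (ln bb) (@geo_id R))) S) _.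
by rewrite (PoE_affine _ l0 (geo_cst 0)) PoE_cst add0r mulrC.
Qed.

(** For summing the errors of order [N^(-1/2)] over all variables. The constant comes from
    [sqrt (N + 1) + sqrt N <= 3 sqrt N]. *)
Lemma sqrt_step (N : R) : 1 <= N -> 3 * Num.sqrt N + (Num.sqrt N)^-1 <= 3 * Num.sqrt (N + 1).
Proof.
move=> N1; have N0 : 0 <= N by lra.
set a := Num.sqrt N; set b := Num.sqrt (N + 1).
have aa : a ^+ 2 = N by rewrite sqr_sqrtr.
have bb' : b ^+ 2 = N + 1 by rewrite sqr_sqrtr// addr_ge0.
have a0 : 0 < a by rewrite sqrtr_gt0 (lt_le_trans ltr01).
have b0 : 0 <= b by exact: sqrtr_ge0.
have ab : b <= 2 * a.
  rewrite -(@ler_pXn2r _ 2)// ?nnegrE//; last by rewrite mulr_ge0// ltW.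
  by rewrite exprMn aa bb'; lra.
have le : a <= b by rewrite ler_wsqrtr// lerDl.
have h : 1 <= 3 * a * (b - a).
  have E : (b + a) * (b - a) = 1.
    have -> : (b + a) * (b - a) = b ^+ 2 - a ^+ 2 by ring.
    by rewrite bb' aa; ring.
  rewrite -[X in X <= _]E; apply: ler_wpM2r; [by rewrite subr_ge0|lra].
rewrite -(ler_pM2r a0) mulrDl mulVf ?gt_eqF//; lra.
Qed.

Definition exp_cst (dup : R) : R := expR (dup * (4 * (bb * bb))).
Definition sqrt_cst (dup : R) : R :=
  (dup * CA + exp_cst dup * C4) * q.+1%:R + dup * (CS * (q.+1%:R + 1)).
Definition slope_cst (dup : R) : R := (dup * CP + exp_cst dup) * (K * q.+1%:R + K ^+ 2).

Lemma sqrt_cst_ge0 dup : 0 <= dup -> 0 <= sqrt_cst dup.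
Proof.
move=> dup0; apply: addr_ge0; apply: mulr_ge0 => //; last first.
  by apply: mulr_ge0; [exact: CS_ge0|apply: addr_ge0].
apply: addr_ge0; apply: mulr_ge0 => //; [exact: CA_ge0|exact: expR_ge0|exact: C4_ge0].
Qed.

Lemma slope_cst_ge0 dup : 0 <= dup -> 0 <= slope_cst dup.
Proof.
move=> dup0; apply: mulr_ge0.
  by apply: addr_ge0; [apply: mulr_ge0 => //; exact: CP_ge0|exact: expR_ge0].
by apply: addr_ge0; [exact: mulr_ge0|exact: exprn_ge0].
Qed.

(** * Upper bound: summation over the variables *)

Section upper.
Variables (d dup BS b : R).
Hypotheses (d0 : 0 <= d) (dd : d <= dup) (BSb : `|BS| <= b).
Hypothesis HBS : forall pi, has_mean pi gam -> bF pi d - d * (1 - K^-1) * aA pi <= BS.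
Local Notation Q := (q.+1%:R : R).

Local Notation M1 := (exp_cst dup).
Local Notation c1 := (sqrt_cst dup).
Local Notation c2 := (slope_cst dup).

Let C40 := C4_ge0.
Let CP0 := CP_ge0.
Let CS0 := CS_ge0.
Let dup0 : 0 <= dup. Proof. exact: le_trans dd. Qed.
Let M10 : 0 <= M1. Proof. exact: expR_ge0. Qed.
Let c10 := sqrt_cst_ge0 dup0.
Let c20 := slope_cst_ge0 dup0.

Let err_arith (mu m0 le' h' lq t de' s lm x y : R) : 0 <= mu -> mu <= dup -> 0 <= m0 -> m0 <= M1 ->
  0 <= le' -> le' <= Q * s -> 0 <= de' -> de' <= s -> 0 <= h' ->
  h' <= (K * Q + K ^+ 2) * x -> 0 <= lq -> 0 <= t ->
  lm * (CS * (de' * le' + de' ^+ 2)) = y * (CS * (le' + de')) -> 0 <= y -> y <= dup ->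
  t * (de' * lq) + lm * (CS * (de' * le' + de' ^+ 2)) +
  ((mu * CA + m0 * C4) * le' + (mu * CP + m0) * h') <= (c1 + lq * t) * s + c2 * x.
Proof.
move=> mu0 mud m00 m01 l0 ls de0 des h0 hx lq0 t0 -> y0 yd.
have a1 : t * (de' * lq) <= lq * t * s.
  have -> : t * (de' * lq) = lq * t * de' by ring.
  by apply: ler_wpM2l => //; exact: mulr_ge0.
have a2 : y * (CS * (le' + de')) <= dup * (CS * (Q + 1)) * s.
  have -> : dup * (CS * (Q + 1)) * s = dup * (CS * (Q * s + s)) by ring.
  apply: ler_pM => //; first by apply: mulr_ge0 => //; exact: addr_ge0.
  by apply: ler_wpM2l => //; exact: lerD.
have a3 : (mu * CA + m0 * C4) * le' <= (dup * CA + M1 * C4) * Q * s.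
  rewrite -[leRHS]mulrA; apply: ler_pM => //.
    by apply: addr_ge0; apply: mulr_ge0 => //; exact: CA_ge0.
  by apply: lerD; apply: ler_wpM2r => //; exact: CA_ge0.
have a4 : (mu * CP + m0) * h' <= c2 * x.
  rewrite /slope_cst -[leRHS]mulrA; apply: ler_pM => //.
    by apply: addr_ge0 => //; exact: mulr_ge0.
  by apply: lerD => //; exact: ler_wpM2r.
rewrite /sqrt_cst; lra.
Qed.

Variables (T : nat) (eta : R).
Hypotheses (T0 : (0 < T)%N) (e0 : 0 < eta).
Local Notation x := (eta + (eta * T%:R)^-1).

Lemma tau_step_le n : (k <= n)%N -> tau T n.+1 d <= tau T n d + BS + ((c1 + ln Q * T%:R) / Num.sqrt n.+1%:R + c2 * x).
Proof.
move=> kn; have := @tau_step n T d eta BS (leq_trans kn (leqnSn n)) T0 d0 e0 HBS.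
rewrite -/(tau T n.+1 d) -[PoE (d * n.+1%:R / K) _]/(tau T n d) => /le_trans; apply; rewrite lerD2l.
have K1 : K^-1 <= 1 by rewrite invf_le1// ler1n.
have Ki : 0 <= K^-1 by rewrite invr_ge0.
have s1 : 1 <= Num.sqrt (n.+1%:R : R) by rewrite -[X in X <= _]sqrtr1 ler_wsqrtr// ler1n.
have s0 : 0 < Num.sqrt (n.+1%:R : R) by exact: lt_le_trans s1.
have tp : 0 < T%:R :> R by rewrite ltr0n.
apply: (@err_arith _ _ _ _ _ _ _ _ _ _ (d / K)).
- by rewrite mulr_ge0// subr_ge0.
- by apply: le_trans dd; rewrite ler_piMr// gerBl.
- exact: expR_ge0.
- rewrite ler_expR; apply: (@le_trans _ _ (d * (4 * (bb * bb)))); first by rewrite gerBl.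
  by apply: ler_wpM2r => //; exact: mulr_ge0 (ler0n _ 4) (mulr_ge0 bb_ge0 bb_ge0).
- exact: (lin_er_ge0 (@cone_W0 n)).
- exact: lin_er_W0.
- by rewrite invr_ge0.
- rewrite lef_pV2 ?posrE// -[leLHS]mulr1 -[leRHS](sqr_sqrtr (ler0n R n.+2)).
  apply: (@le_trans _ _ (Num.sqrt n.+2%:R * Num.sqrt n.+2%:R)); last by rewrite expr2.
  apply: ler_pM; [exact: sqrtr_ge0|exact: ler01|by rewrite ler_wsqrtr// ler_nat|].
  by rewrite -[X in X <= _]sqrtr1 ler_wsqrtr// ler1n.
- by rewrite addr_ge0// ?divr_ge0 ?mulr_ge0 ?exprn_ge0// ltW.
- have p1 : 0 <= (eta * T%:R)^-1 by rewrite invr_ge0 mulr_ge0// ltW.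
  have := mulr_ge0 (mulr_ge0 (ler0n R k.+1) (ler0n R q.+1)) p1.
  have := mulr_ge0 (exprn_ge0 2 (ler0n R k.+1)) (ltW e0); lra.
- by rewrite ln_ge0// ler1n.
- exact: ltW.
- have nz : n.+2%:R != 0 :> R by rewrite pnatr_eq0.
  have kz : K != 0 by rewrite pnatr_eq0.
  by move: CS (lin _ _) K (n.+2%:R) kz nz => x1 x2 x3 x4 h1 h2; field; rewrite h1 h2.
- exact: mulr_ge0.
- by apply: le_trans dd; rewrite ler_piMr.
Qed.

Lemma tau_bounds n : Tn n d <= tau T n d <= Tn n d + T%:R * ln Q.
Proof.
have cW := @cone_W0 n; have nL := @nice_Lh R (n.+1.-tuple color); have gA := @good_opA n.
have gav := good_avg T0 (@good_pin R q n).
have l0 : 0 <= d * n.+1%:R / K by rewrite mulr_ge0 ?mulr_ge0 ?invr_ge0.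
have nF := good_nice gav nL.
have g1 : geo (fun m => iter m (@opA n) Lh (@W0 n)) by exact: geo_iter.
have g2 : geo (fun m => iter m (@opA n) (avgE T (@pinop R q n) Lh) (@W0 n)) by exact: geo_iter.
rewrite /tau /Tn; apply/andP; split.
  apply: (PoE_le l0 g1 g2) => m; apply: (good_mono (good_iter m gA)) => // V cV.
  by case/andP: (avg_pin_bounds T0 cV).
rewrite -[T%:R * ln Q](PoE_cst (d * n.+1%:R / K)) -(PoED l0 g1 (geo_cst _)).
apply: (PoE_le l0 g2 (geoD g1 (geo_cst _))) => m; have gI := good_iter m gA.
have nt : nice (fun V : n.+1.-tuple color -> R => T%:R * ln Q * tot V) by apply: niceZ; exact: nice_tot.
have := good_mono gI nF (niceD nL nt) (fun V cV => proj2 (andP (avg_pin_bounds T0 cV))) cW.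
by rewrite (good_D gI nL nt cW) (good_Z gI _ (@nice_tot R _) cW) (good_tot gI cW) tot_W0 mulr1.
Qed.

Lemma tau_sum m : tau T (k + m) d <= tau T k d + m%:R * BS +
  3 * (c1 + ln Q * T%:R) * Num.sqrt (k + m).+1%:R + m%:R * (c2 * x).
Proof.
have lq : 0 <= ln Q by rewrite ln_ge0// ler1n.
have cc0 : 0 <= c1 + ln Q * T%:R by apply: addr_ge0 => //; exact: mulr_ge0.
elim: m => [|m IH].
  by rewrite addn0 !mul0r !addr0 lerDl !mulr_ge0 ?sqrtr_ge0.
rewrite addnS; apply: le_trans (tau_step_le (leq_addr m k)) _.
have h := @sqrt_step (k + m).+1%:R; rewrite natr1 ler1n in h.
have := ler_wpM2l cc0 (h isT); move: IH; rewrite -[m.+1%:R]natr1.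
move: (tau T (k + m) d) (tau T k d) (Num.sqrt _) (Num.sqrt _) => y1 y2 y3 y4.
move: (c1 + _) (c2 * _) (m%:R) => z1 z2 z3; lra.
Qed.

Let ub1 (t y z l nb kb tq s h : R) : t <= y -> y <= z -> z <= l -> - kb <= nb ->
  0 <= tq -> 0 <= s -> 0 <= h -> t <= nb + (kb + l) + tq + s + h.
Proof. lra. Qed.

Let ub2 (t tn tk0 tk y l nb mb kb tq s h mh : R) : t <= tn -> tn <= tk0 + mb + s + mh ->
  tk0 <= tk + tq -> tk <= y -> y <= l -> mb <= nb + kb -> mh <= h ->
  t <= nb + (kb + l) + tq + s + h.
Proof. lra. Qed.

(** The recursion is run from [k] upwards, and its start as well as all smaller [n] are covered by
    the crude bound [Tn_le], uniformly in [d]. *)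
Lemma upper_bound n : Tn n d <= n.+1%:R * BS + (K * b + dup * ln bb) + T%:R * ln Q +
  3 * (c1 + ln Q * T%:R) * Num.sqrt n.+1%:R + n.+1%:R * (c2 * x).
Proof.
have lq : 0 <= ln Q by rewrite ln_ge0// ler1n.
have lb : 0 <= ln bb by rewrite ln_ge0// bb_ge1.
have cc0 : 0 <= c1 + ln Q * T%:R by apply: addr_ge0 => //; exact: mulr_ge0.
have tq : 0 <= T%:R * ln Q by exact: mulr_ge0.
have s0 : 0 <= 3 * (c1 + ln Q * T%:R) * Num.sqrt n.+1%:R by rewrite !mulr_ge0 ?sqrtr_ge0.
have x0 : 0 <= x by rewrite addr_ge0 ?invr_ge0 ?mulr_ge0// ltW.
have cx : 0 <= c2 * x by exact: mulr_ge0.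
have /andP[B1 B2] : - b <= BS <= b by rewrite -ler_norml.
have b0 : 0 <= b by exact: le_trans BSb.
have Kp : 0 <= K by [].
have dl : d * ln bb <= dup * ln bb by exact: ler_wpM2r.
(* For fewer variables nothing is iterated; the term [K * b] absorbs a possibly negative
   [n.+1%:R * BS]. *)
have [nk|kn] := ltnP n k.
  have := Tn_le n d0.
  have h1 : d * n.+1%:R / K * ln bb <= d * ln bb.
    apply: ler_wpM2r => //; rewrite ler_pdivrMr ?ltr0n//; apply: ler_wpM2l => //.
    by rewrite ler_nat ltnW.
  have h2 : - (K * b) <= n.+1%:R * BS.
    apply: (@le_trans _ _ (n.+1%:R * - b)); last exact: ler_wpM2l.
    by rewrite mulrN lerN2; apply: ler_wpM2r => //; rewrite ler_nat ltnW.
  have h3 : 0 <= n.+1%:R * (c2 * x) by exact: mulr_ge0.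
  move=> h4; exact: (ub1 h4 h1 dl h2 tq s0 h3).
have /andP[t1 _] := tau_bounds n; have /andP[_ t2] := tau_bounds k.
have t3 : Tn k d <= d * ln bb by have := Tn_le k d0; rewrite mulfK ?pnatr_eq0.
have := tau_sum (n - k); rewrite subnKC// natrB// => t4.
have h2 : (n%:R - k%:R) * BS <= n.+1%:R * BS + K * b.
  have -> : (n%:R - k%:R) * BS = n.+1%:R * BS + K * - BS by rewrite -![_.+1%:R]natr1; ring.
  by rewrite lerD2l; apply: ler_wpM2l => //; rewrite lerNl.
have h3 : (n%:R - k%:R) * (c2 * x) <= n.+1%:R * (c2 * x).
  apply: ler_wpM2r => //; apply: (@le_trans _ _ n%:R); [by rewrite gerBl|by rewrite ler_nat].
exact: (ub2 t1 t4 t2 t3 dl h2 h3).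
Qed.

End upper.

(** * Change of measure *)

Section density.
Context d (T : measurableType d) (P : probability T R) (h : T -> R).
Hypotheses (bh : bmf h) (h0 : forall x, 0 <= h x).

Definition densm (A : set T) : \bar R := (\int[P]_(x in A) (h x)%:E)%E.

Let densm0 : densm set0 = 0%E.
Proof. exact: integral_set0. Qed.

Let densm_ge0 A : (0 <= densm A)%E.
Proof. by apply: integral_ge0 => x _; rewrite lee_fin. Qed.

Let densm_sigma_additive : semi_sigma_additive densm.
Proof.
apply: semi_sigma_additive_nng_induced => [|x]; last by rewrite lee_fin.
by apply/measurable_EFinP; case: bh.
Qed.

HB.instance Definition _ := isMeasure.Build _ _ _ densm densm0 densm_ge0 densm_sigma_additive.

Let densm_fin : fin_num_fun densm.
Proof.
move=> A mA; apply: integrable_fin_num => //.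
exact: integrableS (bmf_integrable P bh).
Qed.

HB.instance Definition _ := Measure_isFinite.Build _ _ _ densm densm_fin.

(** The density [h] agrees almost everywhere with the Radon-Nikodym derivative of [densm], since
    both have the same integrals over measurable sets. *)
Lemma Ex_density (nu : {measure set T -> \bar R}) (f : T -> R) :
  (forall A, measurable A -> nu A = (\int[P]_(x in A) (h x)%:E)%E) ->
  bmf f -> \int[nu]_x f x = \int[P]_x (f x * h x).
Proof.
move=> nuE bf; rewrite /Rintegral; congr fine.
rewrite (@eq_measure_integral _ _ _ _ densm); last by move=> A mA _; exact: nuE.
have dom : densm `<< P.
  apply/null_content_dominatesP => A mA PA.
  rewrite /densm; apply: null_set_integral => //.
  by apply/measurable_funTS/measurable_EFinP; case: bh.
have fi : densm.-integrable setT (EFin \o f).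
  have [mf [C fC]] := bf.
  apply: (@le_integrable _ _ _ densm _ _ _ (EFin \o cst C)) => //; first exact/measurable_EFinP.
    by move=> x _; rewrite /= lee_fin (le_trans (fC x))// ler_norm.
  have H := @finite_measure_integrable_cst _ _ _ densm setT C measurableT.
  exact: H.
rewrite -(Radon_Nikodym_change_of_variables dom measurableT fi).
apply: ae_eq_integral => //.
- apply: emeasurable_funM; first by apply/measurable_EFinP; case: bf.
  by apply: (measurable_int P); exact: Radon_Nikodym_integrable.
- by apply/measurable_EFinP; case: (bmfM bf bh).
under [X in ae_eq _ _ _ X]eq_fun do rewrite EFinM.
apply: ae_eqe_mul2l; apply: integral_ae_eq => //.
- exact: Radon_Nikodym_integrable.
- by apply/measurable_EFinP; case: bh.
by move=> A _ mA; rewrite -Radon_Nikodym_integral.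
Qed.

End density.

Lemma prod_box d1 d2 (T1 : measurableType d1) (T2 : measurableType d2)
    (P : probability T1 R) (Q : probability T2 R) (A : set T1) :
  measurable A -> P A = 1%E -> (P \x Q)%E (A `*` setT) = 1%E.
Proof.
move=> mA PA; transitivity (P A * Q setT)%E; first exact: product_measure1E.
by rewrite PA probability_setT mule1.
Qed.

Lemma iid_box d (T : measurableType d) (P : probability T R) (B : set T) m :
  measurable B -> P B = 1%E -> iid P m [set x | forall a, B (tnth x a)] = 1%E.
Proof.
move=> mB PB; rewrite (@iidE _ T R P m (fun=> B))//.
by rewrite PB; elim: m => [|m IH]; rewrite ?big_ord0// big_ord_recl mul1e.
Qed.

Lemma measurable_iid_box d (T : measurableType d) (B : set T) m :
  measurable B -> measurable [set x : m.-tuple T | forall a, B (tnth x a)].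
Proof.
move=> mB; rewrite (_ : [set x | _] = \bigcap_(i in [set: 'I_m]) ((@tnth _ T ^~ i) @^-1` B)).
  apply: fin_bigcap_measurable; first exact: finite_finset.
  by move=> i _; rewrite -[X in measurable X]setTI; exact: measurable_tnth.
by apply/seteqP; split => [x xB i _|x xB i]; [exact: xB|exact: (xB i)].
Qed.

(** * The Bethe functional in normalised form *)

Section bethe_formula.
Variables (pi : probability simplex R) (d : R).
Hypotheses (pm : has_mean pi gam) (d0 : 0 <= d).

Let xi0 := xi_gt0.

Lemma Ex_Zf : \int[(p \x iid pi k.+1)%E]_x Lambda (Zf x.1 x.2) = xi_ * aA pi + Lambda xi_.
Proof.
have bH : bmf (fun x : W * k.+1.-tuple simplex => xi_ * Lambda (yA x.1 x.2) + Lambda xi_ * yA x.1 x.2).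
  by apply: bmfD; apply: bmfZ; [exact: bmf_LyA|exact: bmf_yA].
have -> : \int[(p \x iid pi k.+1)%E]_x Lambda (Zf x.1 x.2) =
    \int[(p \x iid pi k.+1)%E]_x (xi_ * Lambda (yA x.1 x.2) + Lambda xi_ * yA x.1 x.2).
  have mm h z : measurable_fun setT (fun x : W * k.+1.-tuple simplex => masses x.2 h z).
    by have [mm _] := bmf_masses h z; exact: (measurableT_comp mm measurable_snd).
  apply: (@Ex_as _ _ _ _ (box `*` setT)).
  - by apply: measurableX => //; exact: measurable_box.
  - by apply: prod_box; [exact: measurable_box|exact: p_box].
  - have mz : measurable_fun setT (fun x : W * k.+1.-tuple simplex => Zf x.1 x.2).
      exact: (measurable_ml_weight (G := fun x => masses x.2) measurable_fst mm).
    by apply: measurable_funM => //; apply: measurableT_comp.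
  - by case: bH.
  by move=> [psi g] [bx _]; rewrite ZfE// LambdaMxi// yA_ge0.
rewrite ExD; [|by apply: bmfZ; exact: bmf_LyA|by apply: bmfZ; exact: bmf_yA].
by rewrite !ExZ; [rewrite Ex_yA// mulr1|exact: bmf_yA|exact: bmf_LyA].
Qed.

Local Notation XS := (W * 'I_k.+1 * k.+1.-tuple simplex)%type.

Definition yv m (x : m.-tuple XS) : R := \sum_s mass gam s * prodf fb x s.

Lemma ZvE m (x : m.-tuple XS) : Zv gam x =
  \sum_s mass gam s * \prod_(a < m) ml (fun t => ((tnth x a).1.1 t)%:num)
    (upd (masses (tnth x a).2) (tnth x a).1.2 (delta s)).
Proof.
apply: eq_bigr => s _; congr (_ * _); apply: eq_bigr => a _.
case: (tnth x a) => -[psi h] g /=; apply: eq_bigr => t _.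
by rewrite prod_upd /delta; ring.
Qed.

Lemma measurable_Zv m : measurable_fun setT (fun x : m.-tuple XS => Zv gam x).
Proof.
rewrite (_ : (fun x => _) = fun x : m.-tuple XS => \sum_s mass gam s * \prod_(a < m)
   ml (fun t => ((tnth x a).1.1 t)%:num) (upd (masses (tnth x a).2) (tnth x a).1.2 (delta s))); last first.
  by apply/funext => x; exact: ZvE.
apply: measurable_sum => s; apply: measurable_funM => //; apply: measurable_prod => a _.
apply: (@measurableT_comp _ _ _ _ _ _ (fun y : XS => ml (fun t => (y.1.1 t)%:num) (upd (masses y.2) y.1.2 (delta s))) _ (fun x : m.-tuple XS => tnth x a)); last exact: measurable_tnth.
have mX : measurable_fun setT (fun y : XS => y.1.1) by exact: (measurableT_comp measurable_fst measurable_fst).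
have mG h z : measurable_fun setT (fun y : XS => upd (masses y.2) y.1.2 (delta s) h z).
  rewrite /upd (_ : (fun y => _) = fun y : XS => (h == y.1.2)%:R * delta s z + (h != y.1.2)%:R * masses y.2 h z); last first.
    by apply/funext => y; case: eqP => _ /=; rewrite ?mul1r ?mul0r ?addr0 ?add0r.
  have mi (f : 'I_k.+1 -> R) : measurable_fun setT (fun y : XS => f y.1.2).
    have mh : measurable_fun setT (fun y : XS => y.1.2) by exact: (measurableT_comp measurable_snd measurable_fst).
    by have [] := bmf_comp mh (bmf_ord f).
  have mm : measurable_fun setT (fun y : XS => masses y.2 h z).
    by have [mm _] := bmf_masses h z; exact: (measurableT_comp mm measurable_snd).
  apply: measurable_funD; apply: measurable_funM => //.
    exact: (mi (fun h' => (h == h')%:R)).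
  exact: (mi (fun h' => (h != h')%:R)).
exact: (measurable_ml_weight mX mG).
Qed.

(** [Zv] is [xi_ ^+ m] times a variable of mean one; the product rule for [Lambda] turns the power
    into the additive term [m * ln xi_]. *)
Lemma Ex_Zv m : \int[iid (muS pi) m]_x (xi_ ^- m * Lambda (Zv gam x)) =
  iter m (opb pi) Lh (mass gam) + ln xi_ * m%:R.
Proof.
have by1 s := bmf_prodf m s mult_fb.
have byv : bmf (@yv m) by apply: bmf_sum => s; exact: bmfZ.
have yv0 x : 0 <= @yv m x.
  by apply: sumr_ge0 => s _; apply: mulr_ge0; [exact: mass_ge0|exact: (mult_ge0 (mult_prodf m mult_fb))].
have bL : bmf (fun x => Lambda (@yv m x)) by apply: bmf_Lambda.
have bH : bmf (fun x => Lambda (@yv m x) + ln xi_ * m%:R * @yv m x) by apply: bmfD => //; exact: bmfZ.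
pose B : set XS := box `*` setT `*` setT.
have mB : measurable B by do 2 apply: measurableX => //; exact: measurable_box.
have PB : muS pi B = 1%E.
  apply: prod_box; first by apply: measurableX => //; exact: measurable_box.
  by apply: prod_box; [exact: measurable_box|exact: p_box].
have -> : \int[iid (muS pi) m]_x (xi_ ^- m * Lambda (Zv gam x)) =
    \int[iid (muS pi) m]_x (Lambda (@yv m x) + ln xi_ * m%:R * @yv m x).
  have E := @Ex_as _ _ _ (iid (muS pi) m) _ (fun x => xi_ ^- m * Lambda (Zv gam x))
    (fun x => Lambda (@yv m x) + ln xi_ * m%:R * @yv m x).
  apply: (E [set x | forall a, B (tnth x a)]); [exact: measurable_iid_box|exact: iid_box|..].
  - apply: measurable_funM => //; apply: measurable_funM; first exact: measurable_Zv.
    by apply: measurableT_comp => //; exact: measurable_Zv.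
  - by case: bH.
  move=> x Bx.
  have xm : 0 < xi_ ^+ m by rewrite exprn_gt0.
  have -> : Zv gam x = xi_ ^+ m * yv x.
    rewrite ZvE /yv mulr_sumr; apply: eq_bigr => s _; rewrite mulrCA; congr (_ * _).
    have -> : xi_ ^+ m = \prod_(a < m) xi_ by rewrite prodr_const card_ord.
    rewrite /prodf -big_split/=; apply: eq_bigr => a _.
    rewrite /fb mulrCA mulfV ?mulr1 ?gt_eqF//; apply: eq_bigr => t _; congr (_ * _).
    by have [[bx _] _] := Bx a; rewrite cl_box.
  rewrite LambdaM ?(ltW xm)// mulrDr mulKf ?gt_eqF// /Lambda lnXn// mulrA mulKf ?gt_eqF//.
  by congr (_ + _ * _); rewrite mulr_natr.
rewrite ExD//; last exact: bmfZ.
rewrite ExZ// -[X in _ + X]mulr1 -mulrA; congr (_ + _).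
  by rewrite (iter_opE _ m mult_fb bb_ge0 (@nice_Lh R color) cone_mass).
rewrite mulrA mulr1 -[RHS]mulr1; congr (_ * _).
rewrite Ex_sum => [|s]; last exact: bmfZ.
rewrite -[RHS]tot_mass; apply: eq_bigr => s _.
by rewrite ExZ// (mean1_prodf (mu := muS pi) m s mult_fb (mean1_fb pm)) mulr1.
Qed.

(** The variable term carries [d * ln xi_] and the edge term removes the part [1 - 1 / K] of it,
    which leaves [d / K * ln xi_], independent of [pi]. *)
Lemma BetheE : Bethe p gam d pi = bF pi d - d * (1 - K^-1) * aA pi + d / K * ln xi_.
Proof.
have gb : geo (fun m => iter m (opb pi) Lh (mass gam)).
  by apply: geo_iter; [exact: good_opb|exact: nice_Lh|exact: cone_mass].
rewrite /Bethe xiE Ex_Zf.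
have -> : \int[poisson_prob d 0]_m (\int[iid (p \x unif 'I_k.+1 R \x iid pi k.+1)%E m]_x (xi_ ^- m * Lambda (Zv gam x))) =
   PoE d (fun m => iter m (opb pi) Lh (mass gam) + ln xi_ * m%:R).
  by rewrite /PoE; congr (Rintegral _ _ _); apply/funext => m; exact: Ex_Zv.
rewrite (PoE_affine _ d0 gb) -/(bF pi d) /Lambda.
have xn : xi_ != 0 by rewrite gt_eqF.
have kz : K != 0 by rewrite pnatr_eq0.
by move: (bF pi d) (aA pi) (ln xi_) (xi_) (K) xn kz => x1 x2 x3 x4 x5 h1 h2; field; rewrite h1 h2.
Qed.

End bethe_formula.

Lemma probability_setC0 d (T : measurableType d) (P : probability T R) (B : set T) :
  measurable B -> P B = 1%E -> P (~` B) = 0%E.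
Proof. by move=> mB PB; rewrite probability_setC// PB subee. Qed.

(** * From the teacher-student model to operators *)

Section interface.
Variable n : nat.
Local Notation N := (n.+1%:R : R).
Local Notation cfg := (n.+1.-tuple color).
Local Notation FG m := (@factor_graph R q k n m).
Local Notation XA := (k.+1.-tuple 'I_n.+1 * W)%type.

Let psi0 := psidn_gt0.
Let D0 : 0 < D. Proof. by rewrite invr_gt0. Qed.

Let boxA : set XA := setT `*` box.

Let mboxA : measurable boxA.
Proof. by apply: measurableX => //; exact: measurable_box. Qed.

Let pboxA : muA n boxA = 1%E.
Proof.
transitivity (unif (k.+1.-tuple 'I_n.+1) R setT * p box)%E.
  by apply: product_measure1E => //; exact: measurable_box.
by rewrite probability_setT p_box mul1e.
Qed.

Let bG m : set (FG m) := [set G | forall a, boxA (tnth G a)].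

Let mbG m : measurable (@bG m).
Proof. exact: measurable_iid_box. Qed.

Let pbG m : iid (muA n) m (@bG m) = 1%E.
Proof. exact: iid_box. Qed.

Let nrm_gt0 (s : cfg) : 0 < nrm s.
Proof. by case/andP: (nrm_bounds s) => /(lt_le_trans psi0). Qed.

Let clprod m (G : FG m) (s : cfg) : \prod_(a < m) cl (tnth G a).2 (atc s (tnth G a).1) =
  nrm s ^+ m * prodf (@fA n) G s.
Proof.
have -> : nrm s ^+ m = \prod_(a < m) nrm s by rewrite prodr_const card_ord.
rewrite /prodf -big_split/=; apply: eq_bigr => a _.
by rewrite /fA mulrCA mulfV ?mulr1// gt_eqF.
Qed.

Let psiG_box m (G : FG m) s : bG G -> psiG G s = nrm s ^+ m * prodf (@fA n) G s.
Proof. by move=> bx; rewrite -clprod; apply: eq_bigr => a _; rewrite cl_box//; case: (bx a). Qed.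

Let bpr m s : bmf (fun G : FG m => prodf (@fA n) G s).
Proof. exact: (bmf_prodf m s (@mult_fA n)). Qed.

Let prodf0 m (G : FG m) s : 0 <= prodf (@fA n) G s.
Proof. exact: (mult_ge0 (mult_prodf m (@mult_fA n))). Qed.

Let Ex_psiG m s : \int[null_model n m p]_G psiG G s = nrm s ^+ m.
Proof.
transitivity (\int[iid (muA n) m]_G (nrm s ^+ m * prodf (@fA n) G s)).
  apply: (Ex_as (mbG (m := m)) (pbG m)); first exact: measurable_psiG.
    by case: (bmfZ (nrm s ^+ m) (bpr m s)).
  by move=> G /psiG_box.
rewrite ExZ; last exact: bpr.
by rewrite (mean1_prodf (mu := muA n) m s (@mult_fA n) (@mean1_fA n)) mulr1.
Qed.

(** On the box the teacher density is the product of the multipliers [fA]: the powers of [nrm s] in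
    numerator and denominator cancel. *)
Let tsE m s (A : set (FG m)) : measurable A ->
  teacher_student p s A = (\int[iid (muA n) m]_(G in A) (prodf (@fA n) G s)%:E)%E.
Proof.
move=> mA; apply: ae_eq_integral => //.
- by apply/measurable_EFinP; apply: measurable_funTS; exact: measurable_teacher_density.
- by apply/measurable_EFinP/measurable_funTS; case: (bpr m s).
exists (~` (@bG m)); split; first exact: (measurableC (mbG (m := m))).
  exact: (probability_setC0 (mbG (m := m)) (pbG m)).
move=> G /= HG; apply: contra_not HG => bx _; congr EFin.
by rewrite /teacher_density Ex_psiG psiG_box// mulrAC mulfV ?mul1r// expf_neq0// gt_eqF.
Qed.

Let ts_boxC m s : teacher_student p s (~` (@bG m)) = 0%E.
Proof.
rewrite tsE; last exact: (measurableC (mbG (m := m))).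
apply: null_set_integral => //; first exact: (measurableC (mbG (m := m))).
  by apply/measurable_funTS/measurable_EFinP; case: (bpr m s).
exact: (probability_setC0 (mbG (m := m)) (pbG m)).
Qed.

Definition clZ m (G : FG m) : R := \sum_s W0 s * (nrm s ^+ m * prodf (@fA n) G s).

Let clZ_bounds m (G : FG m) : psidn ^+ m <= clZ G <= D ^+ m.
Proof.
have b (s : cfg) : psidn ^+ m <= nrm s ^+ m * prodf (@fA n) G s <= D ^+ m.
  rewrite -clprod; have -> (c : R) : c ^+ m = \prod_(a < m) c by rewrite prodr_const card_ord.
  have -> : D ^+ m = \prod_(a < m) D by rewrite prodr_const card_ord.
  apply/andP; split; apply: ler_prod => a _.
    by case/andP: (cl_bounds (tnth G a).2 (atc s (tnth G a).1)) => -> _; rewrite ltW.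
  case/andP: (cl_bounds (tnth G a).2 (atc s (tnth G a).1)) => h ->.
  by rewrite (le_trans _ h)// ltW.
apply/andP; split.
  rewrite -[leLHS]mul1r -(tot_W0 n) /tot mulr_suml; apply: ler_sum => s _.
  by apply: ler_wpM2l; [exact: cone_W0|case/andP: (b s)].
rewrite -[leRHS]mul1r -(tot_W0 n) /tot mulr_suml; apply: ler_sum => s _.
by apply: ler_wpM2l; [exact: cone_W0|case/andP: (b s)].
Qed.

Let clZ_gt0 m (G : FG m) : 0 < clZ G.
Proof. by case/andP: (clZ_bounds G) => /(lt_le_trans _) -> //; rewrite exprn_gt0. Qed.

Let ln_clZ m (G : FG m) : `|ln (clZ G)| <= m%:R * ln D.
Proof.
case/andP: (clZ_bounds G) => h1 h2; have z0 := clZ_gt0 G.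
rewrite ler_norml; apply/andP; split.
  rewrite mulr_natl -lnXn// -lnV ?posrE ?exprn_gt0// /psiup -exprVn invrK.
  by rewrite ler_ln ?posrE ?exprn_gt0.
by rewrite mulr_natl -lnXn// ler_ln ?posrE ?exprn_gt0.
Qed.

Let blnZ m : bmf (fun G : FG m => ln (clZ G)).
Proof.
split; last by exists (m%:R * ln D) => G; exact: ln_clZ.
apply: measurableT_comp => //; apply: measurable_sum => s; apply: measurable_funM => //.
by apply: measurable_funM => //; case: (bpr m s).
Qed.

Let gE (s : cfg) m : R := \int[iid (muA n) m]_G ((N^-1 * ln (clZ G)) * prodf (@fA n) G s).

Let phi_ts m s : \int[@teacher_student _ _ _ n m p s]_G phiG gam G = gE s m.
Proof.
rewrite /gE -(Ex_density (bpr m s) (fun G => prodf0 G s) (fun A mA => @tsE m s A mA) (bmfZ N^-1 (blnZ m))).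
rewrite /Rintegral; congr fine; apply: ae_eq_integral => //.
- apply/measurable_EFinP; apply: measurable_funM => //; apply: measurableT_comp => //.
  by apply: measurable_sum => s'; apply: measurable_funM => //; exact: measurable_psiG.
- by apply/measurable_EFinP; case: (bmfZ N^-1 (blnZ m)).
exists (~` (@bG m)); split; [exact: (measurableC (mbG (m := m)))|exact: ts_boxC|].
move=> G /= HG; apply: contra_not HG => bx _; congr (_ * ln _)%:E.
by apply: eq_bigr => s' _; rewrite psiG_box.
Qed.

Let gE_le s m : `|gE s m| <= ln D * m%:R.
Proof.
have b1 := bmfM (bmfZ N^-1 (blnZ m)) (bpr m s).
apply: le_trans (Ex_normr _ b1) _.
apply: (@le_trans _ _ (\int[iid (muA n) m]_G (ln D * m%:R * prodf (@fA n) G s))).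
  apply: Ex_le; [exact: bmf_norm|by apply: bmfZ; exact: bpr|move=> G].
  rewrite normrM [X in _ * X]ger0_norm ?prodf0//; apply: ler_wpM2r; first exact: prodf0.
  rewrite normrM -[leRHS]mul1r [ln D * _]mulrC; apply: ler_pM => //.
  by rewrite ger0_norm ?invr_ge0// invf_le1// ler1n.
rewrite ExZ; last exact: bpr.
by rewrite (mean1_prodf (mu := muA n) m s (@mult_fA n) (@mean1_fA n)) mulr1.
Qed.

Let lnD0 : 0 <= ln D.
Proof. by have := gE_le (nseq_tuple n.+1 ord0) 1; rewrite mulr1; apply: le_trans. Qed.

Let geo_gE s : geo (gE s).
Proof.
apply: (geo_le (geoZ (ln D) geo_id)) => m.
by rewrite [leRHS]ger0_norm ?mulr_ge0// gE_le.
Qed.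

(** The integrand is unbounded in [m], so integrability on the product space has to be derived from
    geometric growth before Fubini is used. *)
Lemma Ex_iid_pois (h : cfg -> nat -> R) (l : R) : 0 <= l -> (forall s, geo (h s)) ->
  \int[(iid (gam : probability _ R) n.+1 \x poisson_prob l 0)%E]_x h x.1 x.2 =
  PoE l (fun m => \sum_s W0 s * h s m).
Proof.
move=> l0 gh.
have mt d' (T' : measurableType d') (f : cfg -> T') : measurable_fun setT f by move=> _ B _; rewrite setTI; exact: measurable_tuple_ord.
have mh : measurable_fun setT (fun x : cfg * nat => h x.1 x.2).
  rewrite (_ : (fun x => _) = fun x : cfg * nat => \sum_s (x.1 == s)%:R * h s x.2); last first.
    apply/funext => x; rewrite (bigD1 x.1)//= eqxx mul1r big1 ?addr0// => s.
    by rewrite eq_sym => /negbTE ->; rewrite mul0r.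
  apply: measurable_sum => s; apply: measurable_funM.
    exact: (measurableT_comp (mt _ _ (fun s' => (s' == s)%:R : R)) measurable_fst).
  exact: (measurableT_comp (measurable_nat_fun (h s)) measurable_snd).
pose H : nat -> R := fun m => \sum_s `|h s m|.
have gH : geo H by apply: geo_sum => s; apply: geo_le (gh s) _ => m; rewrite normr_id.
have ih : (iid (gam : probability _ R) n.+1 \x poisson_prob l 0)%E.-integrable setT
    (fun x : cfg * nat => (h x.1 x.2)%:E).
  apply/integrable12ltyP; first exact/measurable_EFinP.
  apply: (@le_lt_trans _ _ (\int[iid (gam : probability _ R) n.+1]_x (PoE l H)%:E)%E).
    apply: ge0_le_integral => //.
    - by move=> s _; apply: integral_ge0.
    - exact: mt.
    move=> s _; rewrite /PoE /Rintegral fineK; last first.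
      by apply: integrable_fin_num => //; exact: (geo_integrable l0 gH).
    apply: ge0_le_integral => // m _; rewrite lee_fin.
    by rewrite /H (bigD1 s)//= lerDl sumr_ge0.
  by rewrite integral_cst// ltey_eq fin_numM// fin_num_measure.
rewrite /Rintegral -integral12_prod_meas1//.
transitivity (\int[iid (gam : probability _ R) n.+1]_s PoE l (h s)).
  rewrite /Rintegral; congr fine; apply: eq_integral => s _; rewrite /fubini_F/= /PoE /Rintegral fineK//.
  by apply: integrable_fin_num => //; exact: (geo_integrable l0 (gh s)).
rewrite Ex_iid_simplex PoE_sum//; last by move=> s; apply: geoZ; exact: gh.
by apply: eq_bigr => s _; rewrite PoEZ.
Qed.

Let w m (G : FG m) : cfg -> R := fun s => W0 s * prodf (@fA n) G s.
Let cIF : R := D * (D * K).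

Let cw m (G : FG m) : cone (w G).
Proof. by move=> s; apply: mulr_ge0; [exact: cone_W0|exact: prodf0]. Qed.

(** The upper half is the maximality of [Zbar] at [gam]; the lower half is [ln t <= t - 1] at
    [t = xi_ / nrm s]. *)
Let ln_nrm (s : cfg) : ln xi_ - cIF * er s <= ln (nrm s) <= ln xi_.
Proof.
have x0 := xi_gt0; have n0 := nrm_gt0 s; apply/andP; split; last first.
  by rewrite ler_ln ?posrE//; apply: ml_le_xi; exact: dist_emp.
have := ln_le (divr_gt0 x0 n0); rewrite ln_div ?posrE// => h.
have e : xi_ / nrm s - 1 <= cIF * er s.
  rewrite -[X in _ - X](mulfV (lt0r_neq0 n0)) -mulrBl mulrC /cIF -mulrA.
  apply: ler_pM; [by rewrite invr_ge0 ltW| |by rewrite /psiup lef_pV2// ?posrE//; case/andP: (nrm_bounds s)|].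
    by rewrite subr_ge0; apply: ml_le_xi; exact: dist_emp.
  by apply: le_trans (nrm_lip s); rewrite distrC ler_norm.
by move: h e; move: (ln xi_) (ln (nrm s)) (xi_ / nrm s) (cIF * er s) => x1 x2 x3 x4; lra.
Qed.

Let jensen_arith (S z X Y T l : R) : S - (z - l) * T <= 0 -> X - Y <= S ->
  T * l + X - Y <= z * T.
Proof. by rewrite mulrBl; lra. Qed.

(** The partition function contains [nrm s ^+ m], which varies with [s]. Bounding [nrm] by [xi_]
    gives the upper half; concavity of [ln] under the Gibbs average of [w G], with [ln_nrm], gives
    the lower half. *)
Let jensen m (G : FG m) :
  Lh (w G) + m%:R * (ln xi_ * tot (w G)) - m%:R * (cIF * lin (@er n) (w G)) <=
  ln (clZ G) * tot (w G) <= Lh (w G) + m%:R * (ln xi_ * tot (w G)).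
Proof.
have z0 := clZ_gt0 G.
have zE : clZ G = \sum_s w G s * nrm s ^+ m by apply: eq_bigr => s _; rewrite /w; ring.
have t0 : 0 < tot (w G).
  rewrite lt_neqAle tot_ge0 ?andbT; last exact: cw.
  apply/eqP => e; move: z0; rewrite zE big1 ?ltxx// => s _.
  have : w G s = 0.
    apply/eqP; rewrite eq_le cw andbT e /tot (bigD1 s)//= lerDl; apply: sumr_ge0 => s' _; exact: cw.
  by move=> ->; rewrite mul0r.
have x0 := xi_gt0.
apply/andP; split; last first.
  have h : ln (clZ G) <= m%:R * ln xi_ + ln (tot (w G)).
    rewrite mulr_natl -lnXn// -lnM ?posrE ?exprn_gt0// ler_ln ?posrE ?mulr_gt0 ?exprn_gt0//.
    rewrite zE mulrC /tot mulr_suml; apply: ler_sum => s _; apply: ler_wpM2l; first exact: cw.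
    by apply: lerXn2r; [rewrite nnegrE ltW|rewrite nnegrE ltW|apply: ml_le_xi; exact: dist_emp].
  have := ler_wpM2r (ltW t0) h; rewrite /Lh /Lambda.
  by move: (ln xi_) (ln (clZ G)) (tot (w G)) (ln (tot (w G))) (m%:R) => x1 x2 x3 x4 x5; lra.
have h : \sum_s w G s * (m%:R * ln (nrm s) - (ln (clZ G) - ln (tot (w G)))) <= 0.
  apply: (@le_trans _ _ (\sum_s w G s * (nrm s ^+ m * (tot (w G) / clZ G) - 1))).
    apply: ler_sum => s _; apply: ler_wpM2l; first exact: cw.
    have a0 : 0 < nrm s ^+ m * (tot (w G) / clZ G) by rewrite mulr_gt0 ?divr_gt0 ?exprn_gt0.
    have := ln_le a0; rewrite lnM ?posrE ?divr_gt0 ?exprn_gt0// ln_div ?posrE// lnXn// -[_ *+ m]mulr_natl.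
    by move: (ln _) (ln _) (ln _) (_ * (_ / _)) (m%:R) => x1 x2 x3 x4 x5; lra.
  rewrite (eq_bigr (fun s => w G s * nrm s ^+ m * (tot (w G) / clZ G) - w G s)); last first.
    by move=> s _; move: (tot _ / _) => c; ring.
  by rewrite sumrB -mulr_suml -zE mulrCA mulfV ?mulr1 ?subrr// gt_eqF.
have h2 : \sum_s w G s * (m%:R * (ln xi_ - cIF * er s)) <= \sum_s w G s * (m%:R * ln (nrm s)).
  by apply: ler_sum => s _; apply: ler_wpM2l; [exact: cw|apply: ler_wpM2l => //; case/andP: (ln_nrm s)].
have e1 : \sum_s w G s * (m%:R * (ln xi_ - cIF * er s)) =
    m%:R * (ln xi_ * tot (w G)) - m%:R * (cIF * lin (@er n) (w G)).
  rewrite /tot /lin !mulr_sumr -sumrB; apply: eq_bigr => s _.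
  by move: (w G s) (ln _) (er s) => x1 x2 x3; ring.
have e2 : \sum_s w G s * (m%:R * ln (nrm s) - (ln (clZ G) - ln (tot (w G)))) =
    \sum_s w G s * (m%:R * ln (nrm s)) - (ln (clZ G) - ln (tot (w G))) * tot (w G).
  by rewrite /tot mulr_sumr -sumrB; apply: eq_bigr => s _; rewrite mulrBr; congr (_ - _); rewrite mulrC.
move: h h2; rewrite e2 e1; exact: jensen_arith.
Qed.

Let E m : R := \sum_s W0 s * gE s m.

Let bZw m : bmf (fun G : FG m => ln (clZ G) * tot (w G)).
Proof. by apply: bmfM; [exact: blnZ|apply: bmf_sum => s; apply: bmfZ; exact: bpr]. Qed.

Let Ex_lin m e : \int[iid (muA n) m]_G lin e (w G) = lin e (@W0 n).
Proof.
rewrite Ex_sum => [|s]; last by under eq_fun do rewrite mulrC; apply: bmfZ; apply: bmfZ; exact: bpr.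
apply: eq_bigr => s _; under eq_Rintegral do rewrite /w mulrAC.
rewrite ExZ; last exact: bpr.
by rewrite (mean1_prodf (mu := muA n) m s (@mult_fA n) (@mean1_fA n)) mulr1.
Qed.

Let E_E m : N * E m = \int[iid (muA n) m]_G (ln (clZ G) * tot (w G)).
Proof.
transitivity (\int[iid (muA n) m]_G \sum_s W0 s * (ln (clZ G) * prodf (@fA n) G s)); last first.
  by congr Rintegral; apply/funext => G; rewrite /tot mulr_sumr; apply: eq_bigr => s _; rewrite /w mulrCA.
have bb1 s : bmf (fun G : FG m => ln (clZ G) * prodf (@fA n) G s) by apply: bmfM; [exact: blnZ|exact: bpr].
rewrite Ex_sum => [|s]; last by apply: bmfZ.
rewrite /E mulr_sumr; apply: eq_bigr => s _; rewrite ExZ// mulrCA; congr (_ * _).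
rewrite /gE; under eq_Rintegral do rewrite -mulrA.
by rewrite ExZ// mulrA mulfV ?mul1r// pnatr_eq0.
Qed.

Let E_bounds m : iter m (@opA n) Lh (@W0 n) + ln xi_ * m%:R - cIF * lin (@er n) (@W0 n) * m%:R <= N * E m <= iter m (@opA n) Lh (@W0 n) + ln xi_ * m%:R.
Proof.
have Ht : \int[iid (muA n) m]_G tot (w G) = 1.
  have := Ex_lin m (fun=> 1); rewrite lin_cst tot_W0 mul1r => <-.
  by congr Rintegral; apply/funext => G; rewrite lin_cst mul1r.
have bl e : bmf (fun G : FG m => lin e (w G)).
  by apply: bmf_sum => s; under eq_fun do rewrite mulrC; apply: bmfZ; apply: bmfZ; exact: bpr.
have bt : bmf (fun G : FG m => tot (w G)) by apply: bmf_sum => s; apply: bmfZ; exact: bpr.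
have bL : bmf (fun G : FG m => Lh (w G)) by apply: bmf_Lambda => // G; apply: tot_ge0; exact: cw.
have EL : \int[iid (muA n) m]_G Lh (w G) = iter m (@opA n) Lh (@W0 n).
  by rewrite (iter_opE _ m (@mult_fA n) bb_ge0 (@nice_Lh R _) (@cone_W0 n)).
have bu : bmf (fun G : FG m => Lh (w G) + m%:R * (ln xi_ * tot (w G))).
  by apply: bmfD => //; do 2 apply: bmfZ.
have be : bmf (fun G : FG m => m%:R * (cIF * lin (@er n) (w G))) by do 2 apply: bmfZ; exact: bl.
have Eu : \int[iid (muA n) m]_G (Lh (w G) + m%:R * (ln xi_ * tot (w G))) =
    iter m (@opA n) Lh (@W0 n) + ln xi_ * m%:R.
  rewrite ExD//; last by do 2 apply: bmfZ.
  by rewrite EL ExZ ?ExZ//; [rewrite Ht mulr1 mulrC|exact: bmfZ].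
rewrite E_E; apply/andP; split.
  have -> : cIF * lin (@er n) (@W0 n) * m%:R = \int[iid (muA n) m]_G (m%:R * (cIF * lin (@er n) (w G))).
    by rewrite ExZ ?ExZ//; [rewrite Ex_lin mulrC|apply: bmfZ; exact: bl].
  rewrite -Eu -ExB//; apply: Ex_le; [exact: bmfB|exact: bZw|move=> G].
  by case/andP: (jensen G).
by rewrite -Eu; apply: Ex_le; [exact: bZw|by []|move=> G; case/andP: (jensen G)].
Qed.

(** The Jensen error is of order [er] per factor, so over [Po(d N / K)] factors it is of order
    [sqrt N], negligible after division by [N]. *)
Lemma expected_phi_bounds d : 0 <= d ->
  Tn n d + d * N / K * ln xi_ - d * N / K * (cIF * (q.+1%:R / Num.sqrt N)) <=
  N * expected_phi p gam d n <= Tn n d + d * N / K * ln xi_.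
Proof.
move=> d0; set l := d * N / K; have l0 : 0 <= l by rewrite mulr_ge0// ?invr_ge0// mulr_ge0.
have gL : geo (fun m => iter m (@opA n) Lh (@W0 n)).
  by apply: geo_iter; [exact: good_opA|exact: nice_Lh|exact: cone_W0].
have gEE : geo (fun m => N * E m) by apply: geoZ; apply: geo_sum => s; apply: geoZ.
have gU c : geo (fun m => iter m (@opA n) Lh (@W0 n) + c * m%:R) by apply: geoD => //; apply: geoZ; exact: geo_id.
have -> : N * expected_phi p gam d n = PoE l (fun m => N * E m).
  rewrite PoEZ//; last by apply: geo_sum => s; apply: geoZ.
  rewrite -(Ex_iid_pois l0 geo_gE) /expected_phi; congr (_ * Rintegral _ _ _).
  by apply/funext => -[s m]; exact: phi_ts.
apply/andP; split.
  apply: (@le_trans _ _ (Tn n d + (ln xi_ - cIF * lin (@er n) (@W0 n)) * l)).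
    rewrite [l * ln _]mulrC mulrBl addrA lerD2l lerN2 [_ * l]mulrC; apply: ler_wpM2l => //.
    apply: ler_wpM2l; last exact: lin_er_W0.
    by apply: mulr_ge0; [exact: ltW D0|apply: mulr_ge0 => //; exact: ltW D0].
  rewrite -(PoE_affine _ l0 gL); apply: PoE_le => // m.
  by rewrite mulrBl addrA; case/andP: (E_bounds m).
rewrite [l * _]mulrC -(PoE_affine _ l0 gL); apply: PoE_le => // m.
by case/andP: (E_bounds m).
Qed.

End interface.

(** * A priori bounds and choice of the parameters *)

Lemma bF_bounds pi d : has_mean pi gam -> 0 <= d -> 0 <= bF pi d <= d * ln bb.
Proof.
move=> pm d0; have gB := good_opb pm; have cW : cone (mass gam) by exact: cone_mass.
have nL := @nice_Lh R color.
have mb := mean1_fb pm.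
have Z m : iter m idE (@Lh R color) (mass gam) = 0.
  have -> : iter m idE (@Lh R color) = Lh by elim: m => // m /= ->.
  by rewrite /Lh tot_mass Lambda1.
have up m : iter m (opb pi) Lh (mass gam) <= 0 + ln bb * m%:R.
  have H (V : color -> R) : cone V -> opb pi Lh V <= idE Lh V + lin (fun=> ln bb) V.
    by move=> cV; rewrite lin_cst; exact: (op_le_Lh mult_fb mb bb_ge0 cV).
  have := tele gB (@good_id R _) (@commutes_id R _ (opb pi)) nL H m cW.
  by rewrite Z lin_cst tot_mass mulr1 [m%:R * _]mulrC.
have lo m : 0 <= iter m (opb pi) Lh (mass gam).
  have h := iter_op_Lh mult_fb bb_ge0 mb bb_ge1 (fun x s => proj1 (andP (fb_bounds x s))) m cW; apply: (le_trans _ h).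
  rewrite {1}/Lh tot_mass Lambda1 add0r mulr_ge0// subr_ge0.
  exact: (Lh_le_op mult_fb bb_ge0 mb cW).
apply/andP; split.
  by rewrite -(PoE_cst d 0); apply: (PoE_le d0 (geo_cst 0) (geo_iter gB nL cW)).
apply: le_trans (PoE_le d0 (geo_iter gB nL cW) (geoD (geo_cst 0) (geoZ (ln bb) (@geo_id R))) up) _.
by rewrite (PoE_affine _ d0 (geo_cst 0)) PoE_cst add0r mulrC.
Qed.

Lemma aA_abs pi : `|aA pi| <= 1 + bb ^+ 2.
Proof.
apply: Ex_bound; first exact: bmf_LyA.
move=> [psi g]; have /andP[h1 h2] := yA_bounds psi g.
apply: le_trans (Lambda_abs (le_trans (ltW bbi_gt0) h1)) _.
by rewrite lerD2l lerXn2r// nnegrE ?bb_ge0// (le_trans (ltW bbi_gt0) h1).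
Qed.

Definition bethe_cst (dup : R) : R := dup * (ln bb + (1 + bb ^+ 2)).

(** Collects the coefficients of [up_arith] and [lo_arith]. All summands are nonnegative, so one
    constant serves both one-sided estimates. *)
Definition rate_cst (dup : R) : R :=
  (K * bethe_cst dup + dup * ln bb) + 2 * ln q.+1%:R + 3 * (sqrt_cst dup + 2 * ln q.+1%:R) +
  2 * slope_cst dup +
  dup * ((CA + CB) * q.+1%:R + CP * (K * (q.+1%:R + K))) + D * (D * K) * (dup * q.+1%:R).

Section rate.
Variables (d dup : R).
Hypotheses (d0 : 0 <= d) (dd : d <= dup).

Let dup0 : 0 <= dup. Proof. exact: le_trans dd. Qed.
Let lnb0 : 0 <= ln bb. Proof. by rewrite ln_ge0// bb_ge1. Qed.
Let Bn pi := bF pi d - d * (1 - K^-1) * aA pi.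
Let b := bethe_cst dup.
Let BS := Bethe_sup p gam d - d / K * ln xi_.

Let Ki01 : 0 <= K^-1 <= 1. Proof. by rewrite invr_ge0 ler0n/= invf_le1// ler1n. Qed.

Let Bn_abs pi : has_mean pi gam -> `|Bn pi| <= b.
Proof.
move=> pm; have /andP[f0 f1] := bF_bounds pm d0; have a1 := aA_abs pi.
have /andP[K0 K1] := Ki01.
apply: le_trans (ler_normB _ _) _; rewrite /b /bethe_cst [leRHS]mulrDr; apply: lerD.
  by rewrite ger0_norm//; apply: le_trans f1 _; apply: ler_wpM2r.
rewrite normrM; apply: ler_pM => //; rewrite normrM !ger0_norm ?subr_ge0//.
by rewrite -[leRHS]mulr1; apply: ler_pM; rewrite ?subr_ge0//; lra.
Qed.

(** A competitor for the supremum: with it the set of Bethe values is nonempty and [sup] is a true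
    least upper bound. *)
Let mean_dirac : has_mean (dirac gam : probability simplex R) gam.
Proof.
move=> z; rewrite /Rintegral integral_dirac//; last first.
  by apply/measurable_EFinP; by case: (@bmf_mass R q z).
by rewrite diracT mul1e.
Qed.

Let Bs : set R := [set Bethe p gam d pi | pi in [set pi | has_mean pi gam]].

Let Bs_ne : Bs !=set0.
Proof. by exists (Bethe p gam d (dirac gam)); exists (dirac gam : probability simplex R). Qed.

Let Bs_ub : ubound Bs (b + d / K * ln xi_).
Proof.
move=> _ [pi /= pm <-]; rewrite (BetheE pm d0) lerD2r.
by have := Bn_abs pm; rewrite ler_norml => /andP[].
Qed.

Let BnBS pi : has_mean pi gam -> Bn pi <= BS.
Proof.
move=> pm; rewrite /BS lerBrDr -(BetheE pm d0); apply: ub_le_sup.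
  by exists (b + d / K * ln xi_); exact: Bs_ub.
by exists pi.
Qed.

Let BS_le c : (forall pi, has_mean pi gam -> Bn pi <= c) -> BS <= c.
Proof.
move=> H; rewrite /BS lerBlDr; apply: ge_sup; first exact: Bs_ne.
by move=> _ [pi /= pm <-]; rewrite (BetheE pm d0) lerD2r; exact: H.
Qed.

Let BS_abs : `|BS| <= b.
Proof.
rewrite ler_norml; apply/andP; split.
  by apply: le_trans (BnBS mean_dirac); have := Bn_abs mean_dirac; rewrite ler_norml => /andP[].
by apply: BS_le => pi pm; have := Bn_abs pm; rewrite ler_norml => /andP[].
Qed.

Variables (n : nat) (y : R).
Hypotheses (y1 : 1 <= y) (yE : n.+1%:R = y ^+ 8).
Local Notation N := (n.+1%:R : R).
Let u := y^-1.
(** The number of pins, about [N^(1/4)]. With [eta = u], about [N^(-1/8)], both [eta] and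
    [1 / (eta * t)] are at most [u], and the cost [t / sqrt N] of the pins stays below [2 u]. *)
Let t := (Num.truncn (y ^+ 2)).+1.

Let y0 : 0 < y. Proof. exact: lt_le_trans y1. Qed.
Let u0 : 0 < u. Proof. by rewrite invr_gt0. Qed.
Let u1 : u <= 1. Proof. by rewrite invf_le1. Qed.
Let uy : u * y = 1. Proof. by rewrite mulVf// gt_eqF. Qed.
Let sE : Num.sqrt N = y ^+ 4.
Proof. by rewrite yE (exprM y 4 2) sqrtr_sqr ger0_norm// exprn_ge0// ltW. Qed.
Let u_le i : u ^+ i.+1 <= u.
Proof. by rewrite exprS -[leRHS]mulr1; apply: ler_wpM2l; [exact: ltW|rewrite exprn_ile1// ltW]. Qed.
Let t_bounds : y ^+ 2 <= t%:R <= 2 * y ^+ 2.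
Proof.
have y2 : 0 <= y ^+ 2 by rewrite exprn_ge0// ltW.
have /andP[h1 h2] := truncn_itv y2.
have h3 : 1 <= y ^+ 2 by rewrite exprn_ege1.
rewrite (ltW h2)/= /t -natr1; lra.
Qed.

Let h1 : u ^+ 8 * N = 1.
Proof. by rewrite yE -exprMn uy expr1n. Qed.
Let uyk i j : u ^+ (i + j) * y ^+ j = u ^+ i.
Proof. by rewrite exprD -mulrA -exprMn uy expr1n mulr1. Qed.
Let h3 : u ^+ 8 * t%:R <= 2 * u.
Proof.
have /andP[_ h] := t_bounds.
apply: le_trans (ler_wpM2l (exprn_ge0 8 (ltW u0)) h) _.
by rewrite mulrCA (uyk 6 2); apply: ler_wpM2l.
Qed.
Let h4 : u ^+ 8 * Num.sqrt N <= u.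
Proof. by rewrite sE (uyk 4 4). Qed.
Let h5 : u ^+ 8 * (t%:R * Num.sqrt N) <= 2 * u.
Proof.
rewrite sE mulrCA (uyk 4 4); have /andP[_ h] := t_bounds.
apply: le_trans (ler_wpM2r (exprn_ge0 4 (ltW u0)) h) _.
by rewrite -mulrA [_ ^+ 2 * _]mulrC (uyk 2 2); apply: ler_wpM2l.
Qed.
Let h6 : (u * t%:R)^-1 <= u.
Proof.
have /andP[h _] := t_bounds.
rewrite -[leRHS]invrK lef_pV2 ?posrE ?invr_gt0 ?mulr_gt0// invrK.
have := ler_wpM2l (ltW u0) h.
by rewrite expr2 mulrA uy mul1r.
Qed.
Let h7 : (Num.sqrt N)^-1 <= u.
Proof. by rewrite sE -exprVn. Qed.

Let K0 : 0 <= K := ler0n _ _.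
Let Q0 : 0 <= (q.+1%:R : R) := ler0n _ _.
Let lq : 0 <= ln (q.+1%:R : R) := lnQ_ge0.
Let N0 : 0 < N. Proof. by []. Qed.

Let b0 : 0 <= b. Proof. exact: le_trans BS_abs. Qed.

Let phi := expected_phi p gam d n.

Let c00 : 0 <= sqrt_cst dup := sqrt_cst_ge0 dup0.
Let c01 : 0 <= slope_cst dup := slope_cst_ge0 dup0.
Let c02 : 0 <= dup * ((CA + CB) * q.+1%:R + CP * (K * (q.+1%:R + K))).
Proof.
apply: mulr_ge0 => //; apply: addr_ge0; apply: mulr_ge0 => //.
- by apply: addr_ge0; [exact: CA_ge0|exact: CB_ge0].
- exact: CP_ge0.
Qed.
Let c03 : 0 <= D * (D * K) * (dup * q.+1%:R).
Proof. by rewrite !mulr_ge0// ltW// /psiup invr_gt0. Qed.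
Let c04 : 0 <= K * b + dup * ln bb.
Proof. by apply: addr_ge0; exact: mulr_ge0. Qed.

Let scale (x e : R) : N * x <= e -> x <= u ^+ 8 * e.
Proof.
move=> h; have := ler_wpM2l (exprn_ge0 8 (ltW u0)) h.
by rewrite mulrA h1 mul1r.
Qed.

Let up_arith (v s T c1 c2 c3 L x : R) : 0 <= L -> 0 <= c1 -> 0 <= c2 -> 0 <= c3 -> v * N = 1 ->
  v <= u -> v * T <= 2 * u -> v * s <= u -> v * (T * s) <= 2 * u -> x <= u ->
  v * (c3 + T * L + 3 * (c1 + L * T) * s + N * (c2 * (u + x))) <=
  (c3 + 2 * L + 3 * (c1 + 2 * L) + 2 * c2) * u.
Proof.
move=> L0 p1 p2 p3 vN a1 a2 a3 a4 a5.
have b1 := ler_wpM2l p3 a1; have b2 := ler_wpM2l L0 a2; have b3 := ler_wpM2l p1 a3.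
have b4 := ler_wpM2l L0 a4; have b5 := ler_wpM2l p2 a5.
have -> : v * (c3 + T * L + 3 * (c1 + L * T) * s + N * (c2 * (u + x))) =
  c3 * v + L * (v * T) + 3 * (c1 * (v * s)) + 3 * (L * (v * (T * s))) + v * N * (c2 * (u + x)) by ring.
rewrite vN; lra.
Qed.

Let phi_up : phi - Bethe_sup p gam d <= rate_cst dup * u.
Proof.
have /andP[_ H] := expected_phi_bounds n d0.
have := @upper_bound d dup BS b d0 dd BS_abs BnBS t u isT u0 n => U.
have S : N * (phi - Bethe_sup p gam d) <= K * b + dup * ln bb + t%:R * ln q.+1%:R +
    3 * (sqrt_cst dup + ln q.+1%:R * t%:R) * Num.sqrt N + N * (slope_cst dup * (u + (u * t%:R)^-1)).
  have E : N * (phi - Bethe_sup p gam d) = N * phi - N * BS - d * N / K * ln xi_.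
    by rewrite /BS; move: (phi) (Bethe_sup _ _ _) (ln xi_) (K^-1) => x1 x2 x3 x4; ring.
  rewrite E; move: H U; rewrite -/phi.
  move: (Tn n d) (N * phi) (N * BS) (d * N / K * ln xi_) (t%:R * _) (3 * _ * _) (N * (slope_cst _ * _)) => x1 x2 x3 x4 x5 x6 x7.
  lra.
apply: le_trans (scale S) _.
apply: le_trans (up_arith lq c00 c01 c04 h1 (u_le 7) h3 h4 h5 h6) _.
apply: ler_wpM2r; first exact: ltW.
by rewrite /rate_cst -/b; move: c02 c03; move: (dup * (_ + _)) (_ * (dup * _)) => x1 x2; lra.
Qed.

Let lo_arith (v T c1 c2 c3 L si Qq Kk Ti : R) : 0 <= L -> 0 <= c1 -> 0 <= c2 -> 0 <= c3 ->
  0 <= Qq -> 0 <= Kk -> 0 <= si ->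
  v * N = 1 -> v * T <= 2 * u -> si <= u -> Ti <= u -> 0 <= Ti ->
  v * (d * N * (c1 * (Qq * si) + c2 * (Kk * (u * Qq / 2 + 2^-1 * (Kk * Ti)))) + T * L +
    d * N / K * (c3 * (Qq * si))) <=
  (2 * L + dup * (c1 * Qq + c2 * (Kk * (Qq + Kk))) + c3 * (dup * Qq)) * u.
Proof.
move=> L0 p1 p2 p3 Q00 K00 si0 vN a1 a2 a3 a4.
have -> : v * (d * N * (c1 * (Qq * si) + c2 * (Kk * (u * Qq / 2 + 2^-1 * (Kk * Ti)))) + T * L +
    d * N / K * (c3 * (Qq * si))) =
  v * N * (d * (c1 * (Qq * si) + c2 * (Kk * (u * Qq / 2 + 2^-1 * (Kk * Ti)))) +
    d * (K^-1 * (c3 * (Qq * si)))) + L * (v * T) by move: (K^-1) => r; ring.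
rewrite vN mul1r.
have /andP[k0 k1] := Ki01.
have q1 : 0 <= Qq * si by exact: mulr_ge0.
have q2 : Qq * si <= Qq * u by exact: ler_wpM2l.
have r1 : c1 * (Qq * si) <= c1 * (Qq * u) by exact: ler_wpM2l.
have r2 : u * Qq / 2 + 2^-1 * (Kk * Ti) <= (Qq + Kk) * u.
  have := ler_wpM2l K00 a3; have := mulr_ge0 Q00 (ltW u0); have := mulr_ge0 K00 (ltW u0); lra.
have r3 := ler_wpM2l p2 (ler_wpM2l K00 r2).
have r30 : 0 <= c2 * (Kk * (u * Qq / 2 + 2^-1 * (Kk * Ti))).
  by apply: mulr_ge0 => //; apply: mulr_ge0 => //; apply: addr_ge0; rewrite !mulr_ge0// ltW.
have r4 : d * (c1 * (Qq * si) + c2 * (Kk * (u * Qq / 2 + 2^-1 * (Kk * Ti)))) <=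
    dup * (c1 * (Qq * u) + c2 * (Kk * ((Qq + Kk) * u))).
  by apply: ler_pM => //; [apply: addr_ge0 => //; exact: mulr_ge0|exact: lerD].
have r5 : K^-1 * (c3 * (Qq * si)) <= 1 * (c3 * (Qq * u)).
  by apply: ler_pM => //; [exact: mulr_ge0|exact: ler_wpM2l].
have r6 : d * (K^-1 * (c3 * (Qq * si))) <= dup * (1 * (c3 * (Qq * u))).
  by apply: ler_pM => //; apply: mulr_ge0 => //; exact: mulr_ge0.
have r7 := ler_wpM2l L0 a1.
move: r4 r6 r7; move: (d * (_ + _)) (d * (K^-1 * _)) (L * (v * T)) => z1 z2 z3; lra.
Qed.

Let phi_lo : Bethe_sup p gam d - phi <= rate_cst dup * u.
Proof.
have /andP[H _] := expected_phi_bounds n d0.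
pose e := d * N * ((CA + CB) * (q.+1%:R / Num.sqrt N) +
   CP * (K * (u * q.+1%:R / 2 + (2 * u)^-1 * (K / t%:R)))) + t%:R * ln q.+1%:R.
have BT : N * BS <= Tn n d + e.
  rewrite mulrC -ler_pdivlMr//; apply: BS_le => pi pm; rewrite ler_pdivlMr// mulrC.
  have := @lower_bound n pi d u t pm d0 u0 isT; rewrite /Bn /e.
  move: (Tn n d) (CP * _) ((CA + CB) * _) (t%:R * _) (bF _ _) (aA _) (K^-1) => x1 x2 x3 x4 x5 x6 x7.
  lra.
have S : N * (Bethe_sup p gam d - phi) <= e + d * N / K * (D * (D * K) * (q.+1%:R / Num.sqrt N)).
  have E : N * (Bethe_sup p gam d - phi) = N * BS + d * N / K * ln xi_ - N * phi.
    by rewrite /BS; move: (phi) (Bethe_sup _ _ _) (ln xi_) (K^-1) => x1 x2 x3 x4; ring.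
  rewrite E; move: H BT; rewrite -/phi.
  move: (Tn n d) (N * phi) (N * BS) (d * N / K * ln xi_) (e) (d * N / K * (D * _ * _)) => x1 x2 x3 x4 x5 x6.
  lra.
apply: le_trans (scale S) _.
have -> : e = d * N * ((CA + CB) * (q.+1%:R * (Num.sqrt N)^-1) +
   CP * (K * (u * q.+1%:R / 2 + 2^-1 * (K * (u * t%:R)^-1)))) + t%:R * ln q.+1%:R.
  rewrite /e !invfM; congr (_ * (_ + _ * (_ * (_ + _))) + _).
  by move: (u^-1) (t%:R^-1) => r1 r2; ring.
have D0 : 0 <= D by rewrite /psiup invr_ge0 ltW.
have si0 : 0 <= (Num.sqrt N)^-1 by rewrite invr_ge0 sqrtr_ge0.
have ti0 : 0 <= (u * t%:R)^-1 by rewrite invr_ge0 mulr_ge0// ltW.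
have CAB : 0 <= CA + CB by apply: addr_ge0; [exact: CA_ge0|exact: CB_ge0].
have CPp : 0 <= CP by exact: CP_ge0.
have LA := lo_arith lq CAB CPp (mulr_ge0 D0 (mulr_ge0 D0 K0)) Q0 K0 si0 h1 h3 h7 h6 ti0.
apply: (le_trans LA).
apply: ler_wpM2r; first exact: ltW.
move: c00 c01 c04 lq; rewrite /rate_cst -/b.
move: (sqrt_cst dup) (slope_cst dup) (K * b + _) (ln q.+1%:R) (dup * (_ + _)) (_ * (dup * _)) => x1 x2 x3 x4 x5 x6.
lra.
Qed.

Lemma phi_Bethe_sup : `|phi - Bethe_sup p gam d| <= rate_cst dup / y.
Proof. by rewrite ler_norml phi_up andbT lerNl opprB phi_lo. Qed.

End rate.

End model.

Theorem theorem2p3 (R : realType) (q k : nat) (psidn dup : R)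
    (psidn_gt0 : 0 < psidn) (psidn_lt : psidn < (q.+1%:R)^-1)
    (dup_gt0 : 0 < dup) :
  exists rho c : R, [/\ 0 < rho, 0 < c &
    forall (p : probability (weight R q k) R) (gam : pprobability 'I_q.+1 R),
      admissible psidn p gam ->
    forall d : R, 0 <= d <= dup ->
    forall n : nat,
      `|expected_phi p gam d n - Bethe_sup p gam d|
        <= c * n.+1%:R `^ (- rho)].
Proof.
(* Absolute value and [+ 1] make the constant positive without discussing the sign of [rate_cst] for
   these parameters. *)
exists 8^-1, (`|@rate_cst R q k psidn dup| + 1); split; [by rewrite invr_gt0|by rewrite ltr_wpDl|].
move=> p gam adm d /andP[d0 dd] n.
pose y : R := n.+1%:R `^ 8^-1.
have y1 : 1 <= y by rewrite -(powRr0 (n.+1%:R : R)) ler_powR// ler1n.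
have yE : n.+1%:R = y ^+ 8.
  by rewrite -powR_mulrn ?powR_ge0// -powRrM mulVf ?powRr1// pnatr_eq0.
apply: le_trans (phi_Bethe_sup psidn_gt0 psidn_lt adm d0 dd y1 yE) _.
rewrite powRN; apply: ler_wpM2r; first by rewrite invr_ge0 powR_ge0.
by apply: le_trans (ler_norm _) _; rewrite lerDl.
Qed.
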